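(* Let $b$ and $a$ be real positive numbers such that $1 > b \ge 1/2$ and $a(1-b) < \pi/2$. Then the equality $$\frac{a}{\pi}\int_0^\infty \frac{\ln|\zeta(b+it)|}{\cosh(at)}\,dt = \frac12 \ln\frac{1-\sin(a(1-b))}{1+\sin(a(1-b))} + \sum_{n=0}^\infty (-1)^n \ln\left(\zeta\left(b+\frac{\pi}{2a}+\frac{\pi n}{a}\right)\right)$$ holds true if and only if the Riemann zeta-function has no zeroes $\rho=\sigma+it$ with $\sigma > b$. In particular, for $b=1/2$ this equality is equivalent to the Riemann hypothesis.
   Context: $\zeta$ denotes the Riemann zeta-function. The Riemann hypothesis states that all non-trivial zeroes of $\zeta$ have real part $1/2$. If a zero of $\zeta$ lies on the integration path, the integral of the logarithm is understood as the appropriate limit (the logarithmic singularity is integrable). *)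

(* Defs.v *)
From HB Require Import structures.
From mathcomp Require Import all_boot all_order all_algebra.
From mathcomp Require Import all_classical all_reals all_analysis.
From mathcomp Require Export complex.

Set Implicit Arguments.
Unset Strict Implicit.
Unset Printing Implicit Defensive.

Import Order.TTheory GRing.Theory Num.Theory.
Import numFieldNormedType.Exports.

Local Open Scope classical_set_scope.
Local Open Scope ring_scope.
Local Open Scope complex_scope.

(* Topological statements about complex numbers go through [R[i]^o], whose
   topology is the one of the norm of the numeric field [R[i]]. *)

Definition cosh (R : realType) (x : R) : R := (expR x + expR (- x)) / 2.

Definition cexp (R : realType) (z : R[i]) : R[i] :=
  (expR (complex.Re z))%:C * (cos (complex.Im z) +i* sin (complex.Im z)).

(* The Dirichlet series [\sum_(m >= 1) m ^ (- s)], indexed by [m = n.+1]. *)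
Definition dirichlet_term (R : realType) (s : R[i]) (n : nat) : R[i] :=
  cexp (- s * (ln (n.+1%:R : R))%:C).

Definition analytic_at (R : realType) (f : R[i] -> R[i]) (s : R[i]) : Prop :=
  exists (c : nat -> R[i]) (r : R), 0 < r /\
    forall z : R[i], Normc.normc (z - s) < r ->
      series (fun k => c k * (z - s) ^+ k) @ \oo --> (f z : R[i]^o).

(* The analytic continuation to the complex plane without [1] of the Dirichlet
   series.  By the identity theorem this determines [zeta] at every point but
   the pole [1]; the (junk) value [zeta 1] is left unconstrained. *)
Definition is_riemann_zeta (R : realType) (zeta : R[i] -> R[i]) : Prop :=
  (forall s : R[i], 1 < complex.Re s ->
     series (dirichlet_term s) @ \oo --> (zeta s : R[i]^o)) /\
  (forall s : R[i], s != 1 -> analytic_at zeta s).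

(* [rho != 1] discards the junk value of [zeta] at its pole. *)
Definition zeta_zero (R : realType) (zeta : R[i] -> R[i]) (rho : R[i]) : Prop :=
  rho != 1 /\ zeta rho = 0.

Definition trivial_zero (R : realType) (rho : R[i]) : Prop :=
  exists k : nat, rho = (- (2 * k.+1%:R : R))%:C.

Definition riemann_hypothesis (R : realType) (zeta : R[i] -> R[i]) : Prop :=
  forall rho : R[i],
    zeta_zero zeta rho -> ~ trivial_zero rho -> complex.Re rho = 1 / 2.

(* The integral over the half-line is a Lebesgue integral, so logarithmic
   singularities of the integrand are handled as usual; at the zeros of [zeta]
   themselves, which form a null set, [ln 0] has the conventional value [0]. *)
Definition log_zeta_integral (R : realType) (zeta : R[i] -> R[i]) (b a : R)
    : \bar R :=
  (\int[lebesgue_measure]_(t in `[0%R, +oo[)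
     (ln (Normc.normc (zeta (b +i* t))) / cosh (a * t))%R%:E)%E.

(* [zeta] is evaluated at real points greater than [1], where it is a positive
   real number; [complex.Re] only casts this value back to [R]. *)
Definition log_zeta_term (R : realType) (zeta : R[i] -> R[i]) (b a : R)
    (n : nat) : R :=
  (-1) ^+ n *
    ln (complex.Re (zeta (b + pi / (2 * a) + pi * n%:R / a)%:C)).

(* The right-hand side is a real number, so the equation in [\bar R] also
   asserts that the integral converges absolutely. *)
Definition log_zeta_equality (R : realType) (zeta : R[i] -> R[i]) (b a : R)
    : Prop :=
  cvgn (series (log_zeta_term zeta b a)) /\
  ((a / pi)%:E * log_zeta_integral zeta b a)%E =
    (1 / 2 * ln ((1 - sin (a * (1 - b))) / (1 + sin (a * (1 - b))))
     + limn (series (log_zeta_term zeta b a)))%:E.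

(* Main.v *)
(** Put [s = b + w] and let [h] be the harmonic function
    [(ln (cosh ay + sin ax) - ln (cosh ay - sin ax)) / (2a)], which vanishes on
    [x = 0] with normal derivative [1 / cosh ay].  Green's formula for [h] cut
    off between [x0] and [x1] (where [1 - b < x0 < x1 < pi / (2a)]) expresses
    [E u + W u], the sum of [int u(0,y) / cosh(ay) dy] and of an integral over
    the strip [x0 <= x <= x1], through the Laplacian of [u].  For [u = ln |G|]
    the result is [2 pi] times the sum of [h] over the zeros of [G] in [x > 0]:
    it is [0] when there is none and positive otherwise.  Applied to
    [G w = (s - 1) zeta s] and, for the pole, to [w - (1 - b)] it gives the first
    term on the right-hand side; [W (ln |zeta|)] is the alternating sum, because
    on [exp (- l w)] both are given by the Fourier transform of [1 / cosh], and
    [ln |zeta|] is a limit of combinations of such exponentials by the Euler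
    product.  For [b = 1 / 2] the functional equation, obtained from the partial
    fractions of [tanh] and the Mellin transform of [1 / cosh], moves the zeros
    with [Re < 1 / 2] to [Re > 1 / 2]. *)

Require Import Defs.
From mathcomp Require Import all_boot all_order all_algebra.
From mathcomp Require Import all_classical all_reals all_analysis.
From mathcomp Require Import measurable_realfun ring lra zify.
Set Implicit Arguments.
Unset Strict Implicit.
Unset Printing Implicit Defensive.
Import Order.TTheory GRing.Theory Num.Theory.
Import numFieldNormedType.Exports.
Import Normc.
Local Notation Re := complex.Re.
Local Notation Im := complex.Im.
Local Open Scope classical_set_scope.
Local Open Scope ring_scope.
Local Open Scope complex_scope.

(** * Complex sequences and power series *)

(** The obstacle is that nothing is known beforehand about [ln |zeta|] in the critical strip,
    neither its size near zeros nor their number; a bound from below is available only where the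
    Euler product converges, that is for [x > 1 - b]. This dictates the cutoff: [W] sees only
    [x0 <= x <= x1], where [G] has no zeros, and [a * (1 - b) < pi / 2] is exactly the room needed
    for [1 - b < x0 < x1 < pi / (2 a)], since [h] is singular at [x = pi / (2 a)], [y = 0].
    Integrability of [ln |G|] further to the left is deduced: [ln (|G|^2 + e) / 2] is subharmonic,
    so [E + W >= 0] for it, and as [e] decreases to [0] this bounds the negative part of the
    logarithm on the line; translates of [G] give the other lines. Infinitely many zeros do no harm,
    because it suffices to divide out one of them: the quotient satisfies the same inequality. The
    decay of [1 / cosh] tolerates growth of [ln |G|] that is linear in [|y|]. *)

Section ComplexNorm.
Context {R : realType}.
Implicit Types (z w : R[i]) (x y : R).

Lemma normc_ge0 z : 0 <= normc z.
Proof. by case: z => x y; exact: sqrtr_ge0. Qed.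

Lemma normc_sqr z : normc z ^+ 2 = Re z ^+ 2 + Im z ^+ 2.
Proof. by case: z => x y /=; rewrite sqr_sqrtr// addr_ge0// sqr_ge0. Qed.

Lemma normc_real x : normc x%:C = `|x|.
Proof. by rewrite /= expr0n /= addr0 sqrtr_sqr. Qed.

Lemma normcX z n : normc (z ^+ n) = normc z ^+ n.
Proof. by elim: n => [|n IH]; rewrite ?expr0 ?normc1// !exprS normcM IH. Qed.

Lemma normc_eq0 z : (normc z == 0) = (z == 0).
Proof.
by apply/eqP/eqP => [|->]; [exact: eq0_normc|exact: normc0].
Qed.

Lemma normc_gt0 z : (0 < normc z) = (z != 0).
Proof. by rewrite lt0r normc_eq0 normc_ge0 andbT. Qed.

Lemma ler_normcB z w : normc (z - w) <= normc z + normc w.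
Proof. by rewrite -(normcN w); exact: le_normcD. Qed.

Lemma normcC z w : normc (z - w) = normc (w - z).
Proof. by rewrite -normcN opprB. Qed.

Lemma ler_normc_dist z w : normc z - normc w <= normc (z - w).
Proof. by rewrite lerBlDr (le_trans _ (le_normcD _ _))// subrK. Qed.

Lemma normc_sum I (r : seq I) (P : pred I) (f : I -> R[i]) :
  normc (\sum_(i <- r | P i) f i) <= \sum_(i <- r | P i) normc (f i).
Proof.
elim/big_ind2 : _ => //; first by rewrite normc0.
by move=> a b c d ab cd; rewrite (le_trans (le_normcD _ _))// lerD.
Qed.

Lemma ler_Re z : `|Re z| <= normc z.
Proof.
case: z => x y /=; rewrite -sqrtr_sqr ler_sqrt ?lerDl ?sqr_ge0//.
by rewrite addr_ge0// sqr_ge0.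
Qed.

Lemma ler_Im z : `|Im z| <= normc z.
Proof.
case: z => x y /=; rewrite -sqrtr_sqr ler_sqrt ?lerDr ?sqr_ge0//.
by rewrite addr_ge0// sqr_ge0.
Qed.

Lemma normc_leD z : normc z <= `|Re z| + `|Im z|.
Proof.
have -> : z = (Re z)%:C + (Im z)%:C * 'i.
  by case: z => x y /=; simpc.
apply: le_trans (le_normcD _ _) _; rewrite normcM !normc_real.
rewrite (_ : normc 'i = 1) ?mulr1; last by rewrite /= expr0n expr1n add0r sqrtr1.
by simpc; rewrite /= ?addr0 ?subr0 ?mulr0 ?mul0r ?mulr1 ?add0r ?addr0.
Qed.

Lemma creD z w : Re (z + w) = Re z + Re w. Proof. by case: z; case: w. Qed.
Lemma cimD z w : Im (z + w) = Im z + Im w. Proof. by case: z; case: w. Qed.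
Lemma creN z : Re (- z) = - Re z. Proof. by case: z. Qed.
Lemma cimN z : Im (- z) = - Im z. Proof. by case: z. Qed.
Lemma creM z w : Re (z * w) = Re z * Re w - Im z * Im w.
Proof. by case: z; case: w. Qed.
Lemma cimM z w : Im (z * w) = Re z * Im w + Im z * Re w.
Proof. by case: z; case: w. Qed.

Lemma Re_sum I (r : seq I) (P : pred I) (f : I -> R[i]) :
  Re (\sum_(i <- r | P i) f i) = \sum_(i <- r | P i) Re (f i).
Proof. by elim/big_ind2 : _ => // a b c d <- <-; rewrite creD. Qed.

Lemma Im_sum I (r : seq I) (P : pred I) (f : I -> R[i]) :
  Im (\sum_(i <- r | P i) f i) = \sum_(i <- r | P i) Im (f i).
Proof. by elim/big_ind2 : _ => // a b c d <- <-; rewrite cimD. Qed.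

Lemma complex_nat n : (n%:R : R[i]) = (n%:R : R)%:C.
Proof. by rewrite rmorph_nat. Qed.

Lemma eqc z w : Re z = Re w -> Im z = Im w -> z = w.
Proof. by case: z => a b; case: w => c d /= -> ->. Qed.

End ComplexNorm.

Lemma cvg_dist0P {R : realType} {T : Type} {F : set_system T} {FF : Filter F}
  (f : T -> R) (l : R) : f @ F --> l <-> (fun t => `|f t - l|) @ F --> (0 : R).
Proof.
split=> [/cvgrPdist_lt|/cvgrPdist_lt] h; apply/cvgrPdist_lt => e /h.
  by apply: filterS => t; rewrite sub0r normrN normr_id distrC.
by apply: filterS => t; rewrite sub0r normrN normr_id distrC.
Qed.

Arguments Normc.normc : simpl never.

Section ComplexCvg.
Context {R : realType}.
Implicit Types (u v : nat -> R[i]) (l m : R[i]).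

(** Convergence is phrased by a real null sequence, so that limit theorems over [R] apply directly;
    [ccvgP] is the link to the topology of [R[i]^o]. *)
Definition ccvg u l := (fun n => normc (u n - l)) @ \oo --> (0 : R).

Lemma ccvgP u l : u @ \oo --> (l : R[i]^o) <-> ccvg u l.
Proof.
have nE z : `|z| = (normc z)%:C by rewrite normc_def; case: z.
split => [/(@cvgrPdist_lt _ R[i]^o) h|/cvgrPdist_lt h].
  apply/cvgrPdist_lt => e e0; have := h e%:C; rewrite ltcR => /(_ e0).
  apply: filterS => n; rewrite sub0r normrN [X in _ -> X < _]ger0_norm ?normc_ge0//.
  by rewrite normcC nE ltcR.
apply/(@cvgrPdist_lt _ R[i]^o) => -[e e']; rewrite ltcE /= => /andP[/eqP -> e0].
apply: filterS (h _ e0) => n; rewrite sub0r normrN ger0_norm ?normc_ge0//.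
by rewrite normcC nE ltcR.
Qed.

Lemma ccvg_squeeze u l (e : nat -> R) :
  (forall n, normc (u n - l) <= e n) -> e @ \oo --> (0 : R) -> ccvg u l.
Proof.
move=> h he; apply: (squeeze_cvgr _ (cvg_cst 0) he).
by apply: nearW => n; rewrite normc_ge0 h.
Qed.

Lemma ccvg_Re u l : ccvg u l -> (fun n => Re (u n)) @ \oo --> Re l.
Proof.
move=> ul; apply/cvg_dist0P; apply: (squeeze_cvgr _ (cvg_cst 0) ul).
by apply: nearW => n; rewrite normr_ge0 /= -creN -creD ler_Re.
Qed.

Lemma ccvg_Im u l : ccvg u l -> (fun n => Im (u n)) @ \oo --> Im l.
Proof.
move=> ul; apply/cvg_dist0P; apply: (squeeze_cvgr _ (cvg_cst 0) ul).
by apply: nearW => n; rewrite normr_ge0 /= -cimN -cimD ler_Im.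
Qed.

Lemma ccvg_ReIm u l : (fun n => Re (u n)) @ \oo --> Re l ->
  (fun n => Im (u n)) @ \oo --> Im l -> ccvg u l.
Proof.
move=> hr hi; apply: (@ccvg_squeeze _ _ (fun n => `|Re (u n) - Re l| + `|Im (u n) - Im l|)).
  by move=> n; rewrite -creN -cimN -creD -cimD normc_leD.
rewrite -[X in _ --> X](addr0 0); by apply: cvgD; apply: (cvg_dist0P _ _).1.
Qed.

Lemma ccvg_unique u l m : ccvg u l -> ccvg u m -> l = m.
Proof.
move=> ul um; apply: eqc.
  exact: (cvg_unique _ (ccvg_Re ul) (ccvg_Re um)).
exact: (cvg_unique _ (ccvg_Im ul) (ccvg_Im um)).
Qed.

Lemma ccvg_cst l : ccvg (fun=> l) l.
Proof. by rewrite /ccvg subrr normc0; exact: cvg_cst. Qed.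

Lemma ccvgD u v l m : ccvg u l -> ccvg v m -> ccvg (fun n => u n + v n) (l + m).
Proof.
move=> ul vm; apply: (@ccvg_squeeze _ _ (fun n => normc (u n - l) + normc (v n - m))).
  by move=> n; rewrite opprD addrACA le_normcD.
by rewrite -[X in _ --> X](addr0 0); apply: cvgD.
Qed.

Lemma ccvg_near u v l : (\forall n \near \oo, u n = v n) -> ccvg u l -> ccvg v l.
Proof.
move=> uv; apply: cvg_trans; apply: near_eq_cvg.
by apply: filterS uv => n ->.
Qed.

Lemma ccvgMl u l c : ccvg u l -> ccvg (fun n => c * u n) (c * l).
Proof.
move=> ul; apply: (@ccvg_squeeze _ _ (fun n => normc c * normc (u n - l))).
  by move=> n; rewrite -mulrBr normcM.
by rewrite -[X in _ --> X](mulr0 (normc c)); apply: cvgM => //; exact: cvg_cst.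
Qed.

Lemma ccvgN u l : ccvg u l -> ccvg (fun n => - u n) (- l).
Proof. by move=> /(ccvgMl (-1)); under eq_fun do rewrite mulN1r; rewrite mulN1r. Qed.

Lemma ccvgM u v l m : ccvg u l -> ccvg v m -> ccvg (fun n => u n * v n) (l * m).
Proof.
move=> ul vm; apply: ccvg_ReIm.
  under eq_fun do rewrite creM.
  by rewrite creM; apply: cvgB; apply: cvgM; (exact: ccvg_Re || exact: ccvg_Im).
under eq_fun do rewrite cimM.
by rewrite cimM; apply: cvgD; apply: cvgM; (exact: ccvg_Re || exact: ccvg_Im).
Qed.

Lemma ccvg_normc u l : ccvg u l -> (fun n => normc (u n)) @ \oo --> normc l.
Proof.
move=> ul; apply/cvg_dist0P; apply: (squeeze_cvgr _ (cvg_cst 0) ul).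
apply: nearW => n; rewrite normr_ge0 /= ler_norml.
have := ler_normc_dist (u n) l; have := ler_normc_dist l (u n).
by rewrite normcC; lra.
Qed.

Lemma ccvg_shift u l k : ccvg u l -> ccvg (fun n => u (n + k)%N) l.
Proof. by move=> ul; exact: (@cvg_comp _ _ _ _ (fun n => normc (u n - l)) _ _ _ (cvg_addnr k) ul). Qed.

Lemma ccvg_bound u l : ccvg u l -> exists2 M, 0 <= M & forall n, normc (u n) <= M.
Proof.
move=> ul; have [M [Mr hM]] := cvg_seq_bounded (cvgP _ (ccvg_normc ul)).
exists (Num.max 0 (M + 1)); first by rewrite le_max lexx.
move=> n; have := hM (M + 1); rewrite ltrDl ltr01 => /(_ isT n I) /=.
by rewrite ger0_norm ?normc_ge0// le_max => ->; rewrite orbT.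
Qed.

Lemma ccvg_le u l (e : R) : ccvg u l ->
  (\forall n \near \oo, normc (u n) <= e) -> normc l <= e.
Proof. by move=> /ccvg_normc h hn; apply: (cvgr_to_le h hn). Qed.

End ComplexCvg.

Section PowerSeries.
Context {R : realType}.
Implicit Types (c d : nat -> R[i]) (f g : R[i] -> R[i]) (s z w : R[i]).

Definition ps c z n := \sum_(k < n) c k * z ^+ k.

(* Unlike [analytic_at], this keeps an explicit geometric bound on the
   coefficients, so that sums and products stay elementary. *)
Definition an f s := exists (c : nat -> R[i]) (q M : R),
  [/\ 0 < q, forall k, normc (c k) <= M * q ^+ k &
   forall z, normc z * q <= 1 / 2 -> ccvg (ps c z) (f (s + z))].

Lemma psS c z n : ps c z n.+1 = ps c z n + c n * z ^+ n.
Proof. by rewrite /ps big_ord_recr. Qed.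

Lemma half_sum n : \sum_(k < n) (1 / 2 : R) ^+ k <= 2.
Proof.
have -> : \sum_(k < n) (1 / 2 : R) ^+ k = 2 - 2 * (1 / 2) ^+ n.
  elim: n => [|n IH]; first by rewrite big_ord0 expr0; lra.
  by rewrite big_ord_recr /= IH exprS; lra.
by rewrite lerBlDr lerDl mulr_ge0// exprn_ge0//; lra.
Qed.

Lemma geom_normc_sum (t : nat -> R[i]) M n :
  (forall k, normc (t k) <= M * (1 / 2) ^+ k) ->
  normc (\sum_(k < n) t k) <= 2 * M.
Proof.
move=> h; have M0 : 0 <= M.
  by have := h 0%N; rewrite expr0 mulr1; apply: le_trans; exact: normc_ge0.
apply: le_trans (normc_sum _ _ _) _.
apply: (@le_trans _ _ (\sum_(k < n) M * (1 / 2) ^+ k)); first by apply: ler_sum => k _.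
by rewrite -mulr_sumr mulrC ler_wpM2r// half_sum.
Qed.

Lemma geom_ccvg (t : nat -> R[i]) M :
  (forall k, normc (t k) <= M * (1 / 2) ^+ k) ->
  exists l, ccvg (fun n => \sum_(k < n) t k) l.
Proof.
move=> h.
have M0 : 0 <= M.
  by have := h 0%N; rewrite expr0 mulr1; apply: le_trans; exact: normc_ge0.
have gs : cvgn (series (geometric M (1 / 2 : R))).
  by apply: is_cvg_geometric_series; rewrite ger0_norm; lra.
have aux (r : nat -> R) : (forall k, `|r k| <= normc (t k)) -> cvgn (series r).
  move=> rt; apply: normed_cvg; apply: (series_le_cvg _ _ _ gs) => k /=.
  - exact: normr_ge0.
  - by rewrite mulr_ge0// exprn_ge0//; lra.
  - exact: le_trans (rt k) (h k).
have [a ha] := (cvg_ex _).1 (aux _ (fun k => ler_Re (t k))).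
have [b hb] := (cvg_ex _).1 (aux _ (fun k => ler_Im (t k))).
exists (a +i* b); apply: ccvg_ReIm => /=.
  by under eq_fun do rewrite Re_sum; move: ha; rewrite /series /= (eq_cvg _ _ (fun n => big_mkord _ _)).
by under eq_fun do rewrite Im_sum; move: hb; rewrite /series /= (eq_cvg _ _ (fun n => big_mkord _ _)).
Qed.

(** At the point [r / 2] the partial sums converge, hence are bounded, and each term is a difference
    of two of them. This is the geometric bound with [q = 2 / r]. *)
Lemma analytic_an f s : analytic_at f s -> an f s.
Proof.
move=> [c [r [r0 h]]].
have hr z : normc z < r -> ccvg (ps c z) (f (s + z)).
  move=> zr; have := h (s + z); rewrite addrAC subrr add0r => /(_ zr) /ccvgP.
  by rewrite /series /ps /= (_ : (fun n => _) = (fun n => \sum_(k < n) c k * z ^+ k))//;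
    apply/funext => n; rewrite big_mkord.
have hz : normc ((r / 2)%:C) < r by rewrite normc_real ger0_norm; lra.
have [M M0 hM] := ccvg_bound (hr _ hz).
exists c, (2 / r), (2 * M); split; first by rewrite divr_gt0.
- move=> k.
  have tk : c k * (r / 2)%:C ^+ k = ps c (r / 2)%:C k.+1 - ps c (r / 2)%:C k.
    by rewrite /ps big_ord_recr /= addrAC subrr add0r.
  have : normc (c k * (r / 2)%:C ^+ k) <= 2 * M.
    rewrite tk; apply: le_trans (ler_normcB _ _) _.
    by have := hM k.+1; have := hM k; lra.
  rewrite normcM normcX normc_real ger0_norm; last lra.
  have rk : 0 < (r / 2) ^+ k by rewrite exprn_gt0//; lra.
  rewrite -ler_pdivlMr// => /le_trans; apply; rewrite -exprVn.
  by rewrite (_ : (r / 2)^-1 = 2 / r)// invf_div.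
- move=> z hz'; apply: hr.
  have : normc z * (2 / r) < 1 by lra.
  by rewrite mulrA ltr_pdivrMr// mul1r; have := normc_ge0 z; lra.
Qed.

Lemma ps_bound c (q M : R) z k : 0 < q -> (forall k, normc (c k) <= M * q ^+ k) ->
  normc z * q <= 1 / 2 -> normc (c k * z ^+ k) <= M * (1 / 2) ^+ k.
Proof.
move=> q0 h zq; have M0 : 0 <= M.
  by have := h 0%N; rewrite expr0 mulr1; apply: le_trans; exact: normc_ge0.
rewrite normcM normcX; apply: (@le_trans _ _ (M * (normc z * q) ^+ k)).
  by rewrite exprMn mulrA mulrAC; apply: ler_pM; rewrite ?normc_ge0 ?exprn_ge0 ?normc_ge0.
rewrite ler_wpM2l// lerXn2r ?nnegrE ?mulr_ge0 ?normc_ge0 ?(ltW q0)//; lra.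
Qed.

Lemma ps_ccvg c (q M : R) z : 0 < q -> (forall k, normc (c k) <= M * q ^+ k) ->
  normc z * q <= 1 / 2 -> exists l, ccvg (ps c z) l.
Proof.
by move=> q0 h zq; apply: (@geom_ccvg (fun k => c k * z ^+ k) M) => k; exact: ps_bound q0 h zq.
Qed.

Lemma ps_le c (q M : R) z l : 0 < q -> (forall k, normc (c k) <= M * q ^+ k) ->
  normc z * q <= 1 / 2 -> ccvg (ps c z) l -> normc l <= 2 * M.
Proof.
move=> q0 h zq /ccvg_le; apply; apply: nearW => n.
by apply: (@geom_normc_sum (fun k => c k * z ^+ k)) => k; exact: ps_bound q0 h zq.
Qed.

(** Replacing [q] by [q + 1 / r] shrinks the disc on which the expansion is required into the one
    where [f] and [g] agree. *)
Lemma an_near f g s (r : R) : 0 < r ->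
  (forall z, normc z <= r -> f (s + z) = g (s + z)) -> an f s -> an g s.
Proof.
move=> r0 fg [c [q [M [q0 h1 h2]]]].
have M0 : 0 <= M.
  by have := h1 0%N; rewrite expr0 mulr1; apply: le_trans; exact: normc_ge0.
exists c, (q + 1 / r), M; split.
- by rewrite addr_gt0// divr_gt0.
- move=> k; apply: le_trans (h1 k) _; rewrite ler_wpM2l// lerXn2r ?nnegrE ?lerDl//.
  + exact: ltW.
  + by rewrite addr_ge0 ?divr_ge0 ?ltW.
  + by rewrite divr_ge0// ltW.
- move=> z; rewrite mulrDr => hz.
  have n0 := normc_ge0 z.
  have z1 : 0 <= normc z * q by rewrite mulr_ge0// ltW.
  have z2 : 0 <= normc z * (1 / r) by rewrite mulr_ge0// divr_ge0// ltW.
  rewrite -fg; first by apply: h2; lra.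
  have : normc z * (1 / r) <= 1 by lra.
  by rewrite mulrA ler_pdivrMr// mulr1 mul1r.
Qed.


Lemma an_M0 c (q M : R) : (forall k, normc (c k) <= M * q ^+ k) -> 0 <= M.
Proof. by move/(_ 0%N); rewrite expr0 mulr1; apply: le_trans; exact: normc_ge0. Qed.

Lemma an_cst a s : an (fun=> a) s.
Proof.
exists (fun k => if k == 0%N then a else 0), 1, (normc a); split => //.
  by move=> [|k] /=; rewrite ?expr1n ?mulr1 ?normc0 ?normc_ge0.
move=> z _; apply: (@ccvg_near _ (fun=> a)); last exact: ccvg_cst.
exists 1%N => // -[//|n] _; rewrite /ps big_ord_recl /= mulr1 big1 ?addr0// => i _.
by rewrite mul0r.
Qed.

Lemma an_id s : an id s.
Proof.
exists (fun k => if k == 0%N then s else if k == 1%N then 1 else 0), 1, (normc s + 1).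
split => //.
  move=> [|[|k]] /=; rewrite ?expr1n ?mulr1 ?normc1 ?normc0 ?lerDl ?lerDr ?normc_ge0//.
  by rewrite addr_ge0// normc_ge0.
move=> z _; apply: (@ccvg_near _ (fun=> s + z)); last exact: ccvg_cst.
exists 2%N => // -[//|[//|n]] _; rewrite /ps !big_ord_recl /= mulr1 expr1 mul1r.
by rewrite big1 ?addr0// => i _; rewrite mul0r.
Qed.

Lemma anD f g s : an f s -> an g s -> an (fun z => f z + g z) s.
Proof.
move=> [c [q [M [q0 h1 h2]]]] [d [p [N [p0 k1 k2]]]].
have M0 := an_M0 h1; have N0 := an_M0 k1.
exists (fun k => c k + d k), (q + p), (M + N); split.
- by rewrite addr_gt0.
- move=> k; apply: le_trans (le_normcD _ _) _; rewrite mulrDl; apply: lerD.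
    by apply: le_trans (h1 k) _; rewrite ler_wpM2l// lerXn2r ?nnegrE; lra.
  by apply: le_trans (k1 k) _; rewrite ler_wpM2l// lerXn2r ?nnegrE; lra.
- move=> z; rewrite mulrDr => hz.
  have z1 : 0 <= normc z * q by rewrite mulr_ge0 ?normc_ge0// ltW.
  have z2 : 0 <= normc z * p by rewrite mulr_ge0 ?normc_ge0// ltW.
  have -> : ps (fun k => c k + d k) z = (fun n => ps c z n + ps d z n).
    by apply/funext => n; rewrite /ps -big_split /=; apply: eq_bigr => k _; rewrite mulrDl.
  by apply: ccvgD; [apply: h2|apply: k2]; lra.
Qed.

(** The bound [k ^ 2 <= 2 * 2 ^ k] trades the ratio [1 / 4] for [1 / 2]. These weights control both
    the Cauchy product and termwise differentiation. *)
Lemma sum_half_sq n : \sum_(k < n) (k%:R ^+ 2 * (1 / 4) ^+ k : R) <= 4.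
Proof.
apply: (@le_trans _ _ (\sum_(k < n) (2 * (1 / 2) ^+ k))); last first.
  by rewrite -mulr_sumr; have := half_sum n; lra.
apply: ler_sum => k _; rewrite (_ : 1 / 4 = (1 / 2) * (1 / 2) :> R); last by lra.
have h0 : 0 <= (1 / 2 : R) ^+ k by rewrite exprn_ge0//; lra.
rewrite exprMn mulrA; apply: ler_wpM2r => //.
rewrite div1r exprVn ler_pdivrMr ?exprn_gt0// -natrX -natrX -natrM ler_nat.
elim: (nat_of_ord k) => [//|m IH]; case: m IH => [//|[//|[//|m]]] IH.
by rewrite [(2 ^ _)%N]expnS; nia.
Qed.

Lemma sqr_geo_cvg0 (C : R) : (fun n => C * n%:R ^+ 2 * (1 / 4) ^+ n) @ \oo --> (0 : R).
Proof.
have h : cvgn (series (fun n => (n%:R ^+ 2 * (1 / 4) ^+ n : R))).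
  apply: nondecreasing_is_cvgn.
    apply: nondecreasing_series => n _ _.
    by rewrite mulr_ge0// ?exprn_ge0//; lra.
  exists 4 => _ [n _ <-]; rewrite /series /= big_mkord; exact: sum_half_sq.
have := cvg_series_cvg_0 h => h0.
rewrite -[X in _ --> X](mulr0 C).
under eq_fun do rewrite -mulrA.
by apply: cvgM => //; exact: cvg_cst.
Qed.

Lemma leSexp2 k : (k.+1 <= 2 ^ k)%N. Proof. by exact: ltn_expl. Qed.

Lemma ps_prod c d z n : ps c z n * ps d z n -
    ps (fun k => \sum_(i < k.+1) c i * d (k - i)%N) z n =
  \sum_(i < n) \sum_(j < n | (n <= i + j)%N) (c i * z ^+ i) * (d j * z ^+ j).
Proof.
have -> : ps (fun k => \sum_(i < k.+1) c i * d (k - i)%N) z n =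
  \sum_(i < n) \sum_(j < n | (i + j < n)%N) (c i * z ^+ i) * (d j * z ^+ j).
  rewrite /ps; under eq_bigr do rewrite mulr_suml.
  rewrite (eq_bigr (fun k : 'I_n => \sum_(i < n | (i <= k)%N) (c i * z ^+ i) * (d (k - i)%N * z ^+ (k - i)))).
    rewrite (exchange_big_dep xpredT)//=; apply: eq_bigr => i _.
    rewrite -(big_mkord (fun k => (i <= k)%N) (fun k => (c i * z ^+ i) * (d (k - i)%N * z ^+ (k - i)))).
    rewrite -(big_mkord (fun j => (i + j < n)%N) (fun j => (c i * z ^+ i) * (d j * z ^+ j))).
    rewrite [LHS](big_cat_nat (n := i)) ?(ltnW (ltn_ord i))//= big_nat_cond big1 ?add0r; last first.
      by move=> k /andP[/andP[_ ki] ik]; move: ki; rewrite ltnNge ik.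
    rewrite [RHS](big_cat_nat (n := (n - i)%N)) ?leq_subr//= [X in _ = _ + X]big_nat_cond.
    rewrite [X in _ = _ + X]big1 ?addr0; last first.
      by move=> k /andP[/andP[h1 _] h2]; exfalso; lia.
    rewrite -{1}(add0n (nat_of_ord i)) big_addn.
    rewrite big_nat_cond [RHS]big_nat_cond; apply: eq_big => k.
      by apply/idP/idP; lia.
    by move=> _; rewrite addnK.
  move=> k _; rewrite (big_ord_widen_cond n xpredT (fun i => c i * d (k - i)%N * z ^+ k)) ?ltn_ord//=.
  apply: eq_big => [i|i ik]; first by rewrite ltnS.
  rewrite (_ : z ^+ k = z ^+ i * z ^+ (k - i)); last by rewrite -exprD subnKC// -ltnS.
  by ring.
rewrite /ps mulr_suml -sumrB; apply: eq_bigr => i _.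
rewrite mulr_sumr (bigID (fun j : 'I_n => (i + j < n)%N)) /= addrAC subrr add0r.
by apply: eq_bigl => j; rewrite -leqNgt.
Qed.

(** The [k + 1] summands of a Cauchy coefficient cost a factor [2 ^ k], whence the rate [2 * r]. On
    the smaller disc [normc z * r <= 1 / 4], so each of the at most [n ^ 2] terms left over in
    [ps_prod] is at most [M * N / 4 ^ n]. *)
Lemma anM f g s : an f s -> an g s -> an (fun z => f z * g z) s.
Proof.
move=> [c [q [M [q0 h1 h2]]]] [d [p [N [p0 k1 k2]]]].
have M0 := an_M0 h1; have N0 := an_M0 k1.
pose r := q + p.
have h1' k : normc (c k) <= M * r ^+ k.
  by apply: le_trans (h1 k) _; rewrite ler_wpM2l// lerXn2r ?nnegrE /r; lra.
have k1' k : normc (d k) <= N * r ^+ k.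
  by apply: le_trans (k1 k) _; rewrite ler_wpM2l// lerXn2r ?nnegrE /r; lra.
have r0 : 0 < r by rewrite addr_gt0.
exists (fun k => \sum_(i < k.+1) c i * d (k - i)%N), (2 * r), (M * N); split.
- by rewrite mulr_gt0.
- move=> k; apply: le_trans (normc_sum _ _ _) _.
  apply: (@le_trans _ _ (\sum_(i < k.+1) M * N * r ^+ k)).
    apply: ler_sum => i _; rewrite normcM.
    apply: le_trans (ler_pM (normc_ge0 _) (normc_ge0 _) (h1' i) (k1' _)) _.
    rewrite mulrACA -exprD subnKC//; exact: (leq_ord i).
  rewrite sumr_const card_ord -[leLHS]mulr_natr exprMn -[leLHS]mulrA; apply: ler_wpM2l.
    exact: mulr_ge0.
  rewrite mulrC; apply: ler_wpM2r; first by rewrite exprn_ge0// ltW.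
  by rewrite -natrX ler_nat leSexp2.
- move=> z hz.
  have zr : normc z * r <= 1 / 4 by lra.
  have z0 : 0 <= normc z * r by rewrite mulr_ge0 ?normc_ge0 ?ltW.
  have hc : ccvg (ps c z) (f (s + z)).
    apply: h2; apply: le_trans (_ : normc z * r <= _); last lra.
    by rewrite ler_wpM2l ?normc_ge0// /r; lra.
  have hd : ccvg (ps d z) (g (s + z)).
    apply: k2; apply: le_trans (_ : normc z * r <= _); last lra.
    by rewrite ler_wpM2l ?normc_ge0// /r; lra.
  pose e k := \sum_(i < k.+1) c i * d (k - i)%N.
  have he : ccvg (fun n => ps c z n * ps d z n - ps e z n) 0.
    apply: ccvg_squeeze (@sqr_geo_cvg0 (M * N)) => n.
    rewrite subr0 ps_prod; apply: le_trans (normc_sum _ _ _) _.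
    apply: (@le_trans _ _ (\sum_(i < n) \sum_(j < n) M * N * (1 / 4) ^+ n)).
      apply: ler_sum => i _; apply: le_trans (normc_sum _ _ _) _.
      rewrite [leRHS](bigID (fun j : 'I_n => (n <= i + j)%N)) /= ler_wpDr//.
        by rewrite sumr_ge0// => j _; rewrite !mulr_ge0// exprn_ge0//; lra.
      apply: ler_sum => j nij; rewrite !normcM !normcX.
      rewrite (_ : _ * _ = (normc (c i) * normc (d j)) * normc z ^+ (i + j)); last by rewrite exprD; ring.
      apply: (@le_trans _ _ (M * N * r ^+ (i + j) * normc z ^+ (i + j))).
        rewrite ler_wpM2r ?exprn_ge0 ?normc_ge0//.
        apply: le_trans (ler_pM (normc_ge0 _) (normc_ge0 _) (h1' i) (k1' j)) _.
        by rewrite mulrACA -exprD.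
      rewrite -mulrA -exprMn ler_wpM2l ?mulr_ge0//.
      apply: (@le_trans _ _ ((1 / 4) ^+ (i + j))).
        by rewrite (mulrC r); apply: lerXn2r; rewrite ?nnegrE; lra.
      by apply: ler_wiXn2l => //; lra.
    rewrite !sumr_const !card_ord -[leLHS]mulr_natr -[X in X * _ <= _]mulr_natr.
    by rewrite le_eqVlt; apply/orP; left; apply/eqP; ring.
  rewrite -(addr0 (f (s + z) * g (s + z))) -(subr0 (_ + 0)).
  have -> : ps e z = (fun n => ps c z n * ps d z n + 0 - (ps c z n * ps d z n - ps e z n)).
    by apply/funext => n; ring.
  apply: ccvgD; last exact: ccvgN.
  by apply: ccvgD; [exact: ccvgM|exact: ccvg_cst].
Qed.


Lemma anN f s : an f s -> an (fun z => - f z) s.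
Proof.
move=> h; have := anM (an_cst (-1) s) h.
by apply: an_near ltr01 _ => z _; rewrite mulN1r.
Qed.

Lemma anB f g s : an f s -> an g s -> an (fun z => f z - g z) s.
Proof. by move=> h1 h2; exact: anD h1 (anN h2). Qed.

(* Dividing a convergent power series by [z - s] amounts to shifting its
   coefficients. *)
Lemma an_shift c (q M : R) f s : 0 < q -> (forall k, normc (c k) <= M * q ^+ k) ->
  (forall z, normc z * q <= 1 / 2 -> ccvg (ps c z) (f (s + z))) ->
  let g w := if w == s then c 1%N else (f w - c 0%N) / (w - s) in
  [/\ forall k, normc (c k.+1) <= (M * q) * q ^+ k,
   forall z, normc z * q <= 1 / 2 -> ccvg (ps (fun k => c k.+1) z) (g (s + z)) &
   forall z, f s = c 0%N -> f (s + z) = c 0%N + z * g (s + z)].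
Proof.
move=> q0 h1 h2 g; split.
- by move=> k; rewrite -mulrA -exprS.
- move=> z zq; rewrite /g; case: eqP => [/eqP|/eqP].
    rewrite -subr_eq0 addrAC subrr add0r => /eqP ->.
    apply: (@ccvg_near _ (fun=> c 1%N)); last exact: ccvg_cst.
    exists 1%N => // -[//|n] _; rewrite /ps big_ord_recl /= expr0 mulr1 big1 ?addr0// => i _.
    by rewrite exprS mul0r mulr0.
  rewrite -subr_eq0 addrAC subrr add0r => z0.
  have -> : ps (fun k => c k.+1) z = (fun n => z^-1 * (ps c z (n + 1)%N - c 0%N)).
    apply/funext => n; rewrite addn1 /ps big_ord_recl /= expr0 mulr1 addrAC subrr add0r.
    rewrite mulr_sumr; apply: eq_bigr => i _.
    by rewrite /bump /= add1n exprS; field.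
  rewrite [X in ccvg _ X]mulrC; apply: ccvgMl.
  apply: ccvgD; last exact: ccvg_cst.
  exact: (@ccvg_shift _ _ _ 1 (h2 z zq)).
- move=> z fs; rewrite /g; case: eqP => [/eqP|/eqP].
    rewrite -subr_eq0 addrAC subrr add0r => /eqP ->.
    by rewrite mul0r !addr0.
  rewrite -subr_eq0 addrAC subrr add0r => z0.
  by field.
Qed.

Lemma ps0 c f s (q : R) : 0 < q ->
  (forall z, normc z * q <= 1 / 2 -> ccvg (ps c z) (f (s + z))) -> f s = c 0%N.
Proof.
move=> q0 h2; have := h2 0; rewrite normc0 mul0r addr0 => hh.
apply: ccvg_unique (hh _) _; first by lra.
apply: (@ccvg_near _ (fun=> c 0%N)); last exact: ccvg_cst.
exists 1%N => // -[//|n] _; rewrite /ps big_ord_recl /= expr0 mulr1 big1 ?addr0// => i _.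
by rewrite exprS mul0r mulr0.
Qed.

Lemma an_bounded f s : an f s ->
  exists r B : R, 0 < r /\ forall z, normc z <= r -> normc (f (s + z)) <= B.
Proof.
move=> [c [q [M [q0 h1 h2]]]]; exists (1 / (2 * q)), (2 * M); split.
  by rewrite divr_gt0// mulr_gt0.
move=> z zr; have zq : normc z * q <= 1 / 2.
  by move: zr; rewrite ler_pdivlMr ?mulr_gt0//; lra.
exact: ps_le q0 h1 zq (h2 z zq).
Qed.

Lemma an_quot f s : an f s -> exists2 g, an g s &
  exists r : R, 0 < r /\ forall z, normc z <= r -> f (s + z) = f s + z * g (s + z).
Proof.
move=> [c [q [M [q0 h1 h2]]]].
have [k1 k2 k3] := an_shift q0 h1 h2.
exists (fun w => if w == s then c 1%N else (f w - c 0%N) / (w - s)).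
  by exists (fun k => c k.+1), q, (M * q).
exists 1; split => // z _; rewrite {1}k3; last exact: ps0 q0 h2.
by rewrite (ps0 q0 h2).
Qed.

Definition ccont f s := forall e : R, 0 < e ->
  exists2 r : R, 0 < r & forall z, normc z <= r -> normc (f (s + z) - f s) <= e.

Lemma an_ccont f s : an f s -> ccont f s.
Proof.
move=> /an_quot[g /an_bounded[r [B [r0 hB]]] [r' [r'0 h]]] e e0.
have B0 : 0 <= B.
  by have := hB 0; rewrite normc0 => /(_ (ltW r0)); apply: le_trans; exact: normc_ge0.
exists (Num.min (Num.min r r') (e / (B + 1))).
  by rewrite !lt_min r0 r'0 divr_gt0// ltr_wpDl.
move=> z; rewrite !le_min => /andP[/andP[zr zr'] ze].
rewrite h// addrAC subrr add0r normcM.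
apply: (@le_trans _ _ (e / (B + 1) * B)).
  by apply: ler_pM; rewrite ?normc_ge0// hB.
by rewrite -mulrA ler_piMr ?(ltW e0)// mulrC ler_pdivrMr; lra.
Qed.

(** If some coefficient is nonzero, the least such index [m] is the order of vanishing: dividing by
    [z] that many times with [an_shift] leaves a series whose constant term is [c m]. *)
Lemma an_zero f s : an f s ->
  (exists2 r : R, 0 < r & forall z, normc z <= r -> f (s + z) = 0) \/
  exists m g, [/\ an g s, g s != 0 & exists2 r : R, 0 < r &
     forall z, normc z <= r -> f (s + z) = z ^+ m * g (s + z)].
Proof.
move=> [c [q [M [q0 h1 h2]]]].
have r0 : 0 < 1 / (2 * q) by rewrite divr_gt0// mulr_gt0.
have rP z : normc z <= 1 / (2 * q) -> normc z * q <= 1 / 2.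
  by rewrite ler_pdivlMr ?mulr_gt0//; lra.
have [hc|/existsNP[m0 /eqP hm0]] := pselect (forall k, c k = 0).
  left; exists (1 / (2 * q)) => // z zr.
  apply: ccvg_unique (h2 _ (rP _ zr)) _.
  rewrite (_ : ps c z = fun=> 0); first exact: ccvg_cst.
  by apply/funext => n; rewrite /ps big1// => i _; rewrite hc mul0r.
right; have ex : exists k, c k != 0 by exists m0.
have [m cm mmin] := ex_minnP ex.
suff H n : (n <= m)%N -> exists g, [/\
   forall k, normc (c (n + k)%N) <= (M * q ^+ n) * q ^+ k,
   forall z, normc z * q <= 1 / 2 -> ccvg (ps (fun k => c (n + k)%N) z) (g (s + z)) &
   forall z, normc z * q <= 1 / 2 -> f (s + z) = z ^+ n * g (s + z)].
  have [g [g1 g2 g3]] := H m (leqnn _).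
  exists m, g; split; first by exists (fun k => c (m + k)%N), q, (M * q ^+ m).
    by rewrite (ps0 q0 g2) addn0.
  by exists (1 / (2 * q)) => // z zr; exact: g3 (rP _ zr).
elim: n => [_|n IH nm].
  exists f; split => // [k|z _]; first by rewrite expr0 mulr1.
  by rewrite expr0 mul1r.
have [g [g1 g2 g3]] := IH (ltnW nm).
have [k1 k2 k3] := an_shift q0 g1 g2.
have cn : c (n + 0)%N = 0.
  by rewrite addn0; apply/eqP/negPn/negP => /mmin; rewrite leqNgt nm.
exists (fun w => if w == s then c (n + 1)%N else (g w - c (n + 0)%N) / (w - s)); split.
- by move=> k; have := k1 k; rewrite addnS -addSn exprSr mulrA.
- move=> z zq; have := k2 z zq; rewrite (_ : (fun k => c (n + k.+1)%N) = (fun k => c (n.+1 + k)%N))//.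
  by apply/funext => k; rewrite addnS -addSn.
- move=> z zq; rewrite g3// {1}k3; last by rewrite (ps0 q0 g2).
  by rewrite cn add0r mulrA -exprSr.
Qed.

(** A quadratic remainder holds for every analytic function and restricts to real partial
    derivatives through [dv_quad]. *)
Definition cderiv f s l := exists r B : R, 0 < r /\
  forall z, normc z <= r -> normc (f (s + z) - f s - l * z) <= B * normc z ^+ 2.

Lemma cderiv_unique f s l m : cderiv f s l -> cderiv f s m -> l = m.
Proof.
move=> [r [B [r0 h]]] [r' [B' [r'0 h']]].
apply/eqP; rewrite -subr_eq0 -normc_eq0 eq_le normc_ge0 andbT.
apply/ler_addgt0Pl => e e0; rewrite addr0.
pose t := Num.min (Num.min r r') (e / (`|B| + `|B'| + 1)).
have BB : 0 < `|B| + `|B'| + 1 by have := normr_ge0 B; have := normr_ge0 B'; lra.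
have t0 : 0 < t by rewrite !lt_min r0 r'0 divr_gt0.
have nt : normc t%:C = t by rewrite normc_real gtr0_norm.
have := h t%:C; rewrite nt /t ge_min ge_min lexx /= => /(_ isT) hh.
have := h' t%:C; rewrite nt /t ge_min ge_min lexx /= orbT /= => /(_ isT) hh'.
have : normc ((l - m) * t%:C) <= (`|B| + `|B'|) * t ^+ 2.
  rewrite -/t in hh hh'.
  have -> : (l - m) * t%:C = (f (s + t%:C) - f s - m * t%:C) - (f (s + t%:C) - f s - l * t%:C) by ring.
  apply: le_trans (ler_normcB _ _) _; rewrite mulrDl addrC; apply: lerD.
    by apply: le_trans hh _; rewrite ler_wpM2r ?sqr_ge0// ler_norm.
  by apply: le_trans hh' _; rewrite ler_wpM2r ?sqr_ge0// ler_norm.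
rewrite normcM nt expr2 mulrA ler_pM2r// => /le_trans; apply.
have te : t <= e / (`|B| + `|B'| + 1) by rewrite /t ge_min lexx orbT.
apply: (@le_trans _ _ ((`|B| + `|B'| + 1) * t)); first by rewrite ler_pM2r//; lra.
by rewrite mulrC -ler_pdivlMr.
Qed.

Lemma an_cderiv0 f s : an f s -> exists l, cderiv f s l.
Proof.
move=> /an_quot[g /an_quot[g' /an_bounded[r [B [r0 hB]]] [r2 [r20 h2]]] [r1 [r10 h1]]].
exists (g s), (Num.min r (Num.min r1 r2)), B; split; first by rewrite !lt_min r0 r10.
move=> z; rewrite !le_min => /andP[zr /andP[zr1 zr2]].
rewrite h1// h2// (_ : _ - _ = z ^+ 2 * g' (s + z)); last by ring.
by rewrite normcM normcX mulrC ler_wpM2r ?exprn_ge0 ?normc_ge0// hB.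
Qed.

(** The Taylor bounds of first and second order for [z ^ k] are multiplied by powers of [p], so that
    no exponent [k - 1] or [k - 2] occurs. One induction proves both because the second-order step
    uses the first-order bound. *)
Lemma pow_taylor2 z h (p : R) k : normc z + normc h <= p ->
  p ^+ 2 * normc ((z + h) ^+ k - z ^+ k - k%:R * h * z ^+ k.-1)
    <= k%:R ^+ 2 * normc h ^+ 2 * p ^+ k /\
  p * normc ((z + h) ^+ k - z ^+ k) <= k%:R * normc h * p ^+ k.
Proof.
move=> zp; have zn := normc_ge0 z; have hn := normc_ge0 h.
have p0 : 0 <= p by lra.
elim: k => [|k [IH1 IH2]].
  by rewrite !expr0 !mul0r subrr subr0 normc0 !mulr0 expr0n /= !mul0r.
have pk : 0 <= p ^+ k by rewrite exprn_ge0.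
have nzh : normc ((z + h) ^+ k) <= p ^+ k.
  rewrite normcX lerXn2r ?nnegrE ?normc_ge0//.
  by apply: le_trans (le_normcD _ _) _; lra.
split; last first.
  have -> : (z + h) ^+ k.+1 - z ^+ k.+1 = z * ((z + h) ^+ k - z ^+ k) + h * (z + h) ^+ k.
    by rewrite !exprS; ring.
  apply: (@le_trans _ _ (p * (normc z * normc ((z + h) ^+ k - z ^+ k) + normc h * p ^+ k))).
    rewrite ler_wpM2l//; apply: le_trans (le_normcD _ _) _; rewrite !normcM lerD//.
    by rewrite ler_wpM2l.
  have : normc z * (p * normc ((z + h) ^+ k - z ^+ k)) <= p * (k%:R * normc h * p ^+ k).
    by apply: ler_pM => //; [rewrite mulr_ge0 ?normc_ge0|lra].
  by rewrite exprS -natr1; nra.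
have -> : (z + h) ^+ k.+1 - z ^+ k.+1 - k.+1%:R * h * z ^+ k.+1.-1 =
    z * ((z + h) ^+ k - z ^+ k - k%:R * h * z ^+ k.-1) + h * ((z + h) ^+ k - z ^+ k).
  by case: k {IH1 IH2 pk nzh} => [|k]; rewrite /= ?expr0 ?expr1 ?exprS -?natr1; ring.
apply: (@le_trans _ _ (p ^+ 2 * (normc z * normc ((z + h) ^+ k - z ^+ k - k%:R * h * z ^+ k.-1)
   + normc h * normc ((z + h) ^+ k - z ^+ k)))).
  by rewrite ler_wpM2l ?exprn_ge0//; apply: le_trans (le_normcD _ _) _; rewrite !normcM.
have e1 : normc z * (p ^+ 2 * normc ((z + h) ^+ k - z ^+ k - k%:R * h * z ^+ k.-1))
    <= p * (k%:R ^+ 2 * normc h ^+ 2 * p ^+ k).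
  by apply: ler_pM => //; [rewrite mulr_ge0 ?normc_ge0 ?exprn_ge0|lra].
have e2 : (p * normc h) * (p * normc ((z + h) ^+ k - z ^+ k)) <= (p * normc h) * (k%:R * normc h * p ^+ k).
  by rewrite ler_wpM2l// mulr_ge0.
have e3 : 0 <= (k%:R + 1) * (normc h ^+ 2 * p ^+ k.+1).
  by rewrite mulr_ge0// ?mulr_ge0 ?exprn_ge0// addr_ge0.
rewrite -(natr1 k); move: e1 e2 e3; rewrite !(exprS p k); lra.
Qed.

Lemma ps_deriv c (q M : R) f s : 0 < q -> (forall k, normc (c k) <= M * q ^+ k) ->
  (forall z, normc z * q <= 1 / 2 -> ccvg (ps c z) (f (s + z))) ->
  exists g, an g s /\ exists2 r : R, 0 < r &
    forall z, normc z <= r -> cderiv f (s + z) (g (s + z)).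
Proof.
move=> q0 h1 h2; have M0 := an_M0 h1.
pose d k := k.+1%:R * c k.+1.
have dk k : normc (d k) <= (M * q) * (2 * q) ^+ k.
  rewrite normcM complex_nat normc_real ger0_norm ?ler0n// exprMn.
  rewrite (_ : _ * _ = 2 ^+ k * (M * q ^+ k.+1)); last by rewrite exprS; ring.
  by apply: ler_pM; rewrite ?ler0n ?normc_ge0// -natrX ler_nat leSexp2.
have q20 : 0 < 2 * q by rewrite mulr_gt0.
have gex w : exists l, normc (w - s) * (2 * q) <= 1 / 2 -> ccvg (ps d (w - s)) l.
  have [h|] := boolP (normc (w - s) * (2 * q) <= 1 / 2); last by exists 0.
  by have [l hl] := ps_ccvg q20 dk h; exists l.
have [g hg] := choice gex.
have hg' z : normc z * (2 * q) <= 1 / 2 -> ccvg (ps d z) (g (s + z)).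
  by move=> zq; have := hg (s + z); rewrite addrAC subrr add0r; apply.
exists g; split; first by exists d, (2 * q), (M * q).
(* Since [p * q = 1 / 4], the [k]-th remainder is dominated by a multiple of [k ^ 2 / 4 ^ k], which
   [sum_half_sq] sums. *)
pose p := 1 / (4 * q); have p0 : 0 < p by rewrite divr_gt0// mulr_gt0.
have pq : p * q = 1 / 4 by rewrite /p; field; rewrite gt_eqF.
clearbody p.
exists (p / 2); first by rewrite divr_gt0.
move=> z zr; exists (p / 2), (4 * M / p ^+ 2); split; first by rewrite divr_gt0.
move=> h hr; rewrite -(addrA s z h).
have zn := normc_ge0 z; have hn := normc_ge0 h.
have zhp : normc z + normc h <= p by lra.
have zhn : normc (z + h) * q <= 1 / 2.
  have : normc (z + h) * q <= p * q.
    by apply: ler_wpM2r; [exact: ltW|apply: le_trans (le_normcD _ _) _].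
  by lra.
have zqn : normc z * q <= 1 / 4 by rewrite -pq; apply: ler_wpM2r; [exact: ltW|lra].
have c1 := h2 _ zhn; have c2 := h2 z ltac:(lra); have c3 := hg' z ltac:(lra).
have cc : ccvg (fun n => ps c (z + h) (n + 1)%N - ps c z (n + 1)%N - ps d z n * h)
    (f (s + (z + h)) - f (s + z) - g (s + z) * h).
  apply: ccvgD; first apply: ccvgD.
  - exact: (@ccvg_shift _ _ _ 1 c1).
  - by apply: ccvgN; exact: (@ccvg_shift _ _ _ 1 c2).
  - by apply: ccvgN; apply: ccvgM => //; exact: ccvg_cst.
apply: ccvg_le cc _; apply: nearW => n.
have -> : ps c (z + h) (n + 1)%N - ps c z (n + 1)%N - ps d z n * h =
   \sum_(k < n.+1) c k * ((z + h) ^+ k - z ^+ k - k%:R * h * z ^+ k.-1).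
  rewrite addn1 /ps /d mulr_suml; under [RHS]eq_bigr do rewrite !mulrBr.
  rewrite !sumrB; congr (_ - _ - _).
  rewrite [RHS]big_ord_recl /= !mul0r mulr0 add0r; apply: eq_bigr => k _.
  by rewrite /bump /= add1n; ring.
apply: le_trans (normc_sum _ _ _) _.
apply: (@le_trans _ _ (\sum_(k < n.+1) (M * normc h ^+ 2 / p ^+ 2) * (k%:R ^+ 2 * (1 / 4) ^+ k))); last first.
  rewrite -mulr_sumr (_ : 4 * M / p ^+ 2 * normc h ^+ 2 = M * normc h ^+ 2 / p ^+ 2 * 4); last by ring.
  apply: ler_wpM2l; last exact: sum_half_sq.
  by apply: divr_ge0; [apply: mulr_ge0 => //; exact: sqr_ge0|exact: sqr_ge0].
apply: ler_sum => k _; rewrite normcM.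
have [+ _] := pow_taylor2 k zhp; set X := normc (_ - _) => hX.
have pp : 0 < p ^+ 2 by rewrite exprn_gt0.
have : X <= k%:R ^+ 2 * normc h ^+ 2 * p ^+ k / p ^+ 2.
  by rewrite ler_pdivlMr// mulrC.
move=> hX'; apply: le_trans (ler_pM (normc_ge0 _) (normc_ge0 _) (h1 k) hX') _.
by rewrite -pq exprMn le_eqVlt; apply/orP; left; apply/eqP; ring.
Qed.


Definition Df f s := xget 0 [set l | cderiv f s l].

Lemma DfE f s l : cderiv f s l -> Df f s = l.
Proof.
move=> h; apply: (cderiv_unique _ h).
by rewrite /Df; apply: (@xgetPex _ 0 [set l | cderiv f s l]); exists l.
Qed.

Lemma an_Df f s : an f s -> cderiv f s (Df f s).
Proof. by move=> /an_cderiv0[l hl]; rewrite (DfE hl). Qed.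

Lemma an_an_Df f s : an f s -> an (Df f) s.
Proof.
move=> [c [q [M [q0 h1 h2]]]].
have [g [ga [r r0 h]]] := ps_deriv q0 h1 h2.
by apply: an_near r0 _ ga => z zr; rewrite (DfE (h z zr)).
Qed.

Lemma an_comp_affine f (a b : R[i]) s : an f (a * s + b) -> an (fun z => f (a * z + b)) s.
Proof.
move=> [c [q [M [q0 h1 h2]]]]; have M0 := an_M0 h1.
pose na := normc a + 1; have na0 : 0 < na by have := normc_ge0 a; rewrite /na; lra.
exists (fun k => c k * a ^+ k), (q * na), M; split.
- by rewrite mulr_gt0.
- move=> k; rewrite normcM normcX exprMn mulrA.
  by apply: ler_pM; rewrite ?normc_ge0 ?exprn_ge0 ?normc_ge0// lerXn2r ?nnegrE ?normc_ge0 ?(ltW na0)// /na; lra.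
- move=> z zq.
  have -> : ps (fun k => c k * a ^+ k) z = ps c (a * z).
    by apply/funext => n; apply: eq_bigr => k _; rewrite -mulrA exprMn.
  have -> : a * (s + z) + b = a * s + b + a * z by ring.
  apply: h2; rewrite normcM; apply: le_trans zq.
  have : 0 <= normc z * q by rewrite mulr_ge0 ?normc_ge0// ltW.
  by rewrite /na; lra.
Qed.

Lemma an_inv_affine (a s : R[i]) : s != a -> an (fun z => (z - a)^-1) s.
Proof.
move=> sa; pose d := s - a; have d0 : d != 0 by rewrite subr_eq0.
have nd0 : 0 < normc d by rewrite normc_gt0.
exists (fun k => (-1) ^+ k / d ^+ k.+1), (normc d)^-1, (normc d)^-1; split.
- by rewrite invr_gt0.
- move=> k; rewrite normcM normcX normcN normc1 expr1n mul1r normcV normcX exprS invfM.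
  by rewrite exprVn.
- move=> z zq; pose x := - z / d.
  have nx : normc x <= 1 / 2 by rewrite normcM normcN normcV.
  have dz : s + z - a = d * (1 - x) by rewrite /x /d; field.
  have x1 : 1 - x != 0.
    apply/eqP => h; have : normc x = 1 by rewrite (_ : x = 1) ?normc1//; apply/eqP; rewrite -subr_eq0 -opprB h oppr0.
    by lra.
  have psE n : ps (fun k => (-1) ^+ k / d ^+ k.+1) z n = (s + z - a)^-1 * (1 - x ^+ n).
    rewrite dz; elim: n => [|n IH]; first by rewrite /ps big_ord0 expr0 subrr mulr0.
    rewrite psS IH (_ : (-1) ^+ n / d ^+ n.+1 * z ^+ n = d^-1 * x ^+ n).
      by rewrite exprS; field; rewrite x1 d0.
    by rewrite /x mulNr [in RHS]exprNn exprMn exprVn exprS invfM; ring.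
  rewrite -[X in ccvg _ X]mulr1 (funext psE); apply: ccvgMl.
  apply: (@ccvg_squeeze _ _ _ (fun n => (1 / 2) ^+ n)).
    move=> n; rewrite addrAC subrr add0r normcN normcX.
    by apply: lerXn2r; rewrite ?nnegrE ?normc_ge0//; lra.
  by apply: cvg_expr; rewrite ger0_norm; lra.
Qed.

Definition vanish f s := exists2 r : R, 0 < r & forall z, normc z <= r -> f (s + z) = 0.

(** A supremum argument: at the supremum [T] of the parameters up to which [f] vanishes, the second
    case of [an_zero] would make [f] nonzero just before [T]. So [f] vanishes around the point of
    parameter [T], and [T < 1] could be exceeded. *)
Lemma an_identity_segment f s (d : R[i]) :
  (forall t : R, 0 <= t <= 1 -> an f (s + t%:C * d)) ->
  vanish f s -> vanish f (s + d).
Proof.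
move=> han hs.
have [->|d0] := eqVneq d 0; first by rewrite addr0.
have nd0 : 0 < normc d by rewrite normc_gt0.
pose A := [set t : R | 0 <= t <= 1 /\ forall u, 0 <= u <= t -> vanish f (s + u%:C * d)].
have A0 : A 0.
  split; first by rewrite lexx ler01.
  move=> u /andP[u0 u1]; have -> : u = 0 by apply/eqP; rewrite eq_le u0 u1.
  by rewrite rmorph0 mul0r addr0.
have Aub : has_ubound A by exists 1 => t [/andP[]].
have supA : has_sup A by split => //; exists 0.
pose T := sup A.
have T0 : 0 <= T by apply: ub_le_sup.
have T1 : T <= 1 by apply: ge_sup; [exists 0|move=> t [/andP[]]].
have below u : 0 <= u -> u < T -> vanish f (s + u%:C * d).
  move=> u0 uT; have [t At ut] := sup_adherent (eps := T - u) ltac:(lra) supA.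
  by apply: At.2; rewrite u0 /=; rewrite -/T in ut; lra.
have vT : vanish f (s + T%:C * d).
  have [//|[m [g [ga g0 [r r0 hr]]]]] := an_zero (han T (introT andP (conj T0 T1))).
  have [T00|Tn0] := eqVneq T 0; first by rewrite T00 rmorph0 mul0r addr0.
  have Tpos : 0 < T by lra.
  exfalso; have [r' r'0 hr'] := an_ccont ga (e := normc (g (s + T%:C * d)) / 2) ltac:(by rewrite divr_gt0// normc_gt0).
  (* The parameter [T - u] lies strictly before [T], within the radius of the factorization and
     within the radius on which [g] stays close to its nonzero value. *)
  pose u := Num.min (Num.min (r / normc d) (r' / normc d)) T / 2.
  have u0 : 0 < u by rewrite divr_gt0// !lt_min !divr_gt0.
  have uT : u < T by rewrite /u ltr_pdivrMr//; apply: le_lt_trans (_ : T < _); [rewrite ge_min lexx orbT|lra].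
  have ur : u * normc d <= r.
    rewrite -ler_pdivlMr//; apply: (@le_trans _ _ (2 * u)); first lra.
    by rewrite /u mulrC divfK// !ge_min lexx.
  have ur' : u * normc d <= r'.
    rewrite -ler_pdivlMr//; apply: (@le_trans _ _ (2 * u)); first lra.
    by rewrite /u mulrC divfK// !ge_min lexx orbT.
  have nu : normc (- (u%:C * d)) = u * normc d by rewrite normcN normcM normc_real gtr0_norm.
  have [r2 r20 /(_ 0)] := below (T - u) ltac:(lra) ltac:(lra).
  rewrite normc0 addr0 => /(_ (ltW r20)).
  have -> : s + (T - u)%:C * d = s + T%:C * d + (- (u%:C * d)) by rewrite rmorphB /=; ring.
  rewrite hr ?nu// => /eqP; rewrite mulf_eq0 expf_eq0 oppr_eq0 mulf_eq0 (negbTE d0) orbF.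
  have -> : (u%:C == 0) = false.
    by apply/negbTE; rewrite -normc_eq0 normc_real gtr0_norm// gt_eqF.
  rewrite andbF /= => /eqP gz.
  have := hr' (- (u%:C * d)); rewrite nu gz sub0r normcN => /(_ ur').
  by have := normc_gt0 (g (s + T%:C * d)); rewrite g0; lra.
have [r r0 hr] := vT.
have near u : `|u - T| <= r / (2 * normc d) -> vanish f (s + u%:C * d).
  move=> uT; exists (r / 2); first by rewrite divr_gt0.
  move=> z zr; have -> : s + u%:C * d + z = s + T%:C * d + ((u - T)%:C * d + z).
    by rewrite rmorphB /=; ring.
  apply: hr; apply: le_trans (le_normcD _ _) _.
  rewrite normcM normc_real; have : `|u - T| * normc d <= r / 2.
    by rewrite -ler_pdivlMr// (_ : r / 2 / normc d = r / (2 * normc d))// invfM mulrA.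
  by lra.
suff T1' : 1 <= T.
  have TE : T = 1 by apply/eqP; rewrite eq_le T1 T1'.
  by move: vT; rewrite TE rmorph1 mul1r.
rewrite leNgt; apply/negP => Tlt1.
pose e := Num.min (r / (2 * normc d)) (1 - T).
have e0 : 0 < e by rewrite lt_min divr_gt0 ?mulr_gt0//=; lra.
have er : e <= r / (2 * normc d) by rewrite /e ge_min lexx.
have e1 : e <= 1 - T by rewrite /e ge_min lexx orbT.
have : A (T + e).
  split; first by apply/andP; split; lra.
  move=> u /andP[u0 u1]; have [uT|uT] := ltP u T; first exact: below.
  by apply: near; rewrite ger0_norm; lra.
by move=> /(ub_le_sup Aub); rewrite -/T; lra.
Qed.

End PowerSeries.

(** * Real calculus and integration *)

Section Derivatives.
Context {R : realType}.
Implicit Types (f g : R -> R) (x a b : R).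

Definition dv f x (l : R) := is_derive x (1 : R) f l.

Lemma dv_cst c x : dv (fun=> c) x 0.
Proof. exact: is_derive_cst. Qed.

Lemma dv_id x : dv (fun y => y) x 1.
Proof. exact: is_derive_id. Qed.

Lemma dvD f g x a b : dv f x a -> dv g x b -> dv (fun y => f y + g y) x (a + b).
Proof. by move=> h k; exact: is_deriveD h k. Qed.

Lemma dvB f g x a b : dv f x a -> dv g x b -> dv (fun y => f y - g y) x (a - b).
Proof. by move=> h k; exact: is_deriveB h k. Qed.

Lemma dvN f x a : dv f x a -> dv (fun y => - f y) x (- a).
Proof. by move=> h; exact: is_deriveN h. Qed.

Lemma dvM f g x a b : dv f x a -> dv g x b ->
  dv (fun y => f y * g y) x (a * g x + f x * b).
Proof.
move=> h k; have := is_deriveM h k; rewrite /dv => H.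
by apply: is_derive_eq H _; rewrite /GRing.scale /=; ring.
Qed.

Lemma dvZ f x a c : dv f x a -> dv (fun y => c * f y) x (c * a).
Proof. by move=> h; have := dvM (dv_cst c x) h; rewrite mul0r add0r. Qed.

Lemma dv_eq f x a b : dv f x a -> a = b -> dv f x b.
Proof. by move=> h <-. Qed.

Lemma dv_comp f g x a b : dv g x a -> dv f (g x) b -> dv (fun y => f (g y)) x (b * a).
Proof.
move=> h k; have := @is_derive1_comp _ f g x b a k h.
by rewrite /dv.
Qed.

Lemma dvV f x a : f x != 0 -> dv f x a -> dv (fun y => (f y)^-1) x (- a / f x ^+ 2).
Proof.
move=> fx h; have := is_deriveV fx h; rewrite /dv => H.
by apply: is_derive_eq H _; rewrite /GRing.scale /= mulNr mulrC mulNr.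
Qed.

Lemma dv_exp f x a : dv f x a -> dv (fun y => expR (f y)) x (expR (f x) * a).
Proof. by move=> h; exact: dv_comp h (is_derive_expR _). Qed.

Lemma dv_sin f x a : dv f x a -> dv (fun y => sin (f y)) x (cos (f x) * a).
Proof. by move=> h; exact: dv_comp h (is_derive_sin _). Qed.

Lemma dv_cos f x a : dv f x a -> dv (fun y => cos (f y)) x (- sin (f x) * a).
Proof. by move=> h; exact: dv_comp h (is_derive_cos _). Qed.

Lemma dv_ln f x a : 0 < f x -> dv f x a -> dv (fun y => ln (f y)) x (a / f x).
Proof. by move=> fx h; rewrite mulrC; exact: dv_comp h (is_derive1_ln fx). Qed.

Lemma dv_atan f x a : dv f x a -> dv (fun y => atan (f y)) x (a / (1 + f x ^+ 2)).
Proof. by move=> h; rewrite mulrC; exact: dv_comp h (is_derive1_atan _). Qed.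

Lemma dvX2 f x a : dv f x a -> dv (fun y => f y ^+ 2) x (2 * f x * a).
Proof.
move=> h; have := dvM h h; rewrite (_ : (fun y => f y * f y) = (fun y => f y ^+ 2)).
  by move=> H; apply: dv_eq H _; ring.
by apply/funext => y; rewrite expr2.
Qed.

Lemma dv_cont f x a : dv f x a -> {for x, continuous f}.
Proof.
by move=> h; apply/differentiable_continuous/derivable1_diffP; exact: (@ex_derive _ _ _ _ _ _ _ h).
Qed.

Lemma dv_MVT f (f' : R -> R) a b : a < b -> (forall x, a <= x <= b -> dv f x (f' x)) ->
  exists2 c, a < c < b & f b - f a = f' c * (b - a).
Proof.
move=> ab h; have [c|c cab|] := @MVT _ f f' a b ab.
- by rewrite in_itv /= => /andP[? ?]; apply: h; rewrite !ltW.
- apply: derivable_within_continuous => y; rewrite in_itv /= => yab.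
  exact: (@ex_derive _ _ _ _ _ _ _ (h y yab)).
- by move=> c; rewrite in_itv /= => cab fE; exists c.
Qed.

End Derivatives.

Section RealIntegral.
Context d (T : measurableType d) (R : realType) (mu : {measure set T -> \bar R}).
Implicit Types (D : set T) (f g : T -> R).

Definition intg D f := mu.-integrable D (EFin \o f).

Lemma intgD D f g : measurable D -> intg D f -> intg D g -> intg D (fun x => f x + g x).
Proof.
move=> mD h k; have := integrableD mD h k; exact: eq_integrable.
Qed.

Lemma intgN D f : measurable D -> intg D f -> intg D (fun x => - f x).
Proof.
move=> mD h; have := integrableN h; exact: eq_integrable.
Qed.

Lemma intgB D f g : measurable D -> intg D f -> intg D g -> intg D (fun x => f x - g x).
Proof. by move=> mD h k; exact: intgD mD h (intgN mD k). Qed.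

Lemma intgZ D f c : measurable D -> intg D f -> intg D (fun x => c * f x).
Proof.
move=> mD h; have := integrableZl mD c h; exact: eq_integrable.
Qed.

Lemma intg_meas D f : intg D f -> measurable_fun D f.
Proof. by move/measurable_int/measurable_EFinP. Qed.

Lemma le_intg D f g : measurable D -> measurable_fun D f ->
  (forall x, D x -> `|f x| <= g x) -> intg D g -> intg D f.
Proof.
move=> mD mf fg; apply: le_integrable => //; first exact/measurable_EFinP.
move=> x Dx /=; rewrite lee_fin; apply: le_trans (fg x Dx) _; exact: ler_norm.
Qed.

Lemma intg_norm D f : measurable D -> intg D f -> intg D (fun x => `|f x|).
Proof. by move=> mD; exact: integrable_norm. Qed.

Lemma eq_intg D f g : measurable D -> {in D, f =1 g} -> intg D f -> intg D g.
Proof. by move=> mD fg; apply: eq_integrable => // x /fg /= ->. Qed.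

Lemma intgS D E f : measurable D -> measurable E -> E `<=` D -> intg D f -> intg E f.
Proof. by move=> mD mE ED; exact: integrableS. Qed.

Lemma intg_bounded D f (M : R) : measurable D -> (mu D < +oo)%E -> measurable_fun D f ->
  (forall x, D x -> `|f x| <= M) -> intg D f.
Proof.
move=> mD fD mf h; apply: measurable_bounded_integrable => //.
exists M; split; first exact: num_real.
by move=> y My x Dx; apply: le_trans (h x Dx) _; exact: ltW.
Qed.

Lemma intgM_bounded D f g (M : R) : measurable D -> measurable_fun D g ->
  (forall x, D x -> `|g x| <= M) -> intg D f -> intg D (fun x => g x * f x).
Proof.
move=> mD mg gM hf; apply: (@le_intg _ _ (fun x => M * `|f x|)) => //.
- by apply: measurable_funM => //; exact: intg_meas.
- by move=> x Dx; rewrite normrM ler_wpM2r// gM.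
- by apply: intgZ => //; exact: intg_norm.
Qed.

Lemma Rint_le_norm D f : measurable D -> intg D f ->
  `|\int[mu]_(x in D) f x| <= \int[mu]_(x in D) `|f x|.
Proof. by move=> mD h; exact: le_normr_Rintegral. Qed.

Lemma Rint_norm_le D f g : measurable D -> measurable_fun D f ->
  (forall x, D x -> `|f x| <= g x) -> intg D g ->
  `|\int[mu]_(x in D) f x| <= \int[mu]_(x in D) g x.
Proof.
move=> mD mf fg ig; have if_ := le_intg mD mf fg ig.
apply: le_trans (Rint_le_norm mD if_) _.
apply: le_Rintegral => //; first exact: intg_norm.
Qed.

Lemma Rint_sum I (s : seq I) D (h : I -> T -> R) : measurable D ->
  (forall i, intg D (h i)) ->
  intg D (fun x => \sum_(i <- s) h i x) /\
  \int[mu]_(x in D) (\sum_(i <- s) h i x) = \sum_(i <- s) \int[mu]_(x in D) h i x.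
Proof.
move=> mD hi; elim: s => [|i s [IH1 IH2]].
  split.
    apply: (@eq_intg _ (fun=> 0)) => //; first by move=> x _; rewrite big_nil.
    exact: integrable0.
  by rewrite big_nil; under eq_Rintegral do rewrite big_nil; rewrite /Rintegral integral0.
split.
  apply: (@eq_intg _ (fun x => h i x + \sum_(j <- s) h j x)) => //.
    by move=> x _; rewrite big_cons.
  exact: intgD.
under eq_Rintegral do rewrite big_cons.
by rewrite big_cons -IH2; exact: (RintegralD mD (hi i) IH1).
Qed.

Lemma Rdct D (f_ : nat -> T -> R) f g : measurable D ->
  (forall n, measurable_fun D (f_ n)) ->
  (forall x, D x -> (fun n => f_ n x) @ \oo --> f x) ->
  intg D g -> (forall n x, D x -> `|f_ n x| <= g x) ->
  intg D f /\ (fun n => \int[mu]_(x in D) f_ n x) @ \oo --> \int[mu]_(x in D) f x.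
Proof.
move=> mD mf ff ig fg.
have mfl : measurable_fun D f by apply: (measurable_fun_cvg mf).
have [] := @dominated_convergence _ T R mu D mD (fun n => EFin \o f_ n) (EFin \o f) (EFin \o g).
- by move=> n; exact/measurable_EFinP.
- exact/measurable_EFinP.
- apply: aeW => x Dx; apply: cvg_EFin; first by apply: nearW.
  exact: ff.
- exact: ig.
- by apply: aeW => x n Dx /=; rewrite lee_fin fg.
move=> iF _ h; split => //.
have fin : (\int[mu]_(x in D) (EFin \o f) x)%E \is a fin_num by exact: integrable_fin_num.
by apply: fine_cvg; rewrite /Rintegral fineK.
Qed.

Lemma Rint_cvg_ge0 D (f_ : nat -> T -> R) f (l : R) : measurable D ->
  (forall n, intg D (f_ n)) ->
  (forall n x, D x -> 0 <= f_ n x) ->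
  (forall x, D x -> {homo f_^~ x : m n / (m <= n)%N >-> m <= n}) ->
  (forall x, D x -> (fun n => f_ n x) @ \oo --> f x) ->
  (fun n => \int[mu]_(x in D) f_ n x) @ \oo --> l ->
  intg D f /\ \int[mu]_(x in D) f x = l.
Proof.
move=> mD fi f0 nd ff hl.
have mf : measurable_fun D f.
  by apply: (measurable_fun_cvg (h := f_)) => // n; exact: intg_meas.
have f_0 x : D x -> 0 <= f x.
  by move=> Dx; apply: (cvgr_to_ge (ff x Dx)); apply: nearW => n; exact: f0.
have h1 : (fun n => \int[mu]_(x in D) (f_ n x)%:E)%E @ \oo --> (\int[mu]_(x in D) (f x)%:E)%E.
  have := @cvg_monotone_convergence _ T R mu D mD (fun n => EFin \o f_ n).
  rewrite (_ : (\int[mu]_(x in D) (limn _))%E = (\int[mu]_(x in D) (f x)%:E)%E); last first.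
    apply: eq_integral => x /set_mem Dx; apply/cvg_lim => //.
    by apply: cvg_EFin; [exact: nearW|exact: ff].
  apply.
  - by move=> n; exact/measurable_EFinP/intg_meas.
  - by move=> n x Dx; rewrite lee_fin f0.
  - by move=> x Dx m n mn; rewrite lee_fin nd.
have h2 : (fun n => \int[mu]_(x in D) (f_ n x)%:E)%E @ \oo --> l%:E.
  apply: cvg_EFin; last exact: hl.
  by apply: nearW => n; exact: (integrable_fin_num mD (fi n)).
have E : (\int[mu]_(x in D) (f x)%:E)%E = l%:E by exact: (cvg_unique _ h1 h2).
split; last by rewrite /Rintegral E.
apply/integrableP; split; first exact/measurable_EFinP.
rewrite (eq_integral (fun x => (f x)%:E)); first by rewrite E ltry.
by move=> x /set_mem Dx /=; rewrite ger0_norm// f_0.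
Qed.

End RealIntegral.

Section Lebesgue1.
Context {R : realType}.
Notation mu := (@lebesgue_measure R).
Implicit Types (f g F : R -> R) (a b : R).

Lemma cont_within f (D : set R) : (forall x, D x -> {for x, continuous f}) ->
  {within D, continuous f}.
Proof. by move=> h; apply/continuous_in_subspaceT => x /set_mem /h. Qed.

Lemma cont_intg f a b : (forall x, a <= x <= b -> {for x, continuous f}) -> intg mu `[a, b] f.
Proof.
move=> h; apply: continuous_compact_integrable; first exact: segment_compact.
by apply: cont_within => x /=; rewrite in_itv /=; exact: h.
Qed.

Lemma Rftc f F a b : a <= b -> (forall x, a <= x <= b -> dv F x (f x)) ->
  (forall x, a <= x <= b -> {for x, continuous f}) ->
  \int[mu]_(x in `[a, b]) f x = F b - F a.
Proof.
rewrite le_eqVlt => /predU1P[<- _ _|ab hF hf].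
  by rewrite set_itv1 Rintegral_set1 subrr.
rewrite /Rintegral (@continuous_FTC2 _ f F)//.
- by apply: cont_within => x /=; rewrite in_itv /=; exact: hf.
- split.
  + move=> x; rewrite in_itv /= => /andP[ax xb].
    by apply: (@ex_derive _ _ _ _ _ _ _ (hF x _)); rewrite !ltW.
  + by apply/cvg_at_right_filter/(dv_cont (hF a _)); rewrite lexx ltW.
  + by apply/cvg_at_left_filter/(dv_cont (hF b _)); rewrite lexx ltW.
- move=> x; rewrite in_itv /= => /andP[ax xb]; rewrite derive1E.
  by apply: (@derive_val _ _ _ _ _ _ _ (hF x _)); rewrite !ltW.
Qed.

(** For a nonnegative integrand, monotone convergence over [[-n, n]] yields integrability together
    with the value. *)
Lemma Rftc_line f F (l1 l2 : R) : (forall x, dv F x (f x)) -> continuous f ->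
  (forall x, 0 <= f x) ->
  (fun n => F n%:R) @ \oo --> l2 -> (fun n => F (- n%:R)) @ \oo --> l1 ->
  intg mu setT f /\ \int[mu]_x f x = l2 - l1.
Proof.
move=> hF hf f0 h2 h1.
pose fn (n : nat) x := f x * \1_(`[- n%:R, n%:R]) x.
have mf : measurable_fun setT f by exact: continuous_measurable_fun.
have fnE n : (fn n) = f \_ `[- n%:R, n%:R].
  apply/funext => x; rewrite /fn patchE indicE; by case: (x \in _); rewrite ?mulr1 ?mulr0.
have ifn (n : nat) : intg mu setT (fn n) /\ \int[mu]_x fn n x = F n%:R - F (- n%:R).
  have ii : intg mu `[- n%:R, n%:R] f by apply: cont_intg => x _; exact: hf.
  split; last first.
    rewrite fnE -Rintegral_mkcond (@Rftc f F)//.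
    - by rewrite -subr_ge0 opprK addr_ge0.
    - by move=> x _; exact: hf.
  rewrite fnE /intg -restrict_EFin; apply/integrable_restrict => //.
  by rewrite setTI.
apply: (@Rint_cvg_ge0 _ (measurableTypeR R) R mu setT fn f) => //.
- by move=> n; exact: (ifn n).1.
- by move=> n x _; rewrite mulr_ge0// indicE.
- move=> x _ m n mn; rewrite /fn ler_wpM2l// !indicE ler_nat.
  have [|] := boolP (x \in `[- m%:R, m%:R]%classic) => //= /set_mem /=.
  rewrite in_itv /= => /andP[xm1 xm2]; rewrite mem_set//= in_itv /=.
  have mnR : m%:R <= n%:R :> R by rewrite ler_nat.
  by apply/andP; split; lra.
- move=> x _; rewrite /fn; apply: cvg_near_cst.
  exists (Num.trunc `|x|).+1 => // n /= hn; rewrite indicE mem_set ?mulr1//= in_itv /=.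
  rewrite -ler_norml ltW//; apply: lt_le_trans (truncnS_gt _) _.
  by rewrite ler_nat.
- rewrite (_ : (fun n => _) = (fun n => F n%:R - F (- n%:R))); first exact: cvgB.
  by apply/funext => n; rewrite (ifn n).2.
Qed.

(** By uniqueness of Lebesgue measure, a map that preserves the length of half-open intervals pushes
    [mu] forward to itself. Translations and the reflection are the instances. *)
Lemma Rint_preserving (phi : measurableTypeR R -> measurableTypeR R) : measurable_fun setT phi ->
  (forall a b, mu (phi @^-1` `]a, b]) = mu `]a, b]%classic) ->
  forall f, intg mu setT f ->
  intg mu setT (fun x => f (phi x)) /\ \int[mu]_x f (phi x) = \int[mu]_x f x.
Proof.
move=> mphi hphi f hf; have mf := intg_meas hf.
have E A : measurable A -> pushforward mu phi A = mu A.
  move=> mA; apply/esym/lebesgue_measure_unique => //= _ [[a b]] _ <-.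
  by rewrite /pushforward /= hphi.
have mfp : measurable_fun setT (fun x => f (phi x)) by exact: measurableT_comp.
have if' : mu.-integrable setT (EFin \o (fun x => f (phi x))).
  apply/integrableP; split; first exact/measurable_EFinP.
  have /integrableP[_] := hf; congr (_ < _)%E.
  have := @ge0_integral_pushforward _ _ _ _ R phi mphi mu setT (fun x => `|(f x)%:E|)%E measurableT.
  rewrite preimage_setT => <-//; last by do 2 apply: measurableT_comp => //.
  by apply: eq_measure_integral => A mA _; exact/esym/E.
split => //.
have := @integral_pushforward _ _ _ _ R phi mphi mu setT (EFin \o f).
rewrite preimage_setT /Rintegral => /(_ _ if' measurableT) <-; last exact/measurable_EFinP.
by congr fine; apply: eq_measure_integral => A mA _; exact: E.
Qed.

Lemma Rint_shift (c : R) f : intg mu setT f ->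
  intg mu setT (fun x => f (x + c)) /\ \int[mu]_x f (x + c) = \int[mu]_x f x.
Proof.
apply: (@Rint_preserving (fun x => x + c)).
  by apply: continuous_measurable_fun => x; apply: cvgD; [exact: cvg_id|exact: cvg_cst].
move=> a b; rewrite (_ : _ @^-1` _ = `]a - c, b - c]%classic).
  rewrite !lebesgue_measure_itv /= !lte_fin ltrD2r.
  by case: ifP => // _; rewrite -!EFinB opprB addrA subrK.
by apply/seteqP; split => x /=; rewrite !in_itv /= ltrBlDr lerBrDr.
Qed.

Lemma Rint_opp f : intg mu setT f ->
  intg mu setT (fun x => f (- x)) /\ \int[mu]_x f (- x) = \int[mu]_x f x.
Proof.
apply: (@Rint_preserving (fun x => - x)).
  by apply: continuous_measurable_fun => x; apply: cvgN; exact: cvg_id.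
by move=> a b; rewrite -[RHS]lebesgue_measureN.
Qed.

Lemma Rint_odd f : intg mu setT f -> (forall x, f (- x) = - f x) -> \int[mu]_x f x = 0.
Proof.
move=> hf fN; have [_] := Rint_opp hf; under eq_Rintegral do rewrite fN.
have -> : \int[mu]_x (- f x) = - \int[mu]_x f x.
  have := @RintegralZl _ _ _ mu setT f (-1) measurableT hf; rewrite mulN1r => <-.
  by apply: eq_Rintegral => x _; rewrite mulN1r.
by move=> h; have : \int[mu]_x f x = 0 by lra.
Qed.

Lemma Rint_even f : intg mu setT f -> (forall x, f (- x) = f x) ->
  intg mu `[0, +oo[ f /\ \int[mu]_x f x = 2 * \int[mu]_(x in `[0, +oo[) f x.
Proof.
move=> hf fN.
have h0 : intg mu `[0, +oo[ f by exact: intgS hf.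
split => //.
have e1 : \int[mu]_x f x = \int[mu]_(x in `]-oo, 0[) f x + \int[mu]_(x in `[0, +oo[) f x.
  rewrite -Rintegral_setU//=.
  - by congr Rintegral; apply/seteqP; split => x //= _; rewrite !in_itv /= andbT; have [|] := ltP x 0; [left|right].
  - by apply: (intgS _ _ _ hf) => //; exact: measurableU.
  - by apply/disj_setPS => x /= []; rewrite !in_itv /= andbT => x1 x2; lra.
rewrite e1; suff -> : \int[mu]_(x in `]-oo, 0[) f x = \int[mu]_(x in `[0, +oo[) f x by ring.
rewrite -[RHS]Rintegral_itv_obnd_cbnd; last first.
  by apply: (intgS _ _ _ h0) => // x /=; rewrite !in_itv /= !andbT; exact: ltW.
rewrite Rintegral_mkcond [RHS]Rintegral_mkcond.
have h1 : intg mu setT (f \_ `]0, +oo[).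
  rewrite /intg -restrict_EFin; apply/integrable_restrict => //.
  by rewrite setTI; exact: intgS hf.
have [_ <-] := Rint_opp h1; apply: eq_Rintegral => x _.
by rewrite !patchE fN (_ : (- x \in `]0, +oo[%classic) = (x \in `]-oo, 0[%classic))//;
  apply/idP/idP => /set_mem /=; rewrite !in_itv /= => ?; apply/mem_set; rewrite /= in_itv /=; lra.
Qed.

Lemma intg_lorentz : intg mu setT (fun x => (1 + x ^+ 2)^-1).
Proof.
have h : cvgn (fun n : nat => atan (n%:R : R)).
  by apply: cvgP; apply: (cvg_comp _ _ cvgr_idn); exact: cvgy_atan.
pose l := limn (fun n : nat => atan (n%:R : R)).
have H := @Rftc_line (fun x => (1 + x ^+ 2)^-1) atan (- l) l.
apply: (H _ _ _ _ _).1.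
- by move=> x; exact: is_derive1_atan.
- move=> x; apply: cvgV; first by rewrite gt_eqF// ltr_pwDl// sqr_ge0.
  by apply: cvgD; [exact: cvg_cst|exact: exprn_continuous].
- by move=> x; rewrite invr_ge0 addr_ge0// sqr_ge0.
- exact: h.
- by under eq_fun do rewrite atanN; exact: cvgN.
Qed.

End Lebesgue1.

(** * Measurability and Fubini's theorem in the plane *)

Section Lebesgue2.
Context {R : realType}.
Notation mu := (@lebesgue_measure R).
Notation mu2 := (mu \x mu)%E.
Implicit Types (f : R * R -> R) (a b c d : R).

Definition rect a b c d : set (R * R) := `[a, b]%classic `*` `[c, d]%classic.

Lemma rectP a b c d p : rect a b c d p <-> a <= p.1 <= b /\ c <= p.2 <= d.
Proof. by rewrite /rect /= !in_itv. Qed.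

Lemma measurable_rect a b c d : measurable (rect a b c d : set (measurableTypeR R * measurableTypeR R)).
Proof. exact: measurableX. Qed.

(** The product sigma-algebra is generated by boxes; an open set belongs to it because it is the
    union of the countably many rational boxes that it contains. *)
Lemma open_prod_measurable (O : set (R * R)) : open O ->
  measurable (O : set (measurableTypeR R * measurableTypeR R)).
Proof.
move=> oO.
pose B (p q e : rat) : set (R * R) := ball (ratr p : R) (ratr e) `*` ball (ratr q : R) (ratr e).
have -> : O = \bigcup_p \bigcup_q \bigcup_e (if `[< B p q e `<=` O >] then B p q e else set0).
  apply/seteqP; split => [[x y] Oxy|[x y] [p _ [q _ [e _]]]]; last first.
    by case: asboolP => // BO /BO.
  have := oO; rewrite openE => /(_ _ Oxy) [[U V] /= [Ux Vy] UV].
  have [e1 /= e10 h1] := (nbhs_ballP _ _).1 Ux; have [e2 /= e20 h2] := (nbhs_ballP _ _).1 Vy.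
  pose e' := Num.min e1 e2; have e'0 : 0 < e' by rewrite lt_min e10.
  have e'2 : 0 < e' / 2 by rewrite divr_gt0.
  have [r] := rat_in_itvoo e'2.
  rewrite in_itv /= => /andP[r0 re].
  have xr : x - ratr r < x + ratr r by lra.
  have [p] := rat_in_itvoo xr.
  rewrite in_itv /= => /andP[p1 p2].
  have yr : y - ratr r < y + ratr r by lra.
  have [q] := rat_in_itvoo yr.
  rewrite in_itv /= => /andP[q1 q2].
  have ee1 : e' <= e1 by rewrite ge_min lexx.
  have ee2 : e' <= e2 by rewrite ge_min lexx orbT.
  exists p => //; exists q => //; exists r => //.
  rewrite asboolT; first by split; rewrite /ball /= ltr_norml; apply/andP; split; lra.
  move=> [x' y'] [/=]; rewrite /ball /= !ltr_norml => /andP[? ?] /andP[? ?].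
  apply: UV; split => /=; [apply: h1|apply: h2]; rewrite /ball /= ltr_norml; apply/andP; split; lra.
apply: bigcupT_measurable_rat => p; apply: bigcupT_measurable_rat => q.
apply: bigcupT_measurable_rat => e; case: asboolP => // _.
by apply: measurableX; exact: measurable_ball.
Qed.

Lemma cont2_measurable f : continuous f ->
  measurable_fun setT (f : measurableTypeR R * measurableTypeR R -> R).
Proof.
move=> /continuousP cf; apply: (measurability _ (RGenOpens.measurableE R)).
move=> _ [_ [a [b ->] <-]]; rewrite setTI; apply: open_prod_measurable.
exact/cf/interval_open.
Qed.

(** For [a <= b] this retracts the line onto [[a, b]]. Composition with it extends a function that
    is continuous at the points of a rectangle to a continuous function on the plane. *)
Definition clamp a b x := Num.max a (Num.min b x).

Lemma clamp_cont a b : continuous (clamp a b).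
Proof.
move=> x; apply: continuous_max; first exact: cvg_cst.
by apply: continuous_min; [exact: cvg_cst|exact: cvg_id].
Qed.

Lemma rect_measurable f a b c d : a <= b -> c <= d ->
  (forall p, rect a b c d p -> {for p, continuous f}) ->
  measurable_fun (rect a b c d) (f : measurableTypeR R * measurableTypeR R -> R).
Proof.
move=> ab cd hf.
pose g p := f (clamp a b p.1, clamp c d p.2).
have gc : continuous g.
  move=> p; apply: (@continuous_comp _ _ _ (fun p => (clamp a b p.1, clamp c d p.2)) f).
    have c1 : {for p, continuous (fun p : R * R => clamp a b p.1)}.
      by apply: (@continuous_comp _ _ _ fst (clamp a b)); [exact: cvg_fst|exact: clamp_cont].
    have c2 : {for p, continuous (fun p : R * R => clamp c d p.2)}.
      by apply: (@continuous_comp _ _ _ snd (clamp c d)); [exact: cvg_snd|exact: clamp_cont].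
    exact: (cvg_pair c1 c2).
  apply: hf; apply/rectP => /=; rewrite /clamp.
  by split; rewrite le_max lexx /= ge_max ge_min lexx /= ?ab ?cd.
apply: (@eq_measurable_fun _ _ _ _ _ g); last exact: (measurable_funS measurableT (@subsetT _ _) (cont2_measurable gc)).
move=> [x y] /set_mem /rectP /= [/andP[ax xb] /andP[cy yd]].
by rewrite /g /clamp /=; congr (f (_, _)); rewrite min_r// max_r.
Qed.

Lemma rect_bounded f a b c d :
  (forall p, rect a b c d p -> {for p, continuous f}) ->
  exists M : R, forall p, rect a b c d p -> `|f p| <= M.
Proof.
move=> hf; have cK : compact (rect a b c d).
  by apply: compact_setX; exact: segment_compact.
have : compact (f @` rect a b c d).
  apply: continuous_compact => //; apply/continuous_in_subspaceT => p /set_mem; exact: hf.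
move=> /compact_bounded [M [_ hM]]; exists (M + 1) => p rp.
by apply: hM; [rewrite ltrDl|exists p].
Qed.

Lemma rect_finite a b c d : (mu2 (rect a b c d) < +oo)%E.
Proof.
rewrite product_measure1E//= !lebesgue_measure_itv /=.
by case: ifP => _; case: ifP => _; rewrite -?EFinB ?mul0e ?mule0 -?EFinM ltry.
Qed.

Lemma rect_intg f a b c d : a <= b -> c <= d ->
  (forall p, rect a b c d p -> {for p, continuous f}) -> intg mu2 (rect a b c d) f.
Proof.
move=> ab cd hf; have [M hM] := rect_bounded hf.
apply: (@intg_bounded _ _ _ _ _ _ M) => //.
- exact: measurable_rect.
- exact: rect_finite.
- exact: rect_measurable.
Qed.

Notation RR := (measurableTypeR R).

Lemma Rfubini1 (A B : set RR) (f : RR * RR -> R) : measurable A -> measurable B ->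
  intg mu2 (A `*` B) f -> (forall x, A x -> intg mu B (fun y => f (x, y))) ->
  \int[mu2]_(p in A `*` B) f p = \int[mu]_(x in A) \int[mu]_(y in B) f (x, y).
Proof.
move=> mA mB hf hx; have mAB : measurable (A `*` B) by exact: measurableX.
have hf' : mu2.-integrable setT (EFin \o (f \_ (A `*` B))).
  by rewrite -restrict_EFin; apply/integrable_restrict; rewrite ?setTI.
rewrite Rintegral_mkcond [RHS]Rintegral_mkcond /Rintegral -(integral12_prod_meas1 hf').
congr fine; apply: eq_integral => x _; rewrite /fubini_F /= patchE.
case: ifPn => [/set_mem Ax|/negP xA].
  rewrite /Rintegral fineK; last by apply: integrable_fin_num => //; exact: hx.
  rewrite [RHS]integral_mkcond; apply: eq_integral => y _; rewrite !patchE /=.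
  have -> : ((x, y) \in A `*` B) = (y \in B).
    by apply/idP/idP => /set_mem; [move=> [] /= _ By|move=> By]; apply/mem_set.
  by case: ifP.
rewrite (eq_integral (fun=> 0%E)) ?integral0// => y _; rewrite patchE /=.
by case: ifPn => // /set_mem [/= Ax _]; case: xA; exact/mem_set.
Qed.

Lemma Rfubini2 (A B : set RR) (f : RR * RR -> R) : measurable A -> measurable B ->
  intg mu2 (A `*` B) f -> (forall y, B y -> intg mu A (fun x => f (x, y))) ->
  \int[mu2]_(p in A `*` B) f p = \int[mu]_(y in B) \int[mu]_(x in A) f (x, y).
Proof.
move=> mA mB hf hx; have mAB : measurable (A `*` B) by exact: measurableX.
have hf' : mu2.-integrable setT (EFin \o (f \_ (A `*` B))).
  by rewrite -restrict_EFin; apply/integrable_restrict; rewrite ?setTI.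
rewrite Rintegral_mkcond [RHS]Rintegral_mkcond /Rintegral -(integral21_prod_meas1 hf').
congr fine; apply: eq_integral => x _; rewrite /fubini_G /= patchE.
case: ifPn => [/set_mem Ax|/negP xA].
  rewrite /Rintegral fineK; last by apply: integrable_fin_num => //; exact: hx.
  rewrite [RHS]integral_mkcond; apply: eq_integral => y _; rewrite !patchE /=.
  have -> : ((y, x) \in A `*` B) = (y \in A).
    by apply/idP/idP => /set_mem; [move=> [] /= By _|move=> By]; apply/mem_set.
  by case: ifP.
rewrite (eq_integral (fun=> 0%E)) ?integral0// => y _; rewrite patchE /=.
by case: ifPn => // /set_mem [/= _ Ax]; case: xA; exact/mem_set.
Qed.

Lemma section1_cont f x y : {for (x, y), continuous f} -> {for y, continuous (fun y => f (x, y))}.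
Proof.
move=> h; apply: (@continuous_comp _ _ _ (fun y => (x, y)) f) => //.
exact: (cvg_pair (cvg_cst x) (@cvg_id _ (nbhs y))).
Qed.

Lemma section2_cont f x y : {for (x, y), continuous f} -> {for x, continuous (fun x => f (x, y))}.
Proof.
move=> h; apply: (@continuous_comp _ _ _ (fun x => (x, y)) f) => //.
exact: (cvg_pair (@cvg_id _ (nbhs x)) (cvg_cst y)).
Qed.

Lemma rect_fubini f a b c d : a <= b -> c <= d ->
  (forall p, rect a b c d p -> {for p, continuous f}) ->
  \int[mu2]_(p in rect a b c d) f p = \int[mu]_(x in `[a, b]) \int[mu]_(y in `[c, d]) f (x, y) /\
  \int[mu2]_(p in rect a b c d) f p = \int[mu]_(y in `[c, d]) \int[mu]_(x in `[a, b]) f (x, y).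
Proof.
move=> ab cd hf; have hi := rect_intg ab cd hf; split.
  apply: Rfubini1 => // x xab; apply: cont_intg => y ycd.
  by apply: section1_cont; apply: hf; apply/rectP; split => //; move: xab; rewrite /= in_itv.
apply: Rfubini2 => // y ycd; apply: cont_intg => x xab.
by apply: section2_cont; apply: hf; apply/rectP; split => //; move: ycd; rewrite /= in_itv.
Qed.

End Lebesgue2.

(** * Green's formula *)

Section QuadraticError.
Context {R : realType}.

Lemma dv_quad (f : R -> R) x l (r B : R) : 0 < r ->
  (forall h, `|h| <= r -> `|f (x + h) - f x - l * h| <= B * h ^+ 2) -> dv f x l.
Proof.
move=> r0 hf.
have H : (fun h => h^-1 *: (f (h *: 1 + x) - f x)) @ 0^' --> l.
  apply/cvgrPdist_le => e e0.
  pose d := Num.min r (e / (`|B| + 1)).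
  have B0 : 0 < `|B| + 1 by rewrite ltr_wpDl.
  have d0 : 0 < d by rewrite lt_min r0 divr_gt0.
  near=> h.
  have h0 : h != 0 by near: h; exact: nbhs_dnbhs_neq.
  have hd : `|h| <= d.
    by near: h; apply: dnbhs0_le.
  have hr : `|h| <= r by apply: le_trans hd _; rewrite ge_min lexx.
  have he : `|h| <= e / (`|B| + 1) by apply: le_trans hd _; rewrite ge_min lexx orbT.
  rewrite /GRing.scale /= mulr1 (addrC h).
  have -> : l - h^-1 * (f (x + h) - f x) = - (h^-1 * (f (x + h) - f x - l * h)) by field.
  rewrite normrN normrM normfV ler_pdivrMl ?normr_gt0//.
  apply: le_trans (hf _ hr) _; apply: (@le_trans _ _ (`|B| * `|h| ^+ 2)).
    by rewrite real_normK ?num_real// ler_wpM2r ?sqr_ge0// ler_norm.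
  rewrite expr2 mulrA mulrC ler_wpM2l//.
  apply: (@le_trans _ _ ((`|B| + 1) * `|h|)); first by rewrite ler_wpM2r// lerDl.
  by rewrite mulrC -ler_pdivlMr.
apply: DeriveDef; last by rewrite /derive; apply/cvg_lim.
by apply/cvg_ex; exists l.
Unshelve. all: by end_near. Qed.

Definition pos (x : R) := Num.max 0 x.

(** Squaring flattens the kink: the remainder is quadratic also when [x] and [x + h] lie on
    different sides of [0]. *)
Lemma dv_pos2 x : dv (fun t => pos t ^+ 2) x (2 * pos x).
Proof.
apply: (@dv_quad _ _ _ 1 3) => // h _; rewrite /pos ler_norml.
by case: (leP 0 (x + h)) => ?; case: (leP 0 x) => ?; apply/andP; split; nra.
Qed.

Lemma dv_pos3 x : dv (fun t => pos t ^+ 3) x (3 * pos x ^+ 2).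
Proof.
have -> : (fun t => pos t ^+ 3) = (fun t => t * pos t ^+ 2).
  apply/funext => t; rewrite /pos; case: (leP 0 t) => ?; rewrite ?exprS; ring.
apply: (dv_eq (dvM (dv_id x) (dv_pos2 x))) => /=.
by rewrite /pos; case: (leP 0 x) => ?; ring.
Qed.

Lemma pos_cont : continuous pos.
Proof.
move=> x; apply: continuous_max; [exact: cvg_cst|exact: cvg_id].
Qed.

End QuadraticError.

Section Partials.
Context {R : realType}.
Implicit Types (f : R[i] -> R[i]) (x y : R).

Lemma cderiv_dv f s l (d : R[i]) : cderiv f s l ->
  dv (fun t => Re (f (s + t%:C * d))) 0 (Re (l * d)) /\
  dv (fun t => Im (f (s + t%:C * d))) 0 (Im (l * d)).
Proof.
move=> [r [B [r0 h]]].
pose n := normc d + 1; have n0 : 0 < n by rewrite ltr_wpDl// normc_ge0.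
have key t : `|t| <= r / n -> normc (f (s + t%:C * d) - f s - l * (t%:C * d)) <= (`|B| * n ^+ 2) * t ^+ 2.
  move=> tr; have tn : normc (t%:C * d) <= `|t| * n.
    by rewrite normcM normc_real ler_wpM2l// lerDl.
  apply: le_trans (h _ _) _; first by apply: le_trans tn _; rewrite -ler_pdivlMr.
  apply: (@le_trans _ _ (`|B| * (`|t| * n) ^+ 2)).
    apply: (@le_trans _ _ (`|B| * normc (t%:C * d) ^+ 2)).
      by rewrite ler_wpM2r ?sqr_ge0// ler_norm.
    by rewrite ler_wpM2l// lerXn2r ?nnegrE ?normc_ge0// mulr_ge0// ltW.
  by rewrite exprMn real_normK ?num_real//; lra.
split; apply: (@dv_quad _ _ _ _ (r / n) (`|B| * n ^+ 2)); rewrite ?divr_gt0// => t tr.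
  apply: le_trans _ (key t tr); apply: le_trans _ (ler_Re _).
  rewrite !creD !creN add0r rmorph0 mul0r addr0 mulrCA [Re (t%:C * _)]creM /= mul0r subr0.
  by rewrite [Re (l * d) * t]mulrC.
apply: le_trans _ (key t tr); apply: le_trans _ (ler_Im _).
rewrite !cimD !cimN add0r rmorph0 mul0r addr0 mulrCA [Im (t%:C * _)]cimM /= mul0r addr0.
by rewrite [Im (l * d) * t]mulrC.
Qed.

Lemma dv_translate (g : R -> R) x l : dv (fun t => g (x + t)) 0 l -> dv g x l.
Proof.
move=> h; have -> : g = (fun y => (fun t => g (x + t)) (y - x)).
  by apply/funext => y; rewrite addrC subrK.
rewrite -[l]mulr1; apply: (@dv_comp _ (fun t => g (x + t)) (fun y => y - x)); last by rewrite subrr.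
by rewrite -[X in dv _ _ X]subr0; apply: dvB; [exact: dv_id|exact: dv_cst].
Qed.

(** The complex derivative taken in the directions [1] and ['i] gives the Cauchy-Riemann
    equations. *)
Lemma an_partials f x y : an f (x +i* y) ->
  [/\ dv (fun x => Re (f (x +i* y))) x (Re (Df f (x +i* y))),
   dv (fun x => Im (f (x +i* y))) x (Im (Df f (x +i* y))),
   dv (fun y => Re (f (x +i* y))) y (- Im (Df f (x +i* y))) &
   dv (fun y => Im (f (x +i* y))) y (Re (Df f (x +i* y)))].
Proof.
move=> /an_Df h; have [h1 h2] := cderiv_dv 1 h; have [h3 h4] := cderiv_dv 'i h.
have e1 t : x +i* y + t%:C * 1 = (x + t) +i* y by rewrite mulr1; simpc.
have e2 t : x +i* y + t%:C * 'i = x +i* (y + t) by simpc.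
split; apply: dv_translate.
- by move: h1; rewrite mulr1; under eq_fun do rewrite e1.
- by move: h2; rewrite mulr1; under eq_fun do rewrite e1.
- by move: h3; under eq_fun do rewrite e2; rewrite creM /= mulr0 mulr1 sub0r.
- by move: h4; under eq_fun do rewrite e2; rewrite cimM /= mulr0 mulr1 addr0.
Qed.

Lemma an_cont2 f x y : an f (x +i* y) ->
  {for (x, y), continuous (fun p : R * R => Re (f (p.1 +i* p.2)))} /\
  {for (x, y), continuous (fun p : R * R => Im (f (p.1 +i* p.2)))}.
Proof.
move=> /an_ccont hf.
have key (e : R) : 0 < e -> \forall p \near (x, y), normc (f (p.1 +i* p.2) - f (x +i* y)) <= e.
  move=> e0; have [r r0 hr] := hf e e0.
  exists (ball x (r / 2), ball y (r / 2)) => /=.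
    by split; apply: nbhsx_ballx; rewrite divr_gt0.
  move=> [x' y'] [/=]; rewrite /ball /= => hx hy.
  have -> : x' +i* y' = x +i* y + ((x' - x) +i* (y' - y)) by simpc; rewrite !addrA !(addrC x) !(addrC y) !addrK ?subrK.
  apply: hr; apply: le_trans (normc_leD _) _ => /=.
  by rewrite (distrC x') (distrC y'); lra.
split; apply/cvgrPdist_le => e e0; apply: filterS (key e e0) => p hp.
  by rewrite distrC -creN -creD (le_trans (ler_Re _)).
by rewrite distrC -cimN -cimD (le_trans (ler_Im _)).
Qed.

End Partials.

Section Green.
Context {R : realType}.
Notation mu := (@lebesgue_measure R).
Notation mu2 := (mu \x mu)%E.
Implicit Types (v : R -> R -> R).

Definition cont2 v x y := {for (x, y), continuous (fun p : R * R => v p.1 p.2)}.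

Lemma cont2D u v x y : cont2 u x y -> cont2 v x y -> cont2 (fun x y => u x y + v x y) x y.
Proof. by move=> hu hv; exact: cvgD hu hv. Qed.
Lemma cont2B u v x y : cont2 u x y -> cont2 v x y -> cont2 (fun x y => u x y - v x y) x y.
Proof. by move=> hu hv; exact: cvgB hu hv. Qed.
Lemma cont2M u v x y : cont2 u x y -> cont2 v x y -> cont2 (fun x y => u x y * v x y) x y.
Proof. by move=> hu hv; exact: cvgM hu hv. Qed.
Lemma cont2N u x y : cont2 u x y -> cont2 (fun x y => - u x y) x y.
Proof. by move=> hu; exact: cvgN hu. Qed.
Lemma cont2V u x y : u x y != 0 -> cont2 u x y -> cont2 (fun x y => (u x y)^-1) x y.
Proof. by move=> u0 hu; exact: cvgV u0 hu. Qed.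
Lemma cont2_cst c x y : cont2 (fun _ _ => c) x y.
Proof. exact: cvg_cst. Qed.
Lemma cont2_comp (g : R -> R) u x y : {for u x y, continuous g} -> cont2 u x y ->
  cont2 (fun x y => g (u x y)) x y.
Proof.
by move=> hg hu; exact: (@continuous_comp _ _ _ (fun p : R * R => u p.1 p.2) g).
Qed.
Lemma cont2_fst x y : cont2 (fun x _ => x) x y. Proof. exact: cvg_fst. Qed.
Lemma cont2_snd x y : cont2 (fun _ y => y) x y. Proof. exact: cvg_snd. Qed.
Lemma cont2_x (g : R -> R) x y : {for x, continuous g} -> cont2 (fun x _ => g x) x y.
Proof. by move=> hg; apply: (cont2_comp hg); exact: cont2_fst. Qed.
Lemma cont2_y (g : R -> R) x y : {for y, continuous g} -> cont2 (fun _ y => g y) x y.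
Proof. by move=> hg; apply: (cont2_comp hg); exact: cont2_snd. Qed.
Lemma cont2X2 u x y : cont2 u x y -> cont2 (fun x y => u x y ^+ 2) x y.
Proof. by move=> hu; exact: (cont2M hu hu). Qed.

(* [C2at v vx vxx vy vyy x y]: near and at [(x, y)] the listed functions are the
   pure partial derivatives of [v] of order at most two, and are continuous. *)
Definition C2at v vx vxx vy vyy x y :=
  [/\ dv (v^~ y) x (vx x y) /\ dv (vx^~ y) x (vxx x y),
   dv (v x) y (vy x y) /\ dv (vy x) y (vyy x y),
   cont2 v x y, cont2 vx x y /\ cont2 vxx x y & cont2 vy x y /\ cont2 vyy x y].

Lemma C2at_M u ux uxx uy uyy v vx vxx vy vyy x y :
  C2at u ux uxx uy uyy x y -> C2at v vx vxx vy vyy x y ->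
  C2at (fun x y => u x y * v x y)
   (fun x y => ux x y * v x y + u x y * vx x y)
   (fun x y => uxx x y * v x y + 2 * (ux x y * vx x y) + u x y * vxx x y)
   (fun x y => uy x y * v x y + u x y * vy x y)
   (fun x y => uyy x y * v x y + 2 * (uy x y * vy x y) + u x y * vyy x y) x y.
Proof.
move=> [[u1 u2] [u3 u4] u5 [u6 u7] [u8 u9]] [[v1 v2] [v3 v4] v5 [v6 v7] [v8 v9]]; split.
- split; first exact: dvM u1 v1.
  by apply: (dv_eq (dvD (dvM u2 v1) (dvM u1 v2))) => /=; ring.
- split; first exact: dvM u3 v3.
  by apply: (dv_eq (dvD (dvM u4 v3) (dvM u3 v4))) => /=; ring.
- exact: cont2M.
- split; first by apply: cont2D; exact: cont2M.
  apply: cont2D; last exact: cont2M.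
  apply: cont2D; first exact: cont2M.
  by apply: cont2M; [exact: cont2_cst|exact: cont2M].
- split; first by apply: cont2D; exact: cont2M.
  apply: cont2D; last exact: cont2M.
  apply: cont2D; first exact: cont2M.
  by apply: cont2M; [exact: cont2_cst|exact: cont2M].
Qed.

(** Green's second identity. The function [v * uxx - u * vxx] is the [x]-derivative of
    [v * ux - u * vx], and similarly in [y]; Fubini allows each half to be integrated first in its
    own variable. *)
Lemma green u ux uxx uy uyy v vx vxx vy vyy a b c d : a <= b -> c <= d ->
  (forall x y, rect a b c d (x, y) -> C2at u ux uxx uy uyy x y) ->
  (forall x y, rect a b c d (x, y) -> C2at v vx vxx vy vyy x y) ->
  \int[mu2]_(p in rect a b c d) (v p.1 p.2 * (uxx p.1 p.2 + uyy p.1 p.2))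
   - \int[mu2]_(p in rect a b c d) (u p.1 p.2 * (vxx p.1 p.2 + vyy p.1 p.2)) =
  \int[mu]_(y in `[c, d]) ((v b y * ux b y - u b y * vx b y) - (v a y * ux a y - u a y * vx a y))
  + \int[mu]_(x in `[a, b]) ((v x d * uy x d - u x d * vy x d) - (v x c * uy x c - u x c * vy x c)).
Proof.
move=> ab cd hu hv.
have mr := @measurable_rect R a b c d.
pose f1 x y := v x y * uxx x y - u x y * vxx x y.
pose f2 x y := v x y * uyy x y - u x y * vyy x y.
have c1 p : rect a b c d p -> {for p, continuous (fun p : R * R => f1 p.1 p.2)}.
  case: p => x y xy; have [_ _ u5 [u6 u7] _] := hu _ _ xy; have [_ _ v5 [v6 v7] _] := hv _ _ xy.
  exact: (cont2B (cont2M v5 u7) (cont2M u5 v7)).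
have c2 p : rect a b c d p -> {for p, continuous (fun p : R * R => f2 p.1 p.2)}.
  case: p => x y xy; have [_ _ u5 _ [u6 u7]] := hu _ _ xy; have [_ _ v5 _ [v6 v7]] := hv _ _ xy.
  exact: (cont2B (cont2M v5 u7) (cont2M u5 v7)).
have i1 := rect_intg ab cd c1; have i2 := rect_intg ab cd c2.
have c3 p : rect a b c d p -> {for p, continuous (fun p : R * R => v p.1 p.2 * (uxx p.1 p.2 + uyy p.1 p.2))}.
  case: p => x y xy; have [_ _ u5 [_ u6] [_ u7]] := hu _ _ xy; have [_ _ v5 _ _] := hv _ _ xy.
  exact: (cont2M v5 (cont2D u6 u7)).
have c4 p : rect a b c d p -> {for p, continuous (fun p : R * R => u p.1 p.2 * (vxx p.1 p.2 + vyy p.1 p.2))}.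
  case: p => x y xy; have [_ _ u5 [_ u6] [_ u7]] := hv _ _ xy; have [_ _ v5 _ _] := hu _ _ xy.
  exact: (cont2M v5 (cont2D u6 u7)).
rewrite -(RintegralB mr (rect_intg ab cd c3) (rect_intg ab cd c4)).
transitivity (\int[mu2]_(p in rect a b c d) (f1 p.1 p.2 + f2 p.1 p.2)).
  by apply: eq_Rintegral => p _; rewrite /f1 /f2; ring.
rewrite (RintegralD mr i1 i2) (rect_fubini ab cd c1).2 (rect_fubini ab cd c2).1.
congr (_ + _); apply: eq_Rintegral => t /set_mem /=; rewrite in_itv /= => tcd.
  rewrite (@Rftc _ _ (fun x => v x t * ux x t - u x t * vx x t))//.
    move=> x xab; have xt : rect a b c d (x, t) by apply/rectP.
    have [[u1 u2] _ _ _ _] := hu _ _ xt; have [[v1 v2] _ _ _ _] := hv _ _ xt.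
    by apply: (dv_eq (dvB (dvM v1 u2) (dvM u1 v2))) => /=; rewrite /f1; ring.
  by move=> x xab; apply: (section2_cont (c1 (x, t) _)); apply/rectP.
rewrite (@Rftc _ _ (fun y => v t y * uy t y - u t y * vy t y))//.
  move=> x xab; have xt : rect a b c d (t, x) by apply/rectP.
  have [_ [u1 u2] _ _ _] := hu _ _ xt; have [_ [v1 v2] _ _ _] := hv _ _ xt.
  by apply: (dv_eq (dvB (dvM v1 u2) (dvM u1 v2))) => /=; rewrite /f2; ring.
by move=> x xab; apply: (section1_cont (c2 (t, x) _)); apply/rectP.
Qed.

(** By the Cauchy-Riemann equations all partial derivatives are expressed through two complex
    derivatives of [f]. The parameter [e] regularizes the logarithm at the zeros of [f]; the value
    [e = 0] is used where [f] has none. *)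
Lemma logmod_C2 (f : R[i] -> R[i]) (e x y : R) :
  let p x y := Re (f (x +i* y)) in let q x y := Im (f (x +i* y)) in
  let p1 x y := Re (Df f (x +i* y)) in let q1 x y := Im (Df f (x +i* y)) in
  let p2 x y := Re (Df (Df f) (x +i* y)) in let q2 x y := Im (Df (Df f) (x +i* y)) in
  let N x y := p x y ^+ 2 + q x y ^+ 2 + e in
  an f (x +i* y) -> 0 < N x y ->
  C2at (fun x y => 1 / 2 * ln (N x y))
   (fun x y => (p x y * p1 x y + q x y * q1 x y) / N x y)
   (fun x y => (p1 x y ^+ 2 + q1 x y ^+ 2 + p x y * p2 x y + q x y * q2 x y) / N x y
      - 2 * (p x y * p1 x y + q x y * q1 x y) ^+ 2 / N x y ^+ 2)
   (fun x y => (q x y * p1 x y - p x y * q1 x y) / N x y)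
   (fun x y => (p1 x y ^+ 2 + q1 x y ^+ 2 - p x y * p2 x y - q x y * q2 x y) / N x y
      - 2 * (q x y * p1 x y - p x y * q1 x y) ^+ 2 / N x y ^+ 2) x y.
Proof.
move=> p q p1 q1 p2 q2 N fa N0.
have fa1 := an_an_Df fa; have fa2 := an_an_Df fa1.
have [d1 d2 d3 d4] := an_partials fa; have [d5 d6 d7 d8] := an_partials fa1.
have [c1 c2] := an_cont2 fa; have [c3 c4] := an_cont2 fa1; have [c5 c6] := an_cont2 fa2.
have cN : cont2 N x y by apply: cont2D; [apply: cont2D; exact: cont2X2|exact: cont2_cst].
have cNV : cont2 (fun x y => (N x y)^-1) x y by apply: cont2V => //; rewrite gt_eqF.
have cN2 : cont2 (fun x y => (N x y ^+ 2)^-1) x y.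
  by apply: cont2V; [rewrite expf_neq0// gt_eqF|exact: cont2X2].
have Nx : dv (N^~ y) x (2 * (p x y * p1 x y + q x y * q1 x y)).
  apply: (dv_eq (dvD (dvD (dvX2 d1) (dvX2 d2)) (dv_cst e x))) => /=.
  by rewrite /p /q /p1 /q1; ring.
have Ny : dv (N x) y (2 * (q x y * p1 x y - p x y * q1 x y)).
  apply: (dv_eq (dvD (dvD (dvX2 d3) (dvX2 d4)) (dv_cst e y))) => /=.
  by rewrite /p /q /p1 /q1; ring.
have Nn0 : N x y != 0 by rewrite gt_eqF.
split.
- split; first by apply: (dv_eq (dvZ (1 / 2) (dv_ln (f := N^~ y) N0 Nx))) => /=; field.
  have H := dvM (dvD (dvM d1 d5) (dvM d2 d6)) (dvV (f := N^~ y) Nn0 Nx).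
  refine (dv_eq H _) => /=.
  by rewrite -/(p x y) -/(q x y) -/(p1 x y) -/(q1 x y) -/(p2 x y) -/(q2 x y); field.
- split; first by apply: (dv_eq (dvZ (1 / 2) (dv_ln N0 Ny))) => /=; field.
  have H := dvM (dvB (dvM d4 d7) (dvM d3 d8)) (dvV Nn0 Ny).
  refine (dv_eq H _) => /=.
  by rewrite -/(p x y) -/(q x y) -/(p1 x y) -/(q1 x y) -/(p2 x y) -/(q2 x y); field.
- apply: cont2M; first exact: cont2_cst.
  exact: (cont2_comp (dv_cont (is_derive1_ln N0)) cN).
- split; first by apply: cont2M => //; apply: cont2D; exact: cont2M.
  apply: cont2B; first apply: cont2M => //.
    by do !apply: cont2D; (exact: cont2X2 || exact: cont2M).
  apply: cont2M => //; apply: cont2M; first exact: cont2_cst.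
  by apply: cont2X2; apply: cont2D; exact: cont2M.
- split; first by apply: cont2M => //; apply: cont2B; exact: cont2M.
  apply: cont2B; first apply: cont2M => //.
    by do 2 (apply: cont2B; last exact: cont2M); apply: cont2D; exact: cont2X2.
  apply: cont2M => //; apply: cont2M; first exact: cont2_cst.
  by apply: cont2X2; apply: cont2B; exact: cont2M.
Qed.

End Green.

(** * A harmonic kernel *)

Section Kernel.
Context {R : realType}.
Notation mu := (@lebesgue_measure R).
Notation mu2 := (mu \x mu)%E.
Implicit Types (x y : R).
Variables (a : R).
Hypothesis a0 : 0 < a.

Definition sinha (y : R) := (expR (a * y) - expR (- (a * y))) / 2.
Let ch y := cosh (a * y).
Let sh := sinha.
Let sn x := sin (a * x).
Let cs x := cos (a * x).

Lemma dv_mulc x : dv (fun y => a * y) x a.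
Proof. by have := dvZ a (dv_id x); rewrite mulr1. Qed.

Lemma dv_ch y : dv ch y (a * sh y).
Proof.
rewrite /ch /cosh /sh /sinha.
have h1 := dv_exp (dv_mulc y); have h2 := dv_exp (dvN (dv_mulc y)).
by apply: (dv_eq (dvM (dvD h1 h2) (dv_cst 2^-1 y))) => /=; field.
Qed.

Lemma dv_sh y : dv sh y (a * ch y).
Proof.
rewrite /ch /cosh /sh /sinha.
have h1 := dv_exp (dv_mulc y); have h2 := dv_exp (dvN (dv_mulc y)).
by apply: (dv_eq (dvM (dvB h1 h2) (dv_cst 2^-1 y))) => /=; field.
Qed.

Lemma dv_sn x : dv sn x (a * cs x).
Proof. by rewrite mulrC; exact: dv_sin (dv_mulc x). Qed.

Lemma dv_cs x : dv cs x (- (a * sn x)).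
Proof. by apply: (dv_eq (dv_cos (dv_mulc x))); rewrite /sn; ring. Qed.

Lemma ch2sh2 y : ch y ^+ 2 = 1 + sh y ^+ 2.
Proof.
rewrite /ch /cosh /sh /sinha.
have e : expR (a * y) * expR (- (a * y)) = 1 by rewrite -expRD subrr expR0.
by apply/eqP; rewrite -subr_eq0; apply/eqP; transitivity (expR (a * y) * expR (- (a * y)) - 1); [field|rewrite e subrr].
Qed.

Lemma ch_ge1 y : 1 <= ch y.
Proof.
have h0 : 0 < ch y by rewrite /ch /cosh divr_gt0// addr_gt0 ?expR_gt0.
have := ch2sh2 y; have := sqr_ge0 (sh y); nra.
Qed.

Lemma ch_gt0 y : 0 < ch y. Proof. by rewrite (lt_le_trans ltr01 (ch_ge1 y)). Qed.

Lemma sh_le_ch y : `|sh y| <= ch y.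
Proof.
rewrite -(@ler_pXn2r _ 2)// ?nnegrE ?normr_ge0 ?(ltW (ch_gt0 y))//.
by rewrite real_normK ?num_real// ch2sh2 lerDr.
Qed.

(* Harmonic for [|x| < pi / (2 a)], zero on [x = 0], where its [x]-derivative
   is [1 / cosh (a * y)]. *)
Definition green_h x y := (ln (ch y + sn x) - ln (ch y - sn x)) / (2 * a).
Definition green_hx x y := cs x * ch y / (ch y ^+ 2 - sn x ^+ 2).
Definition green_hy x y := - (sh y * sn x) / (ch y ^+ 2 - sn x ^+ 2).
Definition green_hxx x y :=
  a * sn x * ch y * (2 - ch y ^+ 2 - sn x ^+ 2) / (ch y ^+ 2 - sn x ^+ 2) ^+ 2.
Definition green_hyy x y := - green_hxx x y.
Let hy := green_hy. Let hxx := green_hxx.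

Lemma cont2_ch x y : cont2 (fun _ y => ch y) x y.
Proof. exact/cont2_y/(dv_cont (dv_ch y)). Qed.
Lemma cont2_sh x y : cont2 (fun _ y => sh y) x y.
Proof. exact/cont2_y/(dv_cont (dv_sh y)). Qed.
Lemma cont2_sn x y : cont2 (fun x _ => sn x) x y.
Proof. exact/cont2_x/(dv_cont (dv_sn x)). Qed.
Lemma cont2_cs x y : cont2 (fun x _ => cs x) x y.
Proof. exact/cont2_x/(dv_cont (dv_cs x)). Qed.

Lemma green_h_C2 x y : 0 < ch y - sn x -> 0 < ch y + sn x ->
  C2at green_h green_hx green_hxx green_hy green_hyy x y.
Proof.
move=> p1 p2; have an0 : a != 0 by rewrite gt_eqF.
have QE : ch y ^+ 2 - sn x ^+ 2 = (ch y - sn x) * (ch y + sn x) by ring.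
have Q0 : 0 < ch y ^+ 2 - sn x ^+ 2 by rewrite QE mulr_gt0.
have Qn0 : ch y ^+ 2 - sn x ^+ 2 != 0 by rewrite gt_eqF.
have n1 : ch y - sn x != 0 by rewrite gt_eqF.
have n2 : ch y + sn x != 0 by rewrite gt_eqF.
have csE : cs x ^+ 2 = 1 - sn x ^+ 2 by rewrite /cs /sn cos2sin2.
have shE := ch2sh2 y.
have cQ : cont2 (fun x y => ch y ^+ 2 - sn x ^+ 2) x y.
  by apply: cont2B; apply: cont2X2; [exact: cont2_ch|exact: cont2_sn].
have cQV : cont2 (fun x y => (ch y ^+ 2 - sn x ^+ 2)^-1) x y by exact: (@cont2V _ (fun x y => ch y ^+ 2 - sn x ^+ 2) _ _ Qn0 cQ).
have cxx : cont2 green_hxx x y.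
  rewrite /green_hxx; apply: cont2M; last first.
    apply: (@cont2V _ (fun x y => (ch y ^+ 2 - sn x ^+ 2) ^+ 2)); first by rewrite expf_neq0.
    exact: cont2X2.
  apply: cont2M.
    apply: cont2M; last exact: cont2_ch.
    by apply: cont2M; [exact: cont2_cst|exact: cont2_sn].
  apply: cont2B; last by apply: cont2X2; exact: cont2_sn.
  by apply: cont2B; [exact: cont2_cst|apply: cont2X2; exact: cont2_ch].
split.
- split.
    have := dvM (dvB (dv_ln (f := fun x => ch y + sn x) p2 (dvD (dv_cst (ch y) x) (dv_sn x)))
              (dv_ln (f := fun x => ch y - sn x) p1 (dvB (dv_cst (ch y) x) (dv_sn x)))) (dv_cst (2 * a)^-1 x).
    move=> H; apply: (dv_eq H); rewrite /= /green_hx QE.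
    by field; rewrite n1 n2 an0.
  have := dvM (dvM (dv_cs x) (dv_cst (ch y) x)) (dvV (f := fun x => ch y ^+ 2 - sn x ^+ 2) Qn0 (dvB (dv_cst (ch y ^+ 2) x) (dvX2 (dv_sn x)))).
  move=> H; apply: (dv_eq H); rewrite /= /green_hxx.
  transitivity ((- (a * sn x * ch y) * (ch y ^+ 2 - sn x ^+ 2) + 2 * a * sn x * ch y * cs x ^+ 2) / (ch y ^+ 2 - sn x ^+ 2) ^+ 2).
    by field.
  by rewrite csE; field.
- split.
    have := dvM (dvB (dv_ln (f := fun y => ch y + sn x) p2 (dvD (dv_ch y) (dv_cst (sn x) y)))
              (dv_ln (f := fun y => ch y - sn x) p1 (dvB (dv_ch y) (dv_cst (sn x) y)))) (dv_cst (2 * a)^-1 y).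
    move=> H; apply: (dv_eq H); rewrite /= /green_hy QE.
    by field; rewrite n1 n2 an0.
  have := dvM (dvN (dvM (dv_sh y) (dv_cst (sn x) y))) (dvV (f := fun y => ch y ^+ 2 - sn x ^+ 2) Qn0 (dvB (dvX2 (dv_ch y)) (dv_cst (sn x ^+ 2) y))).
  move=> H; apply: (dv_eq H); rewrite /= /green_hyy /green_hxx.
  transitivity ((- (a * sn x * ch y) * (ch y ^+ 2 - sn x ^+ 2) + 2 * a * sn x * ch y * sh y ^+ 2) / (ch y ^+ 2 - sn x ^+ 2) ^+ 2).
    by field.
  rewrite (_ : sh y ^+ 2 = ch y ^+ 2 - 1); last by rewrite shE; ring.
  by field.
- apply: cont2M; last exact: cont2_cst.
  apply: cont2B.
    have cp : cont2 (fun x y => ch y + sn x) x y by apply: cont2D; [exact: cont2_ch|exact: cont2_sn].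
    have cl : {for (ch y + sn x), continuous (@ln R)} := dv_cont (is_derive1_ln p2).
    exact (@cont2_comp R (@ln R) _ x y cl cp).
  have cp : cont2 (fun x y => ch y - sn x) x y by apply: cont2B; [exact: cont2_ch|exact: cont2_sn].
  have cl : {for (ch y - sn x), continuous (@ln R)} := dv_cont (is_derive1_ln p1).
  exact (@cont2_comp R (@ln R) _ x y cl cp).
- split => //; apply: cont2M => //.
  by apply: cont2M; [exact: cont2_cs|exact: cont2_ch].
- split; last exact: cont2N.
  apply: cont2M => //; apply: cont2N.
  by apply: cont2M; [exact: cont2_sh|exact: cont2_sn].
Qed.

Variables (x1 : R).
Hypothesis x10 : 0 < x1.
Hypothesis ax1 : a * x1 < pi / 2.

Lemma sn_ge0 x : 0 <= x <= x1 -> 0 <= sn x.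
Proof.
move=> /andP[x0 xx]; apply: sin_ge0_pi; rewrite mulr_ge0 ?(ltW a0)//=.
have := pi_gt0 R; have := ax1; have : a * x <= a * x1 by rewrite ler_pM2l.
lra.
Qed.

Lemma sn_gt0 x : 0 < x <= x1 -> 0 < sn x.
Proof.
move=> /andP[x0 xx]; apply: sin_gt0_pihalf; rewrite mulr_gt0//=.
by apply: le_lt_trans ax1; rewrite ler_pM2l.
Qed.

Lemma sn_lt1 : sn x1 < 1.
Proof.
rewrite -(sin_pihalf R) /sn ltr_sin// in_itv /=; have := pi_gt0 R; have := ax1; have := mulr_gt0 a0 x10; lra.
Qed.

Lemma sn_le x : 0 <= x <= x1 -> sn x <= sn x1.
Proof.
move=> /andP[x0 xx]; rewrite le_eqVlt; move: xx; rewrite le_eqVlt => /predU1P[->|xx]; first by rewrite eqxx.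
apply/orP; right; have h1 := mulr_ge0 (ltW a0) x0; have h2 : a * x < a * x1 by rewrite ltr_pM2l.
by rewrite /sn ltr_sin// in_itv /=; have := pi_gt0 R; have := ax1; lra.
Qed.

Let k1 := 1 - sn x1.
Let k10 : 0 < k1. Proof. by rewrite subr_gt0 sn_lt1. Qed.

(** Because [ch >= 1], the subtracted sine is at most the fraction [sn x1 < 1] of [ch y]. Hence all
    denominators are comparable with [ch y], which is why [x1] has to stay below [pi / (2 a)]. *)
Lemma ch_sub_sn x y : 0 <= x <= x1 -> k1 * ch y <= ch y - sn x.
Proof.
move=> xx; have := sn_le xx; have := sn_ge0 xx; have := ch_ge1 y; have := sn_lt1.
by rewrite /k1; nra.
Qed.

Lemma green_region x y : 0 <= x <= x1 -> 0 < ch y - sn x /\ 0 < ch y + sn x.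
Proof.
move=> xx; split; first by apply: lt_le_trans (ch_sub_sn y xx); rewrite mulr_gt0 ?ch_gt0.
by rewrite ltr_wpDr ?sn_ge0 ?ch_gt0.
Qed.

(** One constant for [green_h], whose bound carries [1 / (a * k1)], and for its gradient, whose
    bound carries [1 / k1]. *)
Definition green_bound := (1 + a^-1) / (1 - sin (a * x1)).

Lemma green_h_ge0 x y : 0 <= x <= x1 -> 0 <= green_h x y.
Proof.
move=> xx; have [p1 p2] := green_region y xx; rewrite divr_ge0//; last by rewrite mulr_ge0// ltW.
by rewrite subr_ge0 ler_ln// ?posrE//; have := sn_ge0 xx; lra.
Qed.

Lemma green_h_gt0 x y : 0 < x <= x1 -> 0 < green_h x y.
Proof.
move=> xx; have xx' : 0 <= x <= x1 by move/andP: xx => [? ->]; rewrite ltW.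
have [p1 p2] := green_region y xx'; rewrite divr_gt0//; last by rewrite mulr_gt0.
by rewrite subr_gt0 ltr_ln// ?posrE//; have := sn_gt0 xx; lra.
Qed.

Lemma green_h0 y : green_h 0 y = 0.
Proof. by rewrite /green_h /sn mulr0 sin0 addr0 subr0 subrr mul0r. Qed.

Lemma green_hx0 y : green_hx 0 y = (ch y)^-1.
Proof.
have c0 := ch_gt0 y; rewrite /green_hx /sn /cs mulr0 sin0 cos0.
by field; rewrite gt_eqF.
Qed.

Lemma green_hR x : 0 <= x <= x1 ->
  green_h x 0 = ln ((1 + sin (a * x)) / (1 - sin (a * x))) / (2 * a).
Proof.
move=> xx; have [p1 p2] := green_region 0 xx.
have c1 : ch 0 = 1 by rewrite /ch /cosh mulr0 oppr0 expR0; field.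
by rewrite /green_h c1 in p1 p2 *; rewrite ln_div// posrE.
Qed.

Let bnd_ge : [/\ k1^-1 <= green_bound & (a * k1)^-1 <= green_bound].
Proof.
rewrite /green_bound -/(sn x1) -/k1 invfM mulrDl mul1r; split.
  by rewrite lerDl divr_ge0 ?invr_ge0 ?(ltW k10) ?(ltW a0).
by rewrite lerDr invr_ge0 ltW.
Qed.

(** The quotient of the two arguments of the logarithm is [1 + 2 sn x / (ch y - sn x)], so
    [ln (1 + t) <= t] gives the decay [1 / ch y]. *)
Lemma green_h_le x y : 0 <= x <= x1 -> `|green_h x y| <= green_bound / ch y.
Proof.
move=> xx; rewrite ger0_norm ?green_h_ge0//.
have [p1 p2] := green_region y xx; have c0 := ch_gt0 y; have s0 := sn_ge0 xx.
have kc := ch_sub_sn y xx; have s1 := sn_lt1; have sx := sn_le xx.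
apply: (@le_trans _ _ ((a * k1)^-1 / ch y)); last first.
  by rewrite ler_pM2r ?invr_gt0//; case: bnd_ge.
rewrite /green_h -ln_div ?posrE//.
apply: (@le_trans _ _ ((2 * sn x / (ch y - sn x)) / (2 * a))).
  rewrite ler_pM2r ?invr_gt0 ?mulr_gt0//.
  rewrite (_ : (ch y + sn x) / (ch y - sn x) = 1 + 2 * sn x / (ch y - sn x)); last by field; rewrite gt_eqF.
  by apply: le_ln1Dx; rewrite (lt_le_trans (ltrN10 _))// divr_ge0 ?mulr_ge0// ltW.
rewrite (_ : 2 * sn x / (ch y - sn x) / (2 * a) = a^-1 * (sn x / (ch y - sn x))); last by field; rewrite !gt_eqF.
rewrite invfM -mulrA ler_pM2l ?invr_gt0//.
rewrite ler_pdivrMr// -invfM ler_pdivlMl; last by rewrite mulr_gt0.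
by apply: (@le_trans _ _ (k1 * ch y)) => //; rewrite ler_piMr//; [rewrite mulr_ge0// ltW|lra].
Qed.

Let Qge x y : 0 <= x <= x1 -> k1 * ch y ^+ 2 <= ch y ^+ 2 - sn x ^+ 2.
Proof.
move=> xx; have [p1 p2] := green_region y xx; have c0 := ch_gt0 y; have s0 := sn_ge0 xx.
have kc := ch_sub_sn y xx.
have -> : ch y ^+ 2 - sn x ^+ 2 = (ch y - sn x) * (ch y + sn x) by ring.
rewrite expr2 mulrA; apply: ler_pM => //; rewrite ?mulr_ge0 ?(ltW k10) ?(ltW c0)//; lra.
Qed.

Let Qbound x y (N : R) : 0 <= x <= x1 -> `|N| <= ch y ->
  `|N / (ch y ^+ 2 - sn x ^+ 2)| <= green_bound / ch y.
Proof.
move=> xx hN; have c0 := ch_gt0 y; have Q := Qge y xx.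
have kc2 : 0 < k1 * ch y ^+ 2 by rewrite mulr_gt0// exprn_gt0.
have Q0 : 0 < ch y ^+ 2 - sn x ^+ 2 by apply: lt_le_trans Q.
rewrite normrM normfV (gtr0_norm Q0).
apply: (@le_trans _ _ (ch y / (k1 * ch y ^+ 2))).
  by apply: ler_pM => //; rewrite ?invr_ge0 ?(ltW Q0)// lef_pV2 ?posrE.
rewrite (_ : ch y / (k1 * ch y ^+ 2) = k1^-1 / ch y); last by field; rewrite !gt_eqF.
by rewrite ler_pM2r ?invr_gt0//; case: bnd_ge.
Qed.

Lemma green_hx_le x y : 0 <= x <= x1 -> `|green_hx x y| <= green_bound / ch y.
Proof.
move=> xx; apply: Qbound => //; rewrite normrM (gtr0_norm (ch_gt0 y)) ler_piMl ?(ltW (ch_gt0 y))//.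
exact: cos_max.
Qed.

Lemma green_hy_le x y : 0 <= x <= x1 -> `|green_hy x y| <= green_bound / ch y.
Proof.
move=> xx; apply: Qbound => //; rewrite normrN normrM.
apply: (@le_trans _ _ (`|sh y| * 1)); last by rewrite mulr1 sh_le_ch.
by rewrite ler_wpM2l// sin_max.
Qed.

End Kernel.

(** * Cutoffs and the passage from rectangles to a strip *)

Section Strip.
Context {R : realType}.
Notation mu := (@lebesgue_measure R).
Notation mu2 := (mu \x mu)%E.
Notation RR := (measurableTypeR R).
Implicit Types (f : R * R -> R) (x y : R).

Definition strip (b : R) : set (RR * RR) := `[0, b]%classic `*` setT.

Lemma stripP b p : strip b p <-> 0 <= p.1 <= b.
Proof. by rewrite /strip /= in_itv /=; split => [[]|]. Qed.

Lemma measurable_strip b : measurable (strip b).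
Proof. exact: measurableX. Qed.

Lemma strip_measurable f b : 0 <= b ->
  (forall p, strip b p -> {for p, continuous f}) -> measurable_fun (strip b) (f : RR * RR -> R).
Proof.
move=> b0 hf; pose g p := f (clamp 0 b p.1, p.2).
have gc : continuous g.
  move=> p; apply: (@continuous_comp _ _ _ (fun p => (clamp 0 b p.1, p.2)) f).
    have c1 : {for p, continuous (fun p : R * R => clamp 0 b p.1)}.
      by apply: (@continuous_comp _ _ _ fst (clamp 0 b)); [exact: cvg_fst|exact: clamp_cont].
    by exact: (cvg_pair c1 (@cvg_snd _ _ _ _ _)).
  by apply: hf; apply/stripP; rewrite /clamp /= le_max lexx /= ge_max ge_min lexx b0.
apply: (@eq_measurable_fun _ _ _ _ _ g); last exact: (measurable_funS measurableT (@subsetT _ _) (cont2_measurable gc)).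
move=> [x y] /set_mem /stripP /= /andP[ax xb].
by rewrite /g /clamp /=; congr (f (_, _)); rewrite min_r// max_r.
Qed.

Lemma strip_intg_snd (g : R -> R) b : 0 <= b -> intg mu setT g ->
  intg mu2 (strip b) (fun p => g p.2).
Proof.
move=> b0 ig; have mg := intg_meas ig.
have mf : measurable_fun setT (fun p : RR * RR => (g p.2)%:E).
  by apply/measurable_EFinP; apply: (measurableT_comp mg); exact: measurable_snd.
pose F := (fun p : RR * RR => (g p.2)%:E) \_ (strip b).
have mF : measurable_fun setT F.
  apply/(measurable_restrictT _ (measurable_strip b)).
  exact: measurable_funS mf.
apply/(integrable_mkcond _ (measurable_strip b)).
apply: (integrable12ltyP mu mu mF).2.
have -> : (\int[mu]_x \int[mu]_y `|F (x, y)| = \int[mu]_(x in `[0%R, b]) (\int[mu]_y `|(g y)%:E|))%E.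
  rewrite [RHS]integral_mkcond; apply: eq_integral => x _; rewrite patchE.
  case: ifPn => [/set_mem xb|xb].
    by apply: eq_integral => y _; rewrite /F patchE mem_set//; apply/stripP; move: xb; rewrite /= in_itv.
  rewrite -[RHS](@integral0 _ _ _ mu setT); apply: eq_integral => y _; rewrite /F patchE.
  case: ifPn => [/set_mem /stripP /= h|_]; last by rewrite abse0.
  by move/negP: xb; case; apply/mem_set; rewrite /= in_itv.
rewrite integral_cst//= lebesgue_measure_itv /=.
have /integrableP[_ h] := ig.
by case: ifP => _; [apply: lte_mul_pinfty => //; [exact: integral_ge0|by rewrite ge0_fin_numE// integral_ge0|by rewrite -EFinB ltry]|rewrite mule0 ltry].
Qed.

End Strip.

Section Cutoff.
Context {R : realType}.
Notation mu := (@lebesgue_measure R).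
Notation mu2 := (mu \x mu)%E.
Notation RR := (measurableTypeR R).
Implicit Types (x y T : R).
Variables (a x0 x1 : R).
Hypotheses (a0 : 0 < a) (x00 : 0 < x0) (x01 : x0 < x1) (ax1 : a * x1 < pi / 2).
Let x10 : 0 < x1. Proof. exact: lt_trans x01. Qed.
Let l := x1 - x0.
Let l0 : 0 < l. Proof. by rewrite subr_gt0. Qed.
Let ch y := cosh (a * y).
Let h := green_h a. Let hx := green_hx a. Let hy := green_hy a. Let hxx := green_hxx a.

Let m x := pos ((x - x0) / (x1 - x0)).
(* [psi] is the cutoff in [x]: it is [1] for [x <= x0], and vanishes to second order at
   [x1]; [chi T] is the cutoff in [y]. *)
Definition psi x := (1 - pos ((x - x0) / (x1 - x0)) ^+ 3) ^+ 2.
Definition psi1 x := let m := pos ((x - x0) / (x1 - x0)) in - (6 * m ^+ 2 * (1 - m ^+ 3)) / (x1 - x0).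
Definition psi2 x := let m := pos ((x - x0) / (x1 - x0)) in - (6 * (2 * m - 5 * m ^+ 4)) / (x1 - x0) ^+ 2.
Definition chi T y := (1 - (y / T) ^+ 2) ^+ 2.
Definition chi1 T y := - (4 * y * (1 - (y / T) ^+ 2)) / T ^+ 2.
Definition chi2 T y := - (4 - 12 * (y / T) ^+ 2) / T ^+ 2.

(** The cube in [psi] smooths the kink of [pos] at [x0] to second order; the outer square makes
    value and slope vanish at [x1]. *)
Lemma psi_C2 x y : C2at (fun x _ => psi x) (fun x _ => psi1 x) (fun x _ => psi2 x)
  (fun _ _ => 0) (fun _ _ => 0) x y.
Proof.
have dt : dv (fun x => (x - x0) / (x1 - x0)) x (x1 - x0)^-1.
  by apply: (dv_eq (dvM (dvB (dv_id x) (dv_cst x0 x)) (dv_cst (x1 - x0)^-1 x))) => /=; ring.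
have d2 : dv (fun x => m x ^+ 2) x (2 * m x / (x1 - x0)) by exact: (dv_comp dt (dv_pos2 _)).
have d3 : dv (fun x => m x ^+ 3) x (3 * m x ^+ 2 / (x1 - x0)) by exact: (dv_comp dt (dv_pos3 _)).
have D1 : dv psi x (psi1 x).
  apply: (dv_eq (dvX2 (dvB (dv_cst 1 x) d3))); rewrite /psi1 -/(m x) /=; ring.
have D2 : dv psi1 x (psi2 x).
  have H := dvM (dvN (dvM (dvZ 6 d2) (dvB (dv_cst 1 x) d3))) (dv_cst (x1 - x0)^-1 x).
  by apply: (dv_eq H); rewrite /psi2 -/(m x) /= -exprVn; ring.
have cm : {for x, continuous m}.
  by apply: (@continuous_comp _ _ _ (fun x => (x - x0) / (x1 - x0)) pos); [exact: (dv_cont dt)|exact: pos_cont].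
split; [by split|by split; exact: dv_cst| | |by split; exact: cont2_cst].
- exact/cont2_x/(dv_cont D1).
- split; first exact/cont2_x/(dv_cont D2).
  apply: cont2_x; rewrite /psi2 -/m.
  apply: cvgM; last exact: cvg_cst.
  apply: cvgN; apply: cvgM; first exact: cvg_cst.
  apply: cvgB; apply: cvgM; (try exact: cvg_cst) => //.
  by apply: (@continuous_comp _ _ _ m (fun t => t ^+ 4)) => //; exact: exprn_continuous.
Qed.

Lemma chi_C2 T x y : T != 0 -> C2at (fun _ y => chi T y) (fun _ _ => 0) (fun _ _ => 0)
  (fun _ y => chi1 T y) (fun _ y => chi2 T y) x y.
Proof.
move=> T0.
have dt : dv (fun y => y / T) y T^-1.
  by apply: (dv_eq (dvM (dv_id y) (dv_cst T^-1 y))) => /=; ring.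
have D1 : dv (chi T) y (chi1 T y).
  by apply: (dv_eq (dvX2 (dvB (dv_cst 1 y) (dvX2 dt)))); rewrite /chi1 /=; field.
have D2 : dv (chi1 T) y (chi2 T y).
  have H := dvM (dvN (dvM (dvZ 4 (dv_id y)) (dvB (dv_cst 1 y) (dvX2 dt)))) (dv_cst (T ^+ 2)^-1 y).
  by apply: (dv_eq H); rewrite /chi2 /=; field.
split; [by split; exact: dv_cst|by split| |by split; exact: cont2_cst|].
- exact/cont2_y/(dv_cont D1).
- split; first exact/cont2_y/(dv_cont D2).
  apply: cont2_y; have H := dvM (dvN (dvB (dv_cst 4 y) (dvZ 12 (dvX2 dt)))) (dv_cst (T ^+ 2)^-1 y).
  exact: (dv_cont H).
Qed.

Definition cutoff T x y := green_h a x y * psi x * chi T y.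
(* The Laplacians of [cutoff T] and of [green_h * psi]. *)
Definition kernT T x y := (2 * (green_hx a x y * psi1 x) + green_h a x y * psi2 x) * chi T y
  + (2 * (green_hy a x y * chi1 T y) + green_h a x y * chi2 T y) * psi x.
Definition kern x y := 2 * (green_hx a x y * psi1 x) + green_h a x y * psi2 x.

Lemma psi_eq1 x : x <= x0 -> [/\ psi x = 1, psi1 x = 0 & psi2 x = 0].
Proof.
move=> xx; have mE : pos ((x - x0) / (x1 - x0)) = 0.
  by rewrite /pos max_l// pmulr_lle0 ?invr_gt0 ?subr_gt0// subr_le0.
by rewrite /psi /psi1 /psi2 mE !expr0n /= subr0 expr1n !mulr0 !mul0r subrr mulr0 oppr0 !mul0r.
Qed.

Lemma psi_x1 : psi x1 = 0 /\ psi1 x1 = 0.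
Proof.
have mE : pos ((x1 - x0) / (x1 - x0)) = 1.
  by rewrite /pos divff ?gt_eqF// max_r.
by rewrite /psi /psi1 mE !expr1n subrr expr0n /= mulr0 oppr0 mul0r.
Qed.

Lemma kern_eq0 x y : x <= x0 -> kern x y = 0.
Proof. by move=> /psi_eq1[_ k1 k2]; rewrite /kern k1 k2 !mulr0 addr0. Qed.

Lemma m_bound x : x <= x1 -> 0 <= pos ((x - x0) / (x1 - x0)) <= 1.
Proof.
move=> xx; rewrite /pos le_max lexx /= ge_max ler01 /= ler_pdivrMr ?subr_gt0// mul1r.
by rewrite lerB.
Qed.

Lemma psi_bound x : x <= x1 -> [/\ 0 <= psi x <= 1, `|psi1 x| <= 6 / l & `|psi2 x| <= 42 / l ^+ 2].
Proof.
move=> /m_bound; set t := pos _ => /andP[t0 t1].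
have t2 : 0 <= t ^+ 2 <= 1 by rewrite sqr_ge0 exprn_ile1.
have t3 : 0 <= t ^+ 3 <= 1 by rewrite exprn_ge0 ?exprn_ile1.
have t4 : 0 <= t ^+ 4 <= 1 by rewrite exprn_ge0 ?exprn_ile1.
rewrite /psi /psi1 /psi2 -/l -/t; split.
- by rewrite sqr_ge0 /= exprn_ile1//; lra.
- rewrite mulNr normrN normrM normfV (gtr0_norm l0) ler_pM2r ?invr_gt0//.
  by rewrite ger0_norm; nra.
- rewrite mulNr normrN normrM normfV (gtr0_norm (exprn_gt0 2 l0)) ler_pM2r ?invr_gt0 ?exprn_gt0//.
  by rewrite ler_norml; apply/andP; split; lra.
Qed.

Lemma chi_bound T y : 1 <= T -> - T <= y <= T ->
  [/\ 0 <= chi T y <= 1, `|chi1 T y| <= 4 & `|chi2 T y| <= 16].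
Proof.
move=> T1 /andP[y1 y2]; have T0 : 0 < T by lra.
have T2 : 1 <= T ^+ 2 by rewrite exprn_ege1.
have T20 : 0 < T ^+ 2 by rewrite exprn_gt0.
have q0 : `|y / T| <= 1 by rewrite ler_norml ler_pdivrMr// ler_pdivlMr// !mulN1r !mul1r y1.
have q2 : 0 <= (y / T) ^+ 2 <= 1.
  by rewrite sqr_ge0 /= -[_ ^+ 2]real_normK ?num_real// exprn_ile1.
rewrite /chi /chi1 /chi2; split.
- by rewrite sqr_ge0 /= exprn_ile1//; lra.
- rewrite mulNr normrN (_ : _ / _ = 4 / T * ((y / T) * (1 - (y / T) ^+ 2))); last by field; rewrite gt_eqF.
  rewrite normrM ger0_norm; last by rewrite divr_ge0// ltW.
  apply: (@le_trans _ _ (4 / T * 1)).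
    rewrite ler_wpM2l ?divr_ge0 ?(ltW T0)// normrM; apply: mulr_ile1 => //.
    by rewrite ler_norml; apply/andP; split; lra.
  by rewrite mulr1 ler_pdivrMr//; lra.
- rewrite mulNr normrN normrM normfV (gtr0_norm T20) ler_pdivrMr//.
  apply: (@le_trans _ _ 16); last by rewrite ler_peMr.
  by rewrite ler_norml; apply/andP; split; lra.
Qed.

Lemma cutoff_ge0 T x y : 0 <= x <= x1 -> 0 <= cutoff T x y.
Proof.
move=> xx; rewrite /cutoff mulr_ge0 ?sqr_ge0// mulr_ge0 ?sqr_ge0//.
exact: (green_h_ge0 a0 x10 ax1 y xx).
Qed.

(** Green's identity for [cutoff T] and [v]. On [x = x1] and [y = T], [y = - T] the cutoff functions
    vanish with their first derivatives; on [x = 0] the kernel vanishes and only its normal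
    derivative [1 / ch] remains. As [green_h] is harmonic, the Laplacian of the cutoff contains only
    terms with a derivative of [psi] or [chi]. *)
Lemma cutoff_green T v vx vxx vy vyy : 0 < T ->
  (forall x y, rect 0 x1 (- T) T (x, y) -> C2at v vx vxx vy vyy x y) ->
  \int[mu]_(y in `[- T, T]) (v 0 y * (chi T y / ch y)) +
  \int[mu2]_(p in rect 0 x1 (- T) T) (v p.1 p.2 * kernT T p.1 p.2) =
  \int[mu2]_(p in rect 0 x1 (- T) T) (cutoff T p.1 p.2 * (vxx p.1 p.2 + vyy p.1 p.2)).
Proof.
move=> T0 hv; have Tn0 : T != 0 by rewrite gt_eqF.
have TT : - T <= T by lra.
have hC x y : rect 0 x1 (- T) T (x, y) -> C2at h hx hxx hy (green_hyy a) x y.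
  by move=> /rectP /= [xx _]; have [p1 p2] := green_region a0 x10 ax1 y xx; exact: (green_h_C2 a0).
have hphi x y xy := C2at_M (C2at_M (hC x y xy) (psi_C2 x y)) (chi_C2 x y Tn0).
have := green (ltW x10) TT hphi hv.
have ps0 := (psi_eq1 (ltW x00)).
have [ps1 ps11] := psi_x1.
have chT y : y = T \/ y = - T -> chi T y = 0 /\ chi1 T y = 0.
  move=> yT; have e : 1 - (y / T) ^+ 2 = 0 by case: yT => ->; field.
  by rewrite /chi /chi1 e expr0n /= mulr0 oppr0 mul0r.
have [ct1 ct2] := chT _ (or_introl (erefl T)); have [cm1 cm2] := chT _ (or_intror (erefl (- T))).
rewrite [X in _ = _ + X](_ : _ = 0); last first.
  under eq_Rintegral => x _ do rewrite ct1 ct2 cm1 cm2 !(mulr0, addr0, subr0, mul0r).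
  by rewrite Rintegral_cst// ?mul0r//; exact: measurable_itv.
rewrite addr0 => H.
set Y := (X in _ - X) in H; rewrite -[RHS]/Y.
rewrite -[RHS](subKr (\int[mu2]_(p in rect 0 x1 (- T) T) (v p.1 p.2 * kernT T p.1 p.2))).
have [ps00 ps01 _] := ps0.
rewrite addrC; congr (_ + _).
transitivity (- \int[mu]_(y in `[- T, T]) (- 1 * (v 0 y * (chi T y / ch y)))).
  rewrite RintegralZl//; first by rewrite mulN1r opprK.
  apply: cont_intg => y yT; have [_ _ cv _ _] : C2at v vx vxx vy vyy 0 y.
    by apply: hv; apply/rectP; rewrite /= lexx (ltW x10).
  apply: cvgM; first exact: (section1_cont cv).
  have [_ _ cc _ _] := chi_C2 0 y Tn0; apply: cvgM; first exact: (section1_cont cc).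
  by apply: cvgV; [rewrite gt_eqF// ch_gt0|exact: (dv_cont (dv_ch a y))].
congr (- _); transitivity (\int[mu2]_(p in rect 0 x1 (- T) T) (v p.1 p.2 * kernT T p.1 p.2) - Y); last by [].
rewrite -[RHS]/(_ - _); transitivity (\int[mu]_(y in `[- T, T])
       (v x1 y * ((hx x1 y * psi x1 + h x1 y * psi1 x1) * chi T y + h x1 y * psi x1 * 0) -
        h x1 y * psi x1 * chi T y * vx x1 y -
        (v 0 y * ((hx 0 y * psi 0 + h 0 y * psi1 0) * chi T y + h 0 y * psi 0 * 0) -
         h 0 y * psi 0 * chi T y * vx 0 y))).
  apply: eq_Rintegral => y _.
  by rewrite ps00 ps01 ps1 ps11 /hx green_hx0 /h green_h0 -/(ch y); ring.
rewrite -H; congr (_ - _); apply: eq_Rintegral => p _; congr (_ * _).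
by rewrite /kernT /green_hyy -/h -/hx -/hy -/hxx; ring.
Qed.

End Cutoff.

Section Expand.
Context d (T : measurableType d) {R : realType} (mu : {measure set T -> \bar R}).
Implicit Types (f g : T -> R).

Lemma Rdct_expand (D : set T) (A_ : nat -> set T) (f_ : nat -> T -> R) f g : measurable D ->
  (forall n, measurable (A_ n)) -> (forall n, A_ n `<=` D) ->
  (forall x, D x -> \forall n \near \oo, A_ n x) ->
  (forall n, measurable_fun (A_ n) (f_ n)) ->
  (forall x, D x -> (fun n => f_ n x) @ \oo --> f x) ->
  intg mu D g -> (forall n x, A_ n x -> `|f_ n x| <= g x) ->
  intg mu D f /\ (fun n => \int[mu]_(x in A_ n) f_ n x) @ \oo --> \int[mu]_(x in D) f x.
Proof.
move=> mD mA AD Dn mf ff ig fg.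
have -> : (fun n => \int[mu]_(x in A_ n) f_ n x) = (fun n => \int[mu]_(x in D) (f_ n \_ (A_ n)) x).
  by apply: funext => n; rewrite -Rintegral_mkcondr (setIidr (AD n)).
apply: (Rdct mD) ig _.
- move=> n; apply: (measurable_funS measurableT) => //.
  exact/(measurable_restrictT _ (mA n)).
- move=> x Dx; apply: cvg_trans (ff x Dx); apply: near_eq_cvg.
  by apply: filterS (Dn x Dx) => n Ax; rewrite patchE mem_set.
- move=> n x Dx; rewrite patchE; case: ifPn => [/set_mem|_]; first exact: fg.
  (* Outside [A_ n] the restricted function is [0], and [0 <= g x] follows from a later index [m]
     for which [A_ m x] holds. *)
  rewrite normr0; have [m _ h] := Dn x Dx.
  by apply: le_trans (fg m x (h m (leqnn m))).
Qed.

End Expand.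

Section Sech.
Context {R : realType}.
Notation mu := (@lebesgue_measure R).
Implicit Types (x y : R).
Variables (a : R).
Hypothesis a0 : 0 < a.

(** The fourth power of [1 + z / 4 <= exp (z / 4)], with [z = a |y|], beats the cubic
    [(1 + |y|) (1 + y ^ 2)]; the constant [K] converts [1 + |y|] into [1 + z / 4]. *)
Lemma sech_bound : exists2 C : R, 0 < C & forall y, (1 + `|y|) / cosh (a * y) <= C / (1 + y ^+ 2).
Proof.
pose K := 1 + 4 / a; have K1 : 1 <= K by rewrite lerDl divr_ge0// ltW.
have K0 : 0 < K by lra.
exists (2 * K ^+ 4); first by rewrite mulr_gt0// exprn_gt0.
move=> y; have q0 : 0 < 1 + y ^+ 2 by rewrite ltr_pwDl// sqr_ge0.
have c0 : 0 < cosh (a * y) by exact: ch_gt0.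
pose z := a * `|y|; have z0 : 0 <= z by rewrite mulr_ge0// ltW.
have cz : expR z <= 2 * cosh (a * y).
  rewrite /cosh mulrCA divff// mulr1 /z.
  by case: (ger0P y) => _; rewrite ?mulrN ?lerDl ?lerDr expR_ge0.
have ez : (1 + z / 4) ^+ 4 <= expR z.
  rewrite (_ : expR z = expR (z / 4) ^+ 4); last by rewrite -expRM_natl; congr expR; field.
  by rewrite ler_pXn2r// ?nnegrE ?expR_ge0 ?addr_ge0 ?divr_ge0// expR_ge1Dx.
have yz : 1 + `|y| <= K * (1 + z / 4).
  rewrite (_ : K * (1 + z / 4) = 1 + `|y| + (z / 4 + 4 / a)).
    by rewrite lerDl addr_ge0// divr_ge0// ltW.
  by rewrite /K /z; field; rewrite gt_eqF.
rewrite ler_pdivrMr// mulrAC ler_pdivlMr//.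
apply: (@le_trans _ _ ((1 + `|y|) ^+ 4)).
  have y0 := normr_ge0 y; rewrite -[y ^+ 2]real_normK ?num_real//; nra.
apply: (@le_trans _ _ ((K * (1 + z / 4)) ^+ 4)).
  rewrite ler_pXn2r// ?nnegrE ?addr_ge0// mulr_ge0// ?(ltW K0)// addr_ge0// divr_ge0//.
rewrite (_ : 2 * K ^+ 4 * cosh (a * y) = K ^+ 4 * (2 * cosh (a * y))); last by ring.
by rewrite exprMn ler_pM2l ?exprn_gt0// (le_trans ez).
Qed.

Lemma intg_lin_sech : intg mu setT (fun y => (1 + `|y|) / cosh (a * y)).
Proof.
have [C C0 h] := sech_bound.
apply: (@le_intg _ _ _ mu _ _ (fun y => C * (1 + y ^+ 2)^-1)) => //.
- apply: continuous_measurable_fun => y; apply: cvgM.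
    by apply: cvgD; [exact: cvg_cst|exact: norm_continuous].
  by apply: cvgV; [rewrite gt_eqF// ch_gt0|exact: (dv_cont (dv_ch a y))].
- move=> y _; rewrite ger0_norm; first exact: h.
  by rewrite divr_ge0 ?addr_ge0// ltW// ch_gt0.
- by apply: intgZ => //; exact: intg_lorentz.
Qed.

End Sech.

Section StripLimit.
Context {R : realType}.
Notation mu := (@lebesgue_measure R).
Notation mu2 := (mu \x mu)%E.
Notation RR := (measurableTypeR R).
Implicit Types (x y T : R) (v : R -> R -> R).
Variables (a x0 x1 : R).
Hypotheses (a0 : 0 < a) (x00 : 0 < x0) (x01 : x0 < x1) (ax1 : a * x1 < pi / 2).
Let x10 : 0 < x1. Proof. exact: lt_trans x01. Qed.
Let l := x1 - x0.
Let ch y := cosh (a * y).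
Let chp y : 0 < ch y. Proof. exact: ch_gt0. Qed.

(** The numbers are the bounds in [psi_bound] and [chi_bound]. The same constant serves [kern] and
    all [kernT T] with [1 <= T], which is what dominated convergence needs. *)
Definition kern_bound := green_bound a x1 * (2 * (6 / l) + 42 / l ^+ 2 + (2 * 4 + 16)).

Let gb0 : 0 <= green_bound a x1.
Proof.
by rewrite /green_bound; apply: divr_ge0; [rewrite addr_ge0// invr_ge0 ltW|rewrite subr_ge0 ltW// (sn_lt1 a0 x10 ax1)].
Qed.

Let two_term (A B P Q g p q : R) : `|A| <= g -> `|B| <= g -> `|P| <= p -> `|Q| <= q ->
  `|2 * (A * P) + B * Q| <= g * (2 * p + q).
Proof.
move=> hA hB hP hQ; apply: le_trans (ler_normD _ _) _.
rewrite mulrDr lerD//; last by rewrite normrM ler_pM.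
by rewrite !normrM (ger0_norm (ler0n R 2)) [leRHS]mulrCA ler_pM2l// ler_pM.
Qed.

Lemma kern_le x y : 0 <= x <= x1 -> `|kern a x0 x1 x y| <= kern_bound / ch y.
Proof.
move=> xx; have xx1 : x <= x1 by case/andP: xx.
have [_ p1 p2] := psi_bound x01 xx1.
have h0 := green_h_le a0 x10 ax1 y xx; have h1 := green_hx_le a0 x10 ax1 y xx.
have c0 : 0 <= green_bound a x1 / ch y by rewrite divr_ge0// ltW.
apply: le_trans (two_term h1 h0 p1 p2) _; rewrite /kern_bound [leRHS]mulrAC.
by rewrite ler_wpM2l// lerDl.
Qed.

Lemma kernT_le T x y : 1 <= T -> 0 <= x <= x1 -> - T <= y <= T -> `|kernT a x0 x1 T x y| <= kern_bound / ch y.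
Proof.
move=> T1 xx yy; have xx1 : x <= x1 by case/andP: xx.
have [p0 p1 p2] := psi_bound x01 xx1.
have [q0 q1 q2] := chi_bound T1 yy.
have h0 := green_h_le a0 x10 ax1 y xx; have h1 := green_hx_le a0 x10 ax1 y xx.
have h2 := green_hy_le a0 x10 ax1 y xx.
have b0 (P Q B : R) : `|P| <= B -> 0 <= Q <= 1 -> `|P * Q| <= B.
  by move=> hP /andP[hQ1 hQ2]; rewrite normrM (ger0_norm hQ1) -[leRHS]mulr1 ler_pM.
apply: le_trans (ler_normD _ _) _; rewrite /kern_bound [leRHS]mulrAC [leRHS]mulrDr; apply: lerD; apply: b0 => //; exact: two_term.
Qed.

Lemma kernT_cont T x y : T != 0 -> 0 <= x <= x1 -> cont2 (kernT a x0 x1 T) x y.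
Proof.
move=> T0 xx; have [g1 g2] := green_region a0 x10 ax1 y xx.
have [_ _ h0 [h1 _] [h2 _]] := green_h_C2 a0 g1 g2.
have [_ _ p0 [p1 p2] _] := psi_C2 x0 x1 x y; have [_ _ c0 _ [c1 c2]] := chi_C2 x y T0.
apply: cont2D; (apply: cont2M => //; apply: cont2D); [|exact: cont2M| |exact: cont2M];
  by apply: cont2M; [exact: cont2_cst|exact: cont2M].
Qed.

Lemma kern_cont x y : 0 <= x <= x1 -> cont2 (kern a x0 x1) x y.
Proof.
move=> xx; have [g1 g2] := green_region a0 x10 ax1 y xx.
have [_ _ h0 [h1 _] [h2 _]] := green_h_C2 a0 g1 g2.
have [_ _ p0 [p1 p2] _] := psi_C2 x0 x1 x y.
by apply: cont2D; [apply: cont2M; [exact: cont2_cst|exact: cont2M]|exact: cont2M].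
Qed.

(** This is the functional [E], and [stripW] is [W]. The latter depends only on the values of [v]
    for [x0 < x], because [kern] vanishes to the left. *)
Definition lineE v := \int[mu]_y (v 0 y / cosh (a * y)).
Definition stripW v := \int[mu2]_(p in strip x1) (v p.1 p.2 * kern a x0 x1 p.1 p.2).
Definition lineE_T T v := \int[mu]_(y in `[- T, T]) (v 0 y * (chi T y / ch y)).
Definition stripW_T T v := \int[mu2]_(p in rect 0 x1 (- T) T) (v p.1 p.2 * kernT a x0 x1 T p.1 p.2).

Definition lineI v := intg mu setT (fun y => v 0 y / ch y).
Definition stripI v := intg mu2 (strip x1) (fun p => v p.1 p.2 / ch p.2).

Lemma invT_cvg y : (fun n => y / n.+1%:R : R) @ \oo --> (0 : R).
Proof. by rewrite -[X in _ --> X](mulr0 y); apply: cvgM; [exact: cvg_cst|exact: cvg_harmonic]. Qed.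

Lemma chi_cvg y : (fun n => chi n.+1%:R y) @ \oo --> (1 : R).
Proof.
have h := invT_cvg y.
have : (fun n => (1 - (y / n.+1%:R) * (y / n.+1%:R)) * (1 - (y / n.+1%:R) * (y / n.+1%:R)) : R) @ \oo --> ((1 - 0 * 0) * (1 - 0 * 0) : R).
  by apply: cvgM; (apply: cvgB; [exact: cvg_cst|exact: cvgM]).
by rewrite mulr0 subr0 mulr1.
Qed.

Lemma kernT_cvg x y : (fun n => kernT a x0 x1 n.+1%:R x y) @ \oo --> kern a x0 x1 x y.
Proof.
have h := invT_cvg y; have hi := @cvg_harmonic R.
have h1 : (fun n => chi1 n.+1%:R y) @ \oo --> (0 : R).
  have -> : (fun n => chi1 n.+1%:R y) = (fun n => - 4 * (y / n.+1%:R) * (1 - (y / n.+1%:R) * (y / n.+1%:R)) * n.+1%:R^-1 : R).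
    by apply: funext => n; rewrite /chi1; field.
  rewrite -[X in _ --> X](mulr0 (- 4 * 0 * (1 - 0 * 0))); apply: cvgM => //; apply: cvgM.
    by apply: cvgM => //; exact: cvg_cst.
  by apply: cvgB; [exact: cvg_cst|exact: cvgM].
have h2 : (fun n => chi2 n.+1%:R y) @ \oo --> (0 : R).
  have -> : (fun n => chi2 n.+1%:R y) = (fun n => - (4 - 12 * ((y / n.+1%:R) * (y / n.+1%:R))) * n.+1%:R^-1 * n.+1%:R^-1 : R).
    by apply: funext => n; rewrite /chi2; field.
  rewrite -[X in _ --> X](mulr0 (- (4 - 12 * (0 * 0)) * 0)); apply: cvgM => //; apply: cvgM => //.
  apply: cvgN; apply: cvgB; first exact: cvg_cst.
  by apply: cvgM; [exact: cvg_cst|exact: cvgM].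
have -> : kern a x0 x1 x y = kern a x0 x1 x y * 1 + (2 * (green_hy a x y * 0) + green_h a x y * 0) * psi x0 x1 x.
  by rewrite !mulr0 addr0 mul0r addr0 mulr1.
apply: cvgD; first by apply: cvgM; [exact: cvg_cst|exact: chi_cvg].
apply: cvgM; last exact: cvg_cst.
apply: cvgD; last by apply: cvgM => //; exact: cvg_cst.
by apply: cvgM; [exact: cvg_cst|apply: cvgM => //; exact: cvg_cst].
Qed.

Lemma near_itv y : \forall n \near \oo, - (n.+1%:R) <= y <= (n.+1%:R : R).
Proof.
have [k hk] : exists k, `|y| <= k%:R by exists (Num.bound `|y|); rewrite ltW// archi_boundP.
exists k => //= n kn; rewrite -ler_norml; apply: le_trans hk _; rewrite ler_nat; exact: leqW.
Qed.

Lemma strip_limit v : lineI v -> stripI v ->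
  (fun n => lineE_T n.+1%:R v) @ \oo --> lineE v /\
  (fun n => stripW_T n.+1%:R v) @ \oo --> stripW v.
Proof.
move=> iE iS; split.
  have [] := @Rdct_expand _ _ R mu setT (fun n => `[- n.+1%:R, n.+1%:R]%classic)
    (fun n y => v 0 y * (chi n.+1%:R y / ch y)) (fun y => v 0 y / ch y) (fun y => `|v 0 y / ch y|) => //.
  - by move=> x _; exact: near_itv.
  - move=> n; apply: (@eq_measurable_fun _ _ _ _ _ (fun y => (v 0 y / ch y) * chi n.+1%:R y)).
      by move=> y _ /=; rewrite mulrAC -mulrA.
    apply: measurable_funM; first by apply: measurable_funS (intg_meas iE).
    apply: measurable_funS (measurableT) (@subsetT _ _) _; apply: continuous_measurable_fun => y.
    by have [_ _ c0 _ _] := chi_C2 0 y (T := n.+1%:R) (lt0r_neq0 (ltr0Sn _ _)); exact: (section1_cont c0).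
  - move=> y _; rewrite -[X in _ --> X]mulr1.
    have -> : (fun n => v 0 y * (chi n.+1%:R y / ch y)) = (fun n => v 0 y / ch y * chi n.+1%:R y).
      by apply: funext => n; rewrite [RHS]mulrAC mulrA.
    by apply: cvgM; [exact: cvg_cst|exact: chi_cvg].
  - exact: intg_norm.
  - move=> n y /=; rewrite in_itv /= => yn; have [/andP[c0 c1] _ _] := chi_bound (T := n.+1%:R) (ler1n _ _) yn.
    by rewrite mulrCA normrM (ger0_norm c0) ler_piMl.
have [] := @Rdct_expand _ _ R mu2 (strip x1) (fun n => rect 0 x1 (- n.+1%:R) n.+1%:R)
    (fun n p => v p.1 p.2 * kernT a x0 x1 n.+1%:R p.1 p.2) (fun p => v p.1 p.2 * kern a x0 x1 p.1 p.2)
     (fun p => kern_bound * `|v p.1 p.2 / ch p.2|) => //.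
- exact: measurable_strip.
- by move=> n; exact: measurable_rect.
- by move=> n p /rectP[h _]; exact/stripP.
- move=> p /stripP h; apply: filterS (near_itv p.2) => n hn; exact/rectP.
(* Measurability is known for [v / ch] only, so the factor [ch] is moved over to the continuous
   kernel. *)
- move=> n; apply: (@eq_measurable_fun _ _ _ _ _ (fun p => (v p.1 p.2 / ch p.2) * (ch p.2 * kernT a x0 x1 n.+1%:R p.1 p.2))).
    by move=> p _; rewrite -mulrA mulKf// gt_eqF.
  have n1 : - (n.+1%:R) <= (n.+1%:R : R) by have : (0 : R) <= n.+1%:R := ler0n _ _; lra.
  apply: measurable_funM.
    apply: measurable_funS (intg_meas iS); first exact: measurable_strip.
    by move=> p /rectP[h _]; exact/stripP.
  apply: rect_measurable => //; first exact: ltW.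
  move=> [x y] /rectP[/= xx _].
  suff : cont2 (fun x y => ch y * kernT a x0 x1 n.+1%:R x y) x y by [].
  by apply: cont2M; [exact: cont2_ch|exact: kernT_cont].
- by move=> p _; apply: cvgM; [exact: cvg_cst|exact: kernT_cvg].
- by apply: intgZ; [exact: measurable_strip|apply: intg_norm => //; exact: measurable_strip].
- move=> n p /rectP[h1 h2]; rewrite 2!normrM normfV (gtr0_norm (chp _)) mulrCA -mulrA.
  by rewrite ler_wpM2l// mulrA; exact: (kernT_le (T := n.+1%:R) (ler1n _ _) h1 h2).
Qed.

Lemma growth_int v (C : R) : (forall x y, 0 <= x <= x1 -> cont2 v x y) ->
  (forall x y, 0 <= x <= x1 -> `|v x y| <= C * (1 + `|y|)) -> lineI v /\ stripI v.
Proof.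
move=> cv hv.
have x1x : 0 <= (0 : R) <= x1 by apply/andP; split => //; exact: ltW.
have i0 := intgZ C measurableT (intg_lin_sech a0).
have cc y : {for y, continuous (fun y => (ch y)^-1)}.
  by apply: cvgV; [rewrite gt_eqF|exact: (dv_cont (dv_ch a y))].
split.
  apply: (le_intg measurableT) i0.
    apply: continuous_measurable_fun; suff h : continuous (fun y : R => v 0 y / ch y) by [].
    by move=> y; apply: cvgM; [exact: (section1_cont (cv 0 y x1x))|exact: cc].
  move=> y _; rewrite normrM normfV (gtr0_norm (chp y)) [leRHS]mulrA.
  by rewrite ler_wpM2r ?invr_ge0 ?(ltW (chp y))// hv.
apply: (le_intg (measurable_strip x1)) (strip_intg_snd (ltW x10) i0).
  apply: (strip_measurable (ltW x10)) => -[x y] /stripP /= xx.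
  exact: (cont2M (cv _ _ xx) (cont2_y (cc y))).
move=> [x y] /stripP /= xx; rewrite normrM normfV (gtr0_norm (chp y)) [leRHS]mulrA.
by rewrite ler_wpM2r ?invr_ge0 ?(ltW (chp y))// hv.
Qed.

Lemma green_strip v vx vxx vy vyy :
  (forall x y, 0 <= x <= x1 -> C2at v vx vxx vy vyy x y) -> lineI v -> stripI v ->
  ((forall x y, 0 <= x <= x1 -> 0 <= vxx x y + vyy x y) -> 0 <= lineE v + stripW v) /\
  ((forall x y, 0 <= x <= x1 -> vxx x y + vyy x y = 0) -> lineE v + stripW v = 0).
Proof.
move=> hv iE iS; have [c1 c2] := strip_limit iE iS; 
have c : (fun n => lineE_T n.+1%:R v + stripW_T n.+1%:R v) @ \oo --> lineE v + stripW v by exact: cvgD.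
have key n : lineE_T n.+1%:R v + stripW_T n.+1%:R v =
  \int[mu2]_(p in rect 0 x1 (- n.+1%:R) n.+1%:R) (cutoff a x0 x1 n.+1%:R p.1 p.2 * (vxx p.1 p.2 + vyy p.1 p.2)).
  by apply: cutoff_green => // x y /rectP[/= h _]; exact: hv.
split=> h.
  apply: (cvgr_to_ge c); apply: nearW => n /=; rewrite key; apply: Rintegral_ge0 => p /rectP[h1 h2].
  by rewrite mulr_ge0 ?h// cutoff_ge0.
have h0 : (fun n => lineE_T n.+1%:R v + stripW_T n.+1%:R v) = fun=> 0.
  apply: funext => n; rewrite key; under eq_Rintegral => p /set_mem/rectP[h1 h2] do rewrite h// mulr0.
  by rewrite Rintegral_cst ?mul0r//; exact: measurable_rect.
by apply: (cvg_unique _ c) => //; rewrite [X in X @ _](_ : _ = fun=> 0)//; exact: cvg_cst.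
Qed.

End StripLimit.

(** * Logarithms of moduli *)

Section AlmostEverywhere.
Context d (T : measurableType d) {R : realType} (mu : {measure set T -> \bar R}).
Implicit Types (f g : T -> R) (D N Z : set T).

Lemma Rint_null_set D N f : measurable D -> measurable N -> mu N = 0%E -> intg mu D f ->
  \int[mu]_(x in D) f x = \int[mu]_(x in D `\` N) f x.
Proof. by move=> mD mN N0 fi; rewrite /Rintegral (negligible_integral mN). Qed.

Lemma intg_null_set D N f : measurable D -> measurable N -> mu N = 0%E -> measurable_fun D f ->
  intg mu (D `\` N) f -> intg mu D f.
Proof. by move=> mD mN N0 mf; apply: (negligible_integrable mN mD _ N0).2; exact/measurable_EFinP. Qed.

Lemma Rint_ae_eq D N f g : measurable D -> measurable N -> mu N = 0%E ->
  intg mu D f -> measurable_fun D g -> (forall x, D x -> ~ N x -> f x = g x) ->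
  intg mu D g /\ \int[mu]_(x in D) f x = \int[mu]_(x in D) g x.
Proof.
move=> mD mN N0 fi mg fg.
have mDN : measurable (D `\` N) by exact: measurableD.
have gi : intg mu D g.
  apply: (intg_null_set mD mN N0 mg).
  apply: (eq_intg mDN) (intgS mD mDN (@subDsetl _ _ _) fi).
  by move=> x /set_mem[Dx Nx]; exact: fg.
split=> //; rewrite (Rint_null_set mD mN N0 fi) (Rint_null_set mD mN N0 gi).
by apply: eq_Rintegral => x /set_mem[Dx Nx]; exact: fg.
Qed.

Lemma Rdct_ae D N (f_ : nat -> T -> R) f g : measurable D -> measurable N -> mu N = 0%E ->
  (forall n, measurable_fun D (f_ n)) -> measurable_fun D f ->
  (forall x, D x -> ~ N x -> (fun n => f_ n x) @ \oo --> f x) ->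
  intg mu D g -> (forall n x, D x -> ~ N x -> `|f_ n x| <= g x) ->
  intg mu D f /\ (fun n => \int[mu]_(x in D) f_ n x) @ \oo --> \int[mu]_(x in D) f x.
Proof.
move=> mD mN N0 mf_ mf ff ig fg.
have mDN : measurable (D `\` N) by exact: measurableD.
have [] := @Rdct _ _ R mu (D `\` N) f_ f g mDN.
- by move=> n; apply: measurable_funS (mf_ n).
- by move=> x [Dx Nx]; exact: ff.
- exact: (intgS mD mDN (@subDsetl _ _ _) ig).
- by move=> n x [Dx Nx]; exact: fg.
move=> i1 h; have i2 := intg_null_set mD mN N0 mf i1; split => //.
rewrite (Rint_null_set mD mN N0 i2); apply: cvg_trans h.
have -> : (fun n => \int[mu]_(x in D) f_ n x) = (fun n => \int[mu]_(x in D `\` N) f_ n x).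
  apply: funext => n; rewrite (Rint_null_set mD mN N0)//; apply: (intg_null_set mD mN N0 (mf_ n)).
  apply: (le_intg mDN _ _ (intgS mD mDN (@subDsetl _ _ _) ig)); first exact: measurable_funS (mf_ n).
  by move=> x [Dx Nx]; exact: fg.
exact: cvg_id.
Qed.

(** Monotone convergence with an infinite limit allowed on [Z]: integrals bounded by [B] force [Z]
    to be null, and off [Z] the limit is finite. It will show that the zeros on the line form a null
    set. *)
Lemma Rint_monotone D Z (f_ : nat -> T -> R) f (B : R) : measurable D -> measurable Z -> Z `<=` D ->
  (forall n, intg mu D (f_ n)) -> measurable_fun D f ->
  (forall n x, D x -> 0 <= f_ n x) ->
  (forall x, D x -> {homo f_^~ x : m n / (m <= n)%N >-> m <= n}) ->
  (forall x, D x -> ~ Z x -> (fun n => f_ n x) @ \oo --> f x) ->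
  (forall x, Z x -> (fun n => f_ n x) @ \oo --> +oo) ->
  (forall n, \int[mu]_(x in D) f_ n x <= B) ->
  [/\ mu Z = 0%E, intg mu D f & (fun n => \int[mu]_(x in D) f_ n x) @ \oo --> \int[mu]_(x in D) f x].
Proof.
move=> mD mZ ZD fi mf f0 nd ff fZ fB.
have intE E n : measurable E -> E `<=` D -> (\int[mu]_(x in E) (f_ n x)%:E)%E = (\int[mu]_(x in E) f_ n x)%:E.
  by move=> mE ED; rewrite /Rintegral fineK//; apply: (integrable_fin_num mE); exact: (intgS mD mE ED (fi n)).
have Z0 : mu Z = 0%E.
  have h : (\int[mu]_(x in Z) (cst +oo x) <= B%:E)%E.
    have := @cvg_monotone_convergence _ T R mu Z mZ (fun n => EFin \o f_ n).
    rewrite (_ : (\int[mu]_(x in Z) (limn _))%E = (\int[mu]_(x in Z) (cst +oo x))%E); last first.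
      by apply: eq_integral => x /set_mem Zx; apply/cvg_lim => //; apply/cvgeryP; exact: fZ.
    move=> H; apply: (cvge_to_le (H _ _ _)).
    - by move=> n; apply: measurable_funS (_ : measurable_fun D _) => //; exact/measurable_EFinP/intg_meas.
    - by move=> n x /ZD Dx; rewrite lee_fin f0.
    - by move=> x /ZD Dx m n mn; rewrite lee_fin nd.
    apply: nearW => n; apply: (@le_trans _ _ (\int[mu]_(x in D) (f_ n x)%:E)%E); last by rewrite (intE D)// lee_fin.
    apply: ge0_subset_integral => //; first exact/measurable_EFinP/intg_meas.
    by move=> x Dx; rewrite lee_fin f0.
  apply/eqP/negPn/negP => Zn0; move: h; rewrite integral_cst// gt0_mulye ?leye_eq//.
  by rewrite lt0e Zn0 /=.
have mDZ : measurable (D `\` Z) by exact: measurableD.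
have e n : \int[mu]_(x in D `\` Z) f_ n x = \int[mu]_(x in D) f_ n x.
  by rewrite -(Rint_null_set mD mZ Z0).
have hl : cvgn (fun n => \int[mu]_(x in D) f_ n x).
  apply: nondecreasing_is_cvgn; last by exists B => _ [n _ <-].
  by move=> m n mn; apply: (le_Rintegral mD (fi m) (fi n)) => x Dx; exact: nd.
have [] := @Rint_cvg_ge0 _ _ R mu (D `\` Z) f_ f (limn (fun n => \int[mu]_(x in D) f_ n x)) mDZ.
- by move=> n; exact: (intgS mD mDZ (@subDsetl _ _ _) (fi n)).
- by move=> n x [Dx _]; exact: f0.
- by move=> x [Dx _]; exact: nd.
- by move=> x [Dx Zx]; exact: ff.
- by rewrite (_ : (fun n => \int[mu]_(x in D `\` Z) f_ n x) = (fun n => \int[mu]_(x in D) f_ n x))//; apply: funext.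
move=> i1 i2; have i3 := intg_null_set mD mZ Z0 mf i1; split => //.
by rewrite (Rint_null_set mD mZ Z0 i3) i2.
Qed.

End AlmostEverywhere.

Section StripTonelli.
Context {R : realType}.
Notation mu := (@lebesgue_measure R).
Notation mu2 := (mu \x mu)%E.
Notation RR := (measurableTypeR R).

Lemma strip_intg (f : RR * RR -> R) (b B : R) : 0 <= b -> measurable_fun (strip b) f ->
  (forall x, 0 <= x <= b -> intg mu setT (fun y => f (x, y)) /\ \int[mu]_y `|f (x, y)| <= B) ->
  intg mu2 (strip b) f.
Proof.
move=> b0 mf hf.
pose F := (EFin \o f) \_ (strip b).
have mF : measurable_fun setT F.
  by apply/(measurable_restrictT _ (measurable_strip b)); exact/measurable_EFinP.
apply/(integrable_mkcond _ (measurable_strip b)).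
apply: (integrable12ltyP mu mu mF).2.
have bb : (\int[mu]_x \int[mu]_y `|F (x, y)| <= \int[mu]_(x in `[0%R, b]) B%:E)%E.
  rewrite [X in (_ <= X)%E]integral_mkcond; apply: ge0_le_integral => //.
  - by move=> x _; exact: integral_ge0.
  - by apply: (@measurable_fun_fubini_tonelli_F _ _ _ _ _ _ (fun p => `|F p|%E)) => //; exact: measurableT_comp.
  - by apply: (measurable_restrictT (cst B%:E) (measurable_itv _)).1; exact: measurable_cst.
  move=> x _; rewrite patchE; case: ifPn => [/set_mem xb|xb].
    have xb' : 0 <= x <= b by move: xb; rewrite /= in_itv.
    have [i1 i2] := hf x xb'.
    rewrite (eq_integral (fun y => (`|f (x, y)|)%:E)); last first.
      by move=> y _; rewrite /F patchE mem_set//; exact/stripP.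
    rewrite -[leLHS]fineK ?lee_fin//.
    exact: (integrable_fin_num measurableT (intg_norm measurableT i1)).
  rewrite (eq_integral (cst 0%E)) ?integral0// => y _; rewrite /F patchE.
  case: ifPn => [/set_mem /stripP /= h|_]; last by rewrite abse0.
  by move/negP: xb; case; apply/mem_set; rewrite /= in_itv.
apply: le_lt_trans bb _; rewrite integral_cst//= lebesgue_measure_itv /=.
by case: ifP => _; rewrite ?mule0 ?ltry// -EFinB -EFinM ltry.
Qed.

End StripTonelli.

Section LogModulus.
Context {R : realType}.
Notation mu := (@lebesgue_measure R).
Notation mu2 := (mu \x mu)%E.
Notation RR := (measurableTypeR R).
Implicit Types (x y e X C : R) (G : R[i] -> R[i]).

Definition nsq G x y := Re (G (x +i* y)) ^+ 2 + Im (G (x +i* y)) ^+ 2.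
(** The regularization is added to the square of the modulus, so that the expression stays smooth at
    zeros of [G]. For [e = 0] it is [ln |G|], with the value [0] at the zeros. *)
Definition lgm G e x y := 1 / 2 * ln (nsq G x y + e).

Lemma nsqE G x y : nsq G x y = normc (G (x +i* y)) ^+ 2.
Proof. by rewrite normc_sqr. Qed.

Lemma nsq_ge0 G x y : 0 <= nsq G x y. Proof. by rewrite addr_ge0 ?sqr_ge0. Qed.

Lemma nsq_eq0 G x y : (nsq G x y == 0) = (G (x +i* y) == 0).
Proof. by rewrite nsqE expf_eq0 normc_eq0. Qed.

Lemma nsq_gt0 G x y : (0 < nsq G x y) = (G (x +i* y) != 0).
Proof. by rewrite lt0r nsq_ge0 andbT nsq_eq0. Qed.

Lemma lgmE G x y : lgm G 0 x y = ln (normc (G (x +i* y))).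
Proof.
rewrite /lgm addr0 nsqE; have := normc_ge0 (G (x +i* y)); rewrite le_eqVlt => /predU1P[<-|h].
  by rewrite expr0n /= ln0// mulr0.
by rewrite lnXn// mulr2n; field.
Qed.

Lemma nsq_cont2 G x y : an G (x +i* y) -> cont2 (nsq G) x y.
Proof. by move=> /an_cont2[c1 c2]; apply: cont2D; exact: cont2X2. Qed.

Variable x0 : R.

(* Membership in this class lets [ln |G|] be integrated against [sech]. *)
Definition good G := [/\ (forall x y, 0 <= x -> an G (x +i* y)),
  (forall X, exists C, forall x y, 0 <= x <= X -> nsq G x y <= expR (C * (1 + `|y|)))
  & (forall X, exists C, forall x y, x0 <= x <= X -> expR (- (C * (1 + `|y|))) <= nsq G x y)].

Lemma lgm_upper G X : good G -> exists2 C, 0 <= C &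
  forall e x y, 0 <= e <= 1 -> 0 <= x <= X -> lgm G e x y <= C * (1 + `|y|).
Proof.
move=> [_ /(_ X)[C hC] _]; exists (`|C| + 1); first by rewrite addr_ge0.
move=> e x y /andP[e0 e1] xX; have y1 : 1 <= 1 + `|y| by rewrite lerDl.
have t0 : 0 <= `|C| * (1 + `|y|) by rewrite mulr_ge0//; lra.
have r0 : 0 <= (`|C| + 1) * (1 + `|y|) by rewrite mulr_ge0 ?addr_ge0//; lra.
have N0 : 0 <= nsq G x y + e by rewrite addr_ge0// nsq_ge0.
rewrite /lgm; move: N0; rewrite le_eqVlt => /predU1P[<-|N0]; first by rewrite ln0// mulr0.
suff h : ln (nsq G x y + e) <= (`|C| + 1) * (1 + `|y|) by lra.
rewrite -[leRHS]expRK ler_ln ?posrE ?expR_gt0//.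
apply: (@le_trans _ _ (expR (`|C| * (1 + `|y|)) + 1)).
  apply: lerD => //; apply: le_trans (hC x y xX) _; rewrite ler_expR ler_wpM2r ?ler_norm//; lra.
apply: (@le_trans _ _ (expR (`|C| * (1 + `|y|) + 1))); last by rewrite ler_expR; nra.
have h1 := expR_ge1Dx (`|C| * (1 + `|y|)); have h2 := expR_ge1Dx (1 : R).
rewrite expRD; nra.
Qed.

Lemma lgm_lower G X : good G -> exists2 C, 0 <= C &
  forall e x y, 0 <= e -> x0 <= x <= X -> - (C * (1 + `|y|)) <= lgm G e x y.
Proof.
move=> [_ _ /(_ X)[C hC]]; exists `|C| => // e x y e0 xX.
have y1 : 1 <= 1 + `|y| by rewrite lerDl.
have t0 : 0 <= `|C| * (1 + `|y|) by rewrite mulr_ge0//; lra.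
suff h : - (`|C| * (1 + `|y|)) <= ln (nsq G x y + e) by rewrite /lgm; lra.
have h := hC x y xX; have p := lt_le_trans (expR_gt0 _) h.
rewrite -[leLHS]expRK ler_ln ?posrE ?expR_gt0//; last by rewrite ltr_wpDr.
apply: le_trans (_ : nsq G x y <= _); last by rewrite lerDl.
by apply: le_trans h; rewrite ler_expR lerN2 ler_wpM2r ?ler_norm//; lra.
Qed.

Lemma good_neq0 G x y : good G -> x0 <= x -> nsq G x y != 0.
Proof. by move=> [_ _ /(_ x)[C hC]] xx; rewrite gt_eqF// (lt_le_trans (expR_gt0 _) (hC x y _))// xx /=. Qed.

Lemma lgm_mono G e e' x y : 0 <= e -> 0 < nsq G x y + e -> e <= e' -> lgm G e x y <= lgm G e' x y.
Proof.
move=> e0 p ee; rewrite /lgm ler_pM2l ?divr_gt0// ler_ln ?posrE ?lerD2l//.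
by apply: lt_le_trans p _; rewrite lerD2l.
Qed.

Lemma lgm_eps G e x y : 0 < e -> 1 / 2 * ln e <= lgm G e x y.
Proof.
move=> e0; have n0 := nsq_ge0 G x y; rewrite /lgm ler_pM2l ?divr_gt0// ler_ln ?posrE ?lerDr//.
by rewrite ltr_wpDl.
Qed.

Definition eps n : R := n.+1%:R^-1.
Lemma eps_gt0 n : 0 < eps n. Proof. by rewrite invr_gt0. Qed.
Lemma eps_le1 n : 0 <= eps n <= 1. Proof. by rewrite ltW ?eps_gt0//= invf_le1// ler1n. Qed.

Lemma lgm_cvg G x y : nsq G x y != 0 -> (fun n => lgm G (eps n) x y) @ \oo --> lgm G 0 x y.
Proof.
move=> n0; have p : 0 < nsq G x y + 0 by rewrite addr0 lt0r n0 nsq_ge0.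
apply: cvgM; first exact: cvg_cst.
have c : {for nsq G x y + 0, continuous (@ln R)} := dv_cont (is_derive1_ln p).
have h : (fun n => nsq G x y + eps n) @ \oo --> nsq G x y + 0.
  by apply: cvgD; [exact: cvg_cst|exact: cvg_harmonic].
exact: (cvg_comp _ _ h c).
Qed.

Lemma lgm_cvgNy G x y : nsq G x y = 0 -> (fun n => - lgm G (eps n) x y) @ \oo --> +oo.
Proof.
move=> n0; apply/cvgryPge => A.
have [k hk] : exists k, expR (2 * A) <= k%:R.
  by exists (Num.bound (expR (2 * A))); rewrite ltW// archi_boundP// expR_ge0.
exists k => //= n kn; rewrite /lgm n0 add0r /eps lnV ?posrE//.
suff : 2 * A <= ln n.+1%:R by lra.
rewrite -[leLHS]expRK ler_ln ?posrE ?expR_gt0//; apply: le_trans hk _.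
by rewrite ler_nat; exact: leqW.
Qed.

Lemma good_shift G c : 0 <= c -> good G -> good (fun w => G (w + c%:C)).
Proof.
move=> c0 [h1 h2 h3].
have sh x y : (x +i* y) + c%:C = (x + c) +i* y by apply: eqc => /=; rewrite ?addr0.
have nE x y : nsq (fun w => G (w + c%:C)) x y = nsq G (x + c) y by rewrite /nsq sh.
split.
- move=> x y xx; have := @an_comp_affine _ G 1 c%:C (x +i* y).
  rewrite mul1r sh => /(_ (h1 _ _ (addr_ge0 xx c0))).
  by apply: an_near ltr01 _ => z _; rewrite mul1r.
- move=> X; have [C hC] := h2 (X + c); exists C => x y /andP[xx xX]; rewrite nE hC//.
  by rewrite addr_ge0//= lerD2r.
- move=> X; have [C hC] := h3 (X + c); exists C => x y /andP[xx xX]; rewrite nE hC//.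
  by rewrite lerD2r xX andbT (le_trans xx)// lerDl.
Qed.

Lemma good_cont2 G e x y : good G -> 0 <= x -> 0 < nsq G x y + e -> cont2 (lgm G e) x y.
Proof. by move=> [h1 _ _] xx p; have [_ _ c _ _] := logmod_C2 (h1 x y xx) p. Qed.

Lemma good_line_meas G e : good G -> measurable_fun setT (lgm G e 0).
Proof.
move=> [h1 _ _]; apply: measurable_funM => //.
apply: (measurableT_comp (@measurable_ln R)).
apply: continuous_measurable_fun; suff h : continuous (fun y : R => nsq G 0 y + e) by [].
move=> y; apply: cvgD; last exact: cvg_cst.
exact: (section1_cont (nsq_cont2 (h1 0 y (lexx _)))).
Qed.

Lemma good_strip_meas G e b : 0 <= b -> good G ->
  measurable_fun (strip b) (fun p : RR * RR => lgm G e p.1 p.2).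
Proof.
move=> b0 [h1 _ _]; apply: measurable_funM => //.
apply: (measurableT_comp (@measurable_ln R)).
apply: (strip_measurable b0) => -[x y] /stripP /= /andP[xx _].
by apply: cvgD; [exact: (nsq_cont2 (h1 x y xx))|exact: cvg_cst].
Qed.

End LogModulus.

(** * Subharmonicity and integrability of the logarithm on vertical lines *)

Section LogInequality.
Context {R : realType}.
Notation mu := (@lebesgue_measure R).
Notation mu2 := (mu \x mu)%E.
Notation RR := (measurableTypeR R).
Implicit Types (x y e X C : R) (G : R[i] -> R[i]).
Variables (a x0 x1 : R).
Hypotheses (a0 : 0 < a) (x00 : 0 < x0) (x01 : x0 < x1) (ax1 : a * x1 < pi / 2).
Let x10 : 0 < x1. Proof. exact: lt_trans x01. Qed.
Let ch y := cosh (a * y).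
Let chp y : 0 < ch y. Proof. exact: ch_gt0. Qed.
Let wt y := (1 + `|y|) / ch y.
Let iw : intg mu setT wt. Proof. exact: intg_lin_sech. Qed.
Let isw : intg mu2 (strip x1) (fun p : RR * RR => wt p.2).
Proof. exact: (strip_intg_snd (ltW x10)). Qed.
Let wt0 y : 0 <= wt y. Proof. by rewrite divr_ge0 ?addr_ge0// ltW. Qed.
Let E := lineE a.
Let W := stripW a x0 x1.
Let kb0 : 0 <= kern_bound a x0 x1.
Proof.
have := kern_le a0 x00 x01 ax1 (x := 0) 0; rewrite lexx (ltW x10) => /(_ isT) h.
have := le_trans (normr_ge0 _) h; rewrite pmulr_lge0// invr_gt0; exact: ch_gt0.
Qed.

(** This form of the Laplacian is nonnegative for [e >= 0], vanishes for [e = 0], and for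
    [G w = w - (u +i* v)] is the bump [bumpk u v e]. *)
Lemma lgm_green G e (D : R -> R -> Prop) : (forall x y, D x y -> an G (x +i* y)) ->
  (forall x y, D x y -> 0 < nsq G x y + e) ->
  exists vx vxx vy vyy : R -> R -> R,
   (forall x y, D x y -> C2at (lgm G e) vx vxx vy vyy x y) /\
   (forall x y, D x y -> vxx x y + vyy x y = 2 * e * nsq (Df G) x y / (nsq G x y + e) ^+ 2).
Proof.
move=> ga p; do 4 eexists; split.
  by move=> x y xx; exact: (logmod_C2 (ga x y xx) (p x y xx)).
move=> x y xx /=; have := p x y xx; rewrite /nsq.
set P := Re (G _); set Q := Im (G _); set N := P ^+ 2 + Q ^+ 2 + e => N0.
set P1 := Re (Df G _); set Q1 := Im (Df G _).
rewrite (_ : e = N - P ^+ 2 - Q ^+ 2); last by rewrite /N; ring.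
by clearbody N; field; rewrite gt_eqF.
Qed.

Lemma stripW_dominated G e C : good x0 G -> 0 <= e -> 0 <= C ->
  (forall x y, x0 <= x <= x1 -> `|lgm G e x y| <= C * (1 + `|y|)) ->
  forall p : RR * RR, strip x1 p -> `|lgm G e p.1 p.2 * kern a x0 x1 p.1 p.2| <= C * kern_bound a x0 x1 * wt p.2.
Proof.
move=> gG e0 C0 h [x y] /stripP /= xx; have [xx0|xx0] := leP x x0.
  rewrite kern_eq0// mulr0 normr0; apply: mulr_ge0; [exact: mulr_ge0|exact: wt0].
rewrite normrM /wt (_ : _ * _ * _ = (C * (1 + `|y|)) * (kern_bound a x0 x1 / ch y)); last by ring.
apply: ler_pM => //; last exact: kern_le.
by apply: h; rewrite ltW//=; case/andP: xx.
Qed.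

Let kern_meas : measurable_fun (strip x1) (fun p : RR * RR => kern a x0 x1 p.1 p.2).
Proof. by apply: (strip_measurable (ltW x10)) => -[x y] /stripP /= xx; exact: kern_cont. Qed.

Definition wt_mass := \int[mu2]_(p in strip x1) (kern_bound a x0 x1 * ((1 + `|p.2|) / cosh (a * p.2))).

Lemma stripW_bound G C : good x0 G -> 0 <= C ->
  (forall x y, x0 <= x <= x1 -> `|lgm G 0 x y| <= C * (1 + `|y|)) ->
  intg mu2 (strip x1) (fun p : RR * RR => lgm G 0 p.1 p.2 * kern a x0 x1 p.1 p.2) /\ `|W (lgm G 0)| <= C * wt_mass.
Proof.
move=> gG C0 h; have dom := stripW_dominated gG (lexx 0) C0 h.
have mf : measurable_fun (strip x1) (fun p : RR * RR => lgm G 0 p.1 p.2 * kern a x0 x1 p.1 p.2).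
  by apply: measurable_funM => //; exact: (good_strip_meas 0 (ltW x10) gG).
have mS := measurable_strip x1 (R := R).
split; first by apply: (le_intg mS mf dom); exact: intgZ.
apply: le_trans (Rint_norm_le mS mf dom _) _; first exact: intgZ.
rewrite /wt_mass -RintegralZl//; last exact: intgZ.
rewrite le_eqVlt; apply/orP; left; apply/eqP; apply: eq_Rintegral => p _; by rewrite /wt /ch !mulrA.
Qed.

(** For [e > 0] subharmonicity gives [0 <= E + W]. As [e] decreases, [W] converges because its
    integrand is dominated, so [E] stays bounded below. Monotone convergence then makes the zeros on
    the line a null set and [ln |G| / ch] integrable, and the inequality passes to the limit. *)
Lemma log_inequality G : good x0 G ->
  [/\ measurable [set y : RR | nsq G 0 y = 0], mu [set y : RR | nsq G 0 y = 0] = 0%E, lineI a (lgm G 0) &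
    0 <= E (lgm G 0) + W (lgm G 0)].
Proof.
move=> gG; have [ga _ _] := gG.
have [Cu Cu0 hu] := lgm_upper x1 gG; have [Cl Cl0 hl] := lgm_lower x1 gG.
have mS := measurable_strip x1 (R := R).
pose C := Cu + Cl; have C0 : 0 <= C by rewrite addr_ge0.
have hC e x y : 0 <= e <= 1 -> x0 <= x <= x1 -> `|lgm G e x y| <= C * (1 + `|y|).
  move=> e01 /andP[xx xX]; have y0 : 0 <= 1 + `|y| by rewrite addr_ge0.
  have u : lgm G e x y <= Cu * (1 + `|y|) by apply: hu => //; rewrite xX andbT; apply: ltW; exact: lt_le_trans xx.
  have l : - (Cl * (1 + `|y|)) <= lgm G e x y by apply: hl; [case/andP: e01|rewrite xx].
  have := mulr_ge0 Cu0 y0; have := mulr_ge0 Cl0 y0.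
  by rewrite ler_norml /C mulrDl => ? ?; apply/andP; split; lra.
have iE e : 0 < e <= 1 -> lineI a (lgm G e) /\ stripI a x1 (lgm G e).
  move=> /andP[e0 e1]; apply: (growth_int a0 x00 x01 (C := Cu + `|1 / 2 * ln e|)).
    move=> x y /andP[xx _]; apply: (good_cont2 gG) => //; rewrite ltr_wpDl// nsq_ge0//.
  move=> x y xx; have y0 : 1 <= 1 + `|y| by rewrite lerDl.
  have u : lgm G e x y <= Cu * (1 + `|y|) by apply: hu => //; rewrite ltW.
  have l := lgm_eps G x y e0; have ab := ler_norm (- (1 / 2 * ln e)); rewrite normrN in ab.
  have h1 : 0 <= Cu * (1 + `|y|) by rewrite mulr_ge0//; lra.
  have h2 : `|1 / 2 * ln e| <= `|1 / 2 * ln e| * (1 + `|y|) by rewrite ler_peMr.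
  have q0 := normr_ge0 (1 / 2 * ln e).
  by rewrite mulrDl ler_norml; apply/andP; split; lra.
have ep n : 0 < (eps n : R) <= 1 by rewrite eps_gt0; case/andP: (@eps_le1 R n).
have ineq n : 0 <= E (lgm G (eps n)) + W (lgm G (eps n)).
  have [i1 i2] := iE _ (ep n).
  have ga1 x y : 0 <= x <= x1 -> an G (x +i* y) by move=> /andP[xx _]; exact: ga.
  have p x y : 0 <= x <= x1 -> 0 < nsq G x y + eps n by move=> _; rewrite ltr_wpDl ?nsq_ge0 ?eps_gt0.
  have [vx [vxx [vy [vyy [h1 h2]]]]] := lgm_green (D := fun x y => 0 <= x <= x1) ga1 p.
  apply: (green_strip a0 x00 x01 ax1 h1 i1 i2).1 => x y xx; rewrite h2//.
  by rewrite divr_ge0 ?sqr_ge0// mulr_ge0 ?nsq_ge0// mulr_ge0// ltW// eps_gt0.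
have [_ Wcvg] : intg mu2 (strip x1) (fun p : RR * RR => lgm G 0 p.1 p.2 * kern a x0 x1 p.1 p.2) /\
   (fun n => W (lgm G (eps n))) @ \oo --> W (lgm G 0).
  apply: (Rdct mS (g := fun p : RR * RR => C * kern_bound a x0 x1 * wt p.2)).
  - by move=> n; apply: measurable_funM => //; exact: (good_strip_meas _ (ltW x10) gG).
  - move=> [x y] /stripP /= xx; have [xx0|xx0] := leP x x0.
      by rewrite kern_eq0// mulr0 [X in X @ _](_ : _ = fun=> 0); [exact: cvg_cst|apply: funext => n; rewrite mulr0].
    by apply: cvgM; [apply: lgm_cvg; apply: (good_neq0 y gG); exact: ltW|exact: cvg_cst].
  - exact: intgZ.
  - move=> n p xx; apply: stripW_dominated => //; first by rewrite ltW ?eps_gt0.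
    by move=> x y xx'; apply: hC => //; exact: eps_le1.
have [M hM] : exists M, forall n, W (lgm G (eps n)) <= M.
  have [M [_ hM]] := cvg_seq_bounded (cvgP _ Wcvg).
  by exists (M + 1) => n; apply: le_trans (ler_norm _) _; apply: (hM (M + 1)) => //; lra.
have mZ : measurable [set y : RR | nsq G 0 y = 0].
  have m1 : measurable_fun setT (fun y : RR => nsq G 0 y).
    apply: continuous_measurable_fun; suff h : continuous (fun y : R => nsq G 0 y) by [].
    by move=> y; exact: (section1_cont (nsq_cont2 (ga 0 y (lexx _)))).
  by have := m1 measurableT [set 0] (measurable_set1 0); rewrite setTI.
(* Nonnegative by [lgm_upper], nondecreasing in [n], and tending to infinity at the zeros: the shape
   required by [Rint_monotone]. *)
pose f_ n y := Cu * wt y - lgm G (eps n) 0 y / ch y.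
have f_E n y : f_ n y = (Cu * (1 + `|y|) - lgm G (eps n) 0 y) / ch y by rewrite /f_ /wt; ring.
have i_w : intg mu setT (fun y => Cu * wt y) by exact: intgZ.
have i_f n : intg mu setT (f_ n) by apply: intgB => //; exact: (iE _ (ep n)).1.
have I_f n : \int[mu]_y f_ n y = \int[mu]_y (Cu * wt y) - E (lgm G (eps n)).
  by rewrite RintegralB//; exact: (iE _ (ep n)).1.
have [] := @Rint_monotone _ _ R mu setT [set y : RR | nsq G 0 y = 0] f_ (fun y => (Cu * wt y - lgm G 0 0 y / ch y))
    (\int[mu]_y (Cu * wt y) + M) measurableT mZ (@subsetT _ _) i_f.
- apply: measurable_funB; first exact: (intg_meas i_w).
  apply: measurable_funM; first exact: (good_line_meas 0 gG).
  apply: continuous_measurable_fun; suff h : continuous (fun y : R => (ch y)^-1) by [].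
  by move=> y; apply: cvgV; [rewrite gt_eqF|exact: (dv_cont (dv_ch a y))].
- by move=> n y _; rewrite f_E divr_ge0 ?(ltW (chp y))// subr_ge0 hu ?eps_le1// lexx ltW.
- move=> y _ m n mn; rewrite !f_E ler_pM2r ?invr_gt0// lerD2l lerN2.
  apply: lgm_mono; [by rewrite ltW ?eps_gt0|by rewrite ltr_wpDl ?nsq_ge0 ?eps_gt0|].
  by rewrite lef_pV2 ?posrE// ler_nat.
- move=> y _ /eqP n0; apply: cvgB; first exact: cvg_cst.
  by apply: cvgM; [exact: lgm_cvg|exact: cvg_cst].
- move=> y /= n0; have := lgm_cvgNy n0 => H.
  rewrite (_ : f_^~ y = (fun n => Cu * wt y + (ch y)^-1 * - lgm G (eps n) 0 y)); last first.
    by apply: funext => n; rewrite /f_; ring.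
  apply: (@cvgryPge _ _ _ _ _).2 => A; move/cvgryPge: H => /(_ ((A - Cu * wt y) * ch y)).
  apply: filterS => n hn; by rewrite -lerBlDl [leRHS]mulrC ler_pdivlMr.
- by move=> n; rewrite I_f; have := ineq n; have := hM n; lra.
move=> Z0 i1 cv.
have i2 : lineI a (lgm G 0).
  apply: (eq_intg measurableT) (intgB measurableT i_w i1) => y _ /=; ring.
split => //.
have e1 : \int[mu]_y (Cu * wt y - lgm G 0 0 y / ch y) = \int[mu]_y (Cu * wt y) - E (lgm G 0).
  by rewrite RintegralB.
have cE : (fun n => E (lgm G (eps n))) @ \oo --> E (lgm G 0).
  rewrite (_ : (fun n => E (lgm G (eps n))) = (fun n => \int[mu]_y (Cu * wt y) - \int[mu]_y f_ n y)); last first.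
    by apply: funext => n; rewrite I_f; ring.
  rewrite (_ : E (lgm G 0) = \int[mu]_y (Cu * wt y) - (\int[mu]_y (Cu * wt y - lgm G 0 0 y / ch y))); last by rewrite e1; ring.
  by apply: cvgB => //; exact: cvg_cst.
have c : (fun n => E (lgm G (eps n)) + W (lgm G (eps n))) @ \oo --> E (lgm G 0) + W (lgm G 0) by exact: cvgD.
by apply: (cvgr_to_ge c); exact: nearW.
Qed.

End LogInequality.

Section LineBound.
Context {R : realType}.
Notation mu := (@lebesgue_measure R).
Notation mu2 := (mu \x mu)%E.
Notation RR := (measurableTypeR R).
Implicit Types (x y e c X C : R) (G : R[i] -> R[i]).
Variables (a x0 x1 : R).
Hypotheses (a0 : 0 < a) (x00 : 0 < x0) (x01 : x0 < x1) (ax1 : a * x1 < pi / 2).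
Let x10 : 0 < x1. Proof. exact: lt_trans x01. Qed.
Let ch y := cosh (a * y).
Let chp y : 0 < ch y. Proof. exact: ch_gt0. Qed.
Let wt y := (1 + `|y|) / ch y.
Let iw : intg mu setT wt. Proof. exact: intg_lin_sech. Qed.
Let wt0 y : 0 <= wt y. Proof. by rewrite divr_ge0 ?addr_ge0// ltW. Qed.

Lemma lgm_shift G c e x y : lgm (fun w => G (w + c%:C)) e x y = lgm G e (x + c) y.
Proof.
rewrite /lgm /nsq (_ : (x +i* y) + c%:C = (x + c) +i* y)//.
by apply: eqc => /=; rewrite ?addr0.
Qed.

Lemma inv_ch_meas : measurable_fun setT (fun y : RR => (ch y)^-1).
Proof.
apply: continuous_measurable_fun; suff h : continuous (fun y : R => (ch y)^-1) by [].
by move=> y; apply: cvgV; [rewrite gt_eqF|exact: (dv_cont (dv_ch a y))].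
Qed.

(** For [c > x0] both growth bounds apply directly. For [c <= x0] the translate of [G] by [c]
    satisfies [0 <= E + W]; since the logarithm is bounded above by [Cu * wt], a lower bound of its
    integral bounds the integral of its modulus. Uniformity in [c] is the point. *)
Lemma line_bound G : good x0 G -> exists B, forall c, 0 <= c <= x1 ->
  intg mu setT (fun y => lgm G 0 c y / ch y) /\ \int[mu]_y `|lgm G 0 c y / ch y| <= B.
Proof.
(* The translate by [c <= x1] is examined up to abscissa [x1], so bounds for [G] are needed up to
   [x1 + x1]. *)
move=> gG; have [Cu Cu0 hu] := lgm_upper (x1 + x1) gG; have [Cl Cl0 hl] := lgm_lower (x1 + x1) gG.
pose C := Cu + Cl; have C0 : 0 <= C by rewrite addr_ge0.
have e01 : 0 <= (0 : R) <= 1 by rewrite lexx ler01.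
have hC x y : x0 <= x <= x1 + x1 -> `|lgm G 0 x y| <= C * (1 + `|y|).
  move=> /andP[xx xX]; have y0 : 0 <= 1 + `|y| by rewrite addr_ge0.
  have u : lgm G 0 x y <= Cu * (1 + `|y|) by apply: hu => //; rewrite xX andbT; apply: ltW; exact: lt_le_trans xx.
  have l : - (Cl * (1 + `|y|)) <= lgm G 0 x y by apply: hl => //; rewrite xx.
  have := mulr_ge0 Cu0 y0; have := mulr_ge0 Cl0 y0.
  by rewrite ler_norml /C mulrDl => ? ?; apply/andP; split; lra.
pose I := \int[mu]_y wt y; have I0 : 0 <= I by apply: Rintegral_ge0.
have W0 : 0 <= C * wt_mass a x0 x1.
  rewrite mulr_ge0//; apply: Rintegral_ge0 => p _.
  have k0 := le_trans (normr_ge0 _) (kern_le a0 x00 x01 ax1 (x := 0) p.2 _).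
  rewrite mulrA mulr_ge0 ?invr_ge0 ?(ltW (chp _))// mulr_ge0 ?addr_ge0//.
  by have := k0; rewrite lexx (ltW x10) => /(_ isT); rewrite pmulr_lge0// invr_gt0; exact: chp.
exists (2 * Cu * I + C * wt_mass a x0 x1 + C * I) => c /andP[c0 cx].
have gc := good_shift c0 gG.
have mf : measurable_fun setT (fun y : RR => lgm G 0 c y / ch y).
  apply: measurable_funM inv_ch_meas.
  by have := good_line_meas 0 gc; rewrite (_ : lgm _ 0 0 = lgm G 0 c)//; apply: funext => y; rewrite lgm_shift add0r.
have [cx0|cx0] := leP c x0.
  have [_ _ i0 ineq] := log_inequality a0 x00 x01 ax1 gc.
  have EE : (fun y => lgm (fun w => G (w + c%:C)) 0 0 y / ch y) = (fun y => lgm G 0 c y / ch y).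
    by apply: funext => y; rewrite lgm_shift add0r.
  rewrite /lineI /lineE EE in i0 ineq.
  have i1 : intg mu setT (fun y => 2 * Cu * wt y - lgm G 0 c y / ch y).
    by apply: intgB => //; exact: intgZ.
  split => //; apply: (@le_trans _ _ (\int[mu]_y (2 * Cu * wt y - lgm G 0 c y / ch y))).
    apply: le_Rintegral => //; first exact: intg_norm.
    move=> y _; have u : lgm G 0 c y <= Cu * (1 + `|y|).
      by apply: hu => //; rewrite c0; apply: le_trans cx _; rewrite lerDl ltW.
    rewrite normrM normfV (gtr0_norm (chp y)) /wt mulrA -mulrBl ler_pM2r ?invr_gt0//.
    have p0 : 0 <= Cu * (1 + `|y|) by rewrite mulr_ge0 ?addr_ge0.
    by rewrite ler_norml; apply/andP; split; lra.
  rewrite RintegralB//; last exact: intgZ.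
  rewrite (@RintegralZl _ _ _ mu setT wt (2 * Cu) measurableT iw) -/I.
  have : `|stripW a x0 x1 (lgm (fun w => G (w + c%:C)) 0)| <= C * wt_mass a x0 x1.
    apply: (stripW_bound a0 x00 x01 ax1 gc C0 _).2 => x y /andP[xx xX]; rewrite lgm_shift; apply: hC; apply/andP; split; last exact: lerD.
    by apply: le_trans xx _; rewrite lerDl.
  rewrite ler_norml => /andP[_ ?]; have := mulr_ge0 C0 I0; lra.
have dom y : `|lgm G 0 c y / ch y| <= C * wt y.
  rewrite normrM normfV (gtr0_norm (chp y)) /wt mulrA ler_pM2r ?invr_gt0//; apply: hC.
  by rewrite ltW//=; apply: le_trans cx _; rewrite lerDl ltW.
have iC : intg mu setT (fun y => C * wt y) by exact: intgZ.
have i0 : intg mu setT (fun y => lgm G 0 c y / ch y) by exact: (le_intg measurableT mf (fun y _ => dom y) iC).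
split => //; apply: (@le_trans _ _ (\int[mu]_y (C * wt y))).
  apply: le_Rintegral => //; first exact: intg_norm.
rewrite (@RintegralZl _ _ _ mu setT wt C measurableT iw) -/I.
have : 0 <= 2 * Cu * I by rewrite mulr_ge0// mulr_ge0.
lra.
Qed.

(** By Tonelli the uniform bound on lines gives integrability over the strip, whatever the zeros of
    [G] inside it. *)
Lemma strip_log_int G : good x0 G -> stripI a x1 (lgm G 0).
Proof.
move=> gG; have [B hB] := line_bound gG.
apply: (@strip_intg _ _ _ B (ltW x10)).
  apply: measurable_funM; first exact: (good_strip_meas 0 (ltW x10) gG).
  have := measurableT_comp inv_ch_meas (@measurable_snd _ _ RR RR).
  exact: measurable_funS.
by move=> x xx; exact: hB.
Qed.

(** Off the zeros, [lgm G (eps n)] lies between [lgm G 0] and the upper growth bound; this supplies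
    the dominating function. *)
Lemma lim_eps G (N : set (RR * RR)) T : good x0 G -> 1 <= T ->
  measurable N -> mu2 N = 0%E -> (forall x y, 0 <= x <= x1 -> nsq G x y = 0 -> N (x, y)) ->
  (fun n => lineE_T a T (lgm G (eps n))) @ \oo --> lineE_T a T (lgm G 0) /\
  (fun n => stripW_T a x0 x1 T (lgm G (eps n))) @ \oo --> stripW_T a x0 x1 T (lgm G 0).
Proof.
move=> gG T1 mN N0 hN; have TT : - T <= T by lra.
have T0 : T != 0 by rewrite gt_eqF//; lra.
have mS := measurable_strip x1 (R := R).
have [Cu Cu0 hu] := lgm_upper x1 gG.
have e01 : 0 <= (0 : R) <= 1 by rewrite lexx ler01.
have bd n x y : 0 <= x <= x1 -> nsq G x y != 0 -> `|lgm G (eps n) x y| <= `|lgm G 0 x y| + Cu * (1 + `|y|).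
  move=> xx n0; have u := hu _ x y (eps_le1 n) xx.
  have l : lgm G 0 x y <= lgm G (eps n) x y.
    by apply: lgm_mono => //; [rewrite addr0 lt0r n0 nsq_ge0|rewrite ltW ?eps_gt0].
  have p0 : 0 <= Cu * (1 + `|y|) by rewrite mulr_ge0 ?addr_ge0.
  have := ler_norm (- lgm G 0 x y); rewrite normrN.
  have := normr_ge0 (lgm G 0 x y).
  by rewrite ler_norml => *; apply/andP; split; lra.
have iS := strip_log_int gG; have [B hB] := line_bound gG.
have iE : lineI a (lgm G 0) by apply: (hB 0 _).1; rewrite lexx ltW.
have isw : intg mu2 (strip x1) (fun p : RR * RR => wt p.2) by exact: (strip_intg_snd (ltW x10)).
have kb0 : 0 <= kern_bound a x0 x1.
  have := le_trans (normr_ge0 _) (kern_le a0 x00 x01 ax1 (x := 0) 0 _).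
  by rewrite lexx (ltW x10) => /(_ isT); rewrite pmulr_lge0// invr_gt0; exact: chp.
have [ga _ _] := gG; have mlog := log_inequality a0 x00 x01 ax1 gG.
split.
  have [_ Z0 mZ _] : [/\ True, mu [set y : RR | nsq G 0 y = 0] = 0%E, measurable [set y : RR | nsq G 0 y = 0] & True] by case: mlog.
  have mc : measurable_fun `[- T, T] (fun y : RR => chi T y / ch y).
    apply: (measurable_funS measurableT (@subsetT _ _)).
    apply: measurable_funM inv_ch_meas; apply: continuous_measurable_fun => y.
    by have [_ _ c0 _ _] := chi_C2 0 y T0; exact: (section1_cont c0).
  have ml e : measurable_fun `[- T, T] (fun y : RR => lgm G e 0 y * (chi T y / ch y)).
    by apply: measurable_funM mc; apply: measurable_funS (good_line_meas e gG).
  have [] := @Rdct_ae _ _ R mu `[- T, T] _ (fun n y => lgm G (eps n) 0 y * (chi T y / ch y))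
    (fun y => lgm G 0 0 y * (chi T y / ch y)) (fun y => `|lgm G 0 0 y / ch y| + Cu * wt y)
    (measurable_itv _) mZ Z0 (fun n => ml _) (ml 0) => //.
  - move=> y _ /eqP n0; apply: cvgM; last exact: cvg_cst.
    exact: lgm_cvg.
  - apply: intgD => //; first by apply: intg_norm => //; exact: intgS iE.
    by apply: intgS (intgZ Cu measurableT iw).
  - move=> n y /=; rewrite in_itv /= => yT /eqP n0; have [/andP[c0 c1] _ _] := chi_bound T1 yT.
    rewrite (_ : _ + _ = (`|lgm G 0 0 y| + Cu * (1 + `|y|)) / ch y); last first.
      by rewrite normrM normfV (gtr0_norm (chp y)) /wt; ring.
    rewrite mulrA normrM normfV (gtr0_norm (chp y)) ler_pM2r ?invr_gt0// normrM (ger0_norm c0).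
    apply: (@le_trans _ _ `|lgm G (eps n) 0 y|); first by rewrite ler_piMr.
    by apply: bd => //; rewrite lexx ltW.
have subS : rect 0 x1 (- T) T `<=` strip x1 by move=> p /rectP[h _]; exact/stripP.
have mR := measurable_rect 0 x1 (- T) T.
have ml e : measurable_fun (rect 0 x1 (- T) T) (fun p : RR * RR => lgm G e p.1 p.2 * kernT a x0 x1 T p.1 p.2).
  apply: measurable_funM; first by apply: measurable_funS (good_strip_meas e (ltW x10) gG).
  apply: rect_measurable => //; first exact: ltW.
  move=> [x y] /rectP[/= xx _]; suff : cont2 (kernT a x0 x1 T) x y by [].
  exact: kernT_cont.
have [] := @Rdct_ae _ _ R mu2 (rect 0 x1 (- T) T) N (fun n p => lgm G (eps n) p.1 p.2 * kernT a x0 x1 T p.1 p.2)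
    (fun p => lgm G 0 p.1 p.2 * kernT a x0 x1 T p.1 p.2)
    (fun p => kern_bound a x0 x1 * (`|lgm G 0 p.1 p.2 / ch p.2| + Cu * wt p.2)) mR mN N0 (fun n => ml _) (ml 0) => //.
- move=> [x y] /rectP[/= xx _] nN; apply: cvgM; last exact: cvg_cst.
  by apply: lgm_cvg; apply/eqP => n0; apply: nN; exact: hN.
- apply: intgZ => //; apply: intgD => //.
    by apply: intg_norm => //; exact: intgS iS.
  exact: intgS (intgZ Cu mS isw).
- move=> n [x y] /rectP[/= xx yT] nN; have n0 : nsq G x y != 0 by apply/eqP => n0; apply: nN; exact: hN.
  have h1 := kernT_le a0 x00 x01 ax1 T1 xx yT; have h2 := bd n x y xx n0.
  rewrite normrM; apply: le_trans (ler_pM (normr_ge0 _) (normr_ge0 _) h2 h1) _.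
  rewrite le_eqVlt; apply/orP; left; apply/eqP.
  by rewrite (normrM (lgm G 0 x y)) normfV (gtr0_norm (chp y)) /wt -/(ch y); ring.
Qed.

End LineBound.

(** * Point masses *)

Section PointMass.
Context {R : realType}.
Notation mu := (@lebesgue_measure R).
Notation mu2 := (mu \x mu)%E.
Notation RR := (measurableTypeR R).
Implicit Types (x y e c d t u v : R).

Lemma squeeze_harmonic (f : nat -> R) (l K : R) :
  (forall n, `|f n - l| <= K * n.+1%:R^-1) -> f @ \oo --> l.
Proof.
move=> h; apply/cvg_dist0P; apply: (squeeze_cvgr (f := cst 0) (h := fun n => K * n.+1%:R^-1)).
- by apply: nearW => n; rewrite normr_ge0 h.
- exact: cvg_cst.
- by rewrite -[X in _ --> X](mulr0 K); apply: cvgM; [exact: cvg_cst|exact: cvg_harmonic].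
Qed.

(** In the antiderivative [F] the rational part tends to [0] at both ends, so the arctangent alone
    gives the value. *)
Lemma mass_line c : 0 < c -> intg mu setT (fun y => ((c ^+ 2 + y ^+ 2) ^+ 2)^-1) /\
  \int[mu]_y ((c ^+ 2 + y ^+ 2) ^+ 2)^-1 = pi / (2 * c ^+ 3).
Proof.
move=> c0; have c2 : 0 < c ^+ 2 by rewrite exprn_gt0.
have D0 y : 0 < c ^+ 2 + y ^+ 2 by rewrite ltr_pwDl ?sqr_ge0.
have Dn y : c ^+ 2 + y ^+ 2 != 0 by rewrite gt_eqF.
pose F y := (1 / (2 * c ^+ 2)) * (y / (c ^+ 2 + y ^+ 2)) + (1 / (2 * c ^+ 3)) * atan (y / c).
have dD y : dv (fun y => c ^+ 2 + y ^+ 2) y (2 * y).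
  by apply: (dv_eq (dvD (dv_cst (c ^+ 2) y) (dvX2 (dv_id y)))) => /=; ring.
have dF y : dv F y ((c ^+ 2 + y ^+ 2) ^+ 2)^-1.
  have H1 := dvM (dv_id y) (dvV (f := fun y => c ^+ 2 + y ^+ 2) (Dn y) (dD y)).
  have H2 := dv_atan (dvM (dv_id y) (dv_cst c^-1 y)).
  apply: (dv_eq (dvD (dvZ (1 / (2 * c ^+ 2)) H1) (dvZ (1 / (2 * c ^+ 3)) H2))) => /=.
  have ey : 1 + (y / c) ^+ 2 = (c ^+ 2 + y ^+ 2) / c ^+ 2 by field; rewrite gt_eqF.
  rewrite ey; have := Dn y; set D := c ^+ 2 + y ^+ 2 => Dn0.
  have yE : y ^+ 2 = D - c ^+ 2 by rewrite /D; ring.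
  clearbody D; rewrite (_ : y * (- (2 * y) / D ^+ 2) = - 2 * y ^+ 2 / D ^+ 2); last by ring.
  rewrite yE.
  by field; rewrite Dn0 gt_eqF.
have Fl : (fun n => F n%:R) @ \oo --> (1 / (2 * c ^+ 3)) * (pi / 2).
  rewrite -[X in _ --> X]add0r -{1}(mulr0 (1 / (2 * c ^+ 2))).
    apply: cvgD; apply: cvgM; (try exact: cvg_cst).
    apply: (@squeeze_harmonic _ _ 2) => n; rewrite subr0 ger0_norm ?divr_ge0 ?(ltW (D0 _))//.
    rewrite ler_pdivrMr// mulrAC ler_pdivlMr//.
    case: n => [|n]; first by rewrite mul0r !mulr_ge0 ?(ltW (D0 _)).
    have : (1 : R) <= n.+1%:R by rewrite ler1n.
    rewrite -[n.+2%:R]natr1; nra.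
  apply: (cvg_comp (fun n : nat => n%:R / c) atan) (@cvgy_atan R).
  apply/cvgryPge => A; apply: filterS (nbhs_infty_ger (A * c)) => n.
  by rewrite ler_pdivlMr.
have [] := @Rftc_line _ (fun y => ((c ^+ 2 + y ^+ 2) ^+ 2)^-1) F (- ((1 / (2 * c ^+ 3)) * (pi / 2))) ((1 / (2 * c ^+ 3)) * (pi / 2)) dF.
- move=> y; apply: cvgV; first by rewrite expf_neq0.
  exact: (dv_cont (dvX2 (dD y))).
- by move=> y; rewrite invr_ge0 sqr_ge0.
- exact: Fl.
- have -> : (fun n => F (- n%:R)) = (fun n => - F n%:R).
    by apply: funext => n; rewrite /F !mulNr atanN sqrrN; ring.
  exact: cvgN.
move=> i1 ->; split => //; field; rewrite gt_eqF//.
Qed.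

Lemma mass_outer e : 0 < e -> intg mu setT (fun x => e / Num.sqrt (x ^+ 2 + e) ^+ 3) /\
  \int[mu]_x (e / Num.sqrt (x ^+ 2 + e) ^+ 3) = 2.
Proof.
move=> e0; have D0 x : 0 < x ^+ 2 + e by rewrite ltr_wpDl ?sqr_ge0.
pose S x := Num.sqrt (x ^+ 2 + e).
have S0 x : 0 < S x by rewrite sqrtr_gt0.
have S2 x : S x ^+ 2 = x ^+ 2 + e by rewrite sqr_sqrtr// ltW.
have Sn x : S x != 0 by rewrite gt_eqF.
have dS x : dv S x (x / S x).
  have H : dv (fun x => x ^+ 2 + e) x (2 * x) by apply: (dv_eq (dvD (dvX2 (dv_id x)) (dv_cst e x))) => /=; ring.
  apply: (dv_eq (dv_comp H (is_derive1_sqrt (D0 x)))); rewrite -/(S x).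
  by field; rewrite Sn.
have dF x : dv (fun x => x / S x) x (e / S x ^+ 3).
  apply: (dv_eq (dvM (dv_id x) (dvV (f := S) (Sn x) (dS x)))) => /=.
  by rewrite (_ : e = S x ^+ 2 - x ^+ 2); [field; rewrite Sn|rewrite S2; ring].
have Fl : (fun n : nat => n%:R / S n%:R) @ \oo --> (1 : R).
  apply: (@squeeze_harmonic _ _ (2 * e + 1)) => n.
  have s0 := S0 n%:R; have s2 := S2 n%:R; have n0 : (0 : R) <= n%:R := ler0n _ _.
  have sn : n%:R <= S n%:R by rewrite -(@ler_pXn2r _ 2)// ?nnegrE ?(ltW s0)// s2 lerDl ltW.
  rewrite ler0_norm ?subr_le0 ?ler_pdivrMr ?mul1r// opprB.
  rewrite (_ : 1 - _ = (S n%:R - n%:R) / S n%:R); last by field; rewrite Sn.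
  apply: (@le_trans _ _ (e / S n%:R ^+ 2)).
    rewrite ler_pdivrMr// mulrAC expr2 invfM mulrA mulfK ?Sn// ler_pdivlMr//.
    rewrite (_ : e = S n%:R ^+ 2 - n%:R ^+ 2); [nra|rewrite s2; ring].
  rewrite ler_pdivrMr ?exprn_gt0// mulrAC ler_pdivlMr// s2.
  case: n n0 {s0 s2 sn} => [|n] n0; first by rewrite expr0n /= add0r mulr1; nra.
  have : (1 : R) <= n.+1%:R by rewrite ler1n.
  rewrite -[n.+2%:R]natr1; nra.
have [] := @Rftc_line _ (fun x => e / S x ^+ 3) (fun x => x / S x) (- 1) 1 dF.
- move=> x; apply: cvgM; first exact: cvg_cst.
  apply: cvgV; first by rewrite expf_neq0.
  have c := dv_cont (dS x); exact: (cvgM c (cvgM c c)).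
- by move=> x; rewrite divr_ge0 ?exprn_ge0 ?(ltW (S0 x))// ltW.
- exact: Fl.
- have -> : (fun n : nat => - n%:R / S (- n%:R)) = (fun n : nat => - (n%:R / S n%:R)).
    by apply: funext => n; rewrite /S sqrrN mulNr.
  exact: cvgN.
by move=> i1 ->; split => //; ring.
Qed.

Variables (u v : R).
(** The Laplacian of [ln (|w - (u +i* v)|^2 + e) / 2], which tends to [2 pi] times the point mass at
    [(u, v)]. *)
Definition bumpk e (p : RR * RR) : R := 2 * e / ((p.1 - u) ^+ 2 + (p.2 - v) ^+ 2 + e) ^+ 2.

Lemma bump_ge0 e p : 0 <= e -> 0 <= bumpk e p.
Proof. by move=> e0; rewrite divr_ge0 ?sqr_ge0// mulr_ge0. Qed.

(** Integration in [y] is [mass_line] with [c ^ 2 = (x - u) ^ 2 + e] and leaves [pi e / c ^ 3];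
    [mass_outer] integrates this in [x]. *)
Lemma bump_mass e : 0 < e -> intg mu2 setT (bumpk e) /\ \int[mu2]_p bumpk e p = 2 * pi.
Proof.
move=> e0; pose c x := Num.sqrt ((x - u) ^+ 2 + e).
have D0 x : 0 < (x - u) ^+ 2 + e by rewrite ltr_wpDl ?sqr_ge0.
have c0 x : 0 < c x by rewrite sqrtr_gt0.
have inner x : intg mu setT (fun y => bumpk e (x, y)) /\ \int[mu]_y bumpk e (x, y) = pi * (e / c x ^+ 3).
  have [i1 i2] := mass_line (c0 x).
  have [j1 j2] := Rint_shift (- v) i1.
  have E : (fun y : RR => bumpk e (x, y)) = (fun y => 2 * e * ((c x ^+ 2 + (y - v) ^+ 2) ^+ 2)^-1).
    by apply: funext => y; rewrite /bumpk /= /c sqr_sqrtr ?(ltW (D0 x))//; congr (_ / _ ^+ 2); ring.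
  rewrite E; split; first exact: intgZ.
  rewrite (@RintegralZl _ _ _ mu setT (fun y => ((c x ^+ 2 + (y - v) ^+ 2) ^+ 2)^-1) (2 * e) measurableT j1).
  by rewrite j2 i2; field; rewrite gt_eqF.
have outer : intg mu setT (fun x => pi * (e / c x ^+ 3)) /\ \int[mu]_x (pi * (e / c x ^+ 3)) = 2 * pi.
  have [i1 i2] := mass_outer e0; have [j1 j2] := Rint_shift (- u) i1.
  split; first exact: intgZ.
  rewrite (@RintegralZl _ _ _ mu setT (fun x => e / c x ^+ 3) pi measurableT j1) j2 i2; ring.
have cb : continuous (bumpk e : R * R -> R).
  move=> [x y]; suff : cont2 (fun x y => 2 * e / ((x - u) ^+ 2 + (y - v) ^+ 2 + e) ^+ 2) x y by [].
  have cN : cont2 (fun x y => (x - u) ^+ 2 + (y - v) ^+ 2 + e) x y.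
    apply: cont2D; last exact: cont2_cst.
    apply: cont2D; apply: cont2X2; apply: cont2B; (exact: cont2_cst || exact: cont2_fst || exact: cont2_snd).
  apply: cont2M; first exact: cont2_cst.
  apply: cont2V; last exact: cont2X2.
  by rewrite expf_neq0// gt_eqF// ltr_wpDl// addr_ge0 ?sqr_ge0.
have mb : measurable_fun setT (bumpk e) by exact: cont2_measurable.
have ib : intg mu2 setT (bumpk e).
  apply: (integrable12ltyP mu mu (f := EFin \o bumpk e) _).2; first exact/measurable_EFinP.
  rewrite (eq_integral (fun x : RR => (pi * (e / c x ^+ 3))%:E)).
    by rewrite -[ltLHS]fineK ?ltry//; exact: (integrable_fin_num measurableT outer.1).
  move=> x _; have [i1 <-] := inner x; rewrite /Rintegral fineK; last exact: (integrable_fin_num measurableT i1).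
  by apply: eq_integral => y _ /=; rewrite ger0_norm// bump_ge0// ltW.
split=> //; rewrite -setXTT Rfubini1//; last by move=> x _; exact: (inner x).1.
  by rewrite -outer.2; apply: eq_Rintegral => x _; exact: (inner x).2.
by rewrite setXTT.
Qed.

(* Away from the centre the bump of parameter [e] is dominated by a small
   multiple of a fixed bump, which controls all tails at once. *)
Lemma bump_tail e d p : 0 < e -> 0 < d -> d ^+ 2 <= (p.1 - u) ^+ 2 + (p.2 - v) ^+ 2 ->
  bumpk e p <= 4 * e / d ^+ 2 * bumpk (d ^+ 2) p.
Proof.
move=> e0 d0; rewrite /bumpk; set r : R := (p.1 - u) ^+ 2 + (p.2 - v) ^+ 2 => hr.
have d2 : 0 < d ^+ 2 by rewrite exprn_gt0.
have r0 : 0 < r by apply: lt_le_trans hr.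
clearbody r; have rd : 0 < r + d ^+ 2 by rewrite addr_gt0.
have re : 0 < r + e by rewrite addr_gt0.
rewrite (_ : 4 * e / d ^+ 2 * (2 * d ^+ 2 / (r + d ^+ 2) ^+ 2) = 2 * e * (4 / (r + d ^+ 2) ^+ 2)); last first.
  by field; rewrite !gt_eqF.
rewrite ler_pM2l ?mulr_gt0// ler_pdivlMr ?exprn_gt0//.
rewrite mulrC ler_pdivrMr ?exprn_gt0//.
rewrite (_ : 4 * (r + e) ^+ 2 = (2 * (r + e)) ^+ 2); last by ring.
have q1 : 0 <= r + d ^+ 2 by rewrite addr_ge0 ?ltW.
have q2 : 0 <= 2 * (r + e) by rewrite mulr_ge0// addr_ge0// ltW.
rewrite ler_pXn2r ?nnegrE//; lra.
Qed.

Lemma approximate_identity (f : RR * RR -> R) (M : R) : continuous (f : R * R -> R) -> (forall p, `|f p| <= M) ->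
  (fun n => \int[mu2]_p (f p * bumpk (eps n) p)) @ \oo --> f (u, v) * (2 * pi).
Proof.
move=> cf fM; have M0 : 0 <= M := le_trans (normr_ge0 _) (fM (u, v)).
have mf : measurable_fun setT f by exact: cont2_measurable.
have pi0 := pi_gt0 R.
(* Against the mass [2 pi] the tolerance [t'] costs [t / 2]; the other half pays for the tail, which
   is at most [K * eps n] below. *)
apply/cvgrPdist_le => t t0; pose t' := t / (4 * pi).
have t'0 : 0 < t' by rewrite divr_gt0// mulr_gt0.
have [d d0 hd] : exists2 d : R, 0 < d & forall p : R * R, (p.1 - u) ^+ 2 + (p.2 - v) ^+ 2 < d ^+ 2 -> `|f p - f (u, v)| <= t'.
  have /cvgrPdist_le/(_ t' t'0)/nbhs_ballP[d /= d0 hd] := cf (u, v).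
  exists d => // -[x y] /= h; rewrite distrC; apply: hd; split; rewrite /ball /=.
    rewrite -(@ltr_pXn2r _ 2)// ?nnegrE ?(ltW d0)// real_normK ?num_real//.
    by rewrite -sqrrN opprB; apply: le_lt_trans h; rewrite lerDl sqr_ge0.
  rewrite -(@ltr_pXn2r _ 2)// ?nnegrE ?(ltW d0)// real_normK ?num_real//.
  by rewrite -sqrrN opprB; apply: le_lt_trans h; rewrite lerDr sqr_ge0.
have d2 : 0 < d ^+ 2 by rewrite exprn_gt0.
pose K := 16 * M * pi / d ^+ 2.
have [N hN] : exists N : nat, K * (2 / t) <= N%:R.
  exists (Num.bound (K * (2 / t))); rewrite ltW// archi_boundP//.
  by rewrite !mulr_ge0 ?invr_ge0 ?(ltW pi0) ?(ltW d2) ?(ltW t0).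
exists N => //= n Nn; have e0 := @eps_gt0 R n.
have [b1 b2] := bump_mass e0; have [b3 b4] := bump_mass d2.
have i1 : intg mu2 setT (fun p => f p * bumpk (eps n) p) by exact: (intgM_bounded measurableT mf (fun p _ => fM p) b1).
have i2 : intg mu2 setT (fun p => f (u, v) * bumpk (eps n) p) by exact: intgZ.
rewrite distrC -b2 -(@RintegralZl _ _ _ mu2 setT (bumpk (eps n)) (f (u, v)) measurableT b1).
rewrite -(RintegralB measurableT i1 i2).
have i3 : intg mu2 setT (fun p => t' * bumpk (eps n) p) by exact: intgZ.
have i4 : intg mu2 setT (fun p => 2 * M * (4 * eps n / d ^+ 2) * bumpk (d ^+ 2) p) by exact: intgZ.
apply: (@le_trans _ _ (\int[mu2]_p (t' * bumpk (eps n) p + 2 * M * (4 * eps n / d ^+ 2) * bumpk (d ^+ 2) p))).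
  apply: Rint_norm_le => //.
  - by have := intg_meas (intgB measurableT i1 i2).
  - move=> p _; rewrite -mulrBl normrM (ger0_norm (bump_ge0 _ (ltW e0))).
    have q0 := bump_ge0 p (ltW e0); have q1 := bump_ge0 p (ltW d2).
    have w0 : 0 <= 2 * M * (4 * eps n / d ^+ 2) by rewrite !mulr_ge0 ?invr_ge0 ?(ltW d2) ?(ltW e0).
    have [h|h] := ltP ((p.1 - u) ^+ 2 + (p.2 - v) ^+ 2) (d ^+ 2).
      rewrite -[leLHS]addr0; apply: lerD; last exact: mulr_ge0.
      by apply: ler_wpM2r => //; exact: hd.
    rewrite -[leLHS]add0r; apply: lerD; first by rewrite mulr_ge0// ltW.
    apply: (@le_trans _ _ (2 * M * bumpk (eps n) p)).
      rewrite ler_wpM2r//; apply: le_trans (ler_normB _ _) _; have := fM p; have := fM (u, v); lra.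
    by rewrite -[leRHS]mulrA ler_wpM2l ?mulr_ge0//; exact: bump_tail.
  - exact: intgD.
rewrite (RintegralD measurableT i3 i4).
rewrite (@RintegralZl _ _ _ mu2 setT (bumpk (eps n)) t' measurableT b1).
rewrite (@RintegralZl _ _ _ mu2 setT (bumpk (d ^+ 2)) (2 * M * (4 * eps n / d ^+ 2)) measurableT b3) b2 b4.
have pin0 : (pi : R) != 0 by exact: lt0r_neq0.
rewrite (_ : t' * (2 * pi) = t / 2); last first.
  by rewrite /t'; move: pin0; move: (pi : R) => q qn0; field.
rewrite (_ : _ * (2 * pi) = K * eps n); last by rewrite /K; move: (pi : R) => q; field; exact: lt0r_neq0.
suff : K * eps n <= t / 2 by lra.
rewrite /eps ler_pdivrMr// mulrC -ler_pdivrMr ?divr_gt0// invf_div.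
by apply: le_trans hN _; rewrite ler_nat; exact: leqW.
Qed.

End PointMass.

(** * Zeros as point masses: a formula of Jensen type *)

Section Jensen.
Context {R : realType}.
Notation mu := (@lebesgue_measure R).
Notation mu2 := (mu \x mu)%E.
Notation RR := (measurableTypeR R).
Implicit Types (x y e c u v T X C : R) (G : R[i] -> R[i]).
Variables (a x0 x1 : R).
Hypotheses (a0 : 0 < a) (x00 : 0 < x0) (x01 : x0 < x1) (ax1 : a * x1 < pi / 2).
Let x10 : 0 < x1. Proof. exact: lt_trans x01. Qed.
Let ch y := cosh (a * y).
Let chp y : 0 < ch y. Proof. exact: ch_gt0. Qed.
Let E := lineE a.
Let W := stripW a x0 x1.
Let ET := lineE_T a.
Let WT := stripW_T a x0 x1.

Definition lin u v (w : R[i]) := w - (u +i* v).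

Lemma nsq_lin u v x y : nsq (lin u v) x y = (x - u) ^+ 2 + (y - v) ^+ 2.
Proof. by rewrite /nsq /lin /=. Qed.

Lemma an_lin u v s : an (lin u v) s.
Proof. by apply: anB; [exact: an_id|exact: an_cst]. Qed.

Lemma Df_lin u v s : Df (lin u v) s = 1.
Proof.
apply: DfE; exists 1, 0; split => // z _.
rewrite /lin mul1r (_ : _ - z = 0) ?normc0 ?mul0r//; ring.
Qed.

Lemma lin_le u v x y X : 0 <= x <= X ->
  nsq (lin u v) x y <= expR (2 * (X + `|u| + `|v| + 1) * (1 + `|y|)).
Proof.
move=> /andP[xx xX]; pose K := X + `|u| + `|v| + 1.
have u0 := normr_ge0 u; have v0 := normr_ge0 v; have y0 := normr_ge0 y.
have h1 : `|x - u| + `|y - v| <= K * (1 + `|y|).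
  have := ler_normB x u; have := ler_normB y v; rewrite (ger0_norm xx) /K => ? ?; nra.
apply: (@le_trans _ _ ((K * (1 + `|y|)) ^+ 2)).
  apply: (@le_trans _ _ ((`|x - u| + `|y - v|) ^+ 2)).
    rewrite nsq_lin -[(x - u) ^+ 2]real_normK ?num_real// -[(y - v) ^+ 2]real_normK ?num_real//.
    have := normr_ge0 (x - u); have := normr_ge0 (y - v); nra.
  rewrite ler_pXn2r// nnegrE ?addr_ge0// (le_trans _ h1)// addr_ge0//.
have k0 : 0 <= K * (1 + `|y|) by apply: le_trans h1; rewrite addr_ge0.
rewrite -mulrA mulr_natl mulr2n -/K expRD -expr2 ler_pXn2r ?nnegrE ?expR_ge0//.
by apply: le_trans (expR_ge1Dx _); rewrite lerDr.
Qed.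

Lemma good_lin u v : u < x0 -> good x0 (lin u v).
Proof.
move=> ux; split.
- by move=> x y _; exact: an_lin.
- by move=> X; exists (2 * (X + `|u| + `|v| + 1)) => x y xx; exact: lin_le.
move=> X; pose d := (x0 - u) ^+ 2; have d0 : 0 < d by rewrite exprn_gt0// subr_gt0.
exists `|ln d| => x y /andP[xx _]; rewrite nsq_lin; apply: (@le_trans _ _ d).
  rewrite -[leRHS]lnK ?posrE// ler_expR.
  have := ler_norm (- ln d); rewrite normrN; have := normr_ge0 (ln d); have := normr_ge0 y; nra.
by rewrite /d; have := sqr_ge0 (y - v); nra.
Qed.

Lemma cutoff_cont T x y : T != 0 -> 0 <= x <= x1 -> cont2 (cutoff a x0 x1 T) x y.
Proof.
move=> T0 xx; have [g1 g2] := green_region a0 x10 ax1 y xx.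
have [_ _ h0 _ _] := green_h_C2 a0 g1 g2.
have [_ _ p0 _ _] := psi_C2 x0 x1 x y; have [_ _ c0 _ _] := chi_C2 x y T0.
by apply: cont2M => //; exact: cont2M.
Qed.

Lemma cutoff_boundary T x y : T != 0 -> x = 0 \/ x = x1 \/ y = T \/ y = - T -> cutoff a x0 x1 T x y = 0.
Proof.
move=> T0 [->|[->|h]].
- by rewrite /cutoff green_h0 !mul0r.
- by rewrite /cutoff; have [-> _] := psi_x1 x01; rewrite mulr0 mul0r.
- rewrite /cutoff (_ : chi T y = 0) ?mulr0// /chi.
  by rewrite (_ : 1 - _ = 0) ?expr0n//; case: h => ->; field.
Qed.

(** The cutoff vanishes on the boundary of the rectangle, so clamping the arguments extends it by
    zero to a bounded continuous function on the plane, to which [approximate_identity] applies. *)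
Let ext T (p : RR * RR) := cutoff a x0 x1 T (clamp 0 x1 p.1) (clamp (- T) T p.2).

Lemma clamp_in b c x : b <= c -> b <= clamp b c x <= c.
Proof. by move=> bc; rewrite /clamp le_max lexx /= ge_max bc ge_min lexx. Qed.

Lemma clamp_id b c x : b <= x <= c -> clamp b c x = x.
Proof. by move=> /andP[h1 h2]; rewrite /clamp min_r// max_r. Qed.

Lemma clamp_out b c x : b <= c -> ~ (b <= x <= c) -> clamp b c x = b \/ clamp b c x = c.
Proof.
move=> bc h; rewrite /clamp; have [xc|xc] := leP c x; first by right; rewrite max_r.
by left; rewrite max_l//; apply: contra_notT h; rewrite -ltNge => /ltW ->; rewrite ltW.
Qed.

Lemma ext_cont T : 0 < T -> continuous (ext T : R * R -> R).
Proof.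
move=> T0 p; apply: (@continuous_comp _ _ _ (fun p : R * R => (clamp 0 x1 p.1, clamp (- T) T p.2)) (fun p => cutoff a x0 x1 T p.1 p.2)).
  have c1 : {for p, continuous (fun p : R * R => clamp 0 x1 p.1)}.
    by apply: (@continuous_comp _ _ _ fst (clamp 0 x1)); [exact: cvg_fst|exact: clamp_cont].
  have c2 : {for p, continuous (fun p : R * R => clamp (- T) T p.2)}.
    by apply: (@continuous_comp _ _ _ snd (clamp (- T) T)); [exact: cvg_snd|exact: clamp_cont].
  exact: (cvg_pair c1 c2).
apply: cutoff_cont; first exact: lt0r_neq0.
by apply: clamp_in; exact: ltW.
Qed.

Lemma ext_bounded T : 0 < T -> exists M : R, forall p, `|ext T p| <= M.
Proof.
move=> T0; have [M hM] : exists M : R, forall p : R * R, rect 0 x1 (- T) T p -> `|cutoff a x0 x1 T p.1 p.2| <= M.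
  apply: rect_bounded => -[x y] /rectP[/= xx _]; suff : cont2 (cutoff a x0 x1 T) x y by [].
  by apply: cutoff_cont => //; exact: lt0r_neq0.
exists M => p; apply: (hM (_, _)); apply/rectP; split; apply: clamp_in; [exact: ltW|lra].
Qed.

Lemma point_set_null u v : measurable [set ((u, v) : RR * RR)] /\ mu2 [set ((u, v) : RR * RR)] = 0%E.
Proof.
have -> : [set ((u, v) : RR * RR)] = [set u] `*` [set v].
  by apply/seteqP; split => -[x y] /=; [case=> -> ->|case=> -> ->].
split; first by apply: measurableX; exact: measurable_set1.
have -> := product_measure1E mu mu (measurable_set1 u) (measurable_set1 v).
by rewrite [X in (X * _)%E]lebesgue_measure_set1 mul0e.
Qed.

(** For the regularized logarithm Green's formula has the bump on its right-hand side. As [eps]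
    tends to [0], the left side converges by [lim_eps] and the right side by
    [approximate_identity]. *)
Lemma point_mass_T u v T : 0 <= u < x0 -> - T <= v <= T -> 1 <= T ->
  ET T (lgm (lin u v) 0) + WT T (lgm (lin u v) 0) = cutoff a x0 x1 T u v * (2 * pi).
Proof.
move=> /andP[u0 ux] vT T1; have T0 : 0 < T by lra.
have gl := good_lin v ux; have [mN N0] := point_set_null u v.
have hN x y : 0 <= x <= x1 -> nsq (lin u v) x y = 0 -> [set ((u, v) : RR * RR)] (x, y).
  move=> _ /eqP; rewrite nsq_lin paddr_eq0 ?sqr_ge0// !expf_eq0 /= !subr_eq0 => /andP[/eqP -> /eqP ->].
  by [].
have [c1 c2] := lim_eps a0 x00 x01 ax1 gl T1 mN N0 hN.
have [M hM] := ext_bounded T0.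
have c3 := @approximate_identity R u v _ M (ext_cont T0) hM.
have euv : ext T (u, v) = cutoff a x0 x1 T u v.
  by rewrite /ext /= !clamp_id//; rewrite u0 ltW// (lt_trans ux).
rewrite -euv; apply: (cvg_unique _ (cvgD c1 c2)) => //; apply: cvg_trans c3.
rewrite [X in X @ _](_ : _ = (fun n => \int[mu2]_p (ext T p * bumpk u v (eps n) p)))//.
apply: funext => n /=.
have pn x y : rect 0 x1 (- T) T (x, y) -> 0 < nsq (lin u v) x y + eps n.
  by move=> _; rewrite ltr_wpDl ?nsq_ge0 ?eps_gt0.
have [vx [vxx [vy [vyy [h1 h2]]]]] := lgm_green (fun x y (_ : rect 0 x1 (- T) T (x, y)) => an_lin u v _) pn.
rewrite [LHS](cutoff_green a0 x00 x01 ax1 T0 h1).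
rewrite Rintegral_mkcond; apply: eq_Rintegral => -[x y] _; rewrite patchE.
case: ifPn => [/set_mem xyr|].
  have /rectP[/= xx yT] := xyr; rewrite h2// /ext /= !clamp_id//; congr (_ * _).
  by rewrite /bumpk /= -nsq_lin {1}/nsq Df_lin /=; ring.
move=> /negP nr; rewrite /ext /= cutoff_boundary ?mul0r//; first exact: lt0r_neq0.
have TT : - T <= T by lra.
have [xx|nx] := boolP (0 <= x <= x1).
  have [yT|/negP ny] := boolP (- T <= y <= T); first by case: nr; apply/mem_set/rectP.
  by have [->|->] := clamp_out TT ny; right; right; [right|left].
by have [->|->] := clamp_out (ltW x10) (elimN idP nx); [left|right; left].
Qed.

Lemma point_mass u v : 0 <= u < x0 -> E (lgm (lin u v) 0) + W (lgm (lin u v) 0) = 2 * pi * green_h a u v.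
Proof.
move=> uu; have /andP[u0 ux] := uu; have gl := good_lin v ux.
have [_ _ iE _] := log_inequality a0 x00 x01 ax1 gl; have iS := strip_log_int a0 x00 x01 ax1 gl.
have [c1 c2] := strip_limit a0 x00 x01 ax1 iE iS.
apply: (cvg_unique _ (cvgD c1 c2)) => //.
have c3 : (fun n => cutoff a x0 x1 n.+1%:R u v * (2 * pi)) @ \oo --> 2 * pi * green_h a u v.
  rewrite [X in _ --> X](_ : _ = green_h a u v * psi x0 x1 u * 1 * (2 * pi)); last first.
    by have [-> _ _] := psi_eq1 x01 (ltW ux); ring.
  apply: cvgM; last exact: cvg_cst.
  by apply: cvgM; [exact: cvg_cst|exact: chi_cvg].
apply: cvg_trans c3; apply: near_eq_cvg; apply: filterS (near_itv v) => n vn.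
by rewrite /= -[LHS](point_mass_T uu vn)// ler1n.
Qed.

Lemma anX G (s : R[i]) n : an G s -> an (fun z => G z ^+ n) s.
Proof.
move=> fa; elim: n => [|n IH]; first exact: an_cst.
by apply: (an_near ltr01 _ (anM fa IH)) => z _; rewrite exprS.
Qed.

Lemma nsqM G H1 H2 x y : G (x +i* y) = H1 (x +i* y) * H2 (x +i* y) -> nsq G x y = nsq H1 x y * nsq H2 x y.
Proof. by move=> h; rewrite !nsqE h normcM exprMn. Qed.

Lemma nsqX G n x y : nsq (fun w => G w ^+ n) x y = nsq G x y ^+ n.
Proof. by rewrite !nsqE normcX -!exprM mulnC. Qed.

Lemma lgm_factor G G1 u v m x y : (x +i* y != u +i* v) ->
  G (x +i* y) = lin u v (x +i* y) ^+ m * G1 (x +i* y) -> nsq G1 x y != 0 ->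
  lgm G 0 x y = m%:R * lgm (lin u v) 0 x y + lgm G1 0 x y.
Proof.
move=> ne h n1; have l0 : 0 < nsq (lin u v) x y by rewrite nsq_gt0 subr_eq0.
have g0 : 0 < nsq G1 x y by rewrite lt0r n1 nsq_ge0.
rewrite /lgm !addr0 (nsqM (H1 := fun w => lin u v w ^+ m) h) nsqX lnM ?posrE ?exprn_gt0//.
by rewrite lnXn// -mulr_natl; ring.
Qed.

(** Dividing out a zero preserves the growth conditions. Within distance [d] of the zero the
    quotient is the bounded function [g]; outside, the divisor is bounded away from [0]. For
    [x0 <= x] the divisor is nonzero and at most exponential by [lin_le], so the lower bound
    survives. *)
Lemma factor_good G u v m g (r : R) : good x0 G -> 0 <= u < x0 -> an g (u +i* v) -> 0 < r ->
  (forall z, normc z <= r -> G ((u +i* v) + z) = z ^+ m * g ((u +i* v) + z)) ->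
  exists G1, [/\ good x0 G1, G1 (u +i* v) = g (u +i* v) &
    forall w, w != u +i* v -> G w = lin u v w ^+ m * G1 w].
Proof.
set s0 := u +i* v => -[ga gu gl] /andP[u0 ux] ang r0 hr.
pose G1 w := if w == s0 then g s0 else G w / (w - s0) ^+ m.
have G1E w : w != s0 -> G w = lin u v w ^+ m * G1 w.
  by move=> ws; rewrite /G1 (negbTE ws) /lin mulrC divfK// expf_neq0// subr_eq0.
have G1g z : normc z <= r -> G1 (s0 + z) = g (s0 + z).
  move=> zr; rewrite /G1; case: eqVneq => [/eqP|nz].
    by rewrite -subr_eq0 addrAC subrr add0r => /eqP ->; rewrite addr0.
  have z0 : z != 0 by apply: contra_neq nz => ->; rewrite addr0.
  by rewrite hr// addrAC subrr add0r mulrC mulKf// expf_neq0.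
exists G1; split => //; last by rewrite /G1 eqxx.
have nE x y : x +i* y != s0 -> nsq G x y = nsq (lin u v) x y ^+ m * nsq G1 x y.
  by move=> ne; rewrite (nsqM (H1 := fun w => lin u v w ^+ m) (G1E _ ne)) nsqX.
split.
- move=> x y xx; have [->|ne] := eqVneq (x +i* y) s0.
    by apply: (an_near r0 _ ang) => z zr; rewrite G1g.
  have d0 : 0 < normc ((x +i* y) - s0) / 2 by rewrite divr_gt0// normc_gt0 subr_eq0.
  apply: (an_near d0 _ (anM (ga x y xx) (anX m (an_inv_affine ne)))) => z zd.
  rewrite /G1; case: eqVneq => [e|_]; last by rewrite exprVn.
  have e' : (x +i* y) - s0 = - z by rewrite -e; ring.
  exfalso; move: zd d0; rewrite e' normcN; move: (normc z) => q; lra.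
- move=> X; have [C hC] := gu X; have [r1 [B [r10 hB]]] := an_bounded ang.
  have B0 : 0 <= B by apply: le_trans (normc_ge0 _) (hB 0 _); rewrite normc0 ltW.
  pose d := Num.min r r1; have d0 : 0 < d by rewrite lt_min r0.
  pose q := ((d ^+ 2) ^+ m)^-1; have q0 : 0 < q by rewrite invr_gt0 !exprn_gt0.
  exists (B ^+ 2 + `|C| + q) => x y xX; have y1 : 1 <= 1 + `|y| by rewrite lerDl.
  have b2 := sqr_ge0 B; have c0 := normr_ge0 C.
  have [near_|far] := leP (normc ((x +i* y) - s0)) d.
    rewrite nsqE -(subrK s0 (x +i* y)) addrC G1g; last by apply: le_trans near_ _; rewrite ge_min lexx.
    apply: (@le_trans _ _ (B ^+ 2)).
      by rewrite ler_pXn2r ?nnegrE ?normc_ge0// hB// (le_trans near_)// ge_min lexx orbT.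
    have := expR_ge1Dx ((B ^+ 2 + `|C| + q) * (1 + `|y|)); nra.
  have ne : x +i* y != s0 by rewrite -subr_eq0 -normc_gt0 (lt_trans d0).
  have l0 : d ^+ 2 <= nsq (lin u v) x y by rewrite nsqE ler_pXn2r ?nnegrE ?normc_ge0 ?(ltW d0)// ltW.
  have dm : (d ^+ 2) ^+ m <= nsq (lin u v) x y ^+ m by rewrite lerXn2r ?nnegrE ?sqr_ge0// nsq_ge0.
  have dm0 : 0 < (d ^+ 2) ^+ m by rewrite !exprn_gt0.
  have : nsq G1 x y <= nsq G x y * q.
    by rewrite /q ler_pdivlMr// nE// mulrC ler_wpM2r ?nsq_ge0.
  move=> /le_trans; apply; apply: (@le_trans _ _ (expR (`|C| * (1 + `|y|)) * expR (q * (1 + `|y|)))).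
    apply: ler_pM; rewrite ?nsq_ge0 ?(ltW q0)//.
      by apply: le_trans (hC x y xX) _; rewrite ler_expR ler_wpM2r ?ler_norm//; lra.
    have := expR_ge1Dx (q * (1 + `|y|)); nra.
  by rewrite -expRD ler_expR; nra.
- move=> X; have [C hC] := gl X; pose K := 2 * (X + `|u| + `|v| + 1).
  exists (C + m%:R * K) => x y xX; have /andP[xx0 xX'] := xX.
  have xX0 : 0 <= x <= X by rewrite xX' andbT (le_trans _ xx0)// ltW.
  have ne : x +i* y != s0.
    by apply/eqP => -[xu _]; move: ux; rewrite -xu ltNge xx0.
  have l0 : 0 < nsq (lin u v) x y by rewrite nsq_gt0 subr_eq0.
  have h := hC x y xX; rewrite nE// in h.
  have lm : nsq (lin u v) x y ^+ m <= expR (m%:R * (K * (1 + `|y|))).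
    by rewrite expRM_natl lerXn2r ?nnegrE ?nsq_ge0 ?expR_ge0// lin_le.
  rewrite mulrDl opprD expRD -ler_pdivlMr ?expR_gt0//.
  rewrite [X in _ / X]expRN invrK -mulrA; apply: le_trans h _.
  by rewrite [leLHS]mulrC ler_wpM2l ?nsq_ge0.
Qed.


Let chi_meas T : T != 0 -> measurable_fun setT (fun y : RR => chi T y).
Proof.
move=> T0; apply: continuous_measurable_fun => y.
by have [_ _ c0 _ _] := chi_C2 0 y T0; exact: (section1_cont c0).
Qed.

Lemma ET_int G T : good x0 G -> 1 <= T -> intg mu `[- T, T] (fun y => lgm G 0 0 y * (chi T y / ch y)).
Proof.
move=> gG T1; have T0 : T != 0 by rewrite gt_eqF//; lra.
have [_ _ iE _] := log_inequality a0 x00 x01 ax1 gG.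
have i1 : intg mu `[- T, T] (fun y => lgm G 0 0 y / ch y) by apply: (intgS measurableT) iE.
have m1 : measurable_fun `[- T, T] (fun y : RR => chi T y) by exact: (measurable_funS measurableT (@subsetT _ _) (chi_meas T0)).
have h (y : RR) : `[- T, T]%classic y -> `|chi T y| <= 1.
  by rewrite /= in_itv /= => yT; have [/andP[c0 c1] _ _] := chi_bound T1 yT; rewrite ger0_norm.
have mI : measurable (`[- T, T]%classic : set RR) by exact: measurable_itv.
have i2 := intgM_bounded mI m1 h i1.
rewrite (_ : (fun y => _) = (fun y => chi T y * (lgm G 0 0 y / ch y)))//.
by apply: funext => y; rewrite mulrCA.
Qed.

Lemma WT_int G T : good x0 G -> 1 <= T ->
  intg mu2 (rect 0 x1 (- T) T) (fun p => lgm G 0 p.1 p.2 * kernT a x0 x1 T p.1 p.2).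
Proof.
move=> gG T1; have T0 : T != 0 by rewrite gt_eqF//; lra.
have TT : - T <= T by lra.
have mR := measurable_rect 0 x1 (- T) T.
have subS : rect 0 x1 (- T) T `<=` strip x1 by move=> p /rectP[h _]; exact/stripP.
have iS := strip_log_int a0 x00 x01 ax1 gG.
have i1 := intgS (measurable_strip x1) mR subS iS.
have m1 : measurable_fun (rect 0 x1 (- T) T) (fun p : RR * RR => ch p.2 * kernT a x0 x1 T p.1 p.2).
  apply: rect_measurable => //; first exact: ltW.
  move=> [x y] /rectP[/= xx _]; suff : cont2 (fun x y => ch y * kernT a x0 x1 T x y) x y by [].
  by apply: cont2M; [exact: cont2_ch|exact: kernT_cont].
have h (p : RR * RR) : rect 0 x1 (- T) T p -> `|ch p.2 * kernT a x0 x1 T p.1 p.2| <= kern_bound a x0 x1.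
  move=> /rectP[xx yT]; have := kernT_le a0 x00 x01 ax1 T1 xx yT.
  by rewrite normrM (gtr0_norm (chp _)) ler_pdivlMr ?chp// mulrC.
apply: (eq_intg mR) (intgM_bounded mR m1 h i1) => p _ /=.
by have := chp p.2; rewrite /ch => c0; field; rewrite gt_eqF.
Qed.

Lemma axis_null : measurable ([set (0 : RR)] `*` [set: RR]) /\ mu2 ([set (0 : RR)] `*` [set: RR]) = 0%E.
Proof.
split; first exact: measurableX (measurable_set1 _) measurableT.
have -> := product_measure1E mu mu (measurable_set1 0) measurableT.
by rewrite [X in (X * _)%E]lebesgue_measure_set1 mul0e.
Qed.

(* Zeros on the line are divided out one at a time; each contributes a point
   mass at which the cutoff vanishes. *)
Lemma jensen_T G T (s : seq R) : 1 <= T -> good x0 G ->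
  (forall x y, 0 < x -> nsq G x y != 0) ->
  (forall y, - T <= y <= T -> nsq G 0 y = 0 -> y \in s) ->
  ET T (lgm G 0) + WT T (lgm G 0) = 0.
Proof.
move=> T1; have T0 : 0 < T by lra.
elim: s G => [|y0 s IH] G gG nz hs.
  have gG' := gG; move: gG' => [ga _ _].
  have pn x y : rect 0 x1 (- T) T (x, y) -> 0 < nsq G x y + 0.
    move=> /rectP[/= /andP[]]; rewrite le_eqVlt addr0 => /predU1P[<-|xx] _ yT; last by rewrite lt0r nz// nsq_ge0.
    by rewrite lt0r nsq_ge0 andbT; apply/eqP => /(hs _ yT).
  have ga' x y : rect 0 x1 (- T) T (x, y) -> an G (x +i* y) by move=> /rectP[/= /andP[xx _] _]; exact: ga.
  have [vx [vxx [vy [vyy [h1 h2]]]]] := lgm_green ga' pn.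
  rewrite [LHS](cutoff_green a0 x00 x01 ax1 T0 h1).
  transitivity (\int[mu2]_(p in rect 0 x1 (- T) T) (0 : R)).
    by apply: eq_Rintegral => -[x y] /set_mem xy; rewrite h2//= mulr0 !mul0r mulr0.
  by rewrite Rintegral_cst ?mul0r//; exact: measurable_rect.
have gG' := gG; move: gG' => [ga _ _].
have [n0|n0] := eqVneq (nsq G 0 y0) 0; last first.
  apply: IH => // y yT h; have := hs y yT h; rewrite inE => /predU1P[yy|//].
  by move: n0; rewrite -yy h eqxx.
have [yT|yT] := boolP (- T <= y0 <= T); last first.
  apply: IH => // y yT' h; have := hs y yT' h; rewrite inE => /predU1P[yy|//].
  by move: yT; rewrite -yy yT'.
have [[r r0 hr]|[m [g [ang gn0 [r r0 hr]]]]] := an_zero (ga 0 y0 (lexx _)).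
  have := nz r y0 r0; rewrite nsq_eq0 (_ : r +i* y0 = (0 +i* y0) + r%:C) ?hr ?eqxx//.
    by rewrite normc_real gtr0_norm.
  by apply: eqc => /=; rewrite ?add0r ?addr0.
have uu : 0 <= (0 : R) < x0 by rewrite lexx.
have [G1 [gG1 G1s G1E]] := factor_good gG uu ang r0 hr.
have ne x y : nsq G x y != 0 -> x +i* y != 0 +i* y0.
  by apply: contra_neq => -[-> ->].
have n1 x y : nsq G x y != 0 -> nsq G1 x y != 0.
  move=> h; apply: contra_neq h => h; rewrite (nsqM (H1 := fun w => lin 0 y0 w ^+ m) (H2 := G1)) ?h ?mulr0//.
  have [e|/G1E //] := eqVneq (x +i* y) (0 +i* y0).
  by move: h; rewrite nsqE e G1s -normcX => /eqP; rewrite normc_eq0 expf_eq0 (negbTE gn0).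
have nz1 x y : 0 < x -> nsq G1 x y != 0 by move=> xx; apply: n1; exact: nz.
have := IH G1 gG1 nz1.
have hs1 y : - T <= y <= T -> nsq G1 0 y = 0 -> y \in s.
  move=> yT' h; have yy : y != y0.
    by apply/eqP => e; move: h; rewrite e => /eqP; rewrite nsq_eq0 G1s (negbTE gn0).
  have : nsq G 0 y = 0.
    rewrite (nsqM (H1 := fun w => lin 0 y0 w ^+ m) (H2 := G1)) ?h ?mulr0//.
    by apply: G1E; apply: contra_neq yy => -[].
  by move=> /(hs y yT'); rewrite inE (negbTE yy).
move=> /(_ hs1) e1.
have e2 : ET T (lgm (lin 0 y0) 0) + WT T (lgm (lin 0 y0) 0) = 0.
  by rewrite point_mass_T// cutoff_boundary ?mul0r//; [exact: lt0r_neq0|left].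
have lE x y : nsq G x y != 0 -> m%:R * lgm (lin 0 y0) 0 x y + lgm G1 0 x y = lgm G 0 x y.
  move=> h; rewrite (lgm_factor (G := G) (u := 0) (v := y0) (G1 := G1) (m := m) (ne _ _ h))//; last exact: n1.
  by apply: G1E; exact: ne.
have gl := good_lin y0 x00.
have [mZ Z0 iG _] := log_inequality a0 x00 x01 ax1 gG.
have E1 : ET T (lgm G 0) = m%:R * ET T (lgm (lin 0 y0) 0) + ET T (lgm G1 0).
  have mI : measurable (`[- T, T]%classic : set RR) by exact: measurable_itv.
  have i1 := ET_int gl T1; have i2 := ET_int gG1 T1; have i3 := ET_int gG T1.
  have i4 := intgZ m%:R mI i1.
  have [|_ e3] := Rint_ae_eq mI mZ Z0 (intgD mI i4 i2) (intg_meas i3).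
    by move=> y _ /eqP h; rewrite -(lE _ _ h); ring.
  rewrite /ET /lineE_T -e3 (RintegralD mI i4 i2); congr (_ + _).
  by rewrite -(@RintegralZl _ _ _ mu `[- T, T] (fun y => lgm (lin 0 y0) 0 0 y * (chi T y / ch y)) m%:R mI i1).
have E2 : WT T (lgm G 0) = m%:R * WT T (lgm (lin 0 y0) 0) + WT T (lgm G1 0).
  have mR := measurable_rect 0 x1 (- T) T; have [mN N0] := axis_null.
  have i1 := WT_int gl T1; have i2 := WT_int gG1 T1; have i3 := WT_int gG T1.
  have i4 := intgZ m%:R mR i1.
  have [|_ e3] := Rint_ae_eq mR mN N0 (intgD mR i4 i2) (intg_meas i3).
    move=> [x y] /rectP[/= /andP[xx _] _] hx; have h : nsq G x y != 0.
      by apply: nz; rewrite lt0r xx andbT; apply/eqP => x_0; apply: hx; split.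
    by rewrite -(lE _ _ h); ring.
  rewrite /WT /stripW_T -e3 (RintegralD mR i4 i2); congr (_ + _).
  by rewrite -(@RintegralZl _ _ _ mu2 (rect 0 x1 (- T) T) (fun p : RR * RR => lgm (lin 0 y0) 0 p.1 p.2 * kernT a x0 x1 T p.1 p.2) m%:R mR i1).
rewrite E1 E2; move: e1 e2; set A1 := ET T _; set B1 := WT T _; set A2 := ET T _; set B2 := WT T _ => e1 e2.
have -> : m%:R * A2 + A1 + (m%:R * B2 + B1) = m%:R * (A2 + B2) + (A1 + B1) by ring.
by rewrite e1 e2 mulr0 addr0.
Qed.

(** Zeros on the line are isolated, since [G] does not vanish to the right of it, and a compact
    segment contains finitely many. The covering form of compactness is used with the filter on
    lists generated by inclusion, so that the local lists can be merged. *)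
Lemma zero_list G T : good x0 G -> (forall x y, 0 < x -> nsq G x y != 0) ->
  exists s : seq R, forall y, - T <= y <= T -> nsq G 0 y = 0 -> y \in s.
Proof.
move=> [ga _ _] nz; have K := @segment_compact R (- T) T.
pose F : set_system (seq R) := [set A : set (seq R) | exists s0 : seq R, forall s : seq R, {subset s0 <= s} -> A s].
have FF : Filter F.
  split; first by exists [::].
    by move=> A B [sA hA] [sB hB]; exists (sA ++ sB) => s h; split; [apply: hA|apply: hB] => z zs;
      apply: h; rewrite mem_cat zs ?orbT.
  by move=> A B AB [sA hA]; exists sA => s /hA; exact: AB.
have := (compact_near_coveringP _).1 K _ F (fun (s : seq R) (y : R) => nsq G 0 y = 0 -> y \in s) FF.
case=> [y _|s0 /(_ s0) h]; last first.
  by exists s0 => y yT; apply: h => //=; rewrite in_itv.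
have [[r r0 hr]|[m [g [ang gn0 [r r0 hr]]]]] := an_zero (ga 0 y (lexx _)).
  have := nz r y r0; rewrite nsq_eq0 (_ : r +i* y = (0 +i* y) + r%:C) ?hr ?eqxx//.
    by rewrite normc_real gtr0_norm.
  by apply: eqc => /=; rewrite ?add0r ?addr0.
have gc := an_ccont ang; have g0 : 0 < normc (g (0 +i* y)) / 2 by rewrite divr_gt0// normc_gt0.
have [r1 r10 hg] := gc _ g0; pose d := Num.min r r1; have d0 : 0 < d by rewrite lt_min r0.
exists (ball y d, [set s : seq R | y \in s]) => /=.
  split; first exact: nbhsx_ballx.
  by exists [:: y] => s h; apply: h; rewrite inE.
move=> [y' s] [/= yd ys] /eqP; rewrite nsq_eq0 (_ : 0 +i* y' = (0 +i* y) + (0 +i* (y' - y))); last first.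
  by apply: eqc => /=; ring.
have zd : normc (0 +i* (y' - y)) <= d.
  apply: le_trans (normc_leD _) _; rewrite /= normr0 add0r distrC; exact: ltW.
rewrite hr; last by apply: le_trans zd _; rewrite ge_min lexx.
rewrite mulf_eq0 expf_eq0 => /orP[/andP[_ /eqP[/eqP]]|/eqP gz].
  by rewrite subr_eq0 => /eqP ->.
have := hg _ (le_trans zd _); rewrite gz sub0r normcN => /(_ _) h.
exfalso; have : normc (g (0 +i* y)) <= normc (g (0 +i* y)) / 2 by apply: h; rewrite ge_min lexx orbT.
by move: g0; move: (normc _) => q; lra.
Qed.

Lemma jensen_zero_free G : good x0 G -> (forall x y, 0 < x -> nsq G x y != 0) ->
  E (lgm G 0) + W (lgm G 0) = 0.
Proof.
move=> gG nz; have [_ _ iE _] := log_inequality a0 x00 x01 ax1 gG.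
have iS := strip_log_int a0 x00 x01 ax1 gG.
have [c1 c2] := strip_limit a0 x00 x01 ax1 iE iS.
apply: (cvg_unique _ (cvgD c1 c2)) => //.
rewrite [X in X @ _](_ : _ = fun=> 0); first exact: cvg_cst.
apply: funext => n /=; have [s hs] := zero_list n.+1%:R gG nz.
by apply: (jensen_T _ gG nz hs); rewrite ler1n.
Qed.

Lemma stripW_int H : good x0 H ->
  intg mu2 (strip x1) (fun p : RR * RR => lgm H 0 p.1 p.2 * kern a x0 x1 p.1 p.2).
Proof.
move=> gH; have [Cu Cu0 hu] := lgm_upper x1 gH; have [Cl Cl0 hl] := lgm_lower x1 gH.
apply: (stripW_bound a0 x00 x01 ax1 gH (addr_ge0 Cu0 Cl0) _).1 => x y /andP[xx xX].
have y0 : 0 <= 1 + `|y| by rewrite addr_ge0.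
have hu' : lgm H 0 x y <= Cu * (1 + `|y|).
  by apply: hu; rewrite ?lexx ?ler01// xX andbT (le_trans _ xx)// ltW.
have hl' : - (Cl * (1 + `|y|)) <= lgm H 0 x y by apply: hl => //; rewrite xx.
have := mulr_ge0 Cu0 y0; have := mulr_ge0 Cl0 y0.
by rewrite ler_norml mulrDl => ? ?; apply/andP; split; lra.
Qed.

(** A zero of order [m] contributes [m * 2 pi * green_h a u v > 0], and [log_inequality] keeps the
    contribution of the quotient nonnegative regardless of its other zeros. That [G] vanishes
    identically near the zero is excluded by following the horizontal segment to [x0]. *)
Lemma jensen_zero G u v : good x0 G -> 0 < u -> nsq G u v = 0 -> 0 < E (lgm G 0) + W (lgm G 0).
Proof.
move=> gG u0 n0; have [ga _ _] := gG.
have ux : u < x0 by rewrite ltNge; apply/negP => /(good_neq0 v gG); rewrite n0 eqxx.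
have uu : 0 <= u < x0 by rewrite ltW.
have [va|[m [g [ang gn0 [r r0 hr]]]]] := an_zero (ga u v (ltW u0)).
  have [r r0 hr] : vanish G ((u +i* v) + (x0 - u)%:C).
    apply: an_identity_segment va => t /andP[t0 t1].
    rewrite (_ : _ + _ = (u + t * (x0 - u)) +i* v).
      by apply: ga; rewrite addr_ge0 ?mulr_ge0 ?subr_ge0// ltW.
    by apply: eqc => /=; ring.
  have := good_neq0 v gG (lexx x0); rewrite nsq_eq0.
  have := hr 0; rewrite normc0 => /(_ (ltW r0)); rewrite addr0.
  rewrite (_ : _ + _ = x0 +i* v); first by move=> ->; rewrite eqxx.
  by apply: eqc => /=; ring.
have m0 : (0 < m)%N.
  rewrite lt0n; apply/eqP => m0; move/eqP: n0; rewrite nsq_eq0.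
  have := hr 0; rewrite normc0 addr0 m0 expr0 mul1r => /(_ (ltW r0)) ->.
  by rewrite (negbTE gn0).
have [G1 [gG1 G1s G1E]] := factor_good gG uu ang r0 hr.
have gl := good_lin v ux.
have [_ _ i3 _] := log_inequality a0 x00 x01 ax1 gG.
have [mZ Z0 i2 ineq] := log_inequality a0 x00 x01 ax1 gG1.
have [_ _ i1 _] := log_inequality a0 x00 x01 ax1 gl.
have ne0 y : 0 +i* y != u +i* v by apply/eqP => -[uE _]; move: u0; rewrite -uE ltxx.
have E1 : E (lgm G 0) = m%:R * E (lgm (lin u v) 0) + E (lgm G1 0).
  have i4 := intgZ m%:R measurableT i1.
  have [|_ e3] := Rint_ae_eq measurableT mZ Z0 (intgD measurableT i4 i2) (intg_meas i3).
    by move=> y _ /eqP h; rewrite (lgm_factor (ne0 y) (G1E _ (ne0 y)) h); ring.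
  rewrite /E /lineE -e3 (RintegralD measurableT i4 i2); congr (_ + _).
  by rewrite (@RintegralZl _ _ _ mu setT (fun y => lgm (lin u v) 0 0 y / cosh (a * y)) m%:R measurableT i1).
have E2 : W (lgm G 0) = m%:R * W (lgm (lin u v) 0) + W (lgm G1 0).
  have mS := measurable_strip x1 (R := R).
  have j1 := stripW_int gl; have j2 := stripW_int gG1; have j4 := intgZ m%:R mS j1.
  rewrite /W /stripW.
  rewrite -(@RintegralZl _ _ _ mu2 (strip x1) (fun p : RR * RR => lgm (lin u v) 0 p.1 p.2 * kern a x0 x1 p.1 p.2) m%:R mS j1).
  rewrite -(RintegralD mS j4 j2); apply: eq_Rintegral => -[x y] _ /=.
  have [xx|xx] := leP x x0; first by rewrite kern_eq0// !mulr0 addr0.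
  have ne : x +i* y != u +i* v by apply/eqP => -[xu _]; move: xx ux; rewrite xu; lra.
  rewrite (lgm_factor ne (G1E _ ne)); first by ring.
  exact: (good_neq0 y gG1 (ltW xx)).
have pm := point_mass v uu.
have hp : 0 < green_h a u v.
  by apply: (green_h_gt0 a0 x10 ax1); rewrite u0 ltW// (lt_trans ux).
have mm : 0 < (m%:R : R) * (2 * pi * green_h a u v).
  by rewrite mulr_gt0 ?ltr0n// mulr_gt0// mulr_gt0// pi_gt0.
have e : E (lgm G 0) + W (lgm G 0) = m%:R * (E (lgm (lin u v) 0) + W (lgm (lin u v) 0)) + (E (lgm G1 0) + W (lgm G1 0)).
  by rewrite E1 E2; ring.
by rewrite e pm ltr_pwDl.
Qed.

End Jensen.

(** * Fourier transforms of hyperbolic functions *)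

Section LineShift.
Context {R : realType}.
Notation mu := (@lebesgue_measure R).
Notation RR := (measurableTypeR R).
Implicit Types (x y b c K : R) (u v w : R -> R -> R).

(* Cauchy's theorem on a strip, for the real part: [u + i v] is holomorphic. *)
Lemma line_shift u v w b c K : b <= c ->
  (forall x y, b <= x <= c -> dv (u^~ y) x (w x y)) ->
  (forall x y, b <= x <= c -> dv (v x) y (w x y)) ->
  (forall x y, b <= x <= c -> cont2 w x y) ->
  (forall x y, b <= x <= c -> {for x, continuous (v^~ y)}) ->
  (forall x y, b <= x <= c -> y != 0 -> `|v x y| <= K / `|y|) ->
  intg mu setT (u b) -> intg mu setT (u c) ->
  \int[mu]_y u b y = \int[mu]_y u c y.
Proof.
move=> bc hu hv cw cv hK ib ic.
have mI n : measurable (`[- n.+1%:R, n.+1%:R]%classic : set RR) by exact: measurable_itv.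
have lim f : intg mu setT f -> (fun n => \int[mu]_(y in `[- n.+1%:R, n.+1%:R]) f y) @ \oo --> \int[mu]_y f y.
  move=> fi; have [] := @Rdct_expand _ _ R mu setT (fun n => `[- n.+1%:R, n.+1%:R]%classic)
    (fun _ => f) f (fun y => `|f y|) measurableT mI => //.
  - by move=> y _; exact: near_itv.
  - by move=> n; apply: measurable_funS (intg_meas fi).
  - by move=> y _; exact: cvg_cst.
  - exact: intg_norm.
have K0 : 0 <= K.
  have := le_trans (normr_ge0 _) (hK b 1 _ _); rewrite normr1 divr1; apply => //.
  by rewrite lexx.
have key n : `|\int[mu]_(y in `[- n.+1%:R, n.+1%:R]) u c y - \int[mu]_(y in `[- n.+1%:R, n.+1%:R]) u b y|
    <= 2 * K * (c - b) * n.+1%:R^-1.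
  have N0 : (0 : R) < n.+1%:R by [].
  have NN : - n.+1%:R <= (n.+1%:R : R) by lra.
  have cp p : rect b c (- n.+1%:R) n.+1%:R p -> {for p, continuous (fun p : R * R => w p.1 p.2)}.
    by case: p => x y /rectP[/= xx _]; exact: cw.
  have [f1 f2] := rect_fubini bc NN cp.
  have e1 : \int[mu]_(y in `[- n.+1%:R, n.+1%:R]) \int[mu]_(x in `[b, c]) w x y =
    \int[mu]_(y in `[- n.+1%:R, n.+1%:R]) u c y - \int[mu]_(y in `[- n.+1%:R, n.+1%:R]) u b y.
    have jb : intg mu `[- n.+1%:R, n.+1%:R] (u b) by apply: (intgS measurableT) ib.
    have jc : intg mu `[- n.+1%:R, n.+1%:R] (u c) by apply: (intgS measurableT) ic.
    rewrite -(RintegralB (mI n) jc jb); apply: eq_Rintegral => y _.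
    rewrite (@Rftc _ _ (u^~ y))// => x xx; first exact: hu.
    exact: (section2_cont (cw x y xx)).
  rewrite -e1 -f2 f1.
  have e2 : \int[mu]_(x in `[b, c]) \int[mu]_(y in `[- n.+1%:R, n.+1%:R]) w x y =
     \int[mu]_(x in `[b, c]) (v x n.+1%:R - v x (- n.+1%:R)).
    apply: eq_Rintegral => x /set_mem /=; rewrite in_itv /= => xx.
    rewrite (@Rftc _ _ (v x))// => y yy; first exact: hv.
    exact: (section1_cont (cw x y xx)).
  have i2 : intg mu `[b, c] (fun=> 2 * K * n.+1%:R^-1) by apply: cont_intg => x _; exact: cvg_cst.
  rewrite e2; apply: (@le_trans _ _ (\int[mu]_(x in `[b, c]) (2 * K * n.+1%:R^-1))); last first.
    rewrite Rintegral_cst//= lebesgue_measure_itv /= lte_fin.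
    by case: ltP => // h; [rewrite mulrAC|rewrite mulr0 !mulr_ge0 ?subr_ge0 ?invr_ge0].
  apply: Rint_norm_le => //.
    apply: intg_meas; apply: cont_intg => x xx; apply: cvgB; exact: cv.
  move=> x /=; rewrite in_itv /= => xx; apply: le_trans (ler_normB _ _) _.
  have := hK x n.+1%:R xx (lt0r_neq0 N0); have := hK x (- n.+1%:R) xx.
  rewrite !normrN !(gtr0_norm N0) oppr_eq0 => /(_ (lt0r_neq0 N0)).
  rewrite -mulrA mulr_natl mulr2n => h1 h2; exact: lerD.
have c1 := lim _ ib; have c2 := lim _ ic.
have c3 : (fun n => \int[mu]_(y in `[- n.+1%:R, n.+1%:R]) u c y - \int[mu]_(y in `[- n.+1%:R, n.+1%:R]) u b y) @ \oo --> (0 : R).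
  by apply: (@squeeze_harmonic _ _ _ (2 * K * (c - b))) => n; rewrite subr0.
have c4 : (fun n => \int[mu]_(y in `[- n.+1%:R, n.+1%:R]) u c y - \int[mu]_(y in `[- n.+1%:R, n.+1%:R]) u b y) @ \oo --> \int[mu]_y u c y - \int[mu]_y u b y by exact: cvgB.
by apply/esym/eqP; rewrite -subr_eq0; apply/eqP; exact: (cvg_unique _ c4 c3).
Qed.

End LineShift.

Section SechTransform.
Context {R : realType}.
Notation mu := (@lebesgue_measure R).
Notation RR := (measurableTypeR R).
Implicit Types (x y l t : R).
Variables (a : R).
Hypothesis a0 : 0 < a.
Let ch y := cosh (a * y).
Let sh := sinha a.
Let chp y : 0 < ch y. Proof. exact: ch_gt0. Qed.

Lemma sin_le_id t : 0 <= t -> sin t <= t.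
Proof.
rewrite le_eqVlt => /predU1P[<-|t0]; first by rewrite sin0.
have [c _ h] := dv_MVT t0 (fun x _ => dv_sin (dv_id x)).
by rewrite sin0 !subr0 mulr1 in h; rewrite h ler_piMl ?(ltW t0)// cos_le1.
Qed.

Lemma sin_sqr_le t : sin t ^+ 2 <= t ^+ 2.
Proof.
wlog t0 : t / 0 <= t.
  by move=> H; have [/H//|t0] := leP 0 t; rewrite -sqrrN -sinN -[leRHS]sqrrN H// oppr_ge0 ltW.
have [tp|tp] := leP t 1; last first.
  have := sin_le1 t; have := sin_geN1 t; nra.
have := sin_le_id t0; have h : 0 <= sin t.
  apply: sin_ge0_pi; rewrite t0 /= (le_trans tp)//; have := pi_ge2 R; lra.
nra.
Qed.

Lemma sin_ge_half t : 0 <= t <= 1 -> t / 2 <= sin t.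
Proof.
move=> /andP[]; rewrite le_eqVlt => /predU1P[<- _|t0 t1]; first by rewrite sin0 mul0r.
have [c /andP[c0 ct] h] := dv_MVT t0 (fun x _ => dv_sin (dv_id x)).
rewrite sin0 !subr0 mulr1 in h; rewrite h mulrC ler_pM2r//.
have e : cos c = 1 - 2 * sin (c / 2) ^+ 2.
  by rewrite {1}(_ : c = (c / 2) *+ 2) ?cos_mulr2n ?cos2sin2; [rewrite mulr2n; ring|rewrite mulr2n; field].
by have := sin_sqr_le (c / 2); rewrite e; nra.
Qed.

Lemma exp_sub1_le t : `|expR t - 1| <= `|t| * expR `|t|.
Proof.
have key s : 0 <= s -> expR s - 1 <= s * expR s.
  move=> s0; have := expR_ge1Dx (- s); rewrite expRN => h.
  have p := expR_gt0 s; have := mulVf (lt0r_neq0 p); nra.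
have [t0|t0] := leP 0 t.
  have : 1 <= expR t by rewrite -expR0 ler_expR.
  by move=> h; rewrite !ger0_norm ?subr_ge0// key.
have h : expR t < 1 by rewrite -expR0 ltr_expR.
rewrite ltr0_norm ?subr_lt0// (ltr0_norm t0) opprB.
have := expR_ge1Dx t; have : 1 <= expR (- t) by rewrite -expR0 ler_expR oppr_ge0 ltW.
nra.
Qed.

Lemma sh_ge y : 0 <= y -> a * y <= sh y.
Proof.
rewrite le_eqVlt => /predU1P[<-|y0].
  by rewrite /sh /sinha mulr0 oppr0 subrr mul0r.
have [c /andP[c0 cy] h] := dv_MVT y0 (fun x _ => dv_sh a x).
have s0 : sinha a 0 = 0 by rewrite /sinha mulr0 oppr0 subrr mul0r.
rewrite s0 !subr0 in h; rewrite /sh.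
by rewrite h ler_pM2r// ler_peMr ?(ltW a0)// ch_ge1.
Qed.

Lemma sh_odd y : sh (- y) = - sh y.
Proof. by rewrite /sh /sinha mulrN opprK; ring. Qed.

Lemma sh_sqr_ge y : (a * y) ^+ 2 <= sh y ^+ 2.
Proof.
have [y0|y0] := leP 0 y.
  by rewrite ler_pXn2r ?nnegrE ?sh_ge//; [rewrite mulr_ge0// ltW|apply: le_trans (sh_ge y0); rewrite mulr_ge0// ltW].
have y0' : 0 <= - y by rewrite oppr_ge0 ltW.
rewrite -sqrrN -mulrN -[leRHS]sqrrN -sh_odd ler_pXn2r ?nnegrE ?sh_ge//; first by rewrite mulr_ge0// ltW.
by apply: le_trans (sh_ge y0'); rewrite mulr_ge0// ltW.
Qed.

Lemma sech_mass : intg mu setT (fun y => (ch y)^-1) /\ \int[mu]_y (ch y)^-1 = pi / a.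
Proof.
have dF y : dv (fun y => 2 / a * atan (expR (a * y))) y (ch y)^-1.
  apply: (dv_eq (dvZ (2 / a) (dv_atan (dv_exp (dv_mulc a y))))) => /=.
  rewrite /ch /cosh expRN; have := expR_gt0 (a * y); move: (expR _) => q q0.
  have h1 : q + q^-1 != 0 by rewrite gt_eqF// addr_gt0// invr_gt0.
  have h2 : 1 + q ^+ 2 != 0 by rewrite gt_eqF// addr_gt0// exprn_gt0.
  have -> : q + q^-1 = (1 + q ^+ 2) / q by field; rewrite gt_eqF.
  by field; rewrite h2 !gt_eqF.
have ea n : 1 + a * n%:R <= expR (a * n%:R) by exact: expR_ge1Dx.
have [] := @Rftc_line _ (fun y => (ch y)^-1) (fun y => 2 / a * atan (expR (a * y))) (2 / a * 0) (2 / a * (pi / 2)) dF.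
- by move=> y; apply: cvgV; [rewrite gt_eqF|exact: (dv_cont (dv_ch a y))].
- by move=> y; rewrite invr_ge0 ltW.
- apply: cvgM; first exact: cvg_cst.
  apply: (cvg_comp (fun n : nat => expR (a * n%:R)) atan) (@cvgy_atan R).
  apply/cvgryPge => A; apply: filterS (nbhs_infty_ger (A / a)) => n.
  by rewrite ler_pdivrMr// => h; apply: le_trans (ea n); lra.
- apply: cvgM; first exact: cvg_cst.
  have h : (fun n : nat => expR (a * - n%:R)) @ \oo --> (0 : R).
    apply: (@squeeze_harmonic _ _ _ (1 + a^-1)) => n; rewrite subr0 ger0_norm ?expR_ge0//.
    rewrite mulrN expRN; have p0 : 0 < 1 + a * n%:R by rewrite ltr_pwDl// mulr_ge0// ltW.
    apply: (@le_trans _ _ (1 + a * n%:R)^-1); first by rewrite lef_pV2 ?posrE ?expR_gt0.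
    rewrite -[leLHS]mul1r ler_pdivrMr// mulrAC ler_pdivlMr// mul1r -natr1.
    have n0 : (0 : R) <= n%:R by []; have ai : 0 < a^-1 by rewrite invr_gt0.
    have aa := mulVf (lt0r_neq0 a0); nra.
  have c : {for 0, continuous (@atan R)} := dv_cont (dv_atan (dv_id 0)).
  by have := cvg_comp _ _ h c; rewrite atan0.
move=> i1 ->; split => //; rewrite mulr0 subr0; move: (pi : R) => q; field; exact: lt0r_neq0.
Qed.

Variable l : R.
(** With [z = x + i y], [u + i v] is [(exp (l z) - 1) / sin (a z)]; the subtracted [1] removes the
    singularity at [0]. Here [A + i B] is the numerator, [s + i t] is [sin (a z)], [p - i q] is
    [cos (a z)], [D] is [|sin (a z)|^2], and [w] is the real part of the derivative. On [x = 0] the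
    function [u] is [sin (l y) / sh y]; on [x = pi / (2 a)] it is
    [(exp (l x) cos (l y) - 1) / ch y]. *)
Let A x y := expR (l * x) * cos (l * y) - 1.
Let B x y := expR (l * x) * sin (l * y).
Let s x y := sin (a * x) * ch y.
Let t x y := cos (a * x) * sh y.
Let p x y := cos (a * x) * ch y.
Let q x y := sin (a * x) * sh y.
Let D x y := s x y ^+ 2 + t x y ^+ 2.
Let u x y := (A x y * s x y + B x y * t x y) / D x y.
Let v x y := (B x y * s x y - A x y * t x y) / D x y.
Let w x y := ((l * (A x y + 1) * s x y + A x y * (a * p x y) + l * B x y * t x y - B x y * (a * q x y)) * D x y
   - (A x y * s x y + B x y * t x y) * (2 * s x y * (a * p x y) - 2 * t x y * (a * q x y))) / D x y ^+ 2.

Let DE x y : D x y = sin (a * x) ^+ 2 + sh y ^+ 2.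
Proof. have e : ch y ^+ 2 = 1 + sh y ^+ 2 := ch2sh2 a y.
transitivity (sin (a * x) ^+ 2 * ch y ^+ 2 + cos (a * x) ^+ 2 * sh y ^+ 2); first by rewrite /D /s /t; ring.
by rewrite e cos2sin2; ring. Qed.

Let Dsh x y : sh y ^+ 2 <= D x y. Proof. by rewrite DE lerDr sqr_ge0. Qed.

Let D_gt0 x y : 0 < a * x <= pi / 2 -> 0 < D x y.
Proof.
move=> /andP[x0 x2]; rewrite DE ltr_pwDl ?sqr_ge0// exprn_gt0//.
by apply: sin_gt0_pi; rewrite x0; have := pi_gt0 R; lra.
Qed.

Let D_gt0y x y : y != 0 -> 0 < D x y.
Proof.
move=> y0; apply: lt_le_trans (Dsh x y); apply: lt_le_trans (sh_sqr_ge y).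
by rewrite lt0r sqr_ge0 andbT expf_neq0// mulf_neq0// gt_eqF.
Qed.

Let dmul x : dv (fun x => l * x) x l. Proof. exact: dv_mulc. Qed.

Let Ax x y : dv (A^~ y) x (l * (A x y + 1)).
Proof.
apply: (dv_eq (dvB (dvM (dv_exp (dmul x)) (dv_cst (cos (l * y)) x)) (dv_cst 1 x))) => /=.
by rewrite /A; ring.
Qed.
Let Bx x y : dv (B^~ y) x (l * B x y).
Proof. by apply: (dv_eq (dvM (dv_exp (dmul x)) (dv_cst (sin (l * y)) x))) => /=; rewrite /B; ring. Qed.
Let Ay x y : dv (A x) y (- (l * B x y)).
Proof.
apply: (dv_eq (dvB (dvM (dv_cst (expR (l * x)) y) (dv_cos (dmul y))) (dv_cst 1 y))) => /=.
by rewrite /B; ring.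
Qed.
Let By x y : dv (B x) y (l * (A x y + 1)).
Proof. by apply: (dv_eq (dvM (dv_cst (expR (l * x)) y) (dv_sin (dmul y)))) => /=; rewrite /A; ring. Qed.
Let sx x y : dv (s^~ y) x (a * p x y).
Proof. by apply: (dv_eq (dvM (dv_sn a x) (dv_cst (ch y) x))) => /=; rewrite /p; ring. Qed.
Let tx x y : dv (t^~ y) x (- (a * q x y)).
Proof. by apply: (dv_eq (dvM (dv_cs a x) (dv_cst (sh y) x))) => /=; rewrite /q; ring. Qed.
Let sy x y : dv (s x) y (a * q x y).
Proof. by apply: (dv_eq (dvM (dv_cst (sin (a * x)) y) (dv_ch a y))) => /=; rewrite /q /sh; ring. Qed.
Let ty x y : dv (t x) y (a * p x y).
Proof. by apply: (dv_eq (dvM (dv_cst (cos (a * x)) y) (dv_sh a y))) => /=; rewrite /p /ch; ring. Qed.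

Let ux x y : 0 < D x y -> dv (u^~ y) x (w x y).
Proof.
move=> D0; have Dx := dvD (dvX2 (sx x y)) (dvX2 (tx x y)).
have H := dvM (dvD (dvM (Ax x y) (sx x y)) (dvM (Bx x y) (tx x y))) (dvV (f := D^~ y) (lt0r_neq0 D0) Dx).
apply: (dv_eq H) => /=; rewrite /w.
by move: (lt0r_neq0 D0); move: (D x y) => d d0; field.
Qed.

Let vx x y : 0 < D x y -> {for x, continuous (v^~ y)}.
Proof.
move=> D0; have Dx := dvD (dvX2 (sx x y)) (dvX2 (tx x y)).
have H := dvM (dvB (dvM (Bx x y) (sx x y)) (dvM (Ax x y) (tx x y))) (dvV (f := D^~ y) (lt0r_neq0 D0) Dx).
exact: (dv_cont H).
Qed.

Let vy x y : 0 < D x y -> dv (v x) y (w x y).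
Proof.
move=> D0; have Dy := dvD (dvX2 (sy x y)) (dvX2 (ty x y)).
have H := dvM (dvB (dvM (By x y) (sy x y)) (dvM (Ay x y) (ty x y))) (dvV (f := D x) (lt0r_neq0 D0) Dy).
apply: (dv_eq H) => /=; rewrite /w.
move: (lt0r_neq0 D0); rewrite /D; move: (s x y) (t x y) (A x y) (B x y) (p x y) (q x y) => s' t' A' B' p' q' d0.
by field.
Qed.

Let cA x y : cont2 A x y.
Proof.
apply: cont2B; last exact: cont2_cst.
apply: cont2M; first exact: cont2_x (dv_cont (dv_exp (dmul x))).
exact: cont2_y (dv_cont (dv_cos (dmul y))).
Qed.
Let cB x y : cont2 B x y.
Proof.
apply: cont2M; first exact: cont2_x (dv_cont (dv_exp (dmul x))).
exact: cont2_y (dv_cont (dv_sin (dmul y))).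
Qed.
Let cs' x y : cont2 s x y. Proof. by apply: cont2M; [exact: cont2_sn|exact: cont2_ch]. Qed.
Let ct' x y : cont2 t x y. Proof. by apply: cont2M; [exact: cont2_cs|exact: cont2_sh]. Qed.
Let cp' x y : cont2 p x y. Proof. by apply: cont2M; [exact: cont2_cs|exact: cont2_ch]. Qed.
Let cq' x y : cont2 q x y. Proof. by apply: cont2M; [exact: cont2_sn|exact: cont2_sh]. Qed.
Let cD x y : cont2 D x y. Proof. by apply: cont2D; exact: cont2X2. Qed.

Let cw x y : 0 < D x y -> cont2 w x y.
Proof.
move=> D0; have k (c : R) : cont2 (fun _ _ => c) x y by exact: cont2_cst.
apply: cont2M; last by apply: cont2V; [rewrite expf_neq0// gt_eqF|exact: cont2X2].
apply: cont2B; apply: cont2M => //.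
  apply: cont2B; last by apply: cont2M => //; exact: cont2M.
  apply: cont2D; last by apply: cont2M => //; exact: cont2M.
  apply: cont2D; last by apply: cont2M => //; exact: cont2M.
  by apply: cont2M => //; apply: cont2M => //; exact: cont2D.
  by apply: cont2D; exact: cont2M.
apply: cont2B; apply: cont2M; (try exact: cont2M).
Qed.

Let N2 x y := A x y ^+ 2 + B x y ^+ 2.

Let uvE x y : 0 < D x y -> u x y ^+ 2 * D x y <= N2 x y /\ v x y ^+ 2 * D x y <= N2 x y.
Proof.
move=> D0; have e : u x y ^+ 2 * D x y + v x y ^+ 2 * D x y = N2 x y.
  rewrite /u /v /N2; move: (lt0r_neq0 D0); rewrite /D; move: (s x y) (t x y) => s' t' d0.
  by field.
by have := mulr_ge0 (sqr_ge0 (u x y)) (ltW D0); have := mulr_ge0 (sqr_ge0 (v x y)) (ltW D0); lra.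
Qed.

Let N2E x y : N2 x y = (expR (l * x) - 1) ^+ 2 + 2 * expR (l * x) * (1 - cos (l * y)).
Proof.
rewrite /N2 /A /B exprMn -[sin _ ^+ 2]addr0 -(subrr (cos (l * y) ^+ 2)) addrA (addrC (sin _ ^+ 2)) cos2Dsin2; ring.
Qed.

Let C1 := expR (`|l| * (pi / (2 * a))) + 1.
Let C10 : 0 < C1. Proof. by rewrite addr_gt0 ?expR_gt0. Qed.

Let N2_le x y : 0 <= a * x <= pi / 2 -> N2 x y <= C1 ^+ 2.
Proof.
move=> /andP[x0 x2]; rewrite N2E.
have x0' : 0 <= x by rewrite -(@pmulr_rge0 _ a).
have e0 := expR_gt0 (l * x); have h : expR (l * x) <= C1 - 1.
  rewrite /C1 addrK ler_expR; apply: (@le_trans _ _ (`|l| * x)); first by rewrite ler_wpM2r// ler_norm.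
  rewrite ler_wpM2l// ler_pdivlMr ?mulr_gt0//; lra.
have := cos_geN1 (l * y); nra.
Qed.

Let c2 := 4 * (expR (`|l| / a)) ^+ 2 * l ^+ 2 / a ^+ 2.

Let c20 : 0 <= c2. Proof. by rewrite /c2 mulr_ge0 ?invr_ge0 ?sqr_ge0// mulr_ge0 ?sqr_ge0// mulr_ge0 ?sqr_ge0. Qed.

(** The removable singularity made quantitative: for [a x <= 1] the numerator is at most of order
    [|l z|] and [|sin (a z)|] at least of order [|a z|]. *)
Let N2_leD x y : 0 <= a * x <= 1 -> N2 x y <= c2 * D x y.
Proof.
move=> xx; have /andP[x0 x1] := xx; rewrite N2E.
have x0' : 0 <= x by rewrite -(@pmulr_rge0 _ a).
pose Q := expR (`|l| / a); have Q0 : 0 < Q by exact: expR_gt0.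
have Q1 : 1 <= Q by rewrite -expR0 ler_expR divr_ge0// ltW.
have lx : `|l * x| <= `|l| / a.
  by rewrite normrM (ger0_norm x0') ler_wpM2l// -[leRHS]mul1r ler_pdivlMr// mulrC.
have e0 := expR_gt0 (l * x); have eQ : expR (l * x) <= Q.
  by rewrite ler_expR (le_trans _ lx)// ler_norm.
have h1 : (expR (l * x) - 1) ^+ 2 <= (l * x) ^+ 2 * Q ^+ 2.
  rewrite -exprMn -[leLHS]real_normK ?num_real// -[leRHS]real_normK ?num_real//.
  rewrite ler_pXn2r ?nnegrE ?normr_ge0//; apply: le_trans (exp_sub1_le _) _.
  by rewrite [leRHS]normrM (gtr0_norm Q0) ler_wpM2l// ler_expR.
have h2 : 1 - cos (l * y) <= (l * y) ^+ 2 / 2.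
  have e : cos (l * y) = 1 - 2 * sin (l * y / 2) ^+ 2.
    by rewrite {1}(_ : l * y = (l * y / 2) *+ 2) ?cos_mulr2n ?cos2sin2; [rewrite mulr2n; ring|rewrite mulr2n; field].
  by have := sin_sqr_le (l * y / 2); rewrite e; lra.
have h20 : 0 <= 1 - cos (l * y) by rewrite subr_ge0 cos_le1.
have h3 : 2 * expR (l * x) * (1 - cos (l * y)) <= (l * y) ^+ 2 * Q ^+ 2.
  have y2 := sqr_ge0 (l * y).
  apply: (@le_trans _ _ (2 * Q * ((l * y) ^+ 2 / 2))).
    by apply: ler_pM => //; rewrite ?ler_pM2l// ?mulr_ge0// ltW.
  rewrite (_ : 2 * Q * _ = (l * y) ^+ 2 * Q); last by field.
  by rewrite ler_wpM2l//; nra.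
have d1 : (a * x / 2) ^+ 2 + (a * y) ^+ 2 <= D x y.
  rewrite DE lerD ?sh_sqr_ge// ler_pXn2r ?nnegrE ?divr_ge0//; first exact: sin_ge_half.
  by apply: le_trans (sin_ge_half xx); rewrite divr_ge0.
apply: (@le_trans _ _ (c2 * ((a * x / 2) ^+ 2 + (a * y) ^+ 2))); last first.
  by rewrite ler_wpM2l.
apply: (@le_trans _ _ (l ^+ 2 * Q ^+ 2 * (x ^+ 2 + y ^+ 2))).
  by rewrite mulrDr; move: h1 h3; rewrite !exprMn; lra.
rewrite /c2 -/Q (_ : 4 * _ ^+ 2 * _ / _ * _ = l ^+ 2 * Q ^+ 2 * (x ^+ 2 + 4 * y ^+ 2)); last first.
  by field; rewrite gt_eqF.
apply: ler_wpM2l; first by rewrite mulr_ge0 ?sqr_ge0.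
by have := sqr_ge0 y; lra.
Qed.

(** Near the origin [N2_leD] bounds [u], far away the growth of [sh] does. Adding the two bounds
    through [ch ^ 2 = 1 + sh ^ 2] gives one estimate, uniform up to the line [x = 0]. *)
Let u_le x y : 0 <= a * x <= 1 -> 0 < D x y -> `|u x y| <= (1 + c2 + C1 ^+ 2) / ch y.
Proof.
move=> xx D0; have [h1 _] := uvE D0.
have xx2 : 0 <= a * x <= pi / 2.
  by case/andP: xx => -> /= /le_trans; apply; have := pi_ge2 R; lra.
have h2 : u x y ^+ 2 <= c2.
  by rewrite -(ler_pM2r D0); apply: le_trans h1 _; exact: N2_leD.
have h3 : u x y ^+ 2 * sh y ^+ 2 <= C1 ^+ 2.
  apply: le_trans (N2_le y xx2); apply: le_trans h1; rewrite ler_wpM2l ?sqr_ge0//.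
have h4 : (u x y * ch y) ^+ 2 <= c2 + C1 ^+ 2.
  by rewrite exprMn (ch2sh2 a y : ch y ^+ 2 = 1 + sh y ^+ 2) mulrDr mulr1 lerD.
rewrite ler_pdivlMr// -[X in _ * X](gtr0_norm (chp y)) -normrM.
by move: h4; rewrite -real_normK ?num_real//; have := sqr_ge0 (`|u x y * ch y| - 1); have := sqr_ge0 `|u x y * ch y|; lra.
Qed.


Let S := \int[mu]_y (cos (l * y) / ch y).
Let M := 1 + c2 + C1 ^+ 2.

Let ich : intg mu setT (fun y => M / ch y).
Proof. by apply: intgZ => //; exact: sech_mass.1. Qed.

Let cch y : {for y, continuous (fun y => (ch y)^-1)}.
Proof. by apply: cvgV; [rewrite gt_eqF|exact: (dv_cont (dv_ch a y))]. Qed.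

Lemma cos_sech_int : intg mu setT (fun y => cos (l * y) / ch y).
Proof.
apply: (le_intg measurableT) sech_mass.1.
  apply: continuous_measurable_fun; suff h : continuous (fun y : R => cos (l * y) / ch y) by [].
  by move=> y; apply: cvgM; [exact: (dv_cont (dv_cos (dmul y)))|exact: cch].
move=> y _; rewrite normrM normfV (gtr0_norm (chp y)) ler_piMl ?invr_ge0 ?(ltW (chp y))//.
exact: cos_max.
Qed.

Let X := pi / (2 * a).
Let aX : a * X = pi / 2.
Proof. by rewrite /X; move: (pi : R) => z; field; exact: lt0r_neq0. Qed.

Let u_end : intg mu setT (u X) /\ \int[mu]_y u X y = expR (l * X) * S - pi / a.
Proof.
have e : u X = fun y => expR (l * X) * (cos (l * y) / ch y) - (ch y)^-1.
  apply: funext => y; rewrite /u /D /A /B /s /t aX sin_pihalf cos_pihalf; have := chp y; move: (ch y) => z z0.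
  rewrite !mul1r !mul0r mulr0 expr0n /= !addr0.
  by field; rewrite gt_eqF.
have i1 := intgZ (expR (l * X)) measurableT cos_sech_int; have [i2 i3] := sech_mass.
rewrite e; split; first exact: intgB.
rewrite (RintegralB measurableT i1 i2) i3.
by rewrite (@RintegralZl _ _ _ mu setT (fun y => cos (l * y) / ch y) (expR (l * X)) measurableT cos_sech_int).
Qed.

(** Abscissas tending to [0]. The contour is not shifted to [x = 0] itself, where [sin (a z)] has a
    zero; dominated convergence replaces the last step. *)
Let xn n : R := (a * n.+2%:R)^-1.
Let xnP n : 0 < a * xn n <= 1.
Proof.
rewrite /xn invfM mulrA divff ?gt_eqF// mul1r invr_gt0 ltr0n /=.
by rewrite invf_le1// ler1n.
Qed.

Let un_meas n : measurable_fun setT (u (xn n) : RR -> R).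
Proof.
apply: continuous_measurable_fun; suff h : continuous (u (xn n)) by [].
move=> y; have D0 : 0 < D (xn n) y.
  by apply: D_gt0; have /andP[-> /= h] := xnP n; have := pi_ge2 R; lra.
have Dy := dvD (dvX2 (sy (xn n) y)) (dvX2 (ty (xn n) y)).
exact: (dv_cont (dvM (dvD (dvM (Ay (xn n) y) (sy (xn n) y)) (dvM (By (xn n) y) (ty (xn n) y))) (dvV (f := D (xn n)) (lt0r_neq0 D0) Dy))).
Qed.

Let un_le n y : `|u (xn n) y| <= M / ch y.
Proof.
have /andP[h1 h2] := xnP n; apply: u_le; first by rewrite ltW.
by apply: D_gt0; rewrite h1; have := pi_ge2 R; lra.
Qed.

Let un_int n : \int[mu]_y u (xn n) y = \int[mu]_y u X y.
Proof.
have /andP[h1 h2] := xnP n.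
have xX : xn n <= X by rewrite -(ler_pM2l a0) aX; have := pi_ge2 R; lra.
have D0 x y : xn n <= x <= X -> 0 < D x y.
  move=> /andP[k1 k2]; apply: D_gt0; rewrite -aX ler_pM2l// k2 andbT.
  by apply: lt_le_trans h1 _; rewrite ler_pM2l.
apply: (@line_shift _ u v w (xn n) X (C1 / a)); first exact: xX.
- by move=> x y xx; apply: ux; exact: D0.
- by move=> x y xx; apply: vy; exact: D0.
- by move=> x y xx; apply: cw; exact: D0.
- by move=> x y xx; apply: vx; exact: D0.
- move=> x y xx y0; have [_ hv] := uvE (D0 x y xx).
  have xx2 : 0 <= a * x <= pi / 2.
    case/andP: xx => k1 k2; rewrite -aX ler_pM2l// k2 andbT mulr_ge0 ?(ltW a0)//.
    by apply: le_trans k1; rewrite -(@pmulr_rge0 _ a)// ltW.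
  have y00 : 0 < `|y| by rewrite normr_gt0.
  rewrite ler_pdivlMr// ler_pdivlMr//.
  rewrite -(@ler_pXn2r _ 2)// ?nnegrE ?mulr_ge0 ?(ltW a0) ?(ltW C10)//.
  apply: le_trans (N2_le y xx2); apply: le_trans hv.
  have -> : (`|v x y| * `|y| * a) ^+ 2 = v x y ^+ 2 * (a * y) ^+ 2.
    transitivity (`|v x y| ^+ 2 * `|y| ^+ 2 * a ^+ 2); first by ring.
    by rewrite !real_normK ?num_real//; ring.
  rewrite ler_wpM2l ?sqr_ge0//.
  exact: le_trans (sh_sqr_ge y) (Dsh x y).
- by apply: (le_intg measurableT) ich => [|y _]; [exact: un_meas|exact: un_le].
- exact: u_end.1.
Qed.

Let T := \int[mu]_y (sin (l * y) / sh y).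

Let u0E : u 0 = fun y => sin (l * y) / sh y.
Proof.
apply: funext => y; rewrite /u /D /A /B /s /t !mulr0 sin0 cos0 expR0.
rewrite !mul0r !mulr0 expr0n /= !add0r !mul1r.
have [->|s0] := eqVneq (sh y) 0; first by rewrite !mulr0 invr0 mul0r mulr0.
by field.
Qed.

Let u0_meas : measurable_fun setT (u 0 : RR -> R).
Proof.
rewrite u0E; pose h n y := sin (l * y) * (sh y / (sh y ^+ 2 + eps n)).
have h0 n y : 0 < sh y ^+ 2 + eps n by rewrite ltr_wpDl ?sqr_ge0 ?eps_gt0.
apply: (measurable_fun_cvg (h := h)).
  move=> n; apply: continuous_measurable_fun; suff H : continuous (h n) by [].
  move=> y; apply: cvgM; first exact: (dv_cont (dv_sin (dmul y))).
  have d := dv_sh a y; apply: cvgM; first exact: (dv_cont d).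
  by apply: cvgV; [rewrite gt_eqF|exact: (dv_cont (dvD (dvX2 d) (dv_cst (eps n) y)))].
move=> y _; apply: cvgM; first exact: cvg_cst.
have [s0|s0] := eqVneq (sh y) 0.
  by rewrite s0 invr0 [X in X @ _](_ : _ = fun=> 0); [exact: cvg_cst|apply: funext => n; rewrite mul0r].
have -> : (sh y)^-1 = sh y / (sh y ^+ 2 + 0) by field.
apply: cvgM; first exact: cvg_cst.
apply: cvgV; first by rewrite addr0 expf_neq0.
by apply: cvgD; [exact: cvg_cst|exact: cvg_harmonic].
Qed.

Lemma tanh_step : intg mu setT (fun y => sin (l * y) / sh y) /\ T = expR (l * X) * S - pi / a.
Proof.
have mN : measurable [set (0 : RR)] by exact: measurable_set1.
have N0 : mu [set (0 : RR)] = 0%E by exact: lebesgue_measure_set1.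
have [] := @Rdct_ae _ _ R mu setT [set (0 : RR)] (fun n => u (xn n)) (u 0) (fun y => M / ch y)
  measurableT mN N0 un_meas u0_meas _ ich (fun n y _ _ => un_le n y).
  move=> y _ y0; have D0 : 0 < D 0 y by apply: D_gt0y; exact/eqP.
  have xl : xn @ \oo --> (0 : R).
    apply: (@squeeze_harmonic _ _ _ a^-1) => n; have /andP[h _] := xnP n.
    rewrite subr0 ger0_norm; last by rewrite -(@pmulr_rge0 _ a)// ltW.
    by rewrite /xn invfM ler_pM2l ?invr_gt0// lef_pV2 ?posrE// ler_nat.
  exact: (cvg_comp _ _ xl (dv_cont (ux D0))).
rewrite u0E => i1 c; split => //; rewrite -u_end.2.
have e : (fun n => \int[mu]_y u (xn n) y) = fun=> \int[mu]_y u X y by apply: funext => n; exact: un_int.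
by rewrite e in c; apply: (cvg_unique _ c) => //; exact: cvg_cst.
Qed.

End SechTransform.

Section SechTransform2.
Context {R : realType}.
Notation mu := (@lebesgue_measure R).
Implicit Types (x y l t : R).
Variables (a : R).
Hypothesis a0 : 0 < a.

(** Adding the relations of [tanh_step] for [l] and [- l] eliminates the sine integral, which is odd
    in [l], and leaves the cosine integral, which is even. *)
Lemma sech_transform l :
  \int[mu]_y (cos (l * y) / cosh (a * y)) = pi / a / cosh (l * (pi / (2 * a))).
Proof.
have [_ h1] := tanh_step a0 l; have [_ h2] := tanh_step a0 (- l).
have eS : \int[mu]_y (cos (- l * y) / cosh (a * y)) = \int[mu]_y (cos (l * y) / cosh (a * y)).
  by apply: eq_Rintegral => y _; rewrite mulNr cosN.
have [i3 _] := tanh_step a0 l.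
have eT : \int[mu]_y (sin (- l * y) / sinha a y) = - \int[mu]_y (sin (l * y) / sinha a y).
  have z := @RintegralZl _ _ _ mu setT (fun y => sin (l * y) / sinha a y) (-1) measurableT i3.
  rewrite mulN1r in z; rewrite -z; apply: eq_Rintegral => y _.
  by rewrite mulNr sinN mulN1r mulNr.
rewrite eS eT h1 mulNr in h2.
rewrite /cosh -mulNr; set S := \int[mu]_y _ in h2 *; rewrite mulNr.
move: h2; have := expR_gt0 (l * (pi / (2 * a))); have := expR_gt0 (- (l * (pi / (2 * a)))).
move: (expR _) (expR _) => q p q0 p0; move: (pi : R) => z h2.
have pq : 0 < p + q by rewrite addr_gt0.
have e : S * (p + q) = 2 * (z / a) by lra.
have -> : S = 2 * (z / a) / (p + q) by rewrite -e mulfK ?lt0r_neq0.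
by rewrite (addrC q p); field; rewrite !gt_eqF.
Qed.

Lemma tanh_transform l : intg mu setT (fun y => sin (l * y) / sinha a y) /\
  \int[mu]_y (sin (l * y) / sinha a y) =
    pi / a * ((expR (2 * (l * (pi / (2 * a)))) - 1) / (expR (2 * (l * (pi / (2 * a)))) + 1)).
Proof.
have [i1 ->] := tanh_step a0 l; split=> //; rewrite sech_transform /cosh expRN.
move: (l * (pi / (2 * a))) => k; rewrite (expRM_natl 2 k).
have := expR_gt0 k; move: (expR _) => p p0; move: (pi : R) => z.
have e : p + p^-1 = (p ^+ 2 + 1) / p by field; rewrite gt_eqF.
have pq : 0 < p ^+ 2 + 1 by rewrite addr_gt0// exprn_gt0.
by rewrite e; field; rewrite !gt_eqF.
Qed.

End SechTransform2.

(** * Complex integrals and Laplace transforms *)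

Section ComplexExponential.
Context {R : realType}.
Implicit Types (x y t : R) (z w : R[i]).

Lemma Re_cexp z : Re (cexp z) = expR (Re z) * cos (Im z).
Proof. by rewrite /cexp creM /= mul0r subr0. Qed.

Lemma Im_cexp z : Im (cexp z) = expR (Re z) * sin (Im z).
Proof. by rewrite /cexp cimM /= mul0r addr0. Qed.

Lemma cexpD z w : cexp (z + w) = cexp z * cexp w.
Proof.
apply: eqc.
  by rewrite [RHS]creM !Re_cexp !Im_cexp creD cimD expRD cosD; ring.
by rewrite [RHS]cimM !Re_cexp !Im_cexp creD cimD expRD sinD; ring.
Qed.

Lemma cexp0 : cexp (0 : R[i]) = 1.
Proof. by apply: eqc; rewrite ?Re_cexp ?Im_cexp /= expR0 ?cos0 ?sin0 ?mulr1 ?mulr0. Qed.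

Lemma cexp_neq0 z : cexp z != 0.
Proof.
apply/eqP => h; have := cexpD z (- z); rewrite subrr cexp0 h mul0r => /eqP.
by rewrite oner_eq0.
Qed.

Lemma cexpN z : cexp (- z) = (cexp z)^-1.
Proof.
apply: (mulfI (cexp_neq0 z)); rewrite -cexpD subrr cexp0 mulfV//; exact: cexp_neq0.
Qed.

Lemma cexp_real x : cexp x%:C = (expR x)%:C.
Proof. by apply: eqc; rewrite ?Re_cexp ?Im_cexp /= ?cos0 ?sin0 ?mulr1 ?mulr0. Qed.

Lemma normc_cexp z : normc (cexp z) = expR (Re z).
Proof.
apply/eqP; rewrite -(@eqrXn2 _ 2)// ?normc_ge0 ?expR_ge0// normc_sqr Re_cexp Im_cexp.
by rewrite !exprMn -mulrDr cos2Dsin2 mulr1.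
Qed.

Lemma dv_Xn t n : dv (fun t => t ^+ n.+1) t (n.+1%:R * t ^+ n).
Proof.
elim: n => [|n IH].
  by rewrite expr0 mulr1; apply: (dv_eq (dv_id t)).
have -> : (fun t : R => t ^+ n.+2) = (fun t => t * t ^+ n.+1) by apply: funext => u; rewrite exprS.
apply: (dv_eq (dvM (dv_id t) IH)) => /=.
by rewrite -[n.+2%:R]natr1 exprS; ring.
Qed.

Lemma dv_le (f g f' g' : R -> R) t : 0 <= t -> (forall u, 0 <= u <= t -> dv f u (f' u)) ->
  (forall u, 0 <= u <= t -> dv g u (g' u)) -> (forall u, 0 <= u <= t -> f' u <= g' u) ->
  f 0 <= g 0 -> f t <= g t.
Proof.
rewrite le_eqVlt => /predU1P[<-//|t0] hf hg h h0.
have hd u : 0 <= u <= t -> dv (fun u => g u - f u) u (g' u - f' u) by move=> ut; apply: dvB; [exact: hg|exact: hf].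
have [c /andP[c0 ct] e] := dv_MVT t0 hd.
have : 0 <= (g' c - f' c) * (t - 0) by rewrite mulr_ge0 ?subr0 ?(ltW t0)// subr_ge0 h// !ltW.
by rewrite -e; lra.
Qed.

Definition expc z n : R[i] := \sum_(j < n) z ^+ j / j`!%:R.

Section Remainder.
Variable z : R[i].
Let x := Re z. Let y := Im z.
Let c j := Re (z ^+ j / j`!%:R). Let d j := Im (z ^+ j / j`!%:R).
Let P n t := \sum_(j < n) t ^+ j * c j.
Let Q n t := \sum_(j < n) t ^+ j * d j.

Let zS j : (j.+1%:R : R[i]) * (z ^+ j.+1 / j.+1`!%:R) = z * (z ^+ j / j`!%:R).
Proof.
rewrite factS natrM exprS; have h1 : (j.+1%:R : R[i]) != 0 by rewrite pnatr_eq0.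
have h2 : (j`!%:R : R[i]) != 0 by rewrite pnatr_eq0 -lt0n fact_gt0.
by move: h1 h2; move: (j.+1%:R : R[i]) (j`!%:R : R[i]) => p q p0 q0; field; rewrite p0 q0.
Qed.

Let cS j : j.+1%:R * c j.+1 = x * c j - y * d j.
Proof.
have := congr1 (@complex.Re R) (zS j); by rewrite complex_nat creM -/(c j.+1) -/(d j.+1) creM /= mul0r subr0.
Qed.

Let dS j : j.+1%:R * d j.+1 = x * d j + y * c j.
Proof.
have := congr1 (@complex.Im R) (zS j); by rewrite complex_nat cimM -/(c j.+1) -/(d j.+1) cimM /= mul0r addr0.
Qed.

Let P0 n t : P n.+1 t = P n t + t ^+ n * c n. Proof. by rewrite /P big_ord_recr. Qed.
Let Q0 n t : Q n.+1 t = Q n t + t ^+ n * d n. Proof. by rewrite /Q big_ord_recr. Qed.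

Let dPQ n t : dv (P n.+1) t (x * P n t - y * Q n t) /\ dv (Q n.+1) t (x * Q n t + y * P n t).
Proof.
elim: n => [|n [IH1 IH2]].
  have -> : P 1 = fun=> c 0%N by apply: funext => u; rewrite P0 /P big_ord0 add0r expr0 mul1r.
  have -> : Q 1 = fun=> d 0%N by apply: funext => u; rewrite Q0 /Q big_ord0 add0r expr0 mul1r.
  by rewrite /P /Q !big_ord0 !mulr0 subr0 addr0; split; exact: dv_cst.
have -> : P n.+2 = fun t => P n.+1 t + t ^+ n.+1 * c n.+1 by apply: funext => u; rewrite P0.
have -> : Q n.+2 = fun t => Q n.+1 t + t ^+ n.+1 * d n.+1 by apply: funext => u; rewrite Q0.
split.
  apply: (dv_eq (dvD IH1 (dvM (dv_Xn t n) (dv_cst (c n.+1) t)))) => /=.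
  rewrite P0 Q0 mulr0 addr0 mulrAC cS; ring.
apply: (dv_eq (dvD IH2 (dvM (dv_Xn t n) (dv_cst (d n.+1) t)))) => /=.
rewrite P0 Q0 mulr0 addr0 mulrAC dS; ring.
Qed.

Let f t := expR (x * t) * cos (y * t). Let g t := expR (x * t) * sin (y * t).

Let dfg t : dv f t (x * f t - y * g t) /\ dv g t (x * g t + y * f t).
Proof.
have h1 := dv_exp (dv_mulc x t); have h2 := dv_cos (dv_mulc y t); have h3 := dv_sin (dv_mulc y t).
split.
  by apply: (dv_eq (dvM h1 h2)) => /=; rewrite /f /g; ring.
by apply: (dv_eq (dvM h1 h3)) => /=; rewrite /f /g; ring.
Qed.

Let B := expR `|x|. Let L := `|x| + `|y|.

(** The derivative in [t] of the remainder of order [n + 1] is [z] times the remainder of order [n],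
    so integrating the bound for [n] gives the one for [n + 1]. The factor [L] dominates
    multiplication by [z] in real and imaginary parts. *)
Let remainder n t : 0 <= t <= 1 ->
  `|f t - P n t| <= B * (L * t) ^+ n / n`!%:R /\ `|g t - Q n t| <= B * (L * t) ^+ n / n`!%:R.
Proof.
have L0 : 0 <= L by rewrite addr_ge0.
elim: n t => [|n IH] t tt.
  rewrite /P /Q !big_ord0 !subr0 expr0 mulr1 divr1.
  have e : expR (x * t) <= B.
    case/andP: tt => t0 t1; rewrite ler_expR; apply: le_trans (ler_norm _) _.
    by rewrite normrM (ger0_norm t0) ler_piMr.
  rewrite /f /g !normrM (gtr0_norm (expR_gt0 _)); split; rewrite -[leRHS]mulr1 ler_pM ?expR_ge0//.
    exact: cos_max.
  exact: sin_max.
have [t0 t1] := andP tt; pose b u := B * (L * u) ^+ n.+1 / n.+1`!%:R.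
pose b' u := L * (B * (L * u) ^+ n / n`!%:R).
have db u : dv b u (b' u).
  have h1 : (n.+1%:R : R) != 0 by rewrite pnatr_eq0.
  have h2 : (n`!%:R : R) != 0 by rewrite pnatr_eq0 -lt0n fact_gt0.
  have e : b = fun u => (B * L ^+ n.+1 / n.+1`!%:R) * u ^+ n.+1.
    by apply: funext => v; rewrite /b exprMn; ring.
  rewrite e; apply: (dv_eq (dvZ _ (dv_Xn u n))).
  rewrite /b' factS natrM exprMn exprS; move: h1 h2.
  by move: (n.+1%:R : R) (n`!%:R : R) => p q p0 q0; field; rewrite p0 q0.
have b0 : b 0 = 0 by rewrite /b mulr0 expr0n /= mulr0 mul0r.
have f0 : f 0 = P n.+1 0.
  rewrite /f mulr0 mulr0 expR0 cos0 mulr1 /P big_ord_recl /= expr0 mul1r big1 ?addr0.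
    by rewrite /c expr0 fact0 divr1.
  by move=> i _; rewrite /bump /= expr0n mul0r.
have g0 : g 0 = Q n.+1 0.
  rewrite /g mulr0 mulr0 expR0 sin0 mulr0 /Q big_ord_recl /= expr0 mul1r big1 ?addr0.
    by rewrite /d expr0 fact0 divr1.
  by move=> i _; rewrite /bump /= expr0n mul0r.
have D1 u : dv (fun t => f t - P n.+1 t) u (x * (f u - P n u) - y * (g u - Q n u)).
  by apply: (dv_eq (dvB (dfg u).1 (dPQ n u).1)); ring.
have D2 u : dv (fun t => g t - Q n.+1 t) u (x * (g u - Q n u) + y * (f u - P n u)).
  by apply: (dv_eq (dvB (dfg u).2 (dPQ n u).2)); ring.
have K1 u : 0 <= u <= t -> `|x * (f u - P n u) - y * (g u - Q n u)| <= b' u.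
  move=> /andP[u0 ut]; have u01 : 0 <= u <= 1 by rewrite u0 (le_trans ut).
  have [h1 h2] := IH u u01.
  apply: le_trans (ler_normB _ _) _; rewrite !normrM /b' mulrDl lerD// ler_wpM2l//.
have K2 u : 0 <= u <= t -> `|x * (g u - Q n u) + y * (f u - P n u)| <= b' u.
  move=> /andP[u0 ut]; have u01 : 0 <= u <= 1 by rewrite u0 (le_trans ut).
  have [h1 h2] := IH u u01.
  apply: le_trans (ler_normD _ _) _; rewrite !normrM /b' mulrDl lerD// ler_wpM2l//.
have KK (F F' : R -> R) : (forall u, dv F u (F' u)) -> (forall u, 0 <= u <= t -> `|F' u| <= b' u) -> F 0 = 0 -> `|F t| <= b t.
  move=> dF hF F0; rewrite ler_norml; apply/andP; split.
    apply: (@dv_le (fun u => - b u) F (fun u => - b' u) F') => //.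
    - by move=> u _; exact: dvN.
    - by move=> u /hF; rewrite ler_norml => /andP[].
    - by rewrite b0 F0 oppr0.
  apply: (@dv_le F b F' b') => //.
  - by move=> u /hF; rewrite ler_norml => /andP[].
  - by rewrite b0 F0.
by split; [apply: (KK _ _ D1 K1)|apply: (KK _ _ D2 K2)]; rewrite ?f0 ?g0 subrr.
Qed.

Lemma expc_cvg : ccvg (expc z) (cexp z).
Proof.
have L0 : 0 <= L by rewrite addr_ge0.
have h0 : (fun n => B * L ^+ n / n`!%:R) @ \oo --> (0 : R).
  have := @cvg_exp_coeff R L; rewrite /exp_coeff => h.
  rewrite -[X in _ --> X](mulr0 B); under eq_fun do rewrite -mulrA.
  by apply: cvgM; [exact: cvg_cst|exact: h].
have [P1 Q1] : (forall n, Re (expc z n) = P n 1) /\ (forall n, Im (expc z n) = Q n 1).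
  split=> n; rewrite /expc ?Re_sum ?Im_sum; apply: eq_bigr => j _; by rewrite expr1n mul1r.
have bd n : normc (expc z n - cexp z) <= 2 * (B * L ^+ n / n`!%:R).
  have [h1 h2] : `|f 1 - P n 1| <= B * (L * 1) ^+ n / n`!%:R /\ `|g 1 - Q n 1| <= B * (L * 1) ^+ n / n`!%:R.
    by apply: remainder; rewrite ler01 lexx.
  rewrite normcC; apply: le_trans (normc_leD _) _; rewrite creD creN cimD cimN P1 Q1 Re_cexp Im_cexp.
  by move: h1 h2; rewrite /f /g !mulr1 -/x -/y; lra.
apply: (ccvg_squeeze bd); rewrite -[X in _ --> X](mulr0 2).
by apply: cvgM => //; exact: cvg_cst.
Qed.

End Remainder.

Lemma expc_le z n : normc (expc z n) <= expR (normc z).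
Proof.
apply: le_trans (normc_sum _ _ _) _.
apply: (@le_trans _ _ (series (exp_coeff (normc z)) n)).
  rewrite /series /= big_mkord; apply: ler_sum => j _.
  rewrite normcM normcX normcV complex_nat normc_real ger0_norm//.
apply: nondecreasing_cvgn_le; last exact: is_cvg_series_exp_coeff.
apply: nondecreasing_series => k _ _; exact: exp_coeff_ge0 (normc_ge0 z).
Qed.

End ComplexExponential.

Section ComplexIntegral.
Context {R : realType}.
Notation mu := (@lebesgue_measure R).
Notation RR := (measurableTypeR R).
Implicit Types (t : R) (s z w c : R[i]) (f g : RR -> R[i]).

Definition cI f : R[i] := (\int[mu]_t Re (f t)) +i* (\int[mu]_t Im (f t)).
Definition cintg f := intg mu setT (fun t => Re (f t)) /\ intg mu setT (fun t => Im (f t)).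

Lemma cintgZ c f : cintg f -> cintg (fun t => c * f t) /\ cI (fun t => c * f t) = c * cI f.
Proof.
move=> [i1 i2]; have j1 k := intgZ k measurableT i1; have j2 k := intgZ k measurableT i2.
have eR : (fun t => Re (c * f t)) = fun t => Re c * Re (f t) - Im c * Im (f t).
  by apply: funext => t; rewrite creM.
have eI : (fun t => Im (c * f t)) = fun t => Re c * Im (f t) + Im c * Re (f t).
  by apply: funext => t; rewrite cimM.
split; first by rewrite /cintg eR eI; split; [apply: intgB|apply: intgD].
have zR k := @RintegralZl _ _ _ mu setT (fun t => Re (f t)) k measurableT i1.
have zI k := @RintegralZl _ _ _ mu setT (fun t => Im (f t)) k measurableT i2.
rewrite /cI eR eI (RintegralB measurableT (j1 _) (j2 _)) (RintegralD measurableT (j2 _) (j1 _)).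
by rewrite !zR !zI; apply: eqc; rewrite /= ?creM ?cimM /=.
Qed.

Lemma cintgD f g : cintg f -> cintg g -> cintg (fun t => f t + g t) /\ cI (fun t => f t + g t) = cI f + cI g.
Proof.
move=> [i1 i2] [j1 j2].
have eR : (fun t => Re (f t + g t)) = fun t => Re (f t) + Re (g t) by apply: funext => t; rewrite creD.
have eI : (fun t => Im (f t + g t)) = fun t => Im (f t) + Im (g t) by apply: funext => t; rewrite cimD.
split; first by rewrite /cintg eR eI; split; apply: intgD.
by rewrite /cI eR eI (RintegralD measurableT i1 j1) (RintegralD measurableT i2 j2).
Qed.

Lemma cintg0 : cintg (fun=> 0) /\ cI (fun=> 0) = 0.
Proof.
have i0 : intg mu setT (fun=> 0 : R) by exact: integrable0.
by split; [split|rewrite /cI /= Rintegral_cst// mul0r].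
Qed.

Lemma cintg_sum (F : nat -> RR -> R[i]) n : (forall k, cintg (F k)) ->
  cintg (fun t => \sum_(k < n) F k t) /\ cI (fun t => \sum_(k < n) F k t) = \sum_(k < n) cI (F k).
Proof.
move=> hF; elim: n => [|n [IH1 IH2]].
  have -> : (fun t => \sum_(k < 0) F k t) = fun=> 0 by apply: funext => t; rewrite big_ord0.
  by rewrite big_ord0; exact: cintg0.
have -> : (fun t => \sum_(k < n.+1) F k t) = fun t => \sum_(k < n) F k t + F n t.
  by apply: funext => t; rewrite big_ord_recr.
by have [h1 ->] := cintgD IH1 (hF n); rewrite IH2 big_ord_recr.
Qed.

Definition cmeas f := measurable_fun setT (fun t => Re (f t)) /\ measurable_fun setT (fun t => Im (f t)).

Lemma cintg_le f (g : RR -> R) : cmeas f -> (forall t, normc (f t) <= g t) -> intg mu setT g -> cintg f.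
Proof.
move=> [m1 m2] h ig; split; apply: (le_intg measurableT _ _ ig) => // t _.
  exact: le_trans (ler_Re _) (h t).
exact: le_trans (ler_Im _) (h t).
Qed.

Lemma cI_le f (g : RR -> R) : cmeas f -> (forall t, normc (f t) <= g t) -> intg mu setT g ->
  normc (cI f) <= 2 * \int[mu]_t g t.
Proof.
move=> [m1 m2] h ig; apply: le_trans (normc_leD _) _; rewrite mulr_natl mulr2n; apply: lerD.
  by apply: Rint_norm_le => // t _; exact: le_trans (ler_Re _) (h t).
by apply: Rint_norm_le => // t _; exact: le_trans (ler_Im _) (h t).
Qed.

Lemma cI_dct (f_ : nat -> RR -> R[i]) f (g : RR -> R) : (forall n, cmeas (f_ n)) ->
  (forall t, ccvg (fun n => f_ n t) (f t)) -> intg mu setT g -> (forall n t, normc (f_ n t) <= g t) ->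
  cintg f /\ ccvg (fun n => cI (f_ n)) (cI f).
Proof.
move=> mf ff ig h.
have [i1 c1] := @Rdct _ _ R mu setT (fun n t => Re (f_ n t)) (fun t => Re (f t)) g measurableT
  (fun n => (mf n).1) (fun t _ => ccvg_Re (ff t)) ig (fun n t _ => le_trans (ler_Re _) (h n t)).
have [i2 c2] := @Rdct _ _ R mu setT (fun n t => Im (f_ n t)) (fun t => Im (f t)) g measurableT
  (fun n => (mf n).2) (fun t _ => ccvg_Im (ff t)) ig (fun n t _ => le_trans (ler_Im _) (h n t)).
by split; [split|exact: ccvg_ReIm].
Qed.

(** Two-sided and with kernel [exp (s t)]: under [x = exp t] these are Mellin transforms. *)
Definition laplace (k : RR -> R) s := cI (fun t => (k t)%:C * cexp (s * t%:C)).

Lemma Re_sreal s t : Re (s * t%:C) = Re s * t.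
Proof. by rewrite creM /= mulr0 subr0. Qed.
Lemma Im_sreal s t : Im (s * t%:C) = Im s * t.
Proof. by rewrite cimM /= mulr0 add0r. Qed.
Lemma Re_realM t z : Re (t%:C * z) = t * Re z.
Proof. by rewrite creM /= mul0r subr0. Qed.
Lemma Im_realM t z : Im (t%:C * z) = t * Im z.
Proof. by rewrite cimM /= mul0r addr0. Qed.

Lemma cexp_line_cont s : continuous (fun t => expR (Re s * t) * cos (Im s * t)) /\
  continuous (fun t => expR (Re s * t) * sin (Im s * t)).
Proof.
split=> t; apply: cvgM.
- exact: (dv_cont (dv_exp (dv_mulc _ t))).
- exact: (dv_cont (dv_cos (dv_mulc _ t))).
- exact: (dv_cont (dv_exp (dv_mulc _ t))).
- exact: (dv_cont (dv_sin (dv_mulc _ t))).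
Qed.

Lemma cexp_cmeas s (k : RR -> R) : measurable_fun setT k -> cmeas (fun t => (k t)%:C * cexp (s * t%:C)).
Proof.
move=> mk; have [c1 c2] := cexp_line_cont s.
have eR : (fun t => Re ((k t)%:C * cexp (s * t%:C))) = fun t => k t * (expR (Re s * t) * cos (Im s * t)).
  by apply: funext => t; rewrite Re_realM Re_cexp Re_sreal Im_sreal.
have eI : (fun t => Im ((k t)%:C * cexp (s * t%:C))) = fun t => k t * (expR (Re s * t) * sin (Im s * t)).
  by apply: funext => t; rewrite Im_realM Im_cexp Re_sreal Im_sreal.
by split; rewrite ?eR ?eI; apply: measurable_funM => //; exact: continuous_measurable_fun.
Qed.

Lemma cmeas_realM (h : RR -> R) f : measurable_fun setT h -> cmeas f -> cmeas (fun t => (h t)%:C * f t).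
Proof.
move=> mh [m1 m2]; split.
  by under eq_fun do rewrite Re_realM; exact: measurable_funM.
by under eq_fun do rewrite Im_realM; exact: measurable_funM.
Qed.

Lemma cmeasZ c f : cmeas f -> cmeas (fun t => c * f t).
Proof.
move=> [m1 m2]; split.
  by under eq_fun do rewrite creM; apply: measurable_funB; exact: measurable_funM.
by under eq_fun do rewrite cimM; apply: measurable_funD; exact: measurable_funM.
Qed.

Lemma cmeasD f g : cmeas f -> cmeas g -> cmeas (fun t => f t + g t).
Proof.
move=> [m1 m2] [n1 n2]; split.
  by under eq_fun do rewrite creD; exact: measurable_funD.
by under eq_fun do rewrite cimD; exact: measurable_funD.
Qed.

Lemma cmeas_sum (F : nat -> RR -> R[i]) n : (forall k, cmeas (F k)) -> cmeas (fun t => \sum_(k < n) F k t).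
Proof.
move=> hF; elim: n => [|n IH].
  have -> : (fun t => \sum_(k < 0) F k t) = fun=> 0 by apply: funext => t; rewrite big_ord0.
  by split; exact: measurable_cst.
have -> : (fun t => \sum_(k < n.+1) F k t) = fun t => \sum_(k < n) F k t + F n t.
  by apply: funext => t; rewrite big_ord_recr.
exact: cmeasD.
Qed.

(** Expand [exp (z t)] in powers of [z] and integrate termwise. The function [exp (r |t|)] dominates
    the partial sums, and the [j]-th term up to [r ^ (- j)], which gives the coefficient bound with
    [q = 1 / r]. *)
Lemma laplace_an_core (k : RR -> R) s (r : R) : 0 < r -> measurable_fun setT k ->
  intg mu setT (fun t => `|k t| * expR (Re s * t + r * `|t|)) -> an (laplace k) s.
Proof.
move=> r0 mk ig; pose e t := (k t)%:C * cexp (s * t%:C).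
pose h t := `|k t| * expR (Re s * t + r * `|t|).
pose G (j : nat) t := ((t ^+ j / j`!%:R)%:C) * e t.
have mt (j : nat) : measurable_fun setT (fun t : RR => t ^+ j / j`!%:R).
  apply: continuous_measurable_fun => t; apply: cvgM; last exact: cvg_cst.
  exact: exprn_continuous.
have me : cmeas e by exact: cexp_cmeas.
have mG j : cmeas (G j) by exact: cmeas_realM.
have ne t : normc (e t) = `|k t| * expR (Re s * t).
  by rewrite normcM normc_real normc_cexp Re_sreal.
have pw j t : `|t| ^+ j / j`!%:R * r ^+ j <= expR (r * `|t|).
  have x0 : 0 <= r * `|t| by rewrite mulr_ge0// ltW.
  rewrite mulrAC -exprMn mulrC mulrC (mulrC `|t|).
  apply: le_trans (_ : series (exp_coeff (r * `|t|)) j.+1 <= _).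
    rewrite /series /= big_nat_recr//= /exp_coeff lerDr.
    by apply: sumr_ge0 => i _; exact: exp_coeff_ge0.
  apply: nondecreasing_cvgn_le; last exact: is_cvg_series_exp_coeff.
  by apply: nondecreasing_series => i _ _; exact: exp_coeff_ge0.
have nG j t : normc (G j t) <= r^-1 ^+ j * h t.
  rewrite /G normcM normc_real ne /h expRD normrM normrX [`|_^-1|]ger0_norm ?invr_ge0//.
  rewrite exprVn [leRHS]mulrC ler_pdivlMr ?exprn_gt0//.
  rewrite (_ : _ * _ * r ^+ j = `|k t| * expR (Re s * t) * (`|t| ^+ j / j`!%:R * r ^+ j)); last by ring.
  by rewrite [leRHS]mulrA ler_wpM2l// mulr_ge0// expR_ge0.
have iG j : cintg (G j) by apply: (cintg_le (mG j) (nG j)); exact: intgZ.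
pose I := \int[mu]_t h t.
exists (fun j => cI (G j)), r^-1, (2 * I); split.
- by rewrite invr_gt0.
- move=> j; apply: le_trans (cI_le (mG j) (nG j) _) _; first exact: intgZ.
  rewrite (@RintegralZl _ _ _ mu setT h (r^-1 ^+ j) measurableT ig) -/I.
  by rewrite mulrCA [leRHS]mulrC.
move=> z zr; have zr' : normc z <= r.
  move: zr; rewrite ler_pdivrMr// => /le_trans; apply; lra.
pose F n t := \sum_(j < n) z ^+ j * G j t.
have FE n t : F n t = e t * expc (z * t%:C) n.
  rewrite /F /expc mulr_sumr; apply: eq_bigr => j _; rewrite /G exprMn.
  rewrite rmorphM /= rmorphXn /= fmorphV /= complex_nat; ring.
have psE n : ps (fun j => cI (G j)) z n = cI (F n).
  have [_ ->] := cintg_sum n (fun j => (cintgZ (z ^+ j) (iG j)).1).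
  by apply: eq_bigr => j _; rewrite (cintgZ (z ^+ j) (iG j)).2 mulrC.
have -> : ps (fun j => cI (G j)) z = fun n => cI (F n) by apply: funext.
have -> : laplace k (s + z) = cI (fun t => e t * cexp (z * t%:C)).
  by congr cI; apply: funext => t; rewrite /e -mulrA -cexpD mulrDl.
apply: (cI_dct (g := h) _ _ ig _).2.
- by move=> n; apply: (@cmeas_sum (fun j t => z ^+ j * G j t)) => j; exact: cmeasZ.
- move=> t; have := ccvgMl (e t) (expc_cvg (z * t%:C)).
  by apply: ccvg_near; apply: nearW => n; rewrite FE.
- move=> n t; rewrite FE normcM ne /h expRD mulrA ler_wpM2l ?mulr_ge0 ?expR_ge0//.
  apply: le_trans (expc_le _ _) _; rewrite ler_expR normcM normc_real ler_wpM2r//.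
Qed.

Definition lapI (k : RR -> R) (x : R) := intg mu setT (fun t => k t * expR (x * t)).

Lemma lapI_meas (k : RR -> R) x : lapI k x -> measurable_fun setT k.
Proof.
move=> /intg_meas m; apply: (@eq_measurable_fun _ _ _ _ _ (fun t => (k t * expR (x * t)) * expR (- (x * t)))).
  by move=> t _ /=; rewrite -mulrA -expRD subrr expR0 mulr1.
apply: measurable_funM => //; apply: continuous_measurable_fun.
suff h : continuous (fun t : R => expR (- (x * t))) by [].
by move=> t; exact: (dv_cont (dv_exp (dvN (dv_mulc x t)))).
Qed.

(** On the right half-line [exp (y t)] dominates [exp (u t + r |t|)], on the left half-line
    [exp (x t)] does. *)
Lemma lapI_between (k : RR -> R) (x y u r : R) : lapI k x -> lapI k y -> x + r <= u -> u + r <= y ->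
  intg mu setT (fun t => `|k t| * expR (u * t + r * `|t|)).
Proof.
move=> ix iy xu uy; have mk := lapI_meas ix.
apply: (le_intg measurableT _ _ (intgD measurableT (intg_norm measurableT ix) (intg_norm measurableT iy))).
  apply: measurable_funM; first exact: measurableT_comp.
  apply: continuous_measurable_fun; suff h : continuous (fun t : R => expR (u * t + r * `|t|)) by [].
  move=> t; apply: (@continuous_comp _ _ _ (fun t : R => u * t + r * `|t|) (@expR R)); last exact: continuous_expR.
  apply: cvgD; first exact: (dv_cont (dv_mulc u t)).
  by apply: cvgM; [exact: cvg_cst|exact: norm_continuous].
move=> t _; rewrite !normrM normr_id !(gtr0_norm (expR_gt0 _)) -mulrDr ler_wpM2l//.
have [t0|t0] := leP 0 t.
  apply: ler_wpDl; first exact: expR_ge0.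
  by rewrite ler_expR (ger0_norm t0) -mulrDl ler_wpM2r.
apply: ler_wpDr; first exact: expR_ge0.
rewrite ler_expR (ltr0_norm t0) mulrN -mulrBl -subr_ge0 -mulrBl nmulr_lge0//; lra.
Qed.

Lemma laplace_an (k : RR -> R) (x y : R) s : lapI k x -> lapI k y -> x < Re s < y -> an (laplace k) s.
Proof.
move=> ix iy /andP[xs sy]; pose r := Num.min (Re s - x) (y - Re s).
have r0 : 0 < r by rewrite lt_min !subr_gt0 xs.
apply: (laplace_an_core r0 (lapI_meas ix)).
apply: (lapI_between ix iy).
  have : r <= Re s - x by rewrite ge_min lexx.
  lra.
have : r <= y - Re s by rewrite ge_min lexx orbT.
lra.
Qed.

Lemma laplace_int (k : RR -> R) s : lapI k (Re s) -> cintg (fun t => (k t)%:C * cexp (s * t%:C)).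
Proof.
move=> i; have mk := lapI_meas i.
apply: (cintg_le (cexp_cmeas s mk) (g := fun t => `|k t * expR (Re s * t)|)); last exact: intg_norm.
by move=> t; rewrite normcM normc_real normc_cexp Re_sreal normrM (gtr0_norm (expR_gt0 _)).
Qed.

Lemma laplace_le (k : RR -> R) s : lapI k (Re s) ->
  normc (laplace k s) <= 2 * \int[mu]_t `|k t * expR (Re s * t)|.
Proof.
move=> i; have mk := lapI_meas i; apply: (cI_le (cexp_cmeas s mk)); last exact: intg_norm.
by move=> t; rewrite normcM normc_real normc_cexp Re_sreal normrM (gtr0_norm (expR_gt0 _)).
Qed.

End ComplexIntegral.

(** * Continuation of zeta *)

Section IdentityTheorem.
Context {R : realType}.
Implicit Types (s z : R[i]) (t x y : R) (f : R[i] -> R[i]).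

(** The starting point [c + i] or [c - i] is chosen on the same side of the real axis as [s], so the
    segment to [s] meets the axis at [s] at most. Thus singularities of [f] at other real points do
    not matter. *)
Lemma identity_half_plane f (r c : R) s : r < c -> r < Re s ->
  (forall z, r < Re z -> Im z != 0 \/ z = s -> an f z) ->
  vanish f (c +i* 1) -> vanish f (c +i* (-1)) -> f s = 0.
Proof.
move=> rc rs han v1 v2; pose e : R := if 0 <= Im s then 1 else -1; pose s' : R[i] := c +i* e.
have segE (t : R) : s' + t%:C * (s - s') = ((1 - t) * c + t * Re s) +i* ((1 - t) * e + t * Im s).
  by apply: eqc; rewrite ?creD ?cimD ?Re_realM ?Im_realM ?creD ?cimD ?creN ?cimN /=; ring.
have : vanish f (s' + (s - s')).
  apply: an_identity_segment; last by rewrite /s' /e; case: ifP.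
  move=> t /andP[t0 t1]; have [t1'|t1'] := ltP t 1; last first.
    have -> : t = 1 by apply/eqP; rewrite eq_le t1.
    by rewrite mul1r addrC subrK; apply: han => //; right.
  have im : Im (s' + t%:C * (s - s')) != 0.
    rewrite segE /= /e; case: ifPn => [hI|]; first by rewrite gt_eqF//; have := mulr_ge0 t0 hI; lra.
    rewrite -ltNge => hI; rewrite lt_eqF//; have : 0 <= t * - Im s by rewrite mulr_ge0// oppr_ge0 ltW.
    by lra.
  apply: han; last by left.
  rewrite segE /=; have := mulr_ge0 t0 (ltW (_ : 0 < Re s - r)); rewrite subr_gt0 => /(_ rs).
  by have : 0 < (1 - t) * (c - r) by [rewrite mulr_gt0// subr_gt0]; lra.
case=> v v0 /(_ 0); rewrite normc0 => /(_ (ltW v0)); rewrite addr0 addrC subrK; exact.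
Qed.

Lemma vanish_line f : an f 0 -> (forall y, f (0 +i* y) = 0) -> vanish f 0.
Proof.
move=> /an_zero[[r r0 h]|[m [g [ga g0 [r r0 h]]]]] f0; first by exists r.
have z r' : 0 < r' -> 0 <= r' -> r' <= r -> g (0 +i* r') = 0.
  move=> r'0 _ r'r; have nz : normc (0 +i* r') = r' by rewrite /normc /= expr0n /= add0r sqrtr_sqr gtr0_norm.
  have := h (0 +i* r'); rewrite nz add0r f0 => /(_ r'r) /esym /eqP.
  rewrite mulf_eq0 expf_eq0 => /orP[/andP[_ /eqP e]|/eqP//].
  by move: nz; rewrite e normc0 => e'; move: r'0; rewrite -e' ltxx.
have [//|gn0] := eqVneq (g 0) 0; first by move=> e; move: g0; rewrite e eqxx.
have gp : 0 < normc (g 0) / 2 by rewrite divr_gt0// normc_gt0.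
have [r1 r10 hc] := an_ccont ga gp.
pose r' := Num.min r r1; have r'0 : 0 < r' by rewrite lt_min r0.
have nz : normc (0 +i* r') = r' by rewrite /normc /= expr0n /= add0r sqrtr_sqr gtr0_norm.
have r'r : r' <= r by rewrite ge_min lexx.
have r'r1 : normc (0 +i* r') <= r1 by rewrite nz ge_min lexx orbT.
by have := hc _ r'r1; rewrite add0r (z r')// ?(ltW r'0)// sub0r normcN; move: gp; lra.
Qed.

End IdentityTheorem.

Section StepLaplace.
Context {R : realType}.
Notation mu := (@lebesgue_measure R).
Notation RR := (measurableTypeR R).
Implicit Types (t x c : R) (s z w : R[i]).

Lemma dv_cexp (k w : R[i]) t :
  dv (fun t => Re (k * cexp (w * t%:C))) t (Re (k * (w * cexp (w * t%:C)))) /\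
  dv (fun t => Im (k * cexp (w * t%:C))) t (Im (k * (w * cexp (w * t%:C)))).
Proof.
have eR : (fun t => Re (k * cexp (w * t%:C))) = fun t => Re k * (expR (Re w * t) * cos (Im w * t)) - Im k * (expR (Re w * t) * sin (Im w * t)).
  by apply: funext => u; rewrite creM Re_cexp Im_cexp Re_sreal Im_sreal.
have eI : (fun t => Im (k * cexp (w * t%:C))) = fun t => Re k * (expR (Re w * t) * sin (Im w * t)) + Im k * (expR (Re w * t) * cos (Im w * t)).
  by apply: funext => u; rewrite cimM Re_cexp Im_cexp Re_sreal Im_sreal.
have h1 := dv_exp (dv_mulc (Re w) t); have h2 := dv_cos (dv_mulc (Im w) t); have h3 := dv_sin (dv_mulc (Im w) t).
rewrite eR eI; split.
  apply: (dv_eq (dvB (dvZ _ (dvM h1 h2)) (dvZ _ (dvM h1 h3)))) => /=.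
  rewrite creM [Re (w * _)]creM [Im (w * _)]cimM Re_cexp Im_cexp Re_sreal Im_sreal; ring.
apply: (dv_eq (dvD (dvZ _ (dvM h1 h3)) (dvZ _ (dvM h1 h2)))) => /=.
rewrite cimM [Re (w * _)]creM [Im (w * _)]cimM Re_cexp Im_cexp Re_sreal Im_sreal; ring.
Qed.

Lemma cexp_line_cont2 (k w : R[i]) : continuous (fun t => Re (k * cexp (w * t%:C))) /\
  continuous (fun t => Im (k * cexp (w * t%:C))).
Proof. by split=> t; [exact: (dv_cont (dv_cexp k w t).1)|exact: (dv_cont (dv_cexp k w t).2)]. Qed.

Definition step c t : R := if c <= t then 1 else 0.

Lemma step_meas c : measurable_fun setT (step c : RR -> R).
Proof. by apply: measurable_fun_ifT => //; apply: measurable_fun_ler. Qed.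

Lemma step_lapI c x : 0 < x -> lapI (step c) (- x).
Proof.
move=> x0; have [ii _] := sech_mass x0.
(* For [c <= t] the product [exp (- x t) cosh (x t)] is [(1 + exp (- 2 x t)) / 2], which is at most
   its value at [c]. *)
pose K := (1 + expR (- x * c) ^+ 2) / 2.
apply: (le_intg measurableT _ _ (intgZ K measurableT ii)).
  apply: measurable_funM; first exact: step_meas.
  apply: continuous_measurable_fun; suff h : continuous (fun t : R => expR (- x * t)) by [].
  by move=> t; exact: (dv_cont (dv_exp (dv_mulc (- x) t))).
move=> t _; rewrite normrM (gtr0_norm (expR_gt0 _)) /step.
have c0 : 0 < cosh (x * t) by rewrite /cosh divr_gt0// addr_gt0// expR_gt0.
case: ifPn => ct; last by rewrite normr0 mul0r mulr_ge0 ?invr_ge0 ?(ltW c0)// divr_ge0// addr_ge0// sqr_ge0.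
rewrite normr1 mul1r ler_pdivlMr// /cosh /K mulrA ler_pM2r ?invr_gt0//.
rewrite mulrDr -!expRD mulNr addNr expR0 lerD2l expr2 -expRD ler_expR mulNr; have := ler_wpM2l (ltW x0) ct; lra.
Qed.

Lemma int_step (f : R -> R) c : \int[mu]_t (step c t * f t) = \int[mu]_(t in `[c, +oo[) f t.
Proof.
rewrite [RHS]Rintegral_mkcond; apply: eq_Rintegral => t _; rewrite patchE /step.
case: ifPn => ct; first by rewrite mem_set ?mul1r//= in_itv /= ct.
by rewrite memNset ?mul0r//= in_itv /= andbT; exact/negP.
Qed.

Lemma cexp_tail s c : 0 < Re s -> ccvg (fun n => cexp (- s * (c + n%:R)%:C)) 0.
Proof.
move=> s0; apply: (@ccvg_squeeze _ _ _ (fun n => expR (- (Re s * c)) * expR (- (Re s) * n%:R))).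
  by move=> n; rewrite subr0 normc_cexp Re_sreal creN -expRD mulNr mulrDr opprD mulNr.
rewrite -[X in _ --> X](mulr0 (expR (- (Re s * c)))); apply: cvgM; first exact: cvg_cst.
have h : (fun n : nat => Re s * n%:R) @ \oo --> +oo.
  apply/cvgryPge => M; near=> n; rewrite -ler_pdivrMl//.
  by near: n; exact: nbhs_infty_ger.
under eq_fun do rewrite mulNr.
exact: (cvg_comp _ _ h (@cvgr_expR R)).
Unshelve. all: by end_near. Qed.

Lemma laplace_step c s : 0 < Re s -> laplace (step c) (- s) = cexp (- s * c%:C) / s.
Proof.
move=> s0; have sn0 : s != 0 by apply: contraTneq s0 => ->; rewrite ltxx.
have iD : intg mu `[c, +oo[ (fun t => expR (- Re s * t)).
  have := @intgS _ _ _ mu _ `[c, +oo[%classic _ measurableT _ _ (step_lapI c s0).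
  move=> /(_ (measurable_itv _) (fun _ _ => I)); apply: eq_intg => // t /set_mem /=.
  by rewrite in_itv /= andbT /step => ->; rewrite mul1r.
pose V t := (- s^-1) * cexp (- s * t%:C).
have dV t : dv (fun t => Re (V t)) t (Re (cexp (- s * t%:C))) /\ dv (fun t => Im (V t)) t (Im (cexp (- s * t%:C))).
  have [d1 d2] := dv_cexp (- s^-1) (- s) t.
  have e : - s^-1 * (- s * cexp (- s * t%:C)) = cexp (- s * t%:C) by rewrite mulNr mulNr mulrN opprK mulrA mulVf// mul1r.
  by rewrite e in d1 d2.
have [k1 k2] := cexp_line_cont2 1 (- s).
have c1 : continuous (fun t => Re (cexp (- s * t%:C))) by move=> t; have := k1 t; under eq_fun do rewrite mul1r.
have c2 : continuous (fun t => Im (cexp (- s * t%:C))) by move=> t; have := k2 t; under eq_fun do rewrite mul1r.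
have lim : ccvg (fun n => V (c + n%:R) - V c) (0 - V c).
  apply: ccvgD; last exact: ccvg_cst.
  by rewrite -(mulr0 (- s^-1)); apply: ccvgMl; exact: cexp_tail.
(* [P] stands for the real and the imaginary part, which need the same limit argument. *)
have main (P : R[i] -> R) : (forall z, `|P z| <= normc z) -> continuous (fun t => P (cexp (- s * t%:C))) ->
    (forall t, dv (fun t => P (V t)) t (P (cexp (- s * t%:C)))) ->
    (fun n => P (V (c + n%:R)) - P (V c)) @ \oo --> \int[mu]_(t in `[c, +oo[) P (cexp (- s * t%:C)).
  move=> Pn Pc Pd.
  have -> : (fun n => P (V (c + n%:R)) - P (V c)) = fun n : nat => \int[mu]_(t in `[c, c + n%:R]) P (cexp (- s * t%:C)).
    apply: funext => n; rewrite (@Rftc _ _ (fun t => P (V t)))//.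
      by rewrite lerDl.
    by move=> t _; exact: Pc.
  have mA n : measurable (`[c, c + n%:R]%classic : set RR) by exact: measurable_itv.
  apply: (Rdct_expand _ mA _ _ _ _ iD _).2 => //.
  - by move=> n t /=; rewrite !in_itv /= => /andP[->].
  - move=> t /=; rewrite in_itv /= andbT => ct; near=> n; rewrite /= in_itv /= ct /= -lerBlDl.
    by near: n; exact: nbhs_infty_ger.
  - by move=> n; apply: measurable_funS (continuous_measurable_fun Pc).
  - by move=> t _; exact: cvg_cst.
  - by move=> n t _; apply: le_trans (Pn _) _; rewrite normc_cexp Re_sreal creN.
have m1 := main (@complex.Re R) (@ler_Re R) c1 (fun t => (dV t).1).
have m2 := main (@complex.Im R) (@ler_Im R) c2 (fun t => (dV t).2).
have l1 := ccvg_Re lim; have l2 := ccvg_Im lim.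
rewrite (_ : (fun n => _) = (fun n : nat => Re (V (c + n%:R)) - Re (V c))) in l1; last by apply: funext => n; rewrite creD creN.
rewrite (_ : (fun n => _) = (fun n : nat => Im (V (c + n%:R)) - Im (V c))) in l2; last by apply: funext => n; rewrite cimD cimN.
have e1 : \int[mu]_(t in `[c, +oo[) Re (cexp (- s * t%:C)) = Re (0 - V c) by exact: (cvg_unique _ m1 l1).
have e2 : \int[mu]_(t in `[c, +oo[) Im (cexp (- s * t%:C)) = Im (0 - V c) by exact: (cvg_unique _ m2 l2).
rewrite /laplace /cI.
under eq_Rintegral do rewrite Re_realM.
under [X in _ +i* X]eq_Rintegral do rewrite Im_realM.
rewrite !int_step e1 e2 sub0r.
have -> : - V c = cexp (- s * c%:C) / s by rewrite /V mulNr opprK mulrC.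
by case: (_ / _).
Unshelve. all: by end_near. Qed.

Lemma step_exp_int c x : 0 < x -> \int[mu]_t (step c t * expR (- x * t)) = expR (- x * c) / x.
Proof.
move=> x0; have := @laplace_step c x%:C x0.
have -> : - x%:C = (- x)%:C :> R[i] by rewrite rmorphN.
rewrite -!rmorphM cexp_real -fmorphV -rmorphM /= => /(congr1 (@complex.Re R)) /= <-.
by apply: eq_Rintegral => t _; rewrite !(mul0r, mulr0, subr0, addr0) cos0 mulr1.
Qed.
End StepLaplace.

Section ZetaKernel.
Context {R : realType}.
Notation mu := (@lebesgue_measure R).
Notation RR := (measurableTypeR R).
Implicit Types (t x c y : R) (s z w : R[i]).

Lemma sum_le_truncn y N : 0 <= y -> \sum_(n < N) (if n.+1%:R <= y then 1 else 0 : R) = (minn N (Num.truncn y))%:R.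
Proof.
move=> y0; have e n : (n.+1%:R <= y) = (n < Num.truncn y)%N by rewrite -truncn_ge_nat.
elim: N => [|N IH]; first by rewrite big_ord0 min0n.
rewrite big_ord_recr /= IH e; case: ltnP => h.
  have -> : minn N.+1 (Num.truncn y) = N.+1 by exact/minn_idPl.
  by rewrite -(minn_idPl (ltnW h)) natr1 (minn_idPl (ltnW h)).
have -> : minn N.+1 (Num.truncn y) = Num.truncn y by apply/minn_idPr/(leq_trans h).
by rewrite addr0.
Qed.

(* With [t = ln x], the fractional part of [x >= 1]; it is the pointwise limit of [zker_ N]. *)
Definition zker t : R := if 0 <= t then expR t - (Num.truncn (expR t))%:R else 0.
Definition zker_ N t : R := step 0 t * expR t - \sum_(n < N) step (ln n.+1%:R) t.

Lemma step_ln n t : step (ln (n.+1%:R : R)) t = if n.+1%:R <= expR t then 1 else 0.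
Proof. by rewrite /step -(ler_expR (ln _)) lnK// posrE ltr0n. Qed.

Lemma zker_E N t : zker_ N t = if 0 <= t then expR t - (minn N (Num.truncn (expR t)))%:R else 0.
Proof.
rewrite /zker_ /step; have -> : \sum_(n < N) (if ln (n.+1%:R : R) <= t then 1 else 0 : R) = (minn N (Num.truncn (expR t)))%:R.
  by rewrite -sum_le_truncn ?expR_ge0//; apply: eq_bigr => n _; exact: step_ln.
case: ifPn => [|]; first by rewrite mul1r.
rewrite -ltNge => t0; rewrite mul0r.
have -> : Num.truncn (expR t) = 0%N by apply/truncn0Pn; rewrite -ltNge -expR0 ltr_expR.
by rewrite minn0 subrr.
Qed.

Lemma zker_cvg t : (fun N => zker_ N t) @ \oo --> zker t.
Proof.
apply: cvg_near_cst; exists (Num.truncn (expR t)) => // N /= h.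
by rewrite zker_E /zker (minn_idPr h).
Qed.

Lemma zker_meas_ N : measurable_fun setT (zker_ N : RR -> R).
Proof.
apply: measurable_funB.
  apply: measurable_funM; first exact: step_meas.
  exact: measurable_expR.
by apply: measurable_sum => n; exact: step_meas.
Qed.

Lemma zker_le_ N t : `|zker_ N t| <= step 0 t * expR t.
Proof.
rewrite zker_E /step; case: ifPn => t0; last by rewrite normr0 mul0r.
rewrite mul1r ger0_norm ?subr_ge0; first by rewrite gerBl.
apply: (@le_trans _ _ (Num.truncn (expR t))%:R); first by rewrite ler_nat geq_minr.
by rewrite truncn_le ?expR_ge0.
Qed.

Lemma zker_01 t : 0 <= zker t <= step 0 t.
Proof.
rewrite /zker /step; case: ifPn => t0; last by rewrite lexx.
have := truncn_itv (expR_ge0 t); rewrite -natr1 => /andP[h1 h2].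
by apply/andP; split; lra.
Qed.

Lemma zker_meas : measurable_fun setT (zker : RR -> R).
Proof.
apply: (@measurable_fun_cvg _ _ _ setT (fun N => zker_ N : RR -> R)) => //.
  by move=> N; exact: zker_meas_.
by move=> t _; exact: zker_cvg.
Qed.

Lemma zker_lapI x : 0 < x -> lapI zker (- x).
Proof.
move=> x0; apply: (le_intg measurableT _ _ (step_lapI 0 x0)).
  apply: measurable_funM; first exact: zker_meas.
  apply: continuous_measurable_fun; suff h : continuous (fun t : R => expR (- x * t)) by [].
  by move=> t; exact: (dv_cont (dv_exp (dv_mulc (- x) t))).
move=> t _; have /andP[k0 k1] := zker_01 t.
by rewrite normrM (ger0_norm k0) (gtr0_norm (expR_gt0 _)) ler_wpM2r ?expR_ge0.
Qed.

(** With [x = exp t] this is [s - s (s - 1) int_1^oo {x} x ^ (- s - 1) dx], the classical expression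
    of [(s - 1) zeta s] for [Re s > 0]. *)
Definition zF s := s - s * (s - 1) * laplace zker (- s).

Lemma zF_an s : 0 < Re s -> an zF s.
Proof.
move=> s0; have h : an (laplace zker) (- s).
  apply: (@laplace_an _ _ (- (Re s + 1)) (- (Re s / 2))); try (apply: zker_lapI; lra).
  by rewrite creN; apply/andP; split; lra.
have h' : an (fun z => laplace zker (- z)) s.
  have := @an_comp_affine _ (laplace zker) (-1) 0 s; rewrite mulN1r addr0 => /(_ h).
  by apply: an_near ltr01 _ => z _; rewrite mulN1r addr0.
apply: anB; first exact: an_id.
apply: anM h'; apply: anM; first exact: an_id.
by apply: anB; [exact: an_id|exact: an_cst].
Qed.

Lemma zF1 : zF 1 = 1.
Proof. by rewrite /zF subrr mulr0 mul0r subr0. Qed.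

Lemma zF_le (r : R) s : 0 < r -> r <= Re s -> normc (zF s) <= normc s + normc s * normc (s - 1) * (2 / r).
Proof.
move=> r0 rs; have s0 : 0 < Re s by lra.
apply: le_trans (ler_normcB _ _) _; rewrite lerD2l !normcM ler_wpM2l ?mulr_ge0 ?normc_ge0//.
apply: le_trans (laplace_le _) _; first by rewrite creN; exact: zker_lapI.
rewrite ler_wpM2l//; apply: (@le_trans _ _ (Re s)^-1); last by rewrite lef_pV2.
have := step_exp_int 0 s0; rewrite mulr0 expR0 mul1r => <-.
apply: le_Rintegral => //.
- by apply: intg_norm => //; rewrite creN; exact: zker_lapI.
- exact: step_lapI.
move=> t _; have /andP[k0 k1] := zker_01 t.
by rewrite normrM (ger0_norm k0) (gtr0_norm (expR_gt0 _)) creN ler_wpM2r ?expR_ge0.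
Qed.

Lemma laplace_conj (k : RR -> R) x y : lapI k x ->
  laplace k (x +i* (- y)) = Re (laplace k (x +i* y)) +i* (- Im (laplace k (x +i* y))).
Proof.
move=> ik; have [_ j] := laplace_int (s := x +i* y) ik.
rewrite /laplace /cI /=.
have := @RintegralZl _ _ _ mu setT _ (-1) measurableT j; rewrite mulN1r => <-.
apply: eqc => /=; apply: eq_Rintegral => t _; rewrite !(mulr0, mul0r, subr0, add0r, addr0, mulNr).
  by rewrite cosN.
by rewrite sinN; ring.
Qed.

(** The transform of [zker_ N] is [1 / (s - 1)] minus [1 / s] times a partial sum of the Dirichlet
    series. For [Re s > 1] the bound [exp t] on the kernels suffices for dominated convergence. *)
Lemma zF_dirichlet s l : 1 < Re s -> ccvg (series (dirichlet_term s)) l -> zF s = (s - 1) * l.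
Proof.
move=> s1 hl; have s0 : 0 < Re s by lra.
have sn0 : s != 0 by apply: contraTneq s0 => ->; rewrite ltxx.
have s10 : 0 < Re (s - 1) by rewrite creD creN /=; lra.
have sn1 : s - 1 != 0 by apply: contraTneq s10 => ->; rewrite ltxx.
have ik n : cintg (fun t => (step (ln (n.+1%:R : R)) t)%:C * cexp (- s * t%:C)).
  by apply: laplace_int; rewrite creN; exact: step_lapI.
have i0 : cintg (fun t => (step (0 : R) t)%:C * cexp (- (s - 1) * t%:C)).
  by apply: laplace_int; rewrite creN; exact: step_lapI.
pose D (n : nat) t := (step (ln (n.+1%:R : R)) t)%:C * cexp (- s * t%:C).
have kE N t : (zker_ N t)%:C * cexp (- s * t%:C) =
    (step (0 : R) t)%:C * cexp (- (s - 1) * t%:C) + (-1) * \sum_(n < N) D n t.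
  rewrite /zker_ rmorphB rmorphM /= -cexp_real mulrBl -mulrA -cexpD mulN1r; congr (_ * cexp _ - _).
    by ring.
  by rewrite rmorph_sum /= mulr_suml.
have eN N : laplace (zker_ N) (- s) = (s - 1)^-1 - (s)^-1 * series (dirichlet_term s) N.
  rewrite /laplace; have -> : (fun t => (zker_ N t)%:C * cexp (- s * t%:C)) = fun t => (step (0 : R) t)%:C * cexp (- (s - 1) * t%:C) + (-1) * \sum_(n < N) D n t by apply: funext => t; exact: kE.
  have [jS eS] := cintg_sum N ik; have [jZ eZ] := cintgZ (-1) jS; have [_ ->] := cintgD i0 jZ.
  rewrite eZ eS; have := laplace_step 0 s10; rewrite /laplace => ->.
  rewrite mulr0 cexp0 mul1r mulN1r /series /= big_mkord mulr_sumr; congr (_ - _).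
  by apply: eq_bigr => n _; have := laplace_step (ln (n.+1%:R : R)) s0; rewrite /laplace => ->; rewrite mulrC.
have lim : ccvg (fun N => laplace (zker_ N) (- s)) (laplace zker (- s)).
  apply: (cI_dct (g := fun t => step (0 : R) t * expR (- (Re s - 1) * t)) _ _ _ _).2.
  - by move=> N; apply: cexp_cmeas; exact: zker_meas_.
  - move=> t; apply: ccvg_ReIm.
      rewrite Re_realM; under eq_fun do rewrite Re_realM.
      by apply: cvgM; [exact: zker_cvg|exact: cvg_cst].
    rewrite Im_realM; under eq_fun do rewrite Im_realM.
    by apply: cvgM; [exact: zker_cvg|exact: cvg_cst].
  - by apply: step_lapI; lra.
  - move=> N t; rewrite normcM normc_real normc_cexp Re_sreal creN.
    apply: le_trans (ler_wpM2r (expR_ge0 _) (zker_le_ N t)) _.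
    by rewrite -mulrA -expRD (_ : t + - Re s * t = - (Re s - 1) * t)//; ring.
have lim2 : ccvg (fun N => laplace (zker_ N) (- s)) ((s - 1)^-1 - s^-1 * l).
  apply: (@ccvg_near _ (fun N => (s - 1)^-1 + - (s^-1 * series (dirichlet_term s) N))).
    by apply: nearW => N; rewrite eN.
  apply: ccvgD; first exact: ccvg_cst.
  by apply: ccvgN; exact: ccvgMl.
rewrite /zF (ccvg_unique lim lim2); field; by rewrite sn0 sn1.
Qed.

Lemma zF_zeta (zeta : R[i] -> R[i]) s : is_riemann_zeta zeta -> 0 < Re s -> s != 1 -> zF s = (s - 1) * zeta s.
Proof.
move=> [zd za] s0 s1; pose g z := zF z - (z - 1) * zeta z.
apply/eqP; rewrite -subr_eq0; apply/eqP; rewrite -/(g s).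
have v (u : R) : vanish g (2 +i* u).
  exists (1 / 2) => [|z zr]; first by lra.
  have := le_trans (ler_Re z) zr; rewrite ler_norml => /andP[h1 h2].
  have h : 1 < Re ((2 +i* u) + z) by rewrite creD /=; lra.
  by rewrite /g (zF_dirichlet h (proj1 (ccvgP _ _) (zd _ h))) subrr.
apply: (@identity_half_plane _ g 0 2) => // z z0 hz.
have z1 : z != 1 by case: hz => [h|->//]; apply: contraNneq h => ->.
apply: anB; first exact: zF_an.
apply: anM; first by apply: anB; [exact: an_id|exact: an_cst].
exact/analytic_an/za.
Qed.

Lemma zF_conj x y : 0 < x -> zF (x +i* (- y)) = Re (zF (x +i* y)) +i* (- Im (zF (x +i* y))).
Proof.
move=> x0; have h := @laplace_conj zker (- x) y (zker_lapI x0).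
have h2 := @laplace_conj zker (- x) (- y) (zker_lapI x0).
have e1 : - (x +i* (- y)) = (- x) +i* y :> R[i] by apply: eqc; rewrite /= ?opprK.
have e2 : - (x +i* y) = (- x) +i* (- y) :> R[i] by apply: eqc.
rewrite /zF e1 e2 h; case: (laplace zker _) => p q.
by apply: eqc; rewrite /= ?(creM, cimM, creD, cimD, creN, cimN) /=; ring.
Qed.

Lemma zF_conj_norm x y : 0 < x -> normc (zF (x +i* (- y))) = normc (zF (x +i* y)).
Proof. by move=> x0; rewrite zF_conj//; rewrite /normc; case: (zF _) => p q /=; rewrite sqrrN. Qed.

End ZetaKernel.

(** * The alternating sum *)

Section AlternatingSum.
Context {R : realType}.
Notation mu := (@lebesgue_measure R).
Notation mu2 := (mu \x mu)%E.
Notation RR := (measurableTypeR R).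
Implicit Types (x y l B M : R) (U V : R -> R -> R).
Variables (a x0 x1 d : R).
Hypotheses (a0 : 0 < a) (x00 : 0 < x0) (x01 : x0 < x1) (ax1 : a * x1 < pi / 2) (d0 : 0 < d).
Let x10 : 0 < x1. Proof. exact: lt_trans x01. Qed.
Let ch y := cosh (a * y).
Let W := stripW a x0 x1.
Let kn x y := kern a x0 x1 x y.

(** The points [b + node n] are those of the series in the theorem; [a * node n] runs through the
    odd multiples of [pi / 2]. *)
Definition node n : R := pi / (2 * a) + pi * n%:R / a.
Definition altsum U N := \sum_(n < N) (-1) ^+ n * U (node n) 0.

(* The bound [M] controls the error uniformly in [N], so that the formula passes
   to pointwise limits with the same [M]. *)
Definition alt_formula M U := [/\
  measurable_fun (strip x1) (fun p : RR * RR => U p.1 p.2 * kn p.1 p.2),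
  forall x y, x0 <= x -> `|U x y| <= M &
  forall N, `|altsum U N + a / (2 * pi) * W U| <= M * expR (- d * (node N - x0))].

Lemma node_ge n : x1 <= node n.
Proof.
have h : x1 <= pi / (2 * a).
  by rewrite ler_pdivlMr ?mulr_gt0//; move: ax1; nra.
apply: le_trans h _; rewrite lerDl divr_ge0 ?(ltW a0)// mulr_ge0//; exact: pi_ge0.
Qed.

Lemma node_cvg : (fun N => expR (- d * (node N - x0))) @ \oo --> (0 : R).
Proof.
have h : (fun N => d * (node N - x0)) @ \oo --> +oo.
  have p0 : 0 < pi / a by rewrite divr_gt0 ?pi_gt0.
  apply/cvgryPge => A; near=> N.
  have hN : A <= d * (pi / a) * N%:R.
    have q0 : 0 < d * (pi / a) by exact: mulr_gt0.
    have : A / (d * (pi / a)) <= N%:R by near: N; exact: nbhs_infty_ger.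
    by rewrite ler_pdivrMr// mulrC.
  apply: le_trans hN _; rewrite -mulrA ler_wpM2l ?(ltW d0)//.
  have := node_ge 0; rewrite /node mulr0 mul0r addr0 mulrAC; move: (ltW x01); lra.
under eq_fun do rewrite mulNr.
exact: (cvg_comp _ _ h (@cvgr_expR R)).
Unshelve. all: by end_near. Qed.

Let sech_int : intg mu2 (strip x1) (fun p : RR * RR => (ch p.2)^-1).
Proof.
have h1 x y : 0 <= x <= x1 -> cont2 (fun _ _ : R => 1) x y by move=> _; exact: cont2_cst.
have h2 x y : 0 <= x <= x1 -> `|(fun _ _ : R => 1) x y| <= 1 * (1 + `|y|) by rewrite normr1 mul1r lerDl.
have [_] := growth_int a0 x00 x01 h1 h2.
by apply: eq_intg => [|p _]; [exact: measurable_strip|rewrite mul1r].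
Qed.

Lemma alt_dom M U (p : RR * RR) : (forall x y, x0 <= x -> `|U x y| <= M) -> strip x1 p ->
  `|U p.1 p.2 * kn p.1 p.2| <= M * kern_bound a x0 x1 * (ch p.2)^-1.
Proof.
case: p => x y h /stripP /= xx.
have M0 : 0 <= M by apply: le_trans (h x0 0 (lexx _)).
have kb := kern_le a0 x00 x01 ax1 y xx; have k0 := le_trans (normr_ge0 _) kb.
have [xx0|xx0] := leP x x0.
  by rewrite /kn kern_eq0// mulr0 normr0 -mulrA mulr_ge0.
by rewrite normrM -mulrA ler_pM// h// ltW.
Qed.

Lemma alt_int M U : alt_formula M U -> intg mu2 (strip x1) (fun p : RR * RR => U p.1 p.2 * kn p.1 p.2).
Proof.
move=> [m h _]; apply: (le_intg (measurable_strip x1) m (fun p => alt_dom h)).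
exact: (intgZ _ (measurable_strip x1) sech_int).
Qed.

Lemma alt_formulaZ (c : R) M U : alt_formula M U -> alt_formula (`|c| * M) (fun x y => c * U x y).
Proof.
move=> hU; have iU := alt_int hU; have [m h f] := hU.
have e : W (fun x y => c * U x y) = c * W U.
  rewrite /W /stripW -(@RintegralZl _ _ _ _ _ _ c (measurable_strip x1) iU).
  by apply: eq_Rintegral => p _; rewrite mulrA.
split.
- apply: (eq_measurable_fun (fun p : RR * RR => c * (U p.1 p.2 * kn p.1 p.2))).
    by move=> p _; rewrite mulrA.
  exact: measurable_funM.
- by move=> x y xx; rewrite normrM ler_wpM2l// h.
move=> N; rewrite e (_ : altsum _ N = c * altsum U N).
  rewrite (mulrCA _ c) -mulrDr normrM -[leRHS]mulrA.
  by apply: ler_wpM2l => //; exact: f.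
by rewrite /altsum mulr_sumr; apply: eq_bigr => n _; rewrite mulrCA.
Qed.

Lemma alt_formulaD M N U V : alt_formula M U -> alt_formula N V -> alt_formula (M + N) (fun x y => U x y + V x y).
Proof.
move=> hU hV; have iU := alt_int hU; have iV := alt_int hV; have [m h f] := hU; have [m' h' f'] := hV.
have e : W (fun x y => U x y + V x y) = W U + W V.
  rewrite /W /stripW -(RintegralD (measurable_strip x1) iU iV).
  by apply: eq_Rintegral => p _; rewrite mulrDl.
split.
- apply: (eq_measurable_fun (fun p : RR * RR => U p.1 p.2 * kn p.1 p.2 + V p.1 p.2 * kn p.1 p.2)).
    by move=> p _; rewrite mulrDl.
  exact: measurable_funD.
- by move=> x y xx; apply: le_trans (ler_normD _ _) (lerD (h _ _ xx) (h' _ _ xx)).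
move=> n; rewrite e (_ : altsum _ n = altsum U n + altsum V n).
  have -> : altsum U n + altsum V n + a / (2 * pi) * (W U + W V) = (altsum U n + a / (2 * pi) * W U) + (altsum V n + a / (2 * pi) * W V) by ring.
  by rewrite [leRHS]mulrDl; apply: le_trans (ler_normD _ _) _; apply: lerD; [exact: f|exact: f'].
by rewrite /altsum -big_split; apply: eq_bigr => i _; rewrite mulrDr.
Qed.

Lemma alt_formula0 : alt_formula 0 (fun _ _ => 0).
Proof.
split.
- apply: (eq_measurable_fun (fun=> 0 : R)) => // p _; by rewrite mul0r.
- by move=> x y _; rewrite normr0.
move=> N; rewrite mul0r /W /stripW /altsum big1 => [|i _]; last by rewrite mulr0.
rewrite add0r (_ : \int[_]_(_ in _) _ = 0) ?mulr0 ?normr0//.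
by under eq_Rintegral do rewrite mul0r; rewrite Rintegral_cst// ?mul0r//; exact: measurable_strip.
Qed.

Lemma alt_formula_sum (F : nat -> R -> R -> R) (m : nat -> R) (P : pred nat) N : (forall i, P i -> alt_formula (m i) (F i)) ->
  alt_formula (\sum_(i < N | P i) m i) (fun x y => \sum_(i < N | P i) F i x y).
Proof.
move=> h; elim: N => [|N IH].
  rewrite big_ord0 (_ : (fun x y => _) = fun _ _ => 0); first exact: alt_formula0.
  by apply: funext => x; apply: funext => y; rewrite big_ord0.
rewrite big_mkcond big_ord_recr /= -big_mkcond.
rewrite (_ : (fun x y => _) = fun x y => \sum_(i < N | P i) F i x y + (if P N then F N else fun _ _ => 0) x y); last first.
  by apply: funext => x; apply: funext => y; rewrite big_mkcond big_ord_recr /= -big_mkcond; case: ifP.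
apply: alt_formulaD => //.
by case: ifPn => [/h//|_]; exact: alt_formula0.
Qed.

Lemma alt_formula_lim (F : nat -> R -> R -> R) U M : (forall i, alt_formula M (F i)) ->
  (forall x y, x0 <= x -> (fun i => F i x y) @ \oo --> U x y) -> alt_formula M U.
Proof.
move=> hF FU.
have FK (p : RR * RR) : strip x1 p -> (fun i => F i p.1 p.2 * kn p.1 p.2) @ \oo --> U p.1 p.2 * kn p.1 p.2.
  case: p => x y /stripP /= xx; have [xx0|xx0] := leP x x0.
    rewrite /kn kern_eq0// mulr0; under eq_fun do rewrite mulr0; exact: cvg_cst.
  by apply: cvgM; [apply: FU; exact: ltW|exact: cvg_cst].
have mF i : measurable_fun (strip x1) (fun p : RR * RR => F i p.1 p.2 * kn p.1 p.2) by have [] := hF i.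
have hU x y : x0 <= x -> `|U x y| <= M.
  move=> xx; have c : (fun i => `|F i x y|) @ \oo --> `|U x y| by apply: cvg_norm; exact: FU.
  apply: (@ler_cvg_to _ _ _ _ _ _ _ _ c (cvg_cst M)).
  by apply: nearW => i; have [_ h _] := hF i; exact: h.
have [_ cW] := Rdct (measurable_strip x1) mF FK (intgZ (M * kern_bound a x0 x1) (measurable_strip x1) sech_int)
  (fun i p hp => ltac:(have [_ h _] := hF i; exact: (alt_dom h hp))).
split => //.
  exact: (measurable_fun_cvg mF FK).
move=> N; have cA : (fun i => altsum (F i) N) @ \oo --> altsum U N.
  elim: N => [|N IH]; first by rewrite /altsum big_ord0; under eq_fun do rewrite big_ord0; exact: cvg_cst.
  rewrite {2}/altsum big_ord_recr /=; under eq_fun do rewrite /altsum big_ord_recr /=.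
  apply: cvgD => //; apply: cvgM; first exact: cvg_cst.
  by apply: FU; apply: le_trans (ltW x01) (node_ge N).
have c : (fun i => `|altsum (F i) N + a / (2 * pi) * W (F i)|) @ \oo --> `|altsum U N + a / (2 * pi) * W U|.
  by apply: cvg_norm; apply: cvgD => //; apply: cvgM => //; exact: cvg_cst.
apply: (@ler_cvg_to _ _ _ _ _ _ _ _ c (cvg_cst _)).
by apply: nearW => i; have [_ _ h] := hF i; exact: h.
Qed.

Lemma alt_formula_cvg M U : alt_formula M U -> altsum U @ \oo --> - (a / (2 * pi) * W U).
Proof.
move=> [_ _ h]; apply/cvg_dist0P; apply: (squeeze_cvgr _ (cvg_cst 0)); last first.
  by rewrite -[X in _ --> X](mulr0 M); apply: cvgM; [exact: cvg_cst|exact: node_cvg].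
by apply: nearW => N; rewrite normr_ge0 opprK h.
Qed.

Let altsumS U N : altsum U N.+1 = altsum U N + (-1) ^+ N * U (node N) 0.
Proof. by rewrite /altsum big_ord_recr. Qed.

Let altsum_geo l N : let q := expR (- (l * (pi / (2 * a)))) in
  altsum (fun x y => expR (- l * x) * cos (l * y)) N = q * (1 - (- q ^+ 2) ^+ N) / (1 + q ^+ 2).
Proof.
move=> q; have q0 : 0 < q by exact: expR_gt0.
have e n : expR (- l * node n) = q * (q ^+ 2) ^+ n.
  rewrite /q -exprM -expRM_natl -expRD; congr expR; rewrite /node natrM; move: (pi : R) => p; field; by rewrite gt_eqF.
elim: N => [|N IH]; first by rewrite /altsum big_ord0 expr0 subrr mulr0 mul0r.
rewrite altsumS IH mulr0 cos0 mulr1 e [(- q ^+ 2) ^+ N.+1]exprS.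
rewrite -(mulN1r (q ^+ 2)) [(-1 * q ^+ 2) ^+ N]exprMn; field.
by rewrite gt_eqF// addr_gt0// exprn_gt0.
Qed.

(** The function is harmonic, so [W = - E], and [sech_transform] evaluates [E]. The alternating sum
    over the nodes is geometric with ratio [- q ^ 2]; its full sum [q / (1 + q ^ 2)] is
    [1 / (2 cosh (l pi / (2 a)))], that is [a / (2 pi) * E]. What remains is at most
    [exp (- l * node N)], and [d <= l] makes the decay uniform in [l]. *)
Lemma alt_formula_exp l : d <= l -> alt_formula (expR (- l * x0)) (fun x y => expR (- l * x) * cos (l * y)).
Proof.
move=> dl; have l0 : 0 < l := lt_le_trans d0 dl.
pose U x y := expR (- l * x) * cos (l * y).
have hx x := dv_exp (dv_mulc (- l) x); have hc y := dv_cos (dv_mulc l y); have hs y := dv_sin (dv_mulc l y).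
have ce x y : cont2 (fun x _ => expR (- l * x)) x y by apply: cont2_x; exact: (dv_cont (hx x)).
have cc x y : cont2 (fun _ y => cos (l * y)) x y by apply: (cont2_y (g := fun y => cos (l * y))); exact: (dv_cont (hc y)).
have cs x y : cont2 (fun _ y => sin (l * y)) x y by apply: (cont2_y (g := fun y => sin (l * y))); exact: (dv_cont (hs y)).
have cU x y : cont2 U x y by exact: cont2M.
have dU x y : C2at U (fun x y => - l * U x y) (fun x y => l ^+ 2 * U x y)
    (fun x y => - l * (expR (- l * x) * sin (l * y))) (fun x y => - l ^+ 2 * U x y) x y.
  split.
  - split; apply: (dv_eq).
    + exact: (dvM (hx x) (dv_cst (cos (l * y)) x)).
    + by rewrite /U; ring.
    + exact: (dvZ (- l) (dvM (hx x) (dv_cst (cos (l * y)) x))).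
    + by rewrite /U; ring.
  - split; apply: (dv_eq).
    + exact: (dvZ (expR (- l * x)) (hc y)).
    + by ring.
    + exact: (dvZ (- l) (dvZ (expR (- l * x)) (hs y))).
    + by rewrite /U; ring.
  - exact: cU.
  - by split; apply: cont2M => //; exact: cont2_cst.
  - by split; apply: cont2M => //; [exact: cont2_cst|exact: cont2M|exact: cont2_cst].
have U1 x y : `|U x y| <= expR (- l * x).
  by rewrite /U normrM (gtr0_norm (expR_gt0 _)) ler_piMr ?expR_ge0// cos_max.
have gr x y : 0 <= x <= x1 -> `|U x y| <= 1 * (1 + `|y|).
  move=> /andP[xx _]; apply: le_trans (U1 x y) _; rewrite mul1r.
  apply: (@le_trans _ _ 1); last by rewrite lerDl.
  by rewrite -expR0 ler_expR mulNr oppr_le0 mulr_ge0// ltW.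
have [iE iS] := growth_int a0 x00 x01 (fun x y _ => cU x y) gr.
have [_ h] := green_strip a0 x00 x01 ax1 (fun x y _ => dU x y) iE iS.
have {}h : lineE a U + W U = 0.
  by apply: h => x y _; ring.
have EE : lineE a U = pi / a / cosh (l * (pi / (2 * a))).
  rewrite -(sech_transform a0 l) /lineE; apply: eq_Rintegral => y _.
  by rewrite /U mulr0 expR0 mul1r.
split.
- have h' (x y : R) : 0 <= x <= x1 -> cont2 (fun x y => U x y * kn x y) x y.
    move=> xx; apply: (cont2M (cU x y)); exact: kern_cont.
  by apply: (strip_measurable (ltW x10)) => -[x y] /stripP /= xx; exact: (h' _ _ xx).
- move=> x y xx; apply: le_trans (U1 x y) _.
  by rewrite ler_expR !mulNr lerN2 ler_wpM2l// ltW.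
move=> N; have -> : W U = - (pi / a / cosh (l * (pi / (2 * a)))) by rewrite -EE; lra.
have p0 : (pi : R) != 0 by rewrite gt_eqF// pi_gt0.
rewrite altsum_geo /=; set q := expR (- (l * _)).
have q0 : 0 < q by exact: expR_gt0.
have -> : cosh (l * (pi / (2 * a))) = (q^-1 + q) / 2 by rewrite /cosh /q -expRN opprK.
have q2 : 0 < 1 + q ^+ 2 by rewrite addr_gt0// exprn_gt0.
have -> : q * (1 - (- q ^+ 2) ^+ N) / (1 + q ^+ 2) + a / (2 * pi) * - (pi / a / ((q^-1 + q) / 2)) =
    - (q * (- q ^+ 2) ^+ N / (1 + q ^+ 2)).
  move: (pi : R) p0 ((- q ^+ 2) ^+ N) => r r0 t; field.
  by rewrite r0 !gt_eqF.
rewrite normrN !normrM (gtr0_norm q0) normfV (gtr0_norm q2) normrX normrN (ger0_norm (sqr_ge0 q)).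
rewrite ler_pdivrMr//; apply: (@le_trans _ _ (expR (- l * x0) * expR (- d * (node N - x0)))); last first.
  by rewrite ler_peMr ?mulr_ge0 ?expR_ge0// lerDl sqr_ge0.
rewrite -exprM /q -expRM_natl -!expRD ler_expR natrM.
have xN := le_trans (ltW x01) (node_ge N).
have -> : - (l * (pi / (2 * a))) + 2 * N%:R * - (l * (pi / (2 * a))) = - l * node N.
  by rewrite /node; move: (pi : R) => r; field; rewrite gt_eqF.
have : 0 <= (l - d) * (node N - x0) by rewrite mulr_ge0// subr_ge0.
by lra.
Qed.
End AlternatingSum.

(** * Euler product *)

Section LogSeries.
Context {R : realType}.
Implicit Types (t : R) (z : R[i]).

(** Along [t z] with [0 <= t <= 1] the derivative of [ln |1 - t z|] plus the partial sum is the real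
    part of a geometric remainder. Since [|1 - t z| >= 1 / 2], the mean value theorem bounds the
    difference at [t = 1] by [2 ^ (- K)]. *)
Lemma ln_series z : normc z <= 1 / 2 ->
  (fun K => \sum_(k < K) Re (z ^+ k.+1) / k.+1%:R) @ \oo --> - ln (normc (1 - z)).
Proof.
move=> zh; pose x := Re z; pose y := Im z.
have zz t : 0 <= t <= 1 -> normc (t%:C * z) <= 1 / 2.
  move=> /andP[t0 t1]; rewrite normcM normc_real ger0_norm//.
  by have := normc_ge0 z; nra.
pose D t := (1 - t * x) ^+ 2 + (t * y) ^+ 2.
have DE t : D t = normc (1 - t%:C * z) ^+ 2.
  rewrite normc_sqr creD cimD creN cimN Re_realM Im_realM /D /=; ring.
have nlow t : 0 <= t <= 1 -> 1 / 2 <= normc (1 - t%:C * z).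
  by move=> /zz h; have := ler_normc_dist 1 (t%:C * z); rewrite normc1; lra.
have D0 t : 0 <= t <= 1 -> 0 < D t.
  by move=> /nlow h; rewrite DE exprn_gt0//; lra.
have lnD t : 0 <= t <= 1 -> 1 / 2 * ln (D t) = ln (normc (1 - t%:C * z)).
  by move=> /nlow h; rewrite DE lnXn; [rewrite -[_ *+ 2]mulr_natl; lra|lra].
pose P K t := \sum_(k < K) t ^+ k.+1 * (Re (z ^+ k.+1) / k.+1%:R).
pose P' K t := \sum_(k < K) t ^+ k * Re (z ^+ k.+1).
have dP K t : dv (P K) t (P' K t).
  elim: K => [|K IH].
    have -> : P 0%N = fun=> 0 by apply: funext => u; rewrite /P big_ord0.
    by rewrite /P' big_ord0; exact: dv_cst.
  have -> : P K.+1 = fun t => P K t + t ^+ K.+1 * (Re (z ^+ K.+1) / K.+1%:R) by apply: funext => u; rewrite /P big_ord_recr.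
  apply: (dv_eq (dvD IH (dvM (dv_Xn t K) (dv_cst _ t)))) => /=.
  rewrite {2}/P' big_ord_recr /= mulr0 addr0; congr (_ + _).
  have : (K.+1%:R : R) != 0 by rewrite pnatr_eq0.
  by move: (K.+1%:R : R) (Re _) => p q p0; field.
have dD t : dv D t (2 * (1 - t * x) * (0 - x) + 2 * (t * y) * y).
  have h1 := dvB (dv_cst 1 t) (dvM (dv_id t) (dv_cst x t)).
  have h2 := dvM (dv_id t) (dv_cst y t).
  by apply: (dv_eq (dvD (dvX2 h1) (dvX2 h2))) => /=; ring.
have geo K t : 0 <= t <= 1 -> - z / (1 - t%:C * z) + \sum_(k < K) (t%:C) ^+ k * z ^+ k.+1 = - z * (t%:C * z) ^+ K / (1 - t%:C * z).
  move=> /nlow h; have n0 : 1 - t%:C * z != 0 by rewrite -normc_gt0; lra.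
  elim: K => [|K IH]; first by rewrite big_ord0 expr0 addr0 mulr1.
  rewrite big_ord_recr /= addrA IH !exprMn [z ^+ K.+1]exprS [(t%:C) ^+ K.+1]exprS.
  by move: n0; move: (t%:C) (t%:C ^+ K) (z ^+ K) => u v w n0; field.
pose F K t := 1 / 2 * ln (D t) + P K t.
pose F' K t := 1 / 2 * ((2 * (1 - t * x) * (0 - x) + 2 * (t * y) * y) / D t) + P' K t.
have F'E K t : 0 <= t <= 1 -> F' K t = Re (- z * (t%:C * z) ^+ K / (1 - t%:C * z)).
  move=> tt; rewrite -geo// creD /F'; congr (_ + _).
    have d0 := D0 _ tt; rewrite mulNr creN.
    have -> : z / (1 - t%:C * z) = ((D t)^-1)%:C * (z * ((1 - t * x) +i* (t * y))).
      have n0 : 1 - t%:C * z != 0 by rewrite -normc_gt0; have := nlow _ tt; lra.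
      apply: (mulIf n0); rewrite divfK//.
      have -> : 1 - t%:C * z = (1 - t * x) +i* (- (t * y)).
        by apply: eqc; rewrite ?creD ?cimD ?creN ?cimN ?Re_realM ?Im_realM /= ?sub0r.
      rewrite -!mulrA.
      have -> : ((1 - t * x) +i* (t * y)) * ((1 - t * x) +i* (- (t * y))) = (D t)%:C.
        by apply: eqc; rewrite ?creM ?cimM /= /D; ring.
      by rewrite mulrCA -rmorphM /= mulVf ?gt_eqF// mulr1.
    by rewrite Re_realM creM /= -/x -/y; field; rewrite gt_eqF.
  rewrite Re_sum /P'; apply: eq_bigr => k _.
  by rewrite -rmorphXn Re_realM.
have bd K : `|F K 1| <= (1 / 2) ^+ K.
  have dF t : 0 <= t <= 1 -> dv (F K) t (F' K t).
    by move=> tt; apply: dvD; [apply: dvZ; exact: (dv_ln (D0 _ tt) (dD t))|exact: dP].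
  have [c /andP[c0 c1] e] := @dv_MVT _ (F K) (F' K) 0 1 ltr01 dF.
  have F0 : F K 0 = 0.
    rewrite /F lnD ?lexx ?ler01// (_ : 1 - _ = 1); last by rewrite mul0r subr0.
    rewrite normc1 ln1 add0r /P big1// => i _; by rewrite exprS mul0r mul0r.
  have -> : F K 1 = F' K c by move: e; rewrite F0 !subr0 mulr1.
  have cc : 0 <= c <= 1 by rewrite !ltW.
  rewrite F'E//; apply: le_trans (ler_Re _) _.
  rewrite !normcM normcN normcX normcV ler_pdivrMr; last by have := nlow _ cc; lra.
  rewrite mulrC; apply: ler_pM; rewrite ?exprn_ge0 ?normc_ge0//.
    by apply: lerXn2r; rewrite ?nnegrE ?normc_ge0 ?zz//; lra.
  by apply: le_trans zh _; exact: nlow.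
have FE K : F K 1 = ln (normc (1 - z)) + \sum_(k < K) Re (z ^+ k.+1) / k.+1%:R.
  rewrite /F lnD ?ler01 ?lexx// mul1r /P; congr (_ + _).
  by apply: eq_bigr => k _; rewrite expr1n mul1r.
apply/cvg_dist0P; apply: (squeeze_cvgr _ (cvg_cst 0) (_ : (fun K => (1 / 2 : R) ^+ K) @ \oo --> 0)).
  by apply: nearW => K; rewrite normr_ge0 opprK addrC -FE bd.
by apply: cvg_expr; rewrite ger0_norm; lra.
Qed.

End LogSeries.

Section EulerProduct.
Context {R : realType}.
Implicit Types (s z : R[i]) (x y : R).
Variable zeta : R[i] -> R[i].
Hypothesis zetaE : forall s, 1 < Re s -> ccvg (series (dirichlet_term s)) (zeta s).

(** The sieve of Eratosthenes: no prime below [P] divides [n]. The recursion removes one prime at a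
    time, as [rsum_step] does. *)
Fixpoint rough P n : bool := if P is P'.+1 then rough P' n && ~~ (prime P' && (P' %| n)%N) else true.

Lemma rough_mul P p n : prime p -> (P <= p)%N -> rough P (p * n) = rough P n.
Proof.
move=> pp; elim: P => [//|P IH] Pp /=; rewrite IH ?(ltnW Pp)//.
case: (boolP (prime P)) => //= pP; rewrite Euclid_dvdM// dvdn_prime2//.
by rewrite (ltn_eqF Pp).
Qed.

Lemma rough1 P : rough P 1.
Proof.
elim: P => [//|P IH] /=; rewrite IH dvdn1 /=; apply/negP => /andP[pP /eqP e].
by rewrite e in pP.
Qed.

Lemma rough_dvd P p n : prime p -> (p < P)%N -> (p %| n)%N -> rough P n = false.
Proof.
move=> pp pP pn; elim: P pP => [//|P IH]; rewrite ltnS leq_eqVlt => /predU1P[<-|/IH/= ->//] /=.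
by rewrite pp pn andbF.
Qed.

Lemma rough_lt P n : (1 < n)%N -> (n < P)%N -> rough P n = false.
Proof.
move=> n1 nP; apply: (rough_dvd (pdiv_prime n1) _ (pdiv_dvd n)).
by apply: leq_ltn_trans nP; rewrite pdiv_leq// ltnW.
Qed.

(** The index is shifted back so that the term is [n ^ (- s)] and multiplicative in [n]. *)
Definition dterm s n := dirichlet_term s n.-1.

Lemma dtermM s m n : (0 < m)%N -> (0 < n)%N -> dterm s (m * n) = dterm s m * dterm s n.
Proof.
move=> m0 n0; rewrite /dterm /dirichlet_term !prednK ?muln_gt0 ?m0//.
by rewrite -cexpD -mulrDr -rmorphD /= natrM lnM// posrE ltr0n.
Qed.

Lemma normc_dirichlet s n : normc (dirichlet_term s n) = expR (- Re s * ln n.+1%:R).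
Proof. by rewrite /dirichlet_term normc_cexp Re_sreal creN. Qed.

Lemma sum_dvd (F : nat -> R[i]) p N : (0 < p)%N ->
  \sum_(i < N | (p %| i.+1)%N) F i.+1 = \sum_(m < N %/ p) F (p * m.+1)%N.
Proof.
move=> p0; elim: N => [|N IH]; first by rewrite div0n !big_ord0.
rewrite big_mkcond big_ord_recr /= -big_mkcond IH divnS//.
case: ifPn => [/dvdnP[k e]|_]; last by rewrite add0n addr0.
rewrite add1n big_ord_recr /=; congr (_ + F _).
have : (N.+1 %/ p)%N = (N %/ p).+1 by rewrite divnS// e dvdn_mull.
by rewrite e mulnK// => ->; rewrite mulnC.
Qed.

Definition rsum P s N := \sum_(i < N | rough P i.+1) dterm s i.+1.
Definition eprod P s := \prod_(p < P | prime p) (1 - dterm s p).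

(** The terms sieved out are the [P * m] with [m] rough, and multiplicativity extracts the factor
    [dterm s P]. *)
Lemma rsum_step P s N : prime P -> rsum P.+1 s N = rsum P s N - dterm s P * rsum P s (N %/ P).
Proof.
move=> pP; have P0 := prime_gt0 pP.
have -> : dterm s P * rsum P s (N %/ P) = \sum_(i < N | rough P i.+1 && (P %| i.+1)%N) dterm s i.+1.
  have := sum_dvd (fun n => if rough P n then dterm s n else 0) N P0.
  move=> h; rewrite (eq_bigl (fun i : 'I_N => (P %| i.+1)%N && rough P i.+1)); last by move=> i; rewrite andbC.
  rewrite big_mkcondr /= h /rsum big_mkcond mulr_sumr; apply: eq_bigr => m _.
  by rewrite rough_mul// dtermM//; case: ifP => _; rewrite ?mulr0.
rewrite /rsum [X in _ = X - _](bigID (fun i : 'I_N => (P %| i.+1)%N)) /= [RHS]addrAC subrr add0r.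
by apply: eq_bigl => i /=; rewrite pP.
Qed.

Lemma rsum_cvg P s : 1 < Re s -> ccvg (rsum P s) (zeta s * eprod P s).
Proof.
move=> s1; elim: P => [|P IH].
  rewrite /eprod big_ord0 mulr1; apply: ccvg_near (zetaE s1); apply: nearW => N.
  by rewrite /rsum /series /= big_mkord.
rewrite /eprod big_mkcond big_ord_recr /= -big_mkcond -/(eprod P s).
case: ifPn => pP; last first.
  rewrite mulr1; apply: ccvg_near IH; apply: nearW => N; apply: eq_bigl => i /=.
  by rewrite (negbTE pP) andbT.
apply: (@ccvg_near _ (fun N => rsum P s N - dterm s P * rsum P s (N %/ P))).
  by apply: nearW => N; rewrite rsum_step.
rewrite mulrA mulrBr mulr1 [X in _ - X]mulrC; apply: ccvgD => //; apply: ccvgN; apply: ccvgMl.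
apply: (cvg_comp (fun N => (N %/ P)%N) (fun N => normc (rsum P s N - zeta s * eprod P s)) _ IH).
apply/cvgnyPge => A; exists (A * P)%N => // N /= h.
by rewrite leq_divRL// prime_gt0.
Qed.

Let rt x n := expR (- x * ln (n.+1%:R : R)).

Lemma rt_cvg x : 1 < x -> series (rt x) @ \oo --> Re (zeta x%:C).
Proof.
move=> x1; have := ccvg_Re (@zetaE x%:C x1).
rewrite (_ : (fun n => _) = series (rt x))//; apply: funext => n.
rewrite /series /= Re_sum; apply: eq_bigr => i _.
by rewrite /dirichlet_term -rmorphN -rmorphM cexp_real.
Qed.

Lemma rt_le x N : 1 < x -> series (rt x) N <= Re (zeta x%:C).
Proof.
move=> x1; rewrite -(cvg_lim (@norm_hausdorff _ _) (rt_cvg x1)).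
apply: nondecreasing_cvgn_le; last exact: cvgP (rt_cvg x1).
by apply: nondecreasing_series => n _ _; exact: expR_ge0.
Qed.

Lemma zeta_real x : 1 < x -> [/\ 1 <= Re (zeta x%:C), Im (zeta x%:C) = 0 & normc (zeta x%:C) = Re (zeta x%:C)].
Proof.
move=> x1; have h : 1 <= Re (zeta x%:C).
  by have := rt_le 1 x1; rewrite /series /= big_nat1 /rt ln1 mulr0 expR0.
have i0 : Im (zeta x%:C) = 0.
  apply: (cvg_unique _ (ccvg_Im (@zetaE x%:C x1))) => //.
  rewrite (_ : (fun n => _) = fun=> 0); first exact: cvg_cst.
  apply: funext => n; rewrite /series /= Im_sum big1// => i _.
  by rewrite /dirichlet_term -rmorphN -rmorphM cexp_real.
split => //; have -> : zeta x%:C = (Re (zeta x%:C))%:C by apply: eqc.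
by rewrite normc_real ger0_norm//=; lra.
Qed.

(** After sieving, the term [1] is left together with terms of index at least [P], whose moduli are
    bounded by a tail of the series for [zeta (Re s)]. *)
Lemma eprod_cvg s : 1 < Re s -> ccvg (fun P => zeta s * eprod P s) 1.
Proof.
(* Position [i] of the series carries the term of [i + 1], hence the tail starts at [P.-1]. *)
move=> s1; apply: (@ccvg_squeeze _ _ _ (fun P => Re (zeta (Re s)%:C) - series (rt (Re s)) P.-1)); last first.
  rewrite -(subrr (Re (zeta (Re s)%:C))); apply: cvgB; first exact: cvg_cst.
  rewrite -cvg_shiftS /=; exact: rt_cvg.
move=> P; have c : ccvg (fun N => rsum P s N - 1) (zeta s * eprod P s - 1).
  by apply: ccvgD; [exact: rsum_cvg|exact: ccvg_cst].
apply: (ccvg_le c); exists (maxn 1 P) => // N /=; rewrite geq_max => /andP[N1 NP].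
have -> : rsum P s N - 1 = \sum_(P.-1 <= i < N | rough P i.+1 && (0 < i)%N) dterm s i.+1.
  have -> : rsum P s N - 1 = \sum_(0 <= i < N | rough P i.+1 && (0 < i)%N) dterm s i.+1.
    rewrite /rsum (bigD1 (Ordinal N1)) /= ?rough1// /dterm {1}/dirichlet_term /= ln1 mulr0 cexp0 [LHS]addrAC subrr add0r.
    by rewrite big_mkord; apply: eq_bigl => i; rewrite -val_eqE /= lt0n.
  rewrite (@big_cat_nat _ _ _ P.-1)//=; last by apply: leq_trans NP; exact: leq_pred.
  rewrite big_nat_cond big1 ?add0r// => i /andP[/andP[_ iP] /andP[h i0]].
  by move: h; rewrite rough_lt//; lia.
apply: le_trans (normc_sum _ _ _) _.
apply: (@le_trans _ _ (\sum_(P.-1 <= i < N) rt (Re s) i)).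
  rewrite big_mkcond /=; apply: ler_sum => i _; case: ifP => _; last exact: expR_ge0.
  by rewrite normc_dirichlet.
rewrite -sub_series_geq; last by apply: leq_trans NP; exact: leq_pred.
by rewrite lerD2r rt_le.
Qed.

Lemma dterm_le s n : 1 < Re s -> prime n -> normc (dterm s n) <= 1 / 2.
Proof.
move=> s1 /prime_gt1 n1; rewrite /dterm normc_dirichlet prednK 1?ltnW// mulNr expRN.
rewrite div1r lef_pV2 ?posrE ?expR_gt0//.
have h : (2 : R) <= n%:R by rewrite ler_nat.
have l0 : 0 <= ln (n%:R : R) by rewrite ln_ge0//; lra.
apply: le_trans h _; rewrite -{1}(@lnK _ n%:R) ?posrE ?ltr0n 1?ltnW// ler_expR.
by rewrite ler_peMl// ltW.
Qed.

Lemma zeta_neq0 s : 1 < Re s -> zeta s != 0.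
Proof.
move=> s1; apply/eqP => z0; have := eprod_cvg s1; rewrite z0 => h.
have : ccvg (fun=> 0) (1 : R[i]) by apply: ccvg_near h; apply: nearW => P; rewrite mul0r.
move=> /(ccvg_unique (ccvg_cst 0)) /eqP; by rewrite eq_sym oner_eq0.
Qed.

Lemma ln_zeta s : 1 < Re s ->
  (fun P => \sum_(p < P | prime p) - ln (normc (1 - dterm s p))) @ \oo --> ln (normc (zeta s)).
Proof.
move=> s1; have z0 : 0 < normc (zeta s) by rewrite normc_gt0 zeta_neq0.
have pos p : prime p -> 0 < normc (1 - dterm s p).
  move=> pp; have := ler_normc_dist 1 (dterm s p); rewrite normc1; have := dterm_le s1 pp; lra.
have E P : 0 < normc (eprod P s) /\ ln (normc (eprod P s)) = \sum_(p < P | prime p) ln (normc (1 - dterm s p)).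
  elim: P => [|P [IH1 IH2]]; first by rewrite /eprod !big_ord0 normc1 ln1.
  rewrite /eprod big_mkcond big_ord_recr /= -big_mkcond -/(eprod P s).
  rewrite [in RHS]big_mkcond big_ord_recr /= -big_mkcond -IH2.
  case: ifPn => pP; last by rewrite mulr1 addr0.
  by rewrite normcM; split; [rewrite mulr_gt0// pos|rewrite lnM// posrE// pos].
have := ccvg_normc (eprod_cvg s1); rewrite normc1 => h.
have h2 : (fun P => ln (normc (zeta s * eprod P s))) @ \oo --> ln (1 : R).
  by apply: (cvg_comp _ _ h); exact: continuous_ln.
rewrite ln1 in h2; rewrite -[X in _ --> X]subr0.
rewrite (_ : (fun P => _) = fun P => ln (normc (zeta s)) - ln (normc (zeta s * eprod P s))).
  by apply: cvgB => //; exact: cvg_cst.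
apply: funext => P; have [e1 e2] := E P.
by rewrite normcM lnM ?posrE// e2 opprD addNKr sumrN.
Qed.

End EulerProduct.

(** * The logarithmic integral *)

Section LogZeta.
Context {R : realType}.
Notation mu := (@lebesgue_measure R).
Notation mu2 := (mu \x mu)%E.
Notation RR := (measurableTypeR R).
Implicit Types (x y l B M : R) (U V : R -> R -> R) (s z : R[i]).
Variable zeta : R[i] -> R[i].
Hypothesis zetaE : forall s, 1 < Re s -> ccvg (series (dirichlet_term s)) (zeta s).
Variables (a x0 x1 b : R).
Hypotheses (a0 : 0 < a) (x00 : 0 < x0) (x01 : x0 < x1) (ax1 : a * x1 < pi / 2) (bx0 : 1 < b + x0).

(** The least of the frequencies [k ln p] that occur in the logarithm of the Euler product. *)
Let d : R := ln 2.
Let d0 : 0 < d. Proof. by rewrite ln_gt0//; lra. Qed.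
Let af := alt_formula a x0 x1 d.

Lemma alt_formula_le M M' U : M <= M' -> af M U -> af M' U.
Proof.
move=> MM [h1 h2 h3]; split => //.
  by move=> x y xx; apply: le_trans (h2 _ _ xx) MM.
by move=> N; apply: le_trans (h3 N) _; rewrite ler_wpM2r ?expR_ge0.
Qed.

Lemma cexpX z n : cexp z ^+ n = cexp (n%:R * z).
Proof.
elim: n => [|n IH]; first by rewrite mul0r cexp0 expr0.
by rewrite exprS IH -cexpD -natr1; congr cexp; ring.
Qed.

Let q p := expR (- (b + x0) * ln (p%:R : R)).

(** By [ln_series] the logarithm of one Euler factor is a sum of exponentials with frequencies
    [k ln p]. Their constants are at most [q p ^ k], and [q p <= 1 / 2] makes them sum to at most
    [2 * q p]. *)
Lemma alt_formula_prime p : prime p ->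
  af (2 * q p) (fun x y => - ln (normc (1 - dterm ((b + x) +i* y) p))).
Proof.
move=> pp; have p1 := prime_gt1 pp.
have p2 : (2 : R) <= p%:R by rewrite ler_nat.
have lp : d <= ln p%:R by rewrite /d ler_ln// posrE; lra.
pose l k := k.+1%:R * ln (p%:R : R).
have dl k : d <= l k.
  have := ltW (lt_le_trans d0 lp); have : (1 : R) <= k.+1%:R by rewrite ler1n.
  by rewrite /l; nra.
pose c k := expR (- l k * b) / k.+1%:R.
pose F k x y := c k * (expR (- l k * x) * cos (l k * y)).
have q0 : 0 < q p by exact: expR_gt0.
have q1 : q p <= 1 / 2.
  have x1' : 1 < Re ((b + x0)%:C : R[i]) by [].
  by have := dterm_le x1' pp; rewrite /dterm normc_dirichlet prednK ?prime_gt0.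
have dE x y k : Re (dterm ((b + x) +i* y) p ^+ k.+1) / k.+1%:R = F k x y.
  rewrite /dterm /dirichlet_term cexpX prednK ?prime_gt0// Re_cexp complex_nat.
  rewrite Re_realM Im_realM Re_sreal Im_sreal /= /F /c mulrAC [RHS]mulrA; congr (_ * _).
    by rewrite mulrAC -expRD; congr (expR _ / _); rewrite /l; ring.
  by rewrite -cosN; congr cos; rewrite /l; ring.
apply: (@alt_formula_lim _ _ _ _ _ a0 x00 x01 ax1 (fun K x y => \sum_(k < K | xpredT k) F k x y)).
  move=> K; apply: alt_formula_le; last first.
    apply: (@alt_formula_sum _ _ _ _ _ a0 x00 x01 ax1 F (fun k => `|c k| * expR (- l k * x0)) xpredT K) => k _.
    apply: alt_formulaZ => //; exact: alt_formula_exp.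
  apply: (@le_trans _ _ (\sum_(k < K) q p * (1 / 2) ^+ k)).
    apply: ler_sum => k _.
    have k1 : (1 : R) <= k.+1%:R by rewrite ler1n.
    rewrite ger0_norm ?divr_ge0 ?expR_ge0// /c mulrAC -expRD.
    apply: (@le_trans _ _ (q p ^+ k.+1)).
      rewrite ler_pdivrMr ?ltr0n// -expRM_natl.
      have -> : - l k * b + - l k * x0 = k.+1%:R * (- (b + x0) * ln p%:R) by rewrite /l; ring.
      by rewrite ler_peMr// expR_ge0.
    by rewrite exprS ler_wpM2l ?(ltW q0)//; apply: lerXn2r; rewrite ?nnegrE ?(ltW q0)//; lra.
  by rewrite -mulr_sumr mulrC ler_wpM2r ?(ltW q0)//; exact: half_sum.
move=> x y xx; have h : 1 < Re ((b + x) +i* y) by change (1 < b + x); move: bx0; lra.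
have := ln_series (dterm_le h pp); rewrite (_ : (fun K => _) = fun K => \sum_(k < K | xpredT k) F k x y)//.
by apply: funext => K; apply: eq_bigr => k _; exact: dE.
Qed.

Definition log_zeta x y := ln (normc (zeta ((b + x) +i* y))).

(** The constants of the Euler factors add up to at most [2 * zeta (b + x0)], independently of the
    number of primes, so [alt_formula_lim] applies. *)
Lemma alt_formula_zeta : af (2 * Re (zeta (b + x0)%:C)) log_zeta.
Proof.
apply: (@alt_formula_lim _ _ _ _ _ a0 x00 x01 ax1 (fun P x y => \sum_(p < P | prime p) - ln (normc (1 - dterm ((b + x) +i* y) p)))).
  move=> P; apply: alt_formula_le; last first.
    exact: (@alt_formula_sum _ _ _ _ _ a0 x00 x01 ax1 (fun p x y => - ln (normc (1 - dterm ((b + x) +i* y) p))) (fun p => 2 * q p) prime P (fun p pp => alt_formula_prime pp)).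
  rewrite -mulr_sumr ler_wpM2l//; apply: le_trans (rt_le zetaE P.-1 bx0).
  case: P => [|P]; first by rewrite /series /= big_ord0 big_nil.
  rewrite big_mkcond big_ord_recl /= add0r /series /= big_mkord; apply: ler_sum => i _.
  by case: ifP => _; rewrite ?expR_ge0.
by move=> x y xx; apply: (ln_zeta zetaE); change (1 < b + x); move: bx0; lra.
Qed.


Lemma altsum_log_zeta :
  altsum a log_zeta @ \oo --> - (a / (2 * pi) * stripW a x0 x1 log_zeta).
Proof. exact: (alt_formula_cvg a0 x01 ax1 d0 alt_formula_zeta). Qed.

Hypotheses (b0 : 0 < b) (b1 : b < 1) (zetaF : forall s, 0 < Re s -> s != 1 -> zF s = (s - 1) * zeta s).
Hypothesis pE : 1 - b < x0.

Definition G w := zF (b%:C + w).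
Let p := 1 - b.
Let L := lin p 0.

Let GE x y : G (x +i* y) = zF ((b + x) +i* y).
Proof. by rewrite /G; congr zF; apply: eqc; rewrite /= ?add0r. Qed.

Let LE x y : L (x +i* y) = ((b + x) +i* y) - 1.
Proof. by rewrite /L /lin /p; apply: eqc => /=; ring. Qed.

Let G_factor x y : 0 <= x -> (b + x) +i* y != 1 -> G (x +i* y) = L (x +i* y) * zeta ((b + x) +i* y).
Proof. by move=> x_0 h; rewrite GE LE zetaF//; change (0 < b + x); move: bx0 b0 b1 pE; lra. Qed.

Lemma log_zeta_split x y : x0 <= x -> log_zeta x y = lgm G 0 x y - lgm L 0 x y.
Proof.
move=> xx; have s1 : 1 < Re ((b + x) +i* y) by change (1 < b + x); move: bx0 b0 b1 pE; lra.
have n1 : (b + x) +i* y != 1 by apply: contraTneq s1 => ->; rewrite ltxx.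
have zn : 0 < normc (zeta ((b + x) +i* y)) by rewrite normc_gt0 (zeta_neq0 zetaE).
have Ln : 0 < normc (L (x +i* y)) by rewrite LE normc_gt0 subr_eq0.
rewrite !lgmE G_factor//; last by move: x00; lra.
by rewrite normcM lnM ?posrE// addrAC subrr add0r.
Qed.

(** The upper bound comes from [zF_le], which is quadratic in [1 + |y|]. For [x0 <= x] the bound [M]
    of [alt_formula_zeta] on the modulus of [ln |zeta|] gives [|zeta| >= exp (- M)], and
    [|L| >= b + x0 - 1]. *)
Lemma good_G : good x0 G.
Proof.
split.
- move=> x y xx; have := @an_comp_affine _ (@zF R) 1 b%:C (x +i* y).
  rewrite (_ : 1 * (x +i* y) + b%:C = (b + x) +i* y); last by rewrite mul1r; apply: eqc; rewrite /= ?addr0// addrC.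
  move=> /(_ (zF_an _)) /=; rewrite ltr_wpDr// => /(_ isT).
  by apply: an_near ltr01 _ => z _; rewrite /G mul1r addrC.
- move=> X; pose B := 2 + `|X|; pose A := B + B ^+ 2 * (2 / b).
  have X0 := normr_ge0 X; have B0 : 0 < B by rewrite /B; lra.
  exists (2 * A + 4) => x y /andP[xx xX].
  have y0 := normr_ge0 y; have XX := ler_norm X.
  have h1 : normc ((b + x) +i* y) <= B * (1 + `|y|).
    apply: le_trans (normc_leD _) _; change (`|b + x| + `|y| <= B * (1 + `|y|)).
    rewrite ger0_norm; last by move: b0; lra.
    by move: b0 b1; rewrite /B; nra.
  have h2 : normc (((b + x) +i* y) - 1) <= B * (1 + `|y|).
    apply: le_trans (normc_leD _) _; change (`|b + x - 1| + `|y - 0| <= B * (1 + `|y|)); rewrite subr0.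
    have := ler_normB (b + x) 1; rewrite normr1 (@ger0_norm _ (b + x)); last by move: b0; lra.
    by move: b0 b1; rewrite /B; nra.
  have h3 : normc (G (x +i* y)) <= A * (1 + `|y|) ^+ 2.
    rewrite GE; apply: le_trans (zF_le b0 _) _; first by rewrite /= lerDl.
    have m1 : normc ((b + x) +i* y) * normc (((b + x) +i* y) - 1) <= B * (1 + `|y|) * (B * (1 + `|y|)) by apply: ler_pM; rewrite ?normc_ge0.
    have m2 : 0 <= 2 / b by rewrite divr_ge0// ltW.
    have := ler_wpM2r m2 m1; rewrite /A; nra.
  have A0 : 0 < A by rewrite /A ltr_pwDl// mulr_ge0 ?sqr_ge0// divr_ge0// ltW.
  rewrite nsqE; apply: (@le_trans _ _ ((A * (1 + `|y|) ^+ 2) ^+ 2)).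
    by apply: lerXn2r; rewrite ?nnegrE ?normc_ge0 ?mulr_ge0 ?sqr_ge0// ltW.
  apply: (@le_trans _ _ ((expR A * expR `|y| ^+ 2) ^+ 2)).
    have ya : 1 + `|y| <= expR `|y| by exact: expR_ge1Dx.
    have ha : A <= expR A by apply: le_trans (expR_ge1Dx A); lra.
    apply: lerXn2r; rewrite ?nnegrE ?mulr_ge0 ?sqr_ge0 ?expR_ge0 ?(ltW A0)//.
    by apply: ler_pM; rewrite ?(ltW A0) ?sqr_ge0//; apply: lerXn2r; rewrite ?nnegrE ?expR_ge0//; lra.
  by rewrite -!expRM_natl -expRD -expRM_natl ler_expR; nra.
move=> X; have [_ h _] := alt_formula_zeta.
set M := 2 * _ in h; pose e := b + x0 - 1; have e0 : 0 < e by rewrite /e; move: bx0; lra.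
exists (`|2 * M - 2 * ln e|) => x y /andP[xx _].
have s1 : 1 < Re ((b + x) +i* y) by change (1 < b + x); move: bx0 b0 b1 pE; lra.
have n1 : (b + x) +i* y != 1 by apply: contraTneq s1 => ->; rewrite ltxx.
have zn : 0 < normc (zeta ((b + x) +i* y)) by rewrite normc_gt0 (zeta_neq0 zetaE).
have hz : expR (- M) <= normc (zeta ((b + x) +i* y)).
  rewrite -[leRHS]lnK ?posrE// ler_expR; have := h x y xx; rewrite ler_norml => /andP[]//.
have hL : e <= normc (L (x +i* y)).
  apply: le_trans (ler_Re _); rewrite LE; change (e <= `|b + x - 1|).
  by rewrite ger0_norm /e; move: bx0; lra.
rewrite nsqE G_factor//; last by move: x00; lra.
apply: (@le_trans _ _ ((e * expR (- M)) ^+ 2)); last first.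
  rewrite normcM; apply: lerXn2r; rewrite ?nnegrE ?mulr_ge0 ?normc_ge0 ?expR_ge0 ?(ltW e0)//.
  by apply: ler_pM; rewrite ?(ltW e0) ?expR_ge0.
rewrite -{2}(@lnK _ e) ?posrE// -expRD -expRM_natl ler_expR.
have := ler_norm (2 * M - 2 * ln e); have := normr_ge0 (2 * M - 2 * ln e); have := normr_ge0 y.
by nra.
Qed.

Lemma good_L : good x0 L.
Proof. exact: good_lin. Qed.

Lemma stripW_log_zeta : stripW a x0 x1 log_zeta = stripW a x0 x1 (lgm G 0) - stripW a x0 x1 (lgm L 0).
Proof.
have iG := stripW_int a0 x00 x01 ax1 good_G; have iL := stripW_int a0 x00 x01 ax1 good_L.
rewrite /stripW -(RintegralB (measurable_strip x1) iG iL); apply: eq_Rintegral => -[x y] _ /=.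
have [xx|xx] := leP x x0; first by rewrite kern_eq0// !mulr0 subr0.
by rewrite log_zeta_split ?ltW// mulrBl.
Qed.

Lemma line_log_zeta : lineI a log_zeta /\ lineE a log_zeta = lineE a (lgm G 0) - lineE a (lgm L 0).
Proof.
have [mZ Z0 iG _] := log_inequality a0 x00 x01 ax1 good_G.
have [_ _ iL _] := log_inequality a0 x00 x01 ax1 good_L.
have i := intgB measurableT iG iL.
rewrite /lineE -(RintegralB measurableT iG iL).
have eq (y : R) : nsq G 0 y <> 0 -> lgm G 0 0 y / cosh (a * y) - lgm L 0 0 y / cosh (a * y) = log_zeta 0 y / cosh (a * y).
  rewrite -mulrBl nsqE => Gn; congr (_ / _); rewrite !lgmE /log_zeta.
  have n1 : (b + 0) +i* y != 1 by apply/eqP => /(congr1 (@complex.Re R)) h; have : b + 0 = 1 := h; move: b1; lra.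
  have Ln : 0 < normc (L (0 +i* y)) by rewrite LE normc_gt0 subr_eq0.
  have zn : 0 < normc (zeta ((b + 0) +i* y)).
    rewrite normc_gt0; apply: contra_not_neq Gn => z0.
    by rewrite G_factor// z0 mulr0 normc0 expr0n.
  by rewrite G_factor// normcM lnM ?posrE// addrAC subrr add0r.
have m : measurable_fun setT (fun y : RR => log_zeta 0 y / cosh (a * y)).
  (* At the zeros of [G] on the line [zeta] vanishes too, and there [log_zeta] is [ln 0 = 0]; this
     makes it a measurable function everywhere, not only off a null set. *)
  apply: (eq_measurable_fun (fun y : RR => if nsq G 0 y == 0 then 0 else lgm G 0 0 y / cosh (a * y) - lgm L 0 0 y / cosh (a * y))).
    move=> y _ /=; case: ifPn => [/eqP z0|/eqP]; last exact: eq.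
    have n1 : (b + 0) +i* y != 1 by apply/eqP => /(congr1 (@complex.Re R)) h; have : b + 0 = 1 := h; move: b1; lra.
    have : normc (G (0 +i* y)) == 0 by move/eqP: z0; rewrite nsqE sqrf_eq0.
    rewrite G_factor// normcM mulf_eq0 LE !normc_eq0 subr_eq0 (negbTE n1) /= => /eqP z.
    by rewrite /log_zeta z normc0 ln0// mul0r.
  apply: measurable_fun_ifT => //; last exact: intg_meas i.
  apply: (measurable_fun_bool true); rewrite setTI.
  by rewrite (_ : _ @^-1` _ = [set y : RR | nsq G 0 y = 0])//; apply/seteqP; split => y /= /eqP.
have [j e] := Rint_ae_eq measurableT mZ Z0 i m (fun y _ h => eq y h).
by split => //; rewrite e.
Qed.

Lemma log_zeta_even y : log_zeta 0 (- y) = log_zeta 0 y.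
Proof.
have n1 v : (b + 0) +i* v != 1 by apply/eqP => /(congr1 (@complex.Re R)) h; have : b + 0 = 1 := h; move: b1; lra.
have h := zF_conj_norm y (x := b + 0); rewrite addr0 in h; move: (h b0) => {}h.
rewrite /log_zeta; congr ln.
move: h; rewrite -[in zF (b -i* y)](addr0 b) -[in zF (b +i* y)](addr0 b).
rewrite !zetaF ?n1 //= ?addr0// !normcM.
have -> : normc (b +i* (- y) - 1) = normc (b +i* y - 1) by rewrite /normc /= !subr0 sqrrN.
apply: mulfI; rewrite gt_eqF// normc_gt0 subr_eq0; have := n1 y; by rewrite addr0.
Qed.


(** The pole of [zeta] is a point mass at [(1 - b, 0)] with negative sign; [green_hR] evaluates the
    kernel there. *)
Lemma jensen_log_zeta : lineE a log_zeta + stripW a x0 x1 log_zeta =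
  lineE a (lgm G 0) + stripW a x0 x1 (lgm G 0) - pi / a * ln ((1 + sin (a * p)) / (1 - sin (a * p))).
Proof.
have p0 : 0 <= p by rewrite subr_ge0 ltW.
have pp : 0 <= p < x0 by rewrite p0.
have px1 : 0 <= p <= x1 by rewrite p0 ltW// (lt_trans pE).
have := point_mass a0 x00 x01 ax1 0 pp; rewrite (green_hR a0 (lt_trans x00 x01) ax1 px1).
have [_ ->] := line_log_zeta; rewrite stripW_log_zeta -/L.
have -> : 2 * pi * (ln ((1 + sin (a * p)) / (1 - sin (a * p))) / (2 * a)) = pi / a * ln ((1 + sin (a * p)) / (1 - sin (a * p))).
  by move: (ln _) (pi : R) => u v; field; rewrite gt_eqF.
lra.
Qed.

Lemma log_zeta_integralE : log_zeta_integral zeta b a = (lineE a log_zeta / 2)%:E.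
Proof.
have [i _] := line_log_zeta.
have ev (y : R) : log_zeta 0 (- y) / cosh (a * - y) = log_zeta 0 y / cosh (a * y).
  by rewrite log_zeta_even /cosh mulrN opprK [X in _ / (X / 2)]addrC.
have [i2 e] := Rint_even i ev.
rewrite /log_zeta_integral /lineE e mulrC mulKf//.
rewrite /Rintegral fineK; last exact: integrable_fin_num i2.
by apply: eq_integral => t _; rewrite /log_zeta addr0.
Qed.

Lemma log_zeta_equalityP : log_zeta_equality zeta b a <->
  lineE a (lgm G 0) + stripW a x0 x1 (lgm G 0) = 0.
Proof.
have sE : series (log_zeta_term zeta b a) = altsum a log_zeta.
  apply: funext => N; rewrite /series /= /altsum big_mkord; apply: eq_bigr => n _.
  have h : 1 < b + pi / (2 * a) + pi * n%:R / a.
    have := node_ge a0 ax1 n; rewrite /node -addrA; move: x01 bx0; lra.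
  have [_ _ e] := zeta_real zetaE h.
  by rewrite /log_zeta_term -e /log_zeta /node -addrA.
have c := altsum_log_zeta.
rewrite /log_zeta_equality sE log_zeta_integralE (cvg_lim (@norm_hausdorff _ _) c) -EFinM.
have s1 : 0 < sin (a * p) < 1.
  have q1 : 0 < a * p by rewrite mulr_gt0// subr_gt0.
  have q2 : a * p < pi / 2 by apply: lt_trans ax1; rewrite ltr_pM2l// (lt_trans pE).
  have c0 : 0 < cos (a * p) by apply: cos_gt0_pihalf; move: q1 q2 (pi_gt0 R); lra.
  rewrite sin_gt0_pi; last by apply/andP; split => //; move: q2 (pi_gt0 R); lra.
  have := cos2Dsin2 (a * p); have := sin_max (a * p); rewrite ler_norml => /andP[_ m1] e.
  rewrite lt_neqAle m1 andbT; apply/eqP => s1; move: e; rewrite s1 expr1n.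
  by have := exprn_gt0 2 c0; lra.
have -> : ln ((1 - sin (a * (1 - b))) / (1 + sin (a * (1 - b)))) = - ln ((1 + sin (a * p)) / (1 - sin (a * p))).
  by rewrite -lnV ?invf_div// posrE divr_gt0//; move: s1 => /andP[]; lra.
have J := jensen_log_zeta.
set Y := ln _ in J *; set E := lineE a log_zeta in J *; set W := stripW a x0 x1 log_zeta in J *.
set Z := lineE a (lgm G 0) + stripW a x0 x1 (lgm G 0) in J *.
have p0 : (pi : R) != 0 by rewrite gt_eqF// pi_gt0.
(* Evenness in [y] turns the integral over the half-line into [E / 2]. The equality of the theorem
   is thus off by exactly [a / (2 pi) * Z]. *)
have key : a / pi * (E / 2) = 1 / 2 * - Y - a / (2 * pi) * W + a / (2 * pi) * Z.
  have -> : Z = E + W + pi / a * Y by lra.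
  by move: (pi : R) p0 => r r0; field; rewrite r0 gt_eqF.
have k0 : a / (2 * pi) != 0 by rewrite mulf_neq0 ?invr_neq0 ?mulf_neq0// gt_eqF.
split=> [[_ [e]]|z0].
  have : a / (2 * pi) * Z = 0 by lra.
  by move=> /eqP; rewrite mulf_eq0 (negbTE k0) /= => /eqP.
split; first exact: c.
by congr EFin; move: key; rewrite z0 mulr0; lra.
Qed.

Lemma zero_free_equality : log_zeta_equality zeta b a <->
  (forall rho, zeta_zero zeta rho -> ~ (b < complex.Re rho)).
Proof.
split=> [/log_zeta_equalityP h rho [r1 z0] br|h].
  have u0 : 0 < Re rho - b by rewrite subr_gt0.
  have z : nsq G (Re rho - b) (Im rho) = 0.
    rewrite nsqE GE (_ : _ +i* _ = rho); last by apply: eqc => /=; [ring|].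
    by rewrite zetaF// ?z0 ?mulr0 ?normc0 ?expr0n//; apply: lt_trans br.
  by have := jensen_zero a0 x00 x01 ax1 good_G u0 z; rewrite h ltxx.
apply/log_zeta_equalityP/(jensen_zero_free a0 x00 x01 ax1 good_G) => x y x_0.
rewrite nsqE sqrf_eq0 GE normc_eq0.
have [->|s1] := eqVneq ((b + x) +i* y) 1; first by rewrite zF1 oner_eq0.
have bx : 0 < Re ((b + x) +i* y) by change (0 < b + x); move: b0; lra.
rewrite zetaF// mulf_eq0 subr_eq0 (negbTE s1) /=; apply/negP => /eqP z0.
by apply: (h _ (conj s1 z0)); change (b < b + x); lra.
Qed.

End LogZeta.

Lemma log_zeta_criterion (R : realType) (zeta : R[i] -> R[i]) (a b : R) : is_riemann_zeta zeta ->
  0 < a -> 0 < b -> b < 1 -> a * (1 - b) < pi / 2 ->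
  (log_zeta_equality zeta b a <-> (forall rho : R[i], zeta_zero zeta rho -> ~ (b < complex.Re rho))).
Proof.
(* A third of the gap between [1 - b] and [pi / (2 a)], so that [x0 = 1 - b + d] and
   [x1 = 1 - b + 2 * d] fit strictly inside. *)
move=> hz a0 b0 b1 hab; pose d := (pi / 2 - a * (1 - b)) / (3 * a).
have d0 : 0 < d by rewrite divr_gt0 ?mulr_gt0 ?subr_gt0.
have ad : a * d * 3 = pi / 2 - a * (1 - b) by rewrite /d; move: (pi : R) => r; field; rewrite gt_eqF.
apply: (@zero_free_equality _ zeta (fun s h => proj1 (ccvgP _ _) (hz.1 s h)) a (1 - b + d) (1 - b + 2 * d)) => //.
- by lra.
- by lra.
- by have := mulr_gt0 a0 d0; lra.
- by lra.
- by move=> s; exact: zF_zeta.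
by lra.
Qed.

(** * Functional equation *)

Section EntireFunctions.
Context {R : realType}.
Implicit Types (s z w : R[i]) (x y t : R).

Lemma an_cexp s : an (@cexp R) s.
Proof.
have h0 : an (@cexp R) 0.
  exists (fun k => (k`!%:R)^-1), 1, 1; split => //.
    move=> k; rewrite expr1n mulr1 normcV complex_nat normc_real ger0_norm// invf_le1 ?ltr0n ?fact_gt0//.
    by rewrite ler1n fact_gt0.
  move=> z _; rewrite add0r; have := expc_cvg z; rewrite (_ : expc z = ps (fun k => (k`!%:R)^-1) z)//.
  by apply: funext => n; apply: eq_bigr => k _; rewrite mulrC.
have := @an_comp_affine _ (@cexp R) 1 (- s) s; rewrite mul1r subrr => /(_ h0) h.
have := anM (an_cst (cexp s) s) h; apply: an_near ltr01 _ => z _.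
by rewrite -cexpD; congr cexp; ring.
Qed.

Lemma an_cexpM (k s : R[i]) : an (fun z => cexp (k * z)) s.
Proof.
have := @an_comp_affine _ (@cexp R) k 0 s (an_cexp _); apply: an_near ltr01 _ => z _.
by rewrite addr0.
Qed.

Definition ccos z : R[i] := (cexp ('i * z) + cexp (- 'i * z)) / 2.

Lemma an_ccos (k s : R[i]) : an (fun z => ccos (k * z)) s.
Proof.
have h := anM (anD (an_cexpM ('i * k) s) (an_cexpM (- 'i * k) s)) (an_cst (2^-1) s).
by apply: an_near ltr01 _ h => z _; rewrite /ccos !mulrA.
Qed.

End EntireFunctions.

Section LaplaceRules.
Context {R : realType}.
Notation mu := (@lebesgue_measure R).
Notation RR := (measurableTypeR R).
Implicit Types (k : RR -> R) (s z w : R[i]) (x y t c d C : R).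

Lemma laplaceZ c k s : lapI k (Re s) -> laplace (fun t => c * k t) s = c%:C * laplace k s.
Proof.
move=> i; have [_ <-] := cintgZ c%:C (laplace_int i); rewrite /laplace.
by congr cI; apply: funext => t; rewrite rmorphM mulrA.
Qed.

Lemma laplaceD k h s : lapI k (Re s) -> lapI h (Re s) -> laplace (fun t => k t + h t) s = laplace k s + laplace h s.
Proof.
move=> i j; have [_ <-] := cintgD (laplace_int i) (laplace_int j); rewrite /laplace.
by congr cI; apply: funext => t; rewrite rmorphD mulrDl.
Qed.

Lemma lapID k h x : lapI k x -> lapI h x -> lapI (fun t => k t + h t) x.
Proof. by move=> i j; have := intgD measurableT i j; apply: eq_intg => // t _; rewrite mulrDl. Qed.

Lemma lapIZ c k x : lapI k x -> lapI (fun t => c * k t) x.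
Proof. by move=> i; have := intgZ c measurableT i; apply: eq_intg => // t _; rewrite mulrA. Qed.

Lemma lapI_shift c k x : lapI k x -> lapI (fun t => k (t + c)) x.
Proof.
move=> i; have [j _] := Rint_shift c i; have := intgZ (expR (- (x * c))) measurableT j.
apply: eq_intg => // t _; rewrite mulrCA -expRD; congr (_ * expR _); ring.
Qed.

Lemma laplace_shift c k s : lapI k (Re s) -> laplace (fun t => k (t + c)) s = cexp (- s * c%:C) * laplace k s.
Proof.
move=> i; have [i1 i2] := laplace_int i.
have [j1 e1] := Rint_shift c i1; have [j2 e2] := Rint_shift c i2.
have [_ <-] := cintgZ (cexp (- s * c%:C)) (laplace_int i).
have [_ h] := @cintgZ R (cexp (- s * c%:C)) (fun t => (k (t + c))%:C * cexp (s * (t + c)%:C)) (conj j1 j2).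
have -> : laplace (fun t => k (t + c)) s = cexp (- s * c%:C) * cI (fun t => (k (t + c))%:C * cexp (s * (t + c)%:C)).
  rewrite -h /laplace; congr cI; apply: funext => t; rewrite [RHS]mulrCA -cexpD; congr (_ * cexp _).
  by rewrite rmorphD /=; ring.
have [_ ->] := cintgZ (cexp (- s * c%:C)) (laplace_int i); congr (_ * _).
by rewrite /laplace /cI e1 e2.
Qed.

Lemma lapI_opp k x : lapI k (- x) -> lapI (fun t => k (- t)) x.
Proof. by move=> i; have [j _] := Rint_opp i; apply: eq_intg j => // t _; rewrite mulrNN. Qed.

Lemma laplace_opp k s : lapI k (- Re s) -> laplace (fun t => k (- t)) s = laplace k (- s).
Proof.
rewrite -creN => i; have [i1 i2] := laplace_int i.
have [j1 e1] := Rint_opp i1; have [j2 e2] := Rint_opp i2.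
rewrite /laplace /cI -e1 -e2; congr (_ +i* _); apply: eq_Rintegral => t _; by rewrite rmorphN mulrNN.
Qed.

Lemma laplace_ae k h s N : measurable (N : set RR) -> mu N = 0%E -> lapI k (Re s) -> measurable_fun setT h ->
  (forall t, ~ N t -> k t = h t) -> laplace k s = laplace h s.
Proof.
move=> mN N0 i mh kh; have [i1 i2] := laplace_int i; have [m1 m2] := cexp_cmeas s mh.
rewrite /laplace /cI; congr (_ +i* _).
  by apply: (Rint_ae_eq measurableT mN N0 i1 m1 _).2 => t _ /kh ->.
by apply: (Rint_ae_eq measurableT mN N0 i2 m2 _).2 => t _ /kh ->.
Qed.

Lemma cosh_le y : cosh y <= expR `|y|.
Proof.
rewrite /cosh ler_pdivrMr// mulr_natr mulr2n lerD// ler_expR; first exact: ler_norm.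
by rewrite -normrN ler_norm.
Qed.

(** Since [cosh (d t) <= exp (d |t|)], exponential decay is dominated by a multiple of
    [1 / cosh (d t)], whose integrability is [sech_mass]. *)
Lemma lapI_sech k x d C : measurable_fun setT k -> 0 < d -> (forall t, `|k t * expR (x * t)| <= C * expR (- (d * `|t|))) ->
  lapI k x.
Proof.
move=> mk d0 h; have C0 : 0 <= C.
  by have := le_trans (normr_ge0 _) (h 0); rewrite normr0 mulr0 oppr0 expR0 mulr1.
have [i _] := sech_mass d0; apply: (le_intg measurableT _ _ (intgZ C measurableT i)).
  apply: measurable_funM => //; apply: continuous_measurable_fun.
  suff hc : continuous (fun t : R => expR (x * t)) by [].
  by move=> t; exact: (dv_cont (dv_exp (dv_mulc x t))).
move=> t _; apply: le_trans (h t) _; rewrite ler_wpM2l// expRN lef_pV2 ?posrE ?expR_gt0 ?ch_gt0//.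
by apply: le_trans (cosh_le _) _; rewrite normrM (gtr0_norm d0).
Qed.

End LaplaceRules.

(** * The Gamma function *)

Section Gamma.
Context {R : realType}.
Notation mu := (@lebesgue_measure R).
Notation RR := (measurableTypeR R).
Implicit Types (s z w : R[i]) (x y t c d C : R).

Lemma Rint_derivative (v w : R -> R) : (forall t, dv v t (w t)) -> continuous w -> intg mu setT w ->
  (fun n => v n%:R) @ \oo --> (0 : R) -> (fun n => v (- n%:R)) @ \oo --> (0 : R) -> \int[mu]_t w t = 0.
Proof.
move=> dv_ cw iw v1 v2.
have mA n : measurable (`[- n%:R, n%:R]%classic : set RR) by exact: measurable_itv.
have c : (fun n : nat => \int[mu]_(t in `[- n%:R, n%:R]) w t) @ \oo --> \int[mu]_t w t.
  apply: (Rdct_expand measurableT mA _ _ _ _ (intg_norm measurableT iw) _).2 => //.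
  - move=> t _; exists (Num.trunc `|t|).+1 => // n /= hn; rewrite in_itv /=.
    rewrite -ler_norml ltW//; apply: lt_le_trans (truncnS_gt _) _; by rewrite ler_nat.
  - by move=> n; apply: measurable_funS (intg_meas iw).
  - by move=> t _; exact: cvg_cst.
apply: (cvg_unique _ c) => //.
have -> : (fun n : nat => \int[mu]_(t in `[- n%:R, n%:R]) w t) = fun n => v n%:R - v (- n%:R).
  apply: funext => n; rewrite (@Rftc _ w v)//.
    by rewrite -subr_ge0 opprK addr_ge0.
  by move=> t _; exact: cw.
by have h := cvgB v1 v2; rewrite subr0 in h; exact: h.
Qed.

(** The function [exp (- x)] at [x = exp t]; its transform [gam] is Euler's Gamma function. *)
Definition gker t : R := expR (- expR t).

Lemma gker_meas : measurable_fun setT (gker : RR -> R).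
Proof.
apply: continuous_measurable_fun; suff h : continuous gker by [].
move=> t; have := dv_exp (dvN (dv_exp (dv_id t))); exact: dv_cont.
Qed.

Lemma gker_le x : 0 < x -> exists C, forall t, gker t * expR (x * t) <= C * expR (- (x * `|t|)).
Proof.
(* With [m >= 2 x], the estimate [exp (- u) <= (m / u) ^ m] at [u = exp t] leaves a decay
   [exp (- x t)] after multiplication by [exp (x t)]. *)
move=> x0; pose m := (Num.truncn (2 * x)).+1.
have m2 : 2 * x <= m%:R by rewrite ltW// truncnS_gt.
have m0 : (0 : R) < m%:R by rewrite ltr0n.
have m1 : (1 : R) <= m%:R ^+ m by rewrite -natrX ler1n expn_gt0.
exists (m%:R ^+ m) => t; have [t0|t0] := leP 0 t.
  rewrite (ger0_norm t0); have h : gker t <= m%:R ^+ m * expR (- (2 * x * t)).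
    have k : expR t / m%:R <= expR (expR t / m%:R) by apply: le_trans (expR_ge1Dx _); rewrite lerDr.
    have k2 : (expR t / m%:R) ^+ m <= expR (expR t).
      have -> : expR (expR t) = expR (expR t / m%:R) ^+ m by rewrite -expRM_natl mulrC divfK// gt_eqF.
      by apply: lerXn2r; rewrite ?nnegrE ?expR_ge0// divr_ge0 ?expR_ge0// ltW.
    apply: (@le_trans _ _ (m%:R ^+ m * expR (- (m%:R * t)))); last first.
      by rewrite ler_wpM2l ?(le_trans _ m1)// ler_expR lerN2 ler_wpM2r.
    rewrite /gker !expRN ler_pdivlMr ?expR_gt0// expRM_natl mulrC ler_pdivrMr ?expR_gt0//.
    by move: k2; rewrite expr_div_n ler_pdivrMr ?exprn_gt0// mulrC.
  apply: le_trans (ler_wpM2r (expR_ge0 _) h) _; rewrite -[leLHS]mulrA -expRD.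
  by rewrite (_ : - (2 * x * t) + x * t = - (x * t))//; ring.
rewrite (ltr0_norm t0) mulrN opprK; apply: ler_wpM2r; first exact: expR_ge0.
by apply: le_trans m1; rewrite /gker -expR0 ler_expR oppr_le0 expR_ge0.
Qed.

Lemma gker_lapI x : 0 < x -> lapI gker x.
Proof.
move=> x0; have [C h] := gker_le x0; apply: (lapI_sech gker_meas x0 (C := C)) => t.
by rewrite ger0_norm ?h// mulr_ge0 ?expR_ge0.
Qed.

Definition gam s := laplace gker s.

Lemma gam_an s : 0 < Re s -> an gam s.
Proof.
move=> s0; apply: (@laplace_an _ _ (Re s / 2) (Re s + 1)); try (apply: gker_lapI; lra).
by apply/andP; split; lra.
Qed.

(** Integration by parts: [s] times the first integrand minus the second is the derivative of
    [gker t * cexp (s t)], which tends to [0] at both ends. *)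
Lemma gamS s : 0 < Re s -> gam (s + 1) = s * gam s.
Proof.
move=> s0; have i0 := laplace_int (gker_lapI s0).
have i1 : cintg (fun t => (gker t)%:C * cexp ((s + 1) * t%:C)).
  by apply: laplace_int; apply: gker_lapI; rewrite creD /=; lra.
have [j0 e0] := cintgZ s i0; have [j1 e1] := cintgZ (-1) i1; have [j e] := cintgD j0 j1.
suff : cI (fun t => s * ((gker t)%:C * cexp (s * t%:C)) + -1 * ((gker t)%:C * cexp ((s + 1) * t%:C))) = 0.
  by rewrite e e0 e1 mulN1r => /eqP; rewrite subr_eq0 => /eqP h; exact: esym h.
have wE t : s * ((gker t)%:C * cexp (s * t%:C)) + -1 * ((gker t)%:C * cexp ((s + 1) * t%:C)) =
    (gker t * - expR t)%:C * cexp (s * t%:C) + (gker t)%:C * (s * cexp (s * t%:C)).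
  have -> : (s + 1) * t%:C = s * t%:C + t%:C by ring.
  by rewrite cexpD cexp_real rmorphM rmorphN /=; ring.
have dg t : dv gker t (gker t * - expR t).
  by apply: (dv_eq (dv_exp (dvN (dv_exp (dv_id t))))); rewrite mulr1.
have cg : continuous gker by move=> t; exact: (dv_cont (dg t)).
have ce : continuous (@expR R) by exact: continuous_expR.
have [C gC] := gker_le s0.
have lim (P : R[i] -> R) (u : R) : (u = 1 \/ u = -1) -> (forall z, `|P z| <= normc z) ->
    (fun n : nat => P ((gker (u * n%:R))%:C * cexp (s * (u * n%:R)%:C))) @ \oo --> (0 : R).
  move=> e1' Pn; apply/cvg_dist0P.
  have h : (fun n : nat => Re s * n%:R) @ \oo --> +oo.
    apply/cvgryPge => M; near=> n; rewrite -ler_pdivrMl//.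
    by near: n; exact: nbhs_infty_ger.
  have h2 : (fun n : nat => C * expR (- (Re s * n%:R))) @ \oo --> (0 : R).
    rewrite -[X in _ --> X](mulr0 C); apply: cvgM; first exact: cvg_cst.
    exact: (cvg_comp _ _ h (@cvgr_expR R)).
  apply: (squeeze_cvgr _ (cvg_cst 0) h2); apply: nearW => n; rewrite normr_ge0 subr0 /=.
  apply: le_trans (Pn _) _; rewrite normcM normc_real normc_cexp Re_sreal (ger0_norm (expR_ge0 _)).
  apply: le_trans (gC _) _; rewrite normrM (_ : `|u| = 1) ?mul1r ?(@ger0_norm _ n%:R)//.
  by case: e1' => ->; rewrite ?normrN normr1.
have main (P : R[i] -> R) : (forall z, `|P z| <= normc z) -> (forall x z, P (x%:C * z) = x * P z) ->
    (forall z w, P (z + w) = P z + P w) ->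
    (forall t, dv (fun t => P (cexp (s * t%:C))) t (P (s * cexp (s * t%:C)))) ->
    continuous (fun t => P (s * cexp (s * t%:C))) ->
    intg mu setT (fun t => P (s * ((gker t)%:C * cexp (s * t%:C)) + -1 * ((gker t)%:C * cexp ((s + 1) * t%:C)))) ->
    \int[mu]_t P (s * ((gker t)%:C * cexp (s * t%:C)) + -1 * ((gker t)%:C * cexp ((s + 1) * t%:C))) = 0.
  move=> Pn PM PD dP cP iP; apply: (@Rint_derivative (fun t => P ((gker t)%:C * cexp (s * t%:C)))) => //.
  - move=> t; rewrite wE PD (PM (gker t * - expR t)) (PM (gker t)); have := dvM (dg t) (dP t).
    by rewrite (_ : (fun y => _) = (fun t => P ((gker t)%:C * cexp (s * t%:C))))//; apply: funext => u; rewrite PM.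
  - move=> t; rewrite (_ : (fun t => _) = fun t => gker t * - expR t * P (cexp (s * t%:C)) + gker t * P (s * cexp (s * t%:C))); last first.
      by apply: funext => u; rewrite wE PD (PM (gker u * - expR u)) (PM (gker u)).
    apply: cvgD; last by apply: cvgM; [exact: cg|exact: cP].
    apply: cvgM; last exact: (dv_cont (dP t)).
    by apply: cvgM; [exact: cg|apply: cvgN; exact: ce].
  - have := lim P 1 (or_introl erefl) Pn; by under eq_fun do rewrite mul1r.
  - have := lim P (-1) (or_intror erefl) Pn; by under eq_fun do rewrite mulN1r.
have [c1 c2] := cexp_line_cont2 s s.
rewrite /cI (main (@complex.Re R)) ?(main (@complex.Im R)) //.
- exact: ler_Im.
- exact: Im_realM.
- exact: cimD.
- by move=> t; have [_] := dv_cexp 1 s t; rewrite !mul1r; under eq_fun do rewrite mul1r.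
- exact: j.2.
- exact: ler_Re.
- exact: Re_realM.
- exact: creD.
- by move=> t; have [+ _] := dv_cexp 1 s t; rewrite !mul1r; under eq_fun do rewrite mul1r.
- exact: j.1.
Unshelve. all: by end_near. Qed.

Lemma gam_nat n : gam n.+1%:R = n`!%:R.
Proof.
elim: n => [|n IH].
  have dF t : dv (fun t => - gker t) t (gker t * expR t).
    by apply: (dv_eq (dvN (dv_exp (dvN (dv_exp (dv_id t)))))); rewrite mulr1 mulrN opprK.
  have cF : continuous (fun t : R => gker t * expR t).
    move=> t; apply: cvgM; last exact: continuous_expR.
    exact: (dv_cont (dv_exp (dvN (dv_exp (dv_id t))))).
  have expn : (fun n : nat => expR (n%:R : R)) @ \oo --> +oo.
    apply/cvgryPge => M; near=> n; apply: le_trans (expR_ge1Dx _); rewrite -lerBlDl.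
    by near: n; exact: nbhs_infty_ger.
  have l2 : (fun n : nat => - gker n%:R) @ \oo --> - (0 : R).
    by apply: cvgN; exact: (cvg_comp _ _ expn (@cvgr_expR R)).
  have l1 : (fun n : nat => - gker (- n%:R)) @ \oo --> - (1 : R).
    have h0 : (fun n : nat => - expR (- n%:R : R)) @ \oo --> (0 : R).
      by have h := cvgN (@cvgn_expR R); rewrite oppr0 in h; exact: h.
    have h1 := cvg_comp _ _ h0 (@continuous_expR R 0); rewrite expR0 in h1.
    exact: (cvgN h1).
  have g0 t : 0 <= gker t * expR t by rewrite mulr_ge0 ?expR_ge0.
  have [_ e] := Rftc_line dF cF g0 l2 l1.
  rewrite /gam /laplace /cI fact0; apply: eqc => /=.
    rewrite oppr0 opprK add0r in e; rewrite -[RHS]e; apply: eq_Rintegral => t _.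
    by rewrite !(mul0r, mulr0, subr0, addr0) mul1r cos0 mulr1.
  rewrite (_ : (fun t => _) = fun=> 0) ?Rintegral_cst ?mul0r//.
  by apply: funext => t; rewrite !(mul0r, mulr0, subr0, addr0) sin0 !mulr0.
rewrite -[n.+2%:R]natr1 gamS; first by rewrite IH factS natrM.
by rewrite complex_nat ltr0n.
Unshelve. all: by end_near. Qed.

End Gamma.

(** * Mellin transform of the hyperbolic secant and partial fractions of the hyperbolic tangent *)

Section Mellin.
Context {R : realType}.
Notation mu := (@lebesgue_measure R).
Notation RR := (measurableTypeR R).
Implicit Types (s z w : R[i]) (x y t l m : R).

Definition sech t : R := (cosh t)^-1.

Lemma cosh_gt0 t : 0 < cosh t.
Proof. by rewrite /cosh divr_gt0// addr_gt0// expR_gt0. Qed.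

Lemma sech_meas : measurable_fun setT (sech : RR -> R).
Proof.
apply: continuous_measurable_fun; suff h : continuous sech by [].
move=> t; apply: cvgV; first by rewrite gt_eqF// cosh_gt0.
have h := dv_cont (dvD (dv_exp (dv_id t)) (dv_exp (dvN (dv_id t)))).
by apply: cvgM; [exact: h|exact: cvg_cst].
Qed.

Lemma sech_lapI x : -1 < x < 1 -> lapI sech x.
Proof.
rewrite -ltr_norml => x1; have d0 : 0 < 1 - `|x| by rewrite subr_gt0.
apply: (lapI_sech sech_meas d0 (C := 2)) => t.
rewrite normrM /sech normfV (gtr0_norm (cosh_gt0 t)) (gtr0_norm (expR_gt0 _)).
have h1 : expR `|t| / 2 <= cosh t.
  rewrite /cosh ler_pM2r ?invr_gt0//; case: (ger0P t) => _.
    by rewrite lerDl expR_ge0.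
  by rewrite lerDr expR_ge0.
have h2 : expR (x * t) <= expR (`|x| * `|t|) by rewrite ler_expR -normrM ler_norm.
rewrite mulrC ler_pdivrMr ?cosh_gt0//; apply: le_trans h2 _.
have -> : expR (`|x| * `|t|) = expR (- ((1 - `|x|) * `|t|)) * expR `|t| by rewrite -expRD; congr expR; ring.
have e0 := expR_ge0 (- ((1 - `|x|) * `|t|)); move: h1 e0; move: (expR _) (expR _) (cosh t) => A B C h1 e0.
by have := ler_wpM2r e0 h1; lra.
Qed.

(** On the imaginary axis this is [sech_transform]. Both sides are analytic for [|Re s| < 1], and a
    horizontal segment from the axis carries the identity to the rest of the strip. *)
Lemma sech_laplace s : -1 < Re s < 1 -> laplace sech s * ccos ((pi / 2)%:C * s) = pi%:C.
Proof.
move=> s1; pose f z := laplace sech z * ccos ((pi / 2)%:C * z) - pi%:C.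
have anf z : -1 < Re z < 1 -> an f z.
  move=> /andP[z1 z2]; apply: anB; last exact: an_cst.
  apply: anM; last exact: an_ccos.
  apply: (@laplace_an _ _ ((Re z - 1) / 2) ((Re z + 1) / 2)); last by apply/andP; split; lra.
    by apply: sech_lapI; apply/andP; split; lra.
  by apply: sech_lapI; apply/andP; split; lra.
have f0 y : f (0 +i* y) = 0.
  have E : laplace sech (0 +i* y) = (pi / cosh (y * (pi / 2)))%:C.
    have := sech_transform (@ltr01 R) y; rewrite divr1 mulr1 => h.
    rewrite /laplace /cI; apply: eqc; rewrite [LHS]/= [RHS]/=.
      rewrite -h; apply: eq_Rintegral => t _.
      by rewrite !(mul0r, mulr0, subr0, add0r, addr0, mul1r) oppr0 expR0 mul1r mulrC.
    have i : cintg (fun t => (sech t)%:C * cexp ((0 +i* y) * t%:C)).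
      by apply: laplace_int; apply: sech_lapI; rewrite /= ltr01 ltrN10.
    have sechN t : sech (- t) = sech t by rewrite /sech /cosh opprK addrC.
    apply: (Rint_odd i.2) => t; rewrite sechN rmorphN mulrN !(Im_realM (sech t)).
    by rewrite !Im_cexp creN cimN Re_sreal Im_sreal /= !mul0r oppr0 sinN; ring.
  have C : ccos ((pi / 2)%:C * (0 +i* y)) = (cosh (y * (pi / 2)))%:C.
    have e1 : 'i * ((pi / 2)%:C * (0 +i* y)) = (- (y * (pi / 2)))%:C :> R[i].
      by apply: eqc; rewrite ?creM ?cimM /=; ring.
    have e2 : - 'i * ((pi / 2)%:C * (0 +i* y)) = (y * (pi / 2))%:C :> R[i].
      by rewrite mulNr e1 -rmorphN opprK.
    rewrite /ccos e1 e2 !cexp_real -rmorphD /= (_ : (2 : R[i]) = (2 : R)%:C) ?complex_nat// -fmorphV -rmorphM.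
    by rewrite /cosh addrC.
  have c0 : cosh (y * (pi / 2)) != 0 by rewrite gt_eqF// cosh_gt0.
  by rewrite /f E C -rmorphM /= divfK// subrr.
have v : vanish f (0 + s).
  apply: an_identity_segment; last by apply: vanish_line => //; apply: anf; rewrite /= ltr01 ltrN10.
  move=> t /andP[t0 t1]; apply: anf; rewrite add0r Re_realM; move/andP: s1 => [s1 s2].
  by apply/andP; split; nra.
case: v => r r0 /(_ 0); rewrite normc0 => /(_ (ltW r0)); rewrite addr0 add0r /f => /eqP.
by rewrite subr_eq0 => /eqP.
Qed.

Lemma sin_exp_int l m : 0 < m ->
  intg mu setT (fun t => step 0 t * (sin (l * t) * expR (- m * t))) /\
  \int[mu]_t (step 0 t * (sin (l * t) * expR (- m * t))) = l / (m ^+ 2 + l ^+ 2).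
Proof.
move=> m0; pose s : R[i] := m +i* (- l).
have e := @laplace_step R 0 s m0.
have ii : cintg (fun t => (step (0 : R) t)%:C * cexp (- s * t%:C)).
  by apply: laplace_int; rewrite creN; exact: step_lapI.
have E t : Im ((step (0 : R) t)%:C * cexp (- s * t%:C)) = step 0 t * (sin (l * t) * expR (- m * t)).
  by rewrite Im_realM Im_cexp Re_sreal Im_sreal creN cimN /= opprK mulrC [in RHS]mulrC (mulrC (sin _)).
split; first by have := ii.2; apply: eq_intg => // t _; exact: E.
under eq_Rintegral do rewrite -E.
have sq : 0 < m ^+ 2 + l ^+ 2 by rewrite ltr_pwDl ?sqr_ge0// exprn_gt0.
have : Im (laplace (step 0) (- s)) = l / (m ^+ 2 + l ^+ 2).
  rewrite e mulr0 cexp0 mul1r.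
  have -> : s^-1 = ((m ^+ 2 + l ^+ 2)^-1)%:C * (m +i* l).
    have sn : s != 0 by apply/eqP => /(congr1 (@complex.Re R)) /= h; move: m0; rewrite h ltxx.
    apply: (mulfI sn); rewrite mulfV// mulrCA.
    have -> : s * (m +i* l) = (m ^+ 2 + l ^+ 2)%:C by apply: eqc; rewrite ?creM ?cimM /=; ring.
    by rewrite -rmorphM /= mulVf ?gt_eqF.
  by rewrite Im_realM /= mulrC.
exact.
Qed.

Definition tanh_half x : R := (expR x - 1) / (expR x + 1).

(** In [tanh_transform] with [l = x / pi] expand [1 / sinh y] as [2 * sum_k exp (- (2 k + 1) y)] for
    [y > 0]. The partial sums are the fraction [1 - q y ^ N] of the full integrand, which therefore
    dominates them, and each term integrates to a partial fraction. *)
Lemma tanh_half_series x : 0 < x ->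
  (fun N => \sum_(k < N) 4 * x / ((k.*2.+1%:R * pi) ^+ 2 + x ^+ 2)) @ \oo --> tanh_half x.
Proof.
move=> x0; have p0 : 0 < pi :> R := pi_gt0 R; pose l := x / pi.
have [iD eD] := tanh_transform (@ltr01 R) l.
pose D y := sin (l * y) / sinha 1 y.
have De y : D (- y) = D y.
  have e : sinha 1 (- y) = - sinha 1 y by rewrite /sinha !mul1r opprK; lra.
  by rewrite /D e mulrN sinN invrN mulrNN.
pose q y := expR (- (2 * y)).
pose F N y := \sum_(k < N) 2 * (step 0 y * (sin (l * y) * expR (- (k.*2.+1)%:R * y))).
have FE N y : 0 <= y -> F N y = D y * (1 - q y ^+ N).
  move=> y0; have [->|yn] := eqVneq y 0.
    by rewrite /D /F mulr0 sin0 !mul0r big1// => i _; rewrite ?mul0r ?mulr0.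
  have yp : 0 < y by rewrite lt_neqAle eq_sym yn.
  have q1 : q y < 1 by rewrite /q -expR0 ltr_expR oppr_lt0 mulr_gt0.
  have sh : sinha 1 y = (1 - q y) / (2 * expR (- y)).
    have -> : q y = expR (- y) ^+ 2 by rewrite -expRM_natl /q; congr expR; ring.
    have -> : sinha 1 y = ((expR (- y))^-1 - expR (- y)) / 2 by rewrite /sinha !mul1r -expRN opprK.
    by have := expR_gt0 (- y); move: (expR _) => w w0; field; rewrite gt_eqF.
  elim: N => [|N IH]; first by rewrite /F big_ord0 expr0 subrr mulr0.
  rewrite /F big_ord_recr /= -/(F N y) IH /step y0 mul1r.
  have -> : expR (- (N.*2.+1)%:R * y) = expR (- y) * q y ^+ N.
    rewrite /q -expRM_natl -expRD; congr expR; rewrite -natr1 -mul2n natrM; ring.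
  rewrite /D sh exprS; have e0 := expR_gt0 (- y); move: (q y ^+ N) (sin _) (expR (- y)) e0 => u v w w0.
  by field; rewrite !gt_eqF//= subr_gt0.
have F0 N y : y < 0 -> F N y = 0.
  by move=> y0; rewrite /F big1// => i _; rewrite /step leNgt y0 mul0r mulr0.
have mm k : (0 : R) < (k.*2.+1)%:R by rewrite ltr0n.
have iF N : intg mu setT (F N) /\ \int[mu]_y F N y = \sum_(k < N) 2 * (l / ((k.*2.+1)%:R ^+ 2 + l ^+ 2)).
  have [j1 j2] := @Rint_sum _ _ R mu 'I_N (index_enum _) setT (fun k y => 2 * (step 0 y * (sin (l * y) * expR (- (k.*2.+1)%:R * y)))) measurableT
    (fun k => intgZ 2 measurableT (sin_exp_int l (mm k)).1).
  split; first exact: j1.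
  rewrite /F j2; apply: eq_bigr => k _.
  by rewrite (@RintegralZl _ _ _ mu setT _ 2 measurableT (sin_exp_int l (mm k)).1) (sin_exp_int l (mm k)).2.
have q01 y : 0 <= y -> 0 <= q y <= 1.
  by move=> y0; rewrite expR_ge0 /= /q -expR0 ler_expR oppr_le0 mulr_ge0.
have Fc y : setT y -> (fun N => F N y) @ \oo --> step 0 y * D y.
  move=> _; rewrite /step; case: ifPn => [y0|]; last first.
    rewrite -ltNge => y0; rewrite mul0r (_ : (fun N => _) = fun=> 0); first exact: cvg_cst.
    by apply: funext => N; exact: F0.
  rewrite mul1r (_ : (fun N => _) = fun N => D y * (1 - q y ^+ N)); last by apply: funext => N; exact: FE.
  have [->|yn] := eqVneq y 0.
    by rewrite /D mulr0 sin0 mul0r; under eq_fun do rewrite mul0r; exact: cvg_cst.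
  have yp : 0 < y by rewrite lt_neqAle eq_sym yn.
  have qN : (fun N => q y ^+ N) @ \oo --> (0 : R).
    apply: cvg_expr; rewrite ger0_norm ?expR_ge0// /q -expR0 ltr_expR oppr_lt0 mulr_gt0//.
  have h := cvgM (cvg_cst (D y)) (cvgB (cvg_cst (1 : R)) qN).
  by rewrite subr0 mulr1 in h; exact: h.
have Fb N y : setT y -> `|F N y| <= `|D y|.
  move=> _; have [y0|y0] := leP 0 y; last by rewrite F0// normr0.
  rewrite FE// normrM ler_piMr//; have /andP[qa qb] := q01 y y0.
  have := exprn_ge0 N qa; have := exprn_ile1 N qa qb => h1 h2.
  by rewrite ger0_norm; lra.
have [_ c] := Rdct measurableT (fun N => intg_meas (iF N).1) Fc (intg_norm measurableT iD) Fb.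
have hD : \int[mu]_y (step 0 y * D y) = pi / 2 * tanh_half x.
  have [_ e] := Rint_even iD De; rewrite int_step.
  have -> : \int[mu]_(y in `[0, +oo[) D y = (\int[mu]_y D y) / 2 by rewrite e mulrC mulKf.
  rewrite eD (_ : 2 * (l * (pi / (2 * 1))) = x) /tanh_half; last by rewrite /l; move: (pi : R) p0 => r r0; field; rewrite gt_eqF.
  by rewrite divr1 mulrAC.
have eN N : \sum_(k < N) 4 * x / (((k.*2.+1)%:R * pi) ^+ 2 + x ^+ 2) = 2 / pi * \int[mu]_y F N y.
  rewrite (iF N).2 mulr_sumr; apply: eq_bigr => k _; rewrite /l.
  have := mm k; move: (k.*2.+1%:R : R) => u u0.
  have h1 : 0 < (u * pi) ^+ 2 + x ^+ 2 by rewrite addr_gt0 ?exprn_gt0 ?mulr_gt0.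
  have h2 : 0 < u ^+ 2 + (x / pi) ^+ 2 by rewrite addr_gt0 ?exprn_gt0 ?divr_gt0.
  move: p0 h1 h2; move: (pi : R) => r r0 h1 h2; field.
  by rewrite !gt_eqF//= mulr_gt0.
rewrite (_ : (fun N => _) = fun N => 2 / pi * \int[mu]_y F N y); last by apply: funext.
have h := cvgM (cvg_cst (2 / pi : R)) c; rewrite hD in h.
have e : 2 / pi * (pi / 2 * tanh_half x) = tanh_half x.
  by move: (pi : R) p0 (tanh_half x) => r r0 u; field; rewrite gt_eqF.
by rewrite e in h; exact: h.
Qed.

End Mellin.

(** * From the Mellin transform of [1 / (exp x + 1)] to the functional equation of zeta *)

Section FunctionalEquation.
Context {R : realType}.
Notation mu := (@lebesgue_measure R).
Notation RR := (measurableTypeR R).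
Implicit Types (s z w : R[i]) (x y t : R).
Variable zeta : R[i] -> R[i].
Hypothesis hzeta : is_riemann_zeta zeta.

Let zetaE s : 1 < Re s -> ccvg (series (dirichlet_term s)) (zeta s).
Proof. by move=> s1; apply/ccvgP; exact: hzeta.1. Qed.

Let zeta_an s : s != 1 -> an zeta s.
Proof. by move=> s1; apply: analytic_an; exact: hzeta.2. Qed.

Lemma odd_even_sum (F : nat -> R[i]) N :
  \sum_(i < N.*2) F i.+1 = \sum_(k < N) F k.*2.+1 + \sum_(k < N) F (2 * k.+1)%N.
Proof.
elim: N => [|N IH]; first by rewrite !big_ord0 addr0.
by rewrite doubleS !big_ord_recr /= IH mul2n doubleS addrACA addrA.
Qed.

Lemma odd_series s : 1 < Re s ->
  ccvg (fun N => \sum_(k < N) dterm s k.*2.+1) ((1 - dterm s 2) * zeta s).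
Proof.
move=> s1; have c := zetaE s1.
have c2 : ccvg (fun N => series (dirichlet_term s) N.*2) (zeta s).
  apply: (cvg_comp (fun N => N.*2) (fun N => normc (series (dirichlet_term s) N - zeta s)) _ c).
  by apply/cvgnyPge => A; exists A => // N /= h; apply: leq_trans h _; rewrite -addnn leq_addr.
have := ccvgD c2 (ccvgN (ccvgMl (dterm s 2) c)).
rewrite (_ : zeta s - _ = (1 - dterm s 2) * zeta s); last by ring.
apply: ccvg_near; apply: nearW => N; rewrite /series /= !big_mkord.
have := odd_even_sum (dterm s) N; rewrite /dterm /= -/(dterm s 2) => ->.
rewrite mulr_sumr -addrA [X in _ + X](_ : _ = 0) ?addr0//; apply/eqP; rewrite subr_eq0; apply/eqP.
by apply: eq_bigr => k _; have := @dtermM _ s 2 k.+1 isT isT; rewrite /dterm.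
Qed.

Definition fker t : R := (expR (expR t) + 1)^-1.

Let fkerE t : fker t = gker t / (1 + gker t).
Proof.
rewrite /fker /gker expRN; have := expR_gt0 (expR t); move: (expR _) => v v0.
by field; rewrite !gt_eqF//= addr_gt0.
Qed.

Let gker0 t : 0 < gker t. Proof. exact: expR_gt0. Qed.

Let fker_le t : 0 <= fker t <= gker t.
Proof.
rewrite fkerE; have g0 := gker0 t; rewrite divr_ge0 ?(ltW g0)//=; last by lra.
by rewrite ler_pdivrMr; [nra|lra].
Qed.

Let fker_meas : measurable_fun setT (fker : RR -> R).
Proof.
apply: continuous_measurable_fun; suff h : continuous fker by [].
move=> t; apply: cvgV; first by rewrite gt_eqF// addr_gt0// expR_gt0.
have h := dv_cont (dvD (dv_exp (dv_exp (dv_id t))) (dv_cst 1 t)).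
exact: h.
Qed.

Let fker_lapI x : 0 < x -> lapI fker x.
Proof.
move=> x0; apply: (le_intg measurableT _ _ (gker_lapI x0)).
  apply: measurable_funM; first exact: fker_meas.
  apply: continuous_measurable_fun; suff h : continuous (fun t : R => expR (x * t)) by [].
  by move=> t; exact: (dv_cont (dv_exp (dv_mulc x t))).
move=> t _; have /andP[f0 f1] := fker_le t.
by rewrite normrM (ger0_norm f0) (gtr0_norm (expR_gt0 _)) ler_wpM2r ?expR_ge0.
Qed.

(** The alternating Dirichlet series: [2 * dterm s 2] is [2 ^ (1 - s)]. *)
Definition eta s := (1 - 2 * dterm s 2) * zeta s.

(** Expand [1 / (exp x + 1)] in powers of [exp (- x)]. Grouping the terms in pairs keeps the partial
    sums between [0] and [fker], which serves as dominating function. *)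
Lemma fermi_laplace s : 1 < Re s -> laplace fker s = gam s * eta s.
Proof.
move=> s1; have s0 : 0 < Re s by lra.
pose g (n : nat) t := gker (t + ln n.+1%:R).
have gE n t : g n t = gker t ^+ n.+1.
  rewrite /g /gker expRD lnK ?posrE ?ltr0n// -expRM_natl; congr expR; ring.
have ig n : lapI (g n) (Re s) by apply: (@lapI_shift _ (ln n.+1%:R) gker); exact: gker_lapI.
have lg n : laplace (g n) s = dterm s n.+1 * gam s.
  rewrite (@laplace_shift _ (ln n.+1%:R) gker) //; exact: gker_lapI.
pose E N t := \sum_(k < N) (g k.*2 t + -1 * g k.*2.+1 t).
have EE N t : E N t = fker t * (1 - gker t ^+ N.*2).
  rewrite fkerE; have := gker0 t; rewrite /E; under eq_bigr do rewrite !gE.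
  move: (gker t) => q q0; elim: N => [|N IH]; first by rewrite big_ord0 expr0 subrr mulr0.
  rewrite big_ord_recr /= IH doubleS !exprS; move: (q ^+ N.*2) => v; field.
  by rewrite gt_eqF// addr_gt0.
have g1 t : gker t < 1 by rewrite /gker -expR0 ltr_expR oppr_lt0 expR_gt0.
have ik k : cintg (fun t => (g k.*2 t + -1 * g k.*2.+1 t)%:C * cexp (s * t%:C)).
  by apply: laplace_int; apply: lapID => //; exact: lapIZ.
have lE N : laplace (E N) s = gam s * (\sum_(k < N) dterm s k.*2.+1 - dterm s 2 * series (dirichlet_term s) N).
  have [_ e] := cintg_sum N ik.
  rewrite /laplace (_ : (fun t => _) = fun t => \sum_(k < N) (g k.*2 t + -1 * g k.*2.+1 t)%:C * cexp (s * t%:C)); last first.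
    by apply: funext => t; rewrite /E rmorph_sum /= mulr_suml.
  rewrite e /series /= big_mkord mulr_sumr -sumrB mulr_sumr; apply: eq_bigr => k _.
  rewrite -/(laplace (fun t => g k.*2 t + -1 * g k.*2.+1 t) s) laplaceD//; last exact: lapIZ.
  rewrite laplaceZ// !lg rmorphN mulN1r; have := @dtermM _ s 2 k.+1 isT isT.
  by rewrite mul2n doubleS => ->; rewrite /dterm /=; ring.
have mE N : cmeas (fun t => (E N t)%:C * cexp (s * t%:C)).
  apply: cexp_cmeas; apply: measurable_sum => k; apply: measurable_funD; first exact: lapI_meas (ig _).
  by apply: measurable_funM => //; exact: lapI_meas (ig _).
have cE t : ccvg (fun N => (E N t)%:C * cexp (s * t%:C)) ((fker t)%:C * cexp (s * t%:C)).
  have qN : (fun N => gker t ^+ N.*2) @ \oo --> (0 : R).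
    apply: (cvg_comp (fun N => N.*2) (fun N => gker t ^+ N)).
      by apply/cvgnyPge => A; exists A => // N /= h; apply: leq_trans h _; rewrite -addnn leq_addr.
    by apply: cvg_expr; rewrite ger0_norm ?(ltW (gker0 t)).
  have h : (fun N => E N t) @ \oo --> fker t.
    have h := cvgM (cvg_cst (fker t)) (cvgB (cvg_cst (1 : R)) qN); rewrite subr0 mulr1 in h.
    have e : (fun N => E N t) = fun N => fker t * (1 - gker t ^+ N.*2) by apply: funext => N; exact: EE.
    by rewrite e; exact: h.
  apply: ccvg_ReIm.
    by rewrite Re_realM; under eq_fun do rewrite Re_realM; apply: cvgM => //; exact: cvg_cst.
  by rewrite Im_realM; under eq_fun do rewrite Im_realM; apply: cvgM => //; exact: cvg_cst.
have bE N t : normc ((E N t)%:C * cexp (s * t%:C)) <= `|fker t * expR (Re s * t)|.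
  rewrite normcM normc_real normc_cexp Re_sreal normrM (gtr0_norm (expR_gt0 _)) ler_wpM2r ?expR_ge0//.
  rewrite EE normrM ler_piMr//; have h0 := exprn_ge0 N.*2 (ltW (gker0 t)).
  have := exprn_ile1 N.*2 (ltW (gker0 t)) (ltW (g1 t)) => h1.
  by rewrite ger0_norm; lra.
have [_ c] := cI_dct mE cE (intg_norm measurableT (fker_lapI s0)) bE.
apply: (ccvg_unique c).
have := ccvgMl (gam s) (ccvgD (odd_series s1) (ccvgN (ccvgMl (dterm s 2) (zetaE s1)))).
rewrite (_ : gam s * _ = gam s * eta s); last by rewrite /eta; ring.
by apply: ccvg_near; apply: nearW => N; rewrite -lE.
Qed.

(* Subtracting the value [1 / 2] of [fker] at [-oo] moves the abscissa of
   convergence from [0] to [-1]. *)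
Let kk t : R := fker t + (- 1 / 2) * step 0 (- t).

Definition th t : R := tanh_half (expR t).

Let fker_th t : fker t = 1 / 2 - 1 / 2 * th t.
Proof.
rewrite /fker /th /tanh_half; have := expR_gt0 (expR t); move: (expR _) => v v0.
by field; rewrite gt_eqF// addr_gt0.
Qed.

Let th_bound t : 0 <= th t <= Num.min 1 (expR t).
Proof.
rewrite /th /tanh_half; have u0 := expR_gt0 t; move: (expR t) u0 => u u0.
have v1 : 1 <= expR u by rewrite -expR0 ler_expR ltW.
have v2 : 1 - u <= expR (- u) by have := expR_ge1Dx (- u).
have v3 : expR u - 1 <= u * expR u.
  have : (1 - u) * expR u <= 1.
    by apply: le_trans (ler_wpM2r (expR_ge0 u) v2) _; rewrite -expRD addNr expR0.
  lra.
rewrite divr_ge0 ?subr_ge0 ?addr_ge0 ?expR_ge0//= le_min !ler_pdivrMr; lra.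
Qed.

Let th_meas : measurable_fun setT (th : RR -> R).
Proof.
have -> : th = fun t => 1 - 2 * fker t by apply: funext => t; rewrite fker_th; lra.
by apply: measurable_funB => //; apply: measurable_funM => //; exact: fker_meas.
Qed.

Let th_lapI x : -1 < x < 0 -> lapI th x.
Proof.
move=> /andP[x1 x0]; have d0 : 0 < Num.min (1 + x) (- x) by rewrite lt_min; apply/andP; split; lra.
apply: (lapI_sech th_meas d0 (C := 1)) => t.
have := th_bound t; rewrite le_min => /and3P[t0 t1 t2].
rewrite normrM (ger0_norm t0) (gtr0_norm (expR_gt0 _)) mul1r.
have [tt|tt] := leP 0 t.
  apply: le_trans (ler_wpM2r (expR_ge0 _) t1) _; rewrite mul1r ler_expR (ger0_norm tt).
  have h : Num.min (1 + x) (- x) <= - x by rewrite ge_min lexx orbT.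
  by have := ler_wpM2r tt h; lra.
apply: le_trans (ler_wpM2r (expR_ge0 _) t2) _; rewrite -expRD ler_expR (ltr0_norm tt).
have h : Num.min (1 + x) (- x) <= 1 + x by rewrite ge_min lexx.
have nt : 0 <= - t by lra.
by have := ler_wpM2r nt h; lra.
Qed.

Let kk_meas : measurable_fun setT (kk : RR -> R).
Proof.
apply: measurable_funD; first exact: fker_meas.
apply: measurable_funM => //; apply: (measurableT_comp (@step_meas R 0)).
by apply: continuous_measurable_fun => t; apply: cvgN; exact: cvg_id.
Qed.

(** Left of [0] the kernel is [- th / 2], of order [exp t], whence the abscissa [-1]; to the right
    it is [fker], which decays like [gker]. *)
Let kk_lapI x : -1 < x -> lapI kk x.
Proof.
move=> x1; pose X := `|x| + 1; have X0 : 0 < X by rewrite /X; have := normr_ge0 x; lra.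
have [C hC] := gker_le X0; have d0 : 0 < 1 + x by lra.
have C0 : 0 <= C.
  by have := hC 0; rewrite normr0 !mulr0 oppr0 expR0 !mulr1; apply: le_trans; exact: ltW.
apply: (lapI_sech kk_meas d0 (C := 1 + C)) => t.
rewrite normrM (gtr0_norm (expR_gt0 _)) mulrDl mul1r.
have := th_bound t; rewrite le_min => /and3P[t0 t1 t2].
have xX := ler_norm x.
have [tt|tt] := leP t 0.
  apply: ler_wpDr; first by rewrite mulr_ge0 ?expR_ge0.
  have -> : kk t = - 1 / 2 * th t by rewrite /kk /step oppr_ge0 tt fker_th; lra.
  rewrite ler0_norm; last by lra.
  apply: (@le_trans _ _ (expR t * expR (x * t))); first by rewrite ler_wpM2r ?expR_ge0//; lra.
  by rewrite -expRD ler_expR (ler0_norm tt); lra.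
apply: ler_wpDl; first exact: expR_ge0.
have -> : kk t = fker t by rewrite /kk /step oppr_ge0 leNgt tt /= mulr0 addr0.
have /andP[f0 f1] := fker_le t; rewrite ger0_norm//.
apply: le_trans (ler_wpM2r (expR_ge0 _) f1) _.
apply: (@le_trans _ _ (gker t * expR (X * t))).
  rewrite ler_wpM2l ?(ltW (gker0 t))// ler_expR ler_wpM2r ?(ltW tt)// /X; lra.
apply: le_trans (hC t) _; rewrite ler_wpM2l// ler_expR lerN2 ler_wpM2r// /X; lra.
Qed.

Let K s := laplace kk s.

Let K_an s : -1 < Re s -> an K s.
Proof.
move=> s1; apply: (@laplace_an _ _ ((Re s - 1) / 2) (Re s + 1)); try (apply: kk_lapI; lra).
by apply/andP; split; lra.
Qed.

Let stepN_lapI x : 0 < x -> lapI (fun t => step (0 : R) (- t)) x.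
Proof. by move=> x0; apply: (@lapI_opp _ (step 0)); exact: step_lapI. Qed.

Let K_pos s : 0 < Re s -> s * K s + 1 / 2 = s * laplace fker s.
Proof.
move=> s0; have sn : s != 0 by apply: contraTneq s0 => ->; rewrite ltxx.
rewrite /K /kk laplaceD; last 2 first.
- exact: fker_lapI.
- by apply: lapIZ; exact: stepN_lapI.
rewrite laplaceZ; last exact: stepN_lapI.
rewrite (@laplace_opp _ (step 0)); last exact: step_lapI.
rewrite (laplace_step 0 s0) mulr0 cexp0 mul1r.
have -> : (- 1 / 2 : R)%:C = - (1 / 2) :> R[i] by rewrite mulNr rmorphN !mul1r fmorphV /= complex_nat.
by field.
Qed.

(** Off [t = 0], [kk] is also [- th / 2] plus one half of the step on the right half-line. For
    [Re s < 0] that step has the transform [- 1 / s], and its contribution cancels the added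
    [1 / 2]. *)
Let K_neg s : -1 < Re s < 0 -> s * K s + 1 / 2 = - (s / 2) * laplace th s.
Proof.
move=> /andP[s1 s0]; have sn : s != 0 by apply: contraTneq s0 => ->; rewrite ltxx.
have ns : 0 < Re (- s) by rewrite creN oppr_gt0.
have is0 : lapI (step (0 : R)) (Re s) by have := step_lapI 0 ns; rewrite creN opprK.
have it := th_lapI (introT andP (conj s1 s0)).
have e : laplace kk s = laplace (fun t => (- 1 / 2) * th t + 1 / 2 * step 0 t) s.
  apply: (@laplace_ae _ _ _ _ [set 0]).
  - exact: measurable_set1.
  - exact: lebesgue_measure_set1.
  - exact: kk_lapI.
  - apply: measurable_funD; apply: measurable_funM => //; exact: step_meas.
  move=> t /= t0; rewrite /kk fker_th /step oppr_ge0; case: ltgtP t0 => //= h _; rewrite ?(ltW h) ?leNgt ?h /=; lra.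
rewrite /K e laplaceD; last 2 first.
- exact: lapIZ.
- exact: lapIZ.
rewrite !laplaceZ//; have := laplace_step 0 ns; rewrite opprK mulr0 cexp0 mul1r => ->.
have -> : (- 1 / 2 : R)%:C = - (1 / 2) :> R[i] by rewrite mulNr rmorphN !mul1r fmorphV /= complex_nat.
have -> : (1 / 2 : R)%:C = (1 / 2) :> R[i] by rewrite !mul1r fmorphV /= complex_nat.
by field.
Qed.

Let eta_an s : s != 1 -> an eta s.
Proof.
move=> s1; apply: anM; last exact: zeta_an.
apply: anB; first exact: an_cst.
apply: anM; first exact: an_cst.
by apply: an_near ltr01 _ (an_cexpM (- (ln (2 : R))%:C) s) => z _; rewrite /dterm /dirichlet_term mulNr mulrC mulNr.
Qed.

Let gam1_an (n : nat) s : - n%:R < Re s -> an (fun z => gam (z + n%:R)) s.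
Proof.
move=> sn; have := @an_comp_affine _ gam 1 n%:R s; rewrite mul1r => /(_ (gam_an _)).
rewrite creD complex_nat /= => /(_ _); rewrite -ltrBlDr sub0r => /(_ sn).
by apply: an_near ltr01 _ => z _; rewrite mul1r.
Qed.

(** Writing [gam (s + 1)] in place of [s * gam s] keeps both sides analytic across [Re s = 0], so
    the identity continues from [Re s > 1] to the strip where [K_neg] applies. *)
Lemma eta_formula s : -1 < Re s -> s != 1 -> gam (s + 1) * eta s = s * K s + 1 / 2.
Proof.
move=> sm s1; apply/eqP; rewrite -subr_eq0; apply/eqP.
pose f z := gam (z + 1) * eta z - (z * K z + 1 / 2).
have vf (u : R) : vanish f (2 +i* u).
  exists (1 / 2) => [|z zr]; first by lra.
  have := le_trans (ler_Re z) zr; rewrite ler_norml => /andP[h1 h2].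
  have h : 1 < Re ((2 +i* u) + z) by rewrite creD /=; lra.
  by have h0 := lt_trans ltr01 h; rewrite /f gamS// K_pos// fermi_laplace//; ring.
apply: (@identity_half_plane _ f (-1) 2) => //.
- by lra.
- move=> z zm hz; have z1 : z != 1.
    case: hz => [h|->//]; by apply: contraNneq h => ->.
  apply: anB.
    by apply: anM; [apply: (gam1_an (n := 1))|exact: eta_an].
  by apply: anD; [apply: anM; [exact: an_id|exact: K_an]|exact: an_cst].
Qed.

Let D s : R[i] := dterm s 2.
Let C s : R[i] := ccos ((pi / 2)%:C * s).
Let ppi s : R[i] := cexp ((ln pi)%:C * s).

Let p0 : 0 < pi :> R. Proof. exact: pi_gt0. Qed.

(** At [x = exp t] the partial fraction with [c = (2 k + 1) pi] is [2 / c] times [sech] translated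
    by [ln c]. Its transform is therefore a multiple of [c ^ (s - 1)], and the sum over odd numbers
    is [(1 - 2 ^ (s - 1)) zeta (1 - s)]. *)
Lemma tanh_laplace s : -1 < Re s < 0 ->
  laplace th s = laplace sech s * (2 * cexp ((ln pi)%:C * (s - 1))) * ((1 - D (1 - s)) * zeta (1 - s)).
Proof.
move=> s1; have s2 : -1 < Re s < 1 by move: s1 => /andP[-> h]; rewrite (lt_trans h).
have w1 : 1 < Re (1 - s) by move: s1 => /andP[_]; rewrite creD creN /=; lra.
pose c (k : nat) : R := (k.*2.+1)%:R * pi; have c0 k : 0 < c k by rewrite mulr_gt0 ?ltr0n.
pose g k t := 2 / c k * sech (t + - ln (c k)).
have gE k t : g k t = 4 * expR t / (c k ^+ 2 + expR t ^+ 2).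
  have e1 : expR (t + - ln (c k)) = expR t / c k by rewrite expRD expRN lnK ?posrE ?c0.
  rewrite /g /sech /cosh expRN e1; have := expR_gt0 t; have := c0 k.
  move: (expR t) (c k) => u v v0 u0; have : 0 < v ^+ 2 + u ^+ 2 by rewrite addr_gt0 ?exprn_gt0.
  move=> q0; have q1 : 0 < u ^+ 2 + v ^+ 2 by rewrite addrC.
  field; by rewrite !gt_eqF//= !(mulr_gt0, addr_gt0, exprn_gt0).
have ish k : lapI (fun t => sech (t + - ln (c k))) (Re s) by apply: (@lapI_shift _ _ sech); exact: sech_lapI.
have ig k : lapI (g k) (Re s) by exact: lapIZ.
have lg k : laplace (g k) s = laplace sech s * (2 * cexp ((ln pi)%:C * (s - 1))) * dterm (1 - s) k.*2.+1.
  rewrite /g laplaceZ// (@laplace_shift _ _ sech); last exact: sech_lapI.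
  have m0 : (0 : R) < (k.*2.+1)%:R by rewrite ltr0n.
  have e2 : (2 / c k)%:C = 2 * cexp (- (ln (c k))%:C) :> R[i].
    by rewrite -rmorphN cexp_real expRN lnK ?posrE ?c0// rmorphM /= complex_nat.
  rewrite e2 /dterm /dirichlet_term /= [RHS](_ : _ = 2 * (cexp ((ln pi)%:C * (s - 1)) * cexp (- (1 - s) * (ln (k.*2.+1)%:R)%:C)) * laplace sech s); last by ring.
  rewrite mulrA -[2 * _ * _]mulrA -!cexpD; congr (_ * cexp _ * _).
  by rewrite /c lnM ?posrE// rmorphD /=; ring.
pose E N t := \sum_(k < N) g k t.
have Ec t : (fun N => E N t) @ \oo --> th t.
  have h := tanh_half_series (expR_gt0 t).
  have e : (fun N => E N t) = fun N => \sum_(k < N) 4 * expR t / (((k.*2.+1)%:R * pi) ^+ 2 + expR t ^+ 2).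
    by apply: funext => N; apply: eq_bigr => k _; exact: gE.
  by rewrite e; exact: h.
have g0 k t : 0 <= g k t by rewrite /g mulr_ge0 ?divr_ge0 ?(ltW (c0 _))// invr_ge0 ltW// cosh_gt0.
have E0 N t : 0 <= E N t by apply: sumr_ge0.
have Eth N t : E N t <= th t.
  rewrite -(cvg_lim (@norm_hausdorff _ _) (Ec t)); apply: nondecreasing_cvgn_le (cvgP _ (Ec t)) N.
  by apply/nondecreasing_seqP => n; rewrite /E big_ord_recr /= lerDl.
have ik k : cintg (fun t => (g k t)%:C * cexp (s * t%:C)) by exact: laplace_int.
have lE N : laplace (E N) s = laplace sech s * (2 * cexp ((ln pi)%:C * (s - 1))) * \sum_(k < N) dterm (1 - s) k.*2.+1.
  have [_ e] := cintg_sum N ik.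
  rewrite /laplace (_ : (fun t => _) = fun t => \sum_(k < N) (g k t)%:C * cexp (s * t%:C)); last first.
    by apply: funext => t; rewrite /E rmorph_sum /= mulr_suml.
  rewrite e mulr_sumr; apply: eq_bigr => k _; exact: lg.
have mE N : cmeas (fun t => (E N t)%:C * cexp (s * t%:C)).
  by apply: cexp_cmeas; apply: measurable_sum => k; exact: lapI_meas (ig _).
have cE t : ccvg (fun N => (E N t)%:C * cexp (s * t%:C)) ((th t)%:C * cexp (s * t%:C)).
  apply: ccvg_ReIm.
    by rewrite Re_realM; under eq_fun do rewrite Re_realM; apply: cvgM; [exact: Ec|exact: cvg_cst].
  by rewrite Im_realM; under eq_fun do rewrite Im_realM; apply: cvgM; [exact: Ec|exact: cvg_cst].
have bE N t : normc ((E N t)%:C * cexp (s * t%:C)) <= `|th t * expR (Re s * t)|.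
  rewrite normcM normc_real normc_cexp Re_sreal normrM (gtr0_norm (expR_gt0 _)) ler_wpM2r ?expR_ge0//.
  by rewrite !ger0_norm// (le_trans _ (Eth N t)).
have [_ cc] := cI_dct mE cE (intg_norm measurableT (th_lapI s1)) bE.
apply: (ccvg_unique cc).
have := ccvgMl (laplace sech s * (2 * cexp ((ln pi)%:C * (s - 1)))) (odd_series w1).
by apply: ccvg_near; apply: nearW => N; rewrite -lE.
Qed.

Let rising n z : R[i] := \prod_(i < n) (z + i%:R).

Let risingS n z : rising n.+1 z = rising n z * (z + n%:R).
Proof. by rewrite /rising big_ord_recr. Qed.

(** The difference of the two sides of [2 ^ (1 - z) cos (pi z / 2) Gamma z zeta z = pi ^ z zeta (1 -
    z)], multiplied by [rising n z]. This factor turns [Gamma z] into [Gamma (z + n)], analytic for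
    [Re z > - n], so that larger [n] reach further to the left. *)
Let FE n z := gam (z + n%:R) * (2 * D z) * C z * zeta z - rising n z * ppi z * zeta (1 - z).

Let FE_an n z : - n%:R < Re z -> z != 0 -> z != 1 -> an (FE n) z.
Proof.
move=> zn z0 z1; have ar : an (rising n) z.
  elim: n {zn} => [|n IH].
    by apply: an_near ltr01 _ (an_cst 1 z) => w _; rewrite /rising big_ord0.
  apply: an_near ltr01 _ (anM IH (anD (an_id z) (an_cst n%:R z))) => w _; by rewrite risingS.
have aD : an D z.
  by apply: an_near ltr01 _ (an_cexpM (- (ln (2 : R))%:C) z) => w _; rewrite /D /dterm /dirichlet_term mulNr mulrC mulNr.
have az : an (fun w => zeta (1 - w)) z.
  have := @an_comp_affine _ zeta (-1) 1 z; rewrite mulN1r addrC => /(_ (zeta_an _)).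
  rewrite -subr_eq0 addrAC subrr sub0r oppr_eq0 => /(_ z0).
  by apply: an_near ltr01 _ => w _; rewrite mulN1r addrC.
apply: anB.
  apply: anM; last exact: zeta_an.
  apply: anM; last exact: an_ccos.
  apply: anM; first exact: gam1_an.
  by apply: anM => //; exact: an_cst.
by apply: anM => //; apply: anM => //; exact: an_cexpM.
Qed.

Let D_mul z : 2 * (D z * D (1 - z)) = 1.
Proof.
rewrite /D /dterm /dirichlet_term /= -cexpD.
have -> : - z * (ln (2 : R))%:C + - (1 - z) * (ln (2 : R))%:C = (- ln 2)%:C by rewrite rmorphN; ring.
by rewrite cexp_real expRN lnK ?posrE// fmorphV /= complex_nat mulfV// -complex_nat pnatr_eq0.
Qed.

(** On this strip [eta_formula], [K_neg], [tanh_laplace] and [sech_laplace] all hold. They produce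
    the factors [1 - 2 ^ (1 - z)] and [1 - 2 ^ (z - 1)], which [D_mul] relates; the second is
    nonzero and is cancelled. *)
Let FE1_strip z : -1 < Re z < 0 -> FE 1 z = 0.
Proof.
move=> z10; have /andP[zm z0] := z10.
have zz1 : z != 1 by apply: contraTneq z0 => ->; rewrite -leNgt ler01.
have h1 := eta_formula zm zz1; rewrite (K_neg z10) (tanh_laplace z10) /eta -/(D z) in h1.
have S : laplace sech z * C z = pi%:C by apply: sech_laplace; rewrite zm (lt_trans z0).
have DD := D_mul z.
have D1 : 1 - D (1 - z) != 0.
  rewrite subr_eq0; apply/eqP => e; have : normc (D (1 - z)) < 1.
    rewrite /D /dterm normc_dirichlet /= expR_lt1 creD creN /= mulNr oppr_lt0 mulr_gt0//; first by lra.
    by rewrite ln_gt0//; lra.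
  by rewrite -e normc1 ltxx.
have ppE : ppi z = pi%:C * cexp ((ln pi)%:C * (z - 1)).
  rewrite /ppi mulrBr mulr1 cexpD cexpN cexp_real lnK ?posrE// mulrCA mulfV ?mulr1//.
  by apply/eqP => /(congr1 (@complex.Re R)) /= h; move: p0; rewrite h ltxx.
apply: (mulIf D1); rewrite mul0r /FE /rising big_ord_recl big_ord0 addr0 mulr1 ppE -S.
move: h1 DD S; rewrite mulr1n.
move: (gam _) (D z) (D (1 - z)) (C z) (zeta z) (zeta (1 - z)) (laplace _ _) (cexp _) => g d d' c ze ze' l e h1 DD S.
have -> : (g * (2 * d) * c * ze - z * (l * c * e) * ze') * (1 - d') =
  c * (- (g * ((1 - 2 * d) * ze)) + - (z / 2) * (l * (2 * e) * ((1 - d') * ze'))) + (1 - 2 * (d * d')) * (g * c * ze).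
  by field.
by rewrite -h1 DD subrr mul0r addr0; ring.
Qed.

Let vanish_FE (c : R) n : (forall z, `|Re z - c| <= 1 / 4 -> Im z != 0 -> FE n z = 0) ->
  vanish (FE n) (c +i* 1) /\ vanish (FE n) (c +i* (-1)).
Proof.
move=> h; have v (u : R) : (u = 1 \/ u = -1) -> vanish (FE n) (c +i* u).
  move=> hu; exists (1 / 4) => [|z zr]; first by lra.
  apply: h; first by rewrite creD /= addrAC subrr add0r; exact: le_trans (ler_Re z) zr.
  have := le_trans (ler_Im z) zr; rewrite cimD /= ler_norml => /andP[z1 z2].
  by case: hu => ->; [rewrite gt_eqF//|rewrite lt_eqF//]; lra.
by split; apply: v; [left|right].
Qed.

Let FE_identity n (c : R) s : - n%:R < c -> - n%:R < Re s -> s != 0 -> s != 1 ->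
  (forall z, `|Re z - c| <= 1 / 4 -> Im z != 0 -> FE n z = 0) -> FE n s = 0.
Proof.
move=> nc ns s0 s1 /vanish_FE[v1 v2]; apply: (identity_half_plane nc ns _ v1 v2) => z zn hz.
by apply: FE_an => //; case: hz => [h|->//]; apply: contraNneq h => ->.
Qed.

(** For [n = 0] the identity is continued from the strip around [Re z = - 1 / 2]. Later steps start
    near [Re z = 2], where [FE n.+2] is [z + n.+1%:R] times [FE n.+1]. *)
Lemma functional_equation n s : - n.+1%:R < Re s -> s != 0 -> s != 1 -> FE n.+1 s = 0.
Proof.
elim: n s => [|n IH] s ns s0 s1.
  apply: (@FE_identity 1 (- 1 / 2)) => //; first by lra.
  by move=> z; rewrite ler_norml => /andP[h1 h2] _; apply: FE1_strip; apply/andP; split; lra.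
apply: (@FE_identity n.+2 2) => //; first by rewrite (lt_trans (_ : _ < 0))// ?oppr_lt0 ?ltr0n.
move=> z; rewrite ler_norml => /andP[h1 h2] zi.
have z0 : z != 0 by apply: contraNneq zi => ->.
have z1 : z != 1 by apply: contraNneq zi => ->.
have n0 : (0 : R) <= n.+1%:R by [].
have zn : - n.+1%:R < Re z by lra.
have := IH z zn z0 z1; rewrite /FE => /eqP; rewrite subr_eq0 => /eqP h.
have -> : gam (z + n.+2%:R) = (z + n.+1%:R) * gam (z + n.+1%:R).
  by rewrite -gamS; [rewrite -addrA natr1|rewrite creD complex_nat /=; lra].
rewrite risingS; transitivity ((z + n.+1%:R) * (gam (z + n.+1%:R) * (2 * D z) * C z * zeta z - rising n.+1 z * ppi z * zeta (1 - z))).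
  by ring.
by rewrite h subrr mulr0.
Qed.

(** At [s = 0] the right-hand side of [eta_formula] is [1 / 2]. *)
Let zeta0 : zeta 0 != 0.
Proof.
have h1 : -1 < Re (0 : R[i]) by rewrite /= ltrN10.
have h2 : (0 : R[i]) != 1 by rewrite eq_sym oner_eq0.
have := eta_formula h1 h2; rewrite mul0r !add0r => h; apply/eqP => z0.
move: h; rewrite /eta z0 !mulr0 => /eqP; rewrite eq_sym mul1r invr_eq0.
by rewrite complex_nat => /eqP /(congr1 (@complex.Re R)) /= e; lra.
Qed.

Let cos_pi_nat j : cos (j%:R * pi : R) != 0.
Proof.
elim: j => [|j IH]; first by rewrite mul0r cos0 oner_eq0.
by rewrite -natr1 mulrDl mul1r cosDpi oppr_eq0.
Qed.

Let C_even j : C (j.*2)%:R != 0.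
Proof.
have e : ('i : R[i]) * ((pi / 2)%:C * (j.*2)%:R) = 0 +i* (j%:R * pi).
  by rewrite complex_nat -mul2n natrM; apply: eqc; rewrite ?creM ?cimM /=; move: (pi : R) => r; field.
have e' : (- 'i : R[i]) * ((pi / 2)%:C * (j.*2)%:R) = 0 +i* (- (j%:R * pi)).
  by rewrite mulNr e; apply: eqc; rewrite /= ?oppr0.
have -> : C (j.*2)%:R = (cos (j%:R * pi))%:C.
  rewrite /C /ccos e e'; have -> : cexp (0 +i* (j%:R * pi)) + cexp (0 +i* (- (j%:R * pi))) = 2 * (cos (j%:R * pi))%:C :> R[i].
    by rewrite complex_nat; apply: eqc; rewrite ?creD ?cimD !(Re_cexp, Im_cexp) ?Re_realM ?Im_realM /= expR0 ?cosN ?sinN; ring.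
  by rewrite mulrC mulKf// complex_nat; apply/eqP => /(congr1 (@complex.Re R)) /= h; lra.
by apply/eqP => /(congr1 (@complex.Re R)) /= h; move: (cos_pi_nat j); rewrite h eqxx.
Qed.

(** Take the functional equation at the even number [s = i + 1]: there Gamma is a factorial, the
    cosine is nonzero, and [zeta s] is nonzero by the Euler product, hence so is [zeta (1 - s)]. *)
Let zeta_odd (i : nat) : odd i -> zeta (- i%:R) != 0.
Proof.
move=> oi; have i0 : (0 < i)%N by case: i oi.
pose s : R[i] := i.+1%:R; have ReS : Re s = i.+1%:R by rewrite /s complex_nat.
have s1 : 1 < Re s by rewrite ReS ltr1n ltnS.
have sn0 : s != 0 by apply: contraTneq s1 => ->; rewrite -leNgt ler01.
have sn1 : s != 1 by apply: contraTneq s1 => ->; rewrite ltxx.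
have sm : - 1%:R < Re s by lra.
have := functional_equation sm sn0 sn1; rewrite /FE => /eqP; rewrite subr_eq0 => /eqP h.
apply/eqP => z0; move: h; have -> : 1 - s = - i%:R by rewrite /s -natr1; ring.
rewrite z0 mulr0 -natrD addn1 gam_nat => /eqP; apply/negP.
have fn : (i.+1`!%:R : R[i]) != 0 by rewrite pnatr_eq0 -lt0n fact_gt0.
have Cn : C s != 0.
  by rewrite (_ : s = (i.+1./2.*2)%:R) ?C_even// /s even_halfK//= oi.
have n2 : (2 : R[i]) != 0 by rewrite pnatr_eq0.
exact: (mulf_neq0 (mulf_neq0 (mulf_neq0 fn (mulf_neq0 n2 (cexp_neq0 _))) Cn) (zeta_neq0 zetaE s1)).
Qed.

(* Off the real axis the gamma factor need not be shown to be nonzero: the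
   functional equation is used with [zeta rho] on the gamma side. *)
Lemma zero_right_half rho : zeta_zero zeta rho -> ~ trivial_zero rho -> Re rho < 1 / 2 ->
  exists2 rho', zeta_zero zeta rho' & 1 / 2 < Re rho'.
Proof.
move=> [r1 z0] nt rh; have r0 : rho != 0 by apply/eqP => e; move: zeta0; rewrite e in z0; rewrite z0 eqxx.
pose n := Num.truncn (- Re rho).
have hn : - n.+1%:R < Re rho.
  by rewrite ltrNl; exact: truncnS_gt.
have := functional_equation hn r0 r1; rewrite /FE z0 mulr0 sub0r => /eqP.
rewrite oppr_eq0 mulf_eq0 => /orP[|/eqP z1]; last first.
  exists (1 - rho); last by rewrite creD creN /=; lra.
  by split => //; rewrite -subr_eq0 addrAC subrr sub0r oppr_eq0.
(* A vanishing factor of [rising] puts [rho] at [- i] for a natural [i]. Odd [i] contradicts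
   [zeta_odd], [i = 0] contradicts [r0], and an even positive [i] makes the zero trivial. *)
rewrite mulf_eq0 (negbTE (cexp_neq0 _)) orbF /rising prodf_seq_eq0 => /hasP[i _ /=]; rewrite addr_eq0 => /eqP e.
exfalso; have [oi|] := boolP (odd i).
  by have := zeta_odd oi; rewrite -e z0 eqxx.
move=> ei; apply: nt; have i0 : (0 < i)%N by rewrite lt0n; apply: contraNneq r0 => i0; rewrite e i0 oppr0.
have hi : (i : nat) = (2 * (i./2.-1).+1)%N.
  have := even_halfK ei; case: (i./2) => [|m] h /=; last by rewrite mul2n.
  by move: i0; rewrite -h.
by exists (i./2.-1); rewrite e complex_nat -rmorphN -natrM -hi.
Qed.

End FunctionalEquation.

(** A zero to the right of [1 / 2] is never trivial, since trivial zeros are negative; a nontrivial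
    zero to the left is sent to the right by [zero_right_half]. *)
Lemma riemann_hypothesisP (R : realType) (zeta : R[i] -> R[i]) : is_riemann_zeta zeta ->
  (riemann_hypothesis zeta <-> (forall rho : R[i], zeta_zero zeta rho -> ~ (1 / 2 < complex.Re rho))).
Proof.
move=> hz; split=> [rh rho z0 h|h rho z0 nt].
  have nt : ~ trivial_zero rho.
    by move=> [k e]; move: h; rewrite e /= ltNge (le_trans (_ : _ <= 0)) ?oppr_le0 ?mulr_ge0// divr_ge0.
  by move: h; rewrite (rh rho z0 nt) ltxx.
have [lt|gt|//] := ltgtP (complex.Re rho) (1 / 2).
  by have [rho' z' h'] := zero_right_half hz z0 nt lt; case: (h _ z' h').
by case: (h _ z0 gt).
Qed.

Local Close Scope complex_scope.
Local Close Scope classical_set_scope.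

Theorem theorem1 (R : realType) (zeta : R[i] -> R[i])
    (hzeta : is_riemann_zeta zeta) :
  (forall b a : R, 0 < b -> 0 < a -> 1 / 2 <= b -> b < 1 ->
     a * (1 - b) < pi / 2 ->
     (log_zeta_equality zeta b a <->
      (forall rho : R[i], zeta_zero zeta rho -> ~ (b < complex.Re rho)))) /\
  (forall a : R, 0 < a -> a * (1 - 1 / 2) < pi / 2 ->
     (log_zeta_equality zeta (1 / 2) a <-> riemann_hypothesis zeta)).
Proof.
split=> [b a b0 a0 _ b1|a a0] hab; first exact: log_zeta_criterion.
apply: iff_trans (iff_sym (riemann_hypothesisP hzeta)).
by apply: log_zeta_criterion => //; lra.
Qed.
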